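(* Let $\Sigma\Subset\mathbb{S}$ be a nonempty open set, and let $e\in L^2(\mathbb S)$ and $t>0$ be fixed. Let $h_t\in L^2(\Sigma)$ be the unique solution of the following problem: $\|h_t\|\le t$ and $$\|Ee-E(K+\tfrac12I)Ph_t\|=\inf\{\|Ee-E(K+\tfrac12I)Pg\|: g\in L^2(\Sigma),\ \|g\|\le t\},$$ and define $L_e(t)=\|Ee-E(K+\tfrac12I)Ph_t\|$. Then for any $\varphi\in U_\Sigma^+$ and any $\varphi_\varepsilon\in L^2(\mathbb S)$ with $\|\varphi-\varphi_\varepsilon\|<\varepsilon$ it holds that $$\big|\langle\tau_{pm}(\varphi),e\rangle-\big(\langle P\varphi_\varepsilon,h_t\rangle-\langle\varphi_\varepsilon,e\rangle\big)\big|\le(\|\varphi\|+\|\tau_{pm}(\varphi)\|)\,L_e(t)+\varepsilon\,(t+\|e\|),$$ where $L_e(t)$ decreases monotonically to zero as $t\to\infty$.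
   Context: Let $d\ge 3$, let $\mathbb S$ be the unit sphere in $\mathbb R^d$ with surface measure $\omega$, $\omega_d=\omega(\mathbb S)$, and outward unit normal field $\mathbf n$. $L^2(\mathbb S)$ is the space of square-integrable functions on $\mathbb S$ with canonical inner product $\langle\cdot,\cdot\rangle$ and norm $\|\cdot\|$. For a subspace $H\subseteq L^2(\mathbb S)$, $H/\langle 1\rangle$ denotes the subspace $\{f\in H:\langle f,1\rangle=0\}$ of functions with zero mean. $\nabla_{\mathbb S}$ is the surface gradient, $I$ the identity. $\Sigma\Subset\mathbb S$ means that $\Sigma$ and its closure $\overline\Sigma$ are both proper subsets of $\mathbb S$. For open $\Sigma\subseteq\mathbb S$, $L^2(\Sigma)\subseteq L^2(\mathbb S)$ is the subspace of functions vanishing a.e. outside $\Sigma$, $P=P_\Sigma$ is the orthogonal projection of $L^2(\mathbb S)$ onto $L^2(\Sigma)$, and $C_c^\infty(\Sigma)$ is the set of smooth functions on $\mathbb S$ with compact support in $\Sigma$. For a square-integrable tangent field $\mathbf f$, $\operatorname{div}_{\mathbb S}(\mathbf f)|_\Sigma=0$ means $\int_\Sigma \mathbf f\cdot\nabla_{\mathbb S}\varphi\,d\omega=0$ for all $\varphi\in C_c^\infty(\Sigma)$. Layer potentials, for $f\in L^2(\mathbb S)$ and $x\in\mathbb S$: $Sf(x)=\frac{-1}{\omega_d(d-2)}\int_{\mathbb S}\frac{f(y)}{|x-y|^{d-2}}d\omega(y)$ and $Kf(x)=\mathrm{p.v.}\,\frac{-1}{\omega_d}\int_{\mathbb S}\frac{\mathbf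 n(y)\cdot(x-y)}{|x-y|^{d}}f(y)\,d\omega(y)$. The operator $S$ maps $L^2(\mathbb S)$ bijectively and boundedly onto the Sobolev space $W^{1,2}(\mathbb S)$. Define $\mathcal D_\Sigma=\{f\in L^2(\mathbb S): \operatorname{div}_{\mathbb S}(\nabla_{\mathbb S}Sf)|_\Sigma=0\}$, a closed subspace of $L^2(\mathbb S)$, and let $E$ be the orthogonal projection of $L^2(\mathbb S)$ onto $\mathcal D_\Sigma$. Define $U_\Sigma^+=\{f\in L^2(\mathbb S): Pf=P(K+\tfrac12I)g\text{ for some }g\in\mathcal D_\Sigma\}/\langle1\rangle$. The operator $P(K+\tfrac12I):\mathcal D_\Sigma\to L^2(\Sigma)$ is injective and $[P(K+\tfrac12I)]^{-1}$ denotes its inverse on its range. Define $\tau_{pm}:L^2(\mathbb S)/\langle1\rangle\supseteq U_\Sigma^+\to L^2(\mathbb S)$, $\tau_{pm}(f)=[P(K+\tfrac12I)]^{-1}Pf-f$. *)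

(* Defs.v *)
From HB Require Import structures.
From mathcomp Require Import all_boot all_order all_algebra.
From mathcomp Require Import all_classical all_reals all_analysis.
From mathcomp Require Import measurable_realfun.

Set Implicit Arguments.
Unset Strict Implicit.
Unset Printing Implicit Defensive.

Import Order.TTheory GRing.Theory Num.Theory.
Import numFieldNormedType.Exports.

Local Open Scope classical_set_scope.
Local Open Scope ring_scope.

Definition rV_display : measure_display.
Proof. exact: default_measure_display. Qed.

Section rV_measurable.
Context {R : realType} (n : nat).

(* The product sigma-algebra, i.e. the Borel sets of R^n. *)
Definition rV_coord (i : 'I_n) (x : 'rV[R]_n) : measurableTypeR R := x ord0 i.

Let rV_measurable0 : g_sigma_preimage rV_coord set0.
Proof. exact: sigma_algebra0. Qed.

Let rV_measurableC A :
  g_sigma_preimage rV_coord A -> g_sigma_preimage rV_coord (~` A).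
Proof. exact: sigma_algebraC. Qed.

Let rV_measurable_bigcup (F : (set 'rV[R]_n)^nat) :
  (forall i, g_sigma_preimage rV_coord (F i)) ->
  g_sigma_preimage rV_coord (\bigcup_i F i).
Proof. exact: sigma_algebra_bigcup. Qed.

HB.instance Definition _ := @isMeasurable.Build rV_display
  'rV[R]_n (g_sigma_preimage rV_coord) rV_measurable0 rV_measurableC
  rV_measurable_bigcup.

End rV_measurable.

Section rV_measurable_fun.
Context {R : realType}.

Lemma measurable_rV_coord n (i : 'I_n) :
  measurable_fun [set: 'rV[R]_n] (rV_coord i).
Proof.
move=> _ Y mY; rewrite setTI; apply: sub_sigma_algebra => /=.
rewrite -bigcup_seq/=; exists i => /=; first by rewrite mem_index_enum.
by exists Y => //; rewrite setTI.
Qed.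

Lemma measurable_fun_rV d (T : measurableType d) n (f : T -> 'rV[R]_n) :
  (forall i, measurable_fun [set: T] (rV_coord i \o f)) ->
  measurable_fun [set: T] f.
Proof.
move=> mf _ Y mY; rewrite setTI.
apply: (mY [set B | measurable (f @^-1` B)]); split.
  split => /= [|A mA|F mF].
  - by rewrite preimage_set0.
  - by rewrite setTD preimage_setC; exact: measurableC.
  - by rewrite preimage_bigcup; exact: bigcupT_measurable.
move=> B; rewrite -bigcup_seq => -[i _] [C mC <-].
by rewrite setTI /= -comp_preimage -[X in measurable X]setTI; exact: mf.
Qed.

End rV_measurable_fun.

Section rV_cons.
Context {R : realType} (n : nat).

Definition rV_cons (p : measurableTypeR R * 'rV[R]_n) : 'rV[R]_(1 + n) :=
  row_mx p.1%:M p.2.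
Definition rV_uncons (v : 'rV[R]_(1 + n)) : measurableTypeR R * 'rV[R]_n :=
  (lsubmx v ord0 ord0, rsubmx v).

Lemma rV_consK : cancel rV_cons rV_uncons.
Proof.
case=> a v; rewrite /rV_uncons /rV_cons row_mxKl row_mxKr/=.
by rewrite mxE eqxx.
Qed.

Lemma rV_unconsK : cancel rV_uncons rV_cons.
Proof. by move=> v; rewrite /rV_cons/= -mx11_scalar hsubmxK. Qed.

Lemma measurable_rV_cons : measurable_fun setT rV_cons.
Proof.
apply: measurable_fun_rV => i.
case: (split_ordP i) => j ->.
  rewrite (_ : _ \o _ = fst); first exact: measurable_fst.
  by apply/funext => -[a v]; rewrite /rV_coord/= row_mxEl mxE !ord1 eqxx.
rewrite (_ : _ \o _ = rV_coord j \o snd).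
  by apply: measurableT_comp; [exact: measurable_rV_coord|exact: measurable_snd].
by apply/funext => -[a v]; rewrite /rV_coord/= row_mxEr.
Qed.

Lemma measurable_rV_uncons : measurable_fun setT rV_uncons.
Proof.
apply: measurable_fun_pair => /=.
  rewrite (_ : (fun _ => _) = rV_coord (lshift n ord0)).
    exact: measurable_rV_coord.
  by apply/funext => v; rewrite /rV_coord mxE.
apply: measurable_fun_rV => i.
rewrite (_ : _ \o _ = rV_coord (rshift 1 i)); first exact: measurable_rV_coord.
by apply/funext => v; rewrite /rV_coord/= mxE.
Qed.

Variable mu : {sigma_finite_measure set 'rV[R]_n -> \bar R}.

Definition rV_lebesgueS : set 'rV[R]_(1 + n) -> \bar R :=
  pushforward (@lebesgue_measure R \x mu)%E rV_cons.

HB.instance Definition _ := Measure.copy rV_lebesgueS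
  (measure_function_pushforward__canonical__measure_function_Measure
     (@lebesgue_measure R \x mu)%E measurable_rV_cons).

Let rV_lebesgueS_sigma_finite : sigma_finite setT rV_lebesgueS.
Proof.
have /sigma_finiteP[F [FT ndF Foo]] := sigma_finiteT (@lebesgue_measure R).
have /sigma_finiteP[G [GT ndG Goo]] := sigma_finiteT mu.
exists (fun k => rV_uncons @^-1` (F k `*` G k)).
  rewrite -preimage_bigcup (_ : \bigcup_i _ = setT) ?preimage_setT//.
  rewrite -subTset => -[x y] _.
  have [k _ Fkx] : (\bigcup_k F k) x by rewrite -FT.
  have [l _ Gly] : (\bigcup_k G k) y by rewrite -GT.
  exists (maxn k l) => //; split => /=.
  - by move: x Fkx; exact/subsetPset/ndF/leq_maxl.
  - by move: y Gly; exact/subsetPset/ndG/leq_maxr.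
move=> k; have [mF Fk] := Foo k; have [mG Gk] := Goo k; split.
  rewrite -[X in measurable X]setTI.
  by apply: measurable_rV_uncons => //; exact: measurableX.
rewrite /rV_lebesgueS /pushforward -comp_preimage.
rewrite (_ : _ \o _ = id) ?preimage_id; last first.
  by apply/funext => p /=; rewrite rV_consK.
by rewrite product_measure1E// lte_mul_pinfty// ge0_fin_numE.
Qed.

HB.instance Definition _ :=
  Measure_isSigmaFinite.Build _ _ _ rV_lebesgueS rV_lebesgueS_sigma_finite.

End rV_cons.

Fixpoint rV_lebesgue (R : realType) (n : nat) :
    {sigma_finite_measure set 'rV[R]_n -> \bar R} :=
  match n with
  | 0 => \d_(0 : 'rV[R]_0)
  | m.+1 => rV_lebesgueS (rV_lebesgue R m)
  end.

Section euclidean.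
Context {R : realType} {d : nat}.
Implicit Types x y : 'rV[R]_d.

Definition edot x y : R := \sum_(i < d) x ord0 i * y ord0 i.

(* The library norm on ['rV[R]_d] is the max norm, whence this definition. *)
Definition enorm x : R := Num.sqrt (edot x x).

Definition sphere : set 'rV[R]_d := [set x | enorm x = 1].

Definition radial x : 'rV[R]_d := (enorm x)^-1 *: x.

Definition punctured_ball : set 'rV[R]_d := [set x | 0 < enorm x <= 1].

Lemma measurable_enorm : measurable_fun setT enorm.
Proof.
rewrite (_ : enorm = Num.sqrt \o (fun x => edot x x))//.
apply: measurableT_comp.
  by apply: continuous_measurable_fun; exact: sqrt_continuous.
by apply: measurable_sum => i; apply: measurable_funM;
  exact: measurable_rV_coord.
Qed.

Lemma measurable_radial : measurable_fun setT radial.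
Proof.
apply: measurable_fun_rV => i.
rewrite (_ : _ \o _ = (fun x => enorm x `^ (-1) * rV_coord i x)); last first.
  by apply/funext => x; rewrite /rV_coord/= mxE powR_inv1// sqrtr_ge0.
apply: measurable_funM; last exact: measurable_rV_coord.
rewrite (_ : (fun _ => _) = (@powR R ^~ (-1)) \o enorm)//.
apply: measurableT_comp; [exact: measurable_powR|exact: measurable_enorm].
Qed.

Lemma measurable_punctured_ball : measurable punctured_ball.
Proof.
have := measurable_enorm measurableT (measurable_itv `]0, 1]).
by rewrite setTI; congr measurable; apply/seteqP; split => x;
  rewrite /punctured_ball/= in_itv.
Qed.

Definition cone_volume : set 'rV[R]_d -> \bar R :=
  pushforward (mrestr (rV_lebesgue R d) measurable_punctured_ball) radial.

HB.instance Definition _ := Measure.copy cone_volume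
  (measure_function_pushforward__canonical__measure_function_Measure
    (mrestr (rV_lebesgue R d) measurable_punctured_ball) measurable_radial).

(* The surface measure of the unit sphere, obtained from the volume of cones:
     omega A = d * |{r *: x : x in A, 0 < r <= 1}|   (A a subset of the sphere).
   It is a measure on R^d concentrated on [sphere]; functions on the sphere are
   represented by functions on R^d, whose values off the sphere do not matter. *)
Definition omega : set 'rV[R]_d -> \bar R := mscale d%:R%:nng cone_volume.

HB.instance Definition _ := Measure.on omega.

Definition omega_d : R := fine (omega sphere).

End euclidean.

Arguments sphere R d : clear implicits.
Arguments omega R d : clear implicits.
Arguments omega_d R d : clear implicits.

Section L2.
Context {R : realType} {d : nat}.
Local Notation E := 'rV[R]_d.
Implicit Types (f g : E -> R) (H : set (E -> R)) (Sigma : set E).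

Definition L2 : set (E -> R) := [set f | f \in Lfun (omega R d) 2%:E].

Definition L2dot f g : R := \int[omega R d]_x (f x * g x).

Definition L2norm f : R := Num.sqrt (L2dot f f).

Definition eqL2 f g : Prop := f = g %[ae omega R d].

Definition L2on Sigma : set (E -> R) :=
  [set f | L2 f /\ {ae omega R d, forall x, ~ Sigma x -> f x = 0}].

(* Elements of L^2 being represented by functions, the projection [g] of [f] is
   determined up to a null set only, and [get] selects a representative. *)
Definition is_orthoproj H f g : Prop :=
  H g /\ forall h, H h -> L2dot (f - g) h = 0.

Definition orthoproj H f : E -> R := get [set g | is_orthoproj H f g].

Definition sphere_open Sigma : Prop :=
  exists2 U, open U & Sigma = sphere R d `&` U.

(* The closure in R^d is the closure in the sphere, which is closed. *)
Definition compactly_included Sigma : Prop :=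
  Sigma `<` sphere R d /\ closure Sigma `<` sphere R d.

End L2.

Section smooth.
Context {R : realType} {V W : normedModType R}.

Definition iter_derive (vs : seq V) (f : V -> W) : V -> W :=
  foldr (fun v g => 'D_v g) f vs.

(* C^oo: all iterated directional derivatives exist and are continuous. *)
Definition smooth (f : V -> W) : Prop := forall vs : seq V,
  continuous (iter_derive vs f) /\
  forall x v, derivable (iter_derive vs f) x v.

End smooth.

Section surface_calculus.
Context {R : realType} {d : nat}.
Local Notation E := 'rV[R]_d.
Implicit Types (x : E) (phi u : E -> R) (X F : E -> E) (Sigma : set E).

Definition basis (i : 'I_d) : E := delta_mx ord0 i.

Definition gradient phi x : E := \row_i 'D_(basis i) phi x.

(* Smooth functions and tangent fields on the sphere are represented by smooth
   extensions to R^d; on the sphere, [sgrad] and [sdiv] depend only on the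
   restrictions. [sdiv X] is the surface divergence when [X] is tangent. *)
Definition sgrad phi x : E := gradient phi x - edot x (gradient phi x) *: x.

Definition sdiv X x : R :=
  \sum_(i < d) ('D_(basis i) X x) ord0 i - edot x ('D_x X x).

Definition smooth_tangent X : Prop :=
  smooth X /\ forall x, sphere R d x -> edot x (X x) = 0.

Definition L2tangent F : Prop :=
  (forall i, L2 (fun x => F x ord0 i)) /\
  {ae omega R d, forall x, edot x (F x) = 0}.

(* The existence of [F] amounts, for [u] in L^2, to [u] being in W^{1,2}(S). *)
Definition weak_sgrad u F : Prop :=
  L2tangent F /\
  forall X, smooth_tangent X ->
    \int[omega R d]_x edot (F x) (X x) = - \int[omega R d]_x (u x * sdiv X x).

Definition surface_support phi : set E :=
  closure (sphere R d `&` [set x | phi x != 0]).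

Definition Cc_smooth Sigma : set (E -> R) :=
  [set phi | [/\ smooth phi, compact (surface_support phi) &
                 surface_support phi `<=` Sigma]].

Definition div_free_on Sigma F : Prop :=
  forall phi, Cc_smooth Sigma phi ->
    \int[omega R d]_(x in Sigma) edot (F x) (sgrad phi x) = 0.

End surface_calculus.

Section potentials.
Context {R : realType} {d : nat}.
Local Notation E := 'rV[R]_d.
Implicit Types (x y : E) (f g h e phi : E -> R) (Sigma : set E).

(* The outward unit normal of the sphere at the point [y] of the sphere. *)
Definition normal y : E := y.

Definition single_layer f x : R :=
  - (omega_d R d * (d%:R - 2))^-1 *
    \int[omega R d]_y (f y / enorm (x - y) ^+ (d - 2)).

(* Principal value: the ball of radius [r] around [x] is removed and [r] tends
   to 0 from the right. *)
Definition double_layer f x : R :=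
  lim ((fun r : R => - (omega_d R d)^-1 *
    \int[omega R d]_(y in [set y | r < enorm (x - y)])
      (edot (normal y) (x - y) / enorm (x - y) ^+ d * f y)) @ 0^'+).

Definition Khalf f : E -> R := fun x => double_layer f x + 2^-1 * f x.

Definition D_ Sigma : set (E -> R) :=
  [set f | L2 f /\
    exists2 F, weak_sgrad (single_layer f) F & div_free_on Sigma F].

Definition P_ Sigma f : E -> R := orthoproj (L2on Sigma) f.

Definition E_ Sigma f : E -> R := orthoproj (D_ Sigma) f.

Definition mean_zero : set (E -> R) := [set f | L2dot f (cst 1) = 0].

Definition Uplus Sigma : set (E -> R) :=
  [set f | L2 f /\
    exists2 g, D_ Sigma g & eqL2 (P_ Sigma f) (P_ Sigma (Khalf g))]
  `&` mean_zero.

(* Inverse on its range of P(K + 1/2 I), as an operator on [D_ Sigma]; again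
   [get] selects a representative. *)
Definition inv_PKhalf Sigma f : E -> R :=
  get [set g | D_ Sigma g /\ eqL2 (P_ Sigma (Khalf g)) f].

Definition tau_pm Sigma f : E -> R := inv_PKhalf Sigma (P_ Sigma f) - f.

Definition residual Sigma e h : R :=
  L2norm (E_ Sigma e - E_ Sigma (Khalf (P_ Sigma h))).

Definition admissible Sigma (t : R) : set (E -> R) :=
  [set g | L2on Sigma g /\ L2norm g <= t].

Definition is_minimizer Sigma e (t : R) h : Prop :=
  admissible Sigma t h /\
  residual Sigma e h = inf (residual Sigma e @` admissible Sigma t).

End potentials.

(* Main.v *)
(* On the unit sphere [n(y).(x - y) = - |x - y|^2 / 2], so that [K = G / 2] and
   [S = - G / (2a)], where [a = (d - 2) / 2] and [G] is the normalized integral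
   operator with kernel [|x - y|^(-2a)]. Dilating the kernels [|x - r y|^(-2a)]
   and comparing them with the Poisson kernel yields
   [G (G (a^2 - Delta) f) = a^2 f] for smooth zonal [f].

   The adjoint of [A := E (K + I/2)] on L^2(Sigma) is [P (K + I/2)] on D_Sigma,
   and both are injective. If [g] is in D_Sigma and [h := g + G g] vanishes on
   Sigma, then [h] is orthogonal to [G (a^2 - Delta) phi] for all zonal bumps
   [phi] in Sigma; if [f] is in L^2(Sigma) and [A f = 0], then so is [f] for the
   bumps supported off the closure of Sigma, because [G (a^2 - Delta) phi]
   belongs to D_Sigma. A function [h] that vanishes on an open set V and is
   orthogonal to [G (a^2 - Delta) phi] for all bumps [phi] in V is zero:
   applying the Laplacian to [phi] over and over, [h] is orthogonal to
   [x |-> \int |x - y|^(-2a - 2k) phi(y)] for all [k > 0], hence, by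
   approximation on the range of the kernel, to [\int (x . y)^j phi(y)] for
   all [j]; so the polynomials [x |-> \int h(y) (x . y)^j] vanish on V, hence
   everywhere, and [h] is orthogonal to the Poisson kernels. Finally [g + G g = 0]
   forces [g = 0], as the kernel of [G] is bounded below by a positive constant.

   Injectivity of [A] gives the uniqueness of the minimizer and that of its
   adjoint gives the density of its range in D_Sigma, that is [L_e(t) --> 0].
   The estimate is the Cauchy-Schwarz inequality applied to
   [<g, e> - <P (K + I/2) g, h> = <g, E e - A h>]. *)

Require Import Defs.
From HB Require Import structures.
From mathcomp Require Import all_boot all_order all_algebra.
From mathcomp Require Import all_classical all_reals all_analysis.
From mathcomp Require Import measurable_realfun.
From mathcomp Require Import ring lra.

Set Implicit Arguments.
Unset Strict Implicit.
Unset Printing Implicit Defensive.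

Import Order.TTheory GRing.Theory Num.Theory.
Import numFieldNormedType.Exports.

Local Open Scope classical_set_scope.
Local Open Scope ring_scope.

(** * Prehilbert spaces *)

(** The kernel calculus has a spectral origin. With normalized measure, on spherical harmonics of
    degree l, [kN a r] has the multiplier a r^l / (l + a), the Poisson kernel [kP a r] has r^l, and
    a^2 - Delta has (l + a)^2. Hence G, with multiplier a / (l + a), is a times an inverse square
    root of a^2 - Delta. The obstacle is the singularity on the diagonal. Integrations by parts are
    made for r < 1, where the kernels are C^1 up to s = 1, and r tends to 1 only in the resulting
    identities. Elements of L^2 are represented by functions on R^d, projections are selected by
    [get], and divergent integrals have default values. So linearity and uniqueness hold almost
    everywhere or after pairing with an L^2 function. Kernels and test functions are composed with
    [radial], so that bounds valid on the sphere hold on all of R^d. *)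

Section real_sequences.
Context {R : realType}.
Implicit Types (u : nat -> R) (l m : R).

Lemma cvgn_to_le u l m : u n @[n --> \oo] --> l -> (forall n, u n <= m) -> l <= m.
Proof.
move=> ul um; apply/ler_addgt0Pr => e e0.
move/cvgrPdist_le : ul => /(_ e e0)[N _ /(_ N (leqnn N))] /=.
by rewrite ler_norml => /andP[_]; have := um N; lra.
Qed.

Lemma cvgn_squeeze0 u (v : nat -> R) : (forall n, 0 <= u n <= v n) ->
  v n @[n --> \oo] --> (0 : R) -> u n @[n --> \oo] --> (0 : R).
Proof.
move=> uv v0; apply: (@squeeze_cvgr _ _ _ _ (cst 0) v) => //.
- exact: nearW.
- exact: cvg_cst.
Qed.

Lemma cvgn_sqrt u l : u n @[n --> \oo] --> l ->
  Num.sqrt (u n) @[n --> \oo] --> Num.sqrt l.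
Proof. by move=> ul; apply: continuous_cvg => //; exact: sqrt_continuous. Qed.

End real_sequences.

Section prehilbert.
Context {R : realType} {V : lmodType R}.
Variables (H : set V) (ip : V -> V -> R).

(** Definiteness is left out: in L^2 a function that is null almost everywhere has norm 0 without
    being [0]. The laws are relative to a set [H] because integrals of products are linear only on
    square-integrable functions. *)
Record prehilbert : Prop := Prehilbert {
  ph0 : H 0;
  phD : forall x y, H x -> H y -> H (x + y);
  phZ : forall c x, H x -> H (c *: x);
  ipC : forall x y, H x -> H y -> ip x y = ip y x;
  ipDl : forall x y z, H x -> H y -> H z -> ip (x + y) z = ip x z + ip y z;
  ipZl : forall c x z, H x -> H z -> ip (c *: x) z = c * ip x z;
  ip_ge0 : forall x, H x -> 0 <= ip x x }.

Definition nrm x := Num.sqrt (ip x x).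

Definition tends (u : nat -> V) x := nrm (u n - x) @[n --> \oo] --> 0.

Definition cauchy_seq (u : nat -> V) := forall e : R, 0 < e ->
  exists N, forall m n, (N <= m)%N -> (N <= n)%N -> nrm (u m - u n) <= e.

Hypothesis ph : prehilbert.

Lemma phN x : H x -> H (- x).
Proof. by move=> Hx; rewrite -scaleN1r; exact: (phZ ph). Qed.

Lemma phB x y : H x -> H y -> H (x - y).
Proof. by move=> Hx Hy; apply: (phD ph) => //; exact: phN. Qed.

Lemma ipDr x y z : H x -> H y -> H z -> ip z (x + y) = ip z x + ip z y.
Proof.
move=> Hx Hy Hz; rewrite (ipC ph)//; last exact: (phD ph).
by rewrite (ipDl ph)// !(ipC ph (y := z)).
Qed.

Lemma ipZr c x z : H x -> H z -> ip z (c *: x) = c * ip z x.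
Proof.
move=> Hx Hz; rewrite (ipC ph)//; last exact: (phZ ph).
by rewrite (ipZl ph)// (ipC ph (y := z)).
Qed.

Lemma ipNl x z : H x -> H z -> ip (- x) z = - ip x z.
Proof. by move=> Hx Hz; rewrite -scaleN1r (ipZl ph)// mulN1r. Qed.

Lemma ipNr x z : H x -> H z -> ip z (- x) = - ip z x.
Proof. by move=> Hx Hz; rewrite -scaleN1r ipZr// mulN1r. Qed.

Lemma ipBl x y z : H x -> H y -> H z -> ip (x - y) z = ip x z - ip y z.
Proof. by move=> *; rewrite (ipDl ph)// ?ipNl//; exact: phN. Qed.

Lemma ipBr x y z : H x -> H y -> H z -> ip z (x - y) = ip z x - ip z y.
Proof. by move=> *; rewrite ipDr// ?ipNr//; exact: phN. Qed.

Lemma ip0l x : H x -> ip 0 x = 0.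
Proof. by move=> Hx; rewrite -(scale0r (0:V)) (ipZl ph) ?mul0r//; exact: ph0. Qed.

Lemma nrm_ge0 x : 0 <= nrm x. Proof. exact: sqrtr_ge0. Qed.

Lemma nrm_sqr x : H x -> nrm x ^+ 2 = ip x x.
Proof. by move=> Hx; rewrite sqr_sqrtr// (ip_ge0 ph). Qed.

Lemma nrmZ c x : H x -> nrm (c *: x) = `|c| * nrm x.
Proof.
move=> Hx; rewrite /nrm (ipZl ph)// ?ipZr//; last exact: (phZ ph).
by rewrite mulrA -expr2 sqrtrM ?sqr_ge0// sqrtr_sqr.
Qed.

Lemma nrmN x : H x -> nrm (- x) = nrm x.
Proof. by move=> Hx; rewrite -scaleN1r nrmZ// normrN1 mul1r. Qed.

Lemma nrm_distC x y : H x -> H y -> nrm (x - y) = nrm (y - x).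
Proof. by move=> Hx Hy; rewrite -nrmN ?opprB//; exact: phB. Qed.

Lemma cauchy_schwarz x y : H x -> H y -> `|ip x y| <= nrm x * nrm y.
Proof.
move=> Hx Hy.
have key t : 0 <= ip x x + 2 * t * ip x y + t ^+ 2 * ip y y.
  have Hty : H (t *: y) by exact: (phZ ph).
  have := ip_ge0 ph (phD ph Hx Hty).
  rewrite (ipDl ph)// ?ipDr//; [|exact: (phD ph)].
  rewrite !(ipZl ph)// !ipZr// (ipC ph Hy Hx) => h.
  suff -> : ip x x + 2 * t * ip x y + t ^+ 2 * ip y y =
    ip x x + t * ip x y + (t * ip x y + t * (t * ip y y)) by [].
  by ring.
have sq : ip x y ^+ 2 <= ip x x * ip y y.
  (* [ip y y = 0] does not give [y = 0] here. In that case [key] is affine in t and, unless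
     [ip x y = 0], the chosen t would make it equal to - ip x x - 2 < 0. *)
  have [y0|y0] := eqVneq (ip y y) 0.
    rewrite y0 mulr0; have := key (- (ip x x + 1) / ip x y).
    have [->|xy0] := eqVneq (ip x y) 0; first by rewrite expr0n.
    rewrite y0 mulr0 addr0; have -> : 2 * (- (ip x x + 1) / ip x y) * ip x y =
      - 2 * (ip x x + 1) by field.
    by have := ip_ge0 ph Hx; lra.
  have yy : 0 < ip y y by rewrite lt_neqAle eq_sym y0 (ip_ge0 ph).
  have := key (- ip x y / ip y y); rewrite -(pmulr_rge0 _ yy).
  suff -> : ip y y * (ip x x + 2 * (- ip x y / ip y y) * ip x y +
     (- ip x y / ip y y) ^+ 2 * ip y y) = ip x x * ip y y - ip x y ^+ 2.
    by rewrite subr_ge0.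
  by field.
rewrite -(ler_pXn2r (n := 2))// ?nnegrE ?mulr_ge0 ?nrm_ge0//.
by rewrite exprMn !nrm_sqr// -normrX ger0_norm ?sqr_ge0.
Qed.

Lemma nrmD x y : H x -> H y -> nrm (x + y) <= nrm x + nrm y.
Proof.
move=> Hx Hy; have Hxy := phD ph Hx Hy.
rewrite -(ler_pXn2r (n := 2))// ?nnegrE ?addr_ge0 ?nrm_ge0//.
rewrite sqrrD !nrm_sqr// (ipDl ph)// !ipDr// (ipC ph Hy Hx).
have := le_trans (ler_norm _) (cauchy_schwarz Hx Hy); lra.
Qed.

Lemma nrm_triangle x y z : H x -> H y -> H z ->
  nrm (x - z) <= nrm (x - y) + nrm (y - z).
Proof.
move=> Hx Hy Hz; apply: le_trans (nrmD _ _); rewrite ?subrKA//; exact: phB.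
Qed.

Lemma ler_nrmB x y : H x -> H y -> `|nrm x - nrm y| <= nrm (x - y).
Proof.
move=> Hx Hy; have Hxy := phB Hx Hy; rewrite ler_norml.
have := nrmD Hxy Hy; rewrite subrK => h1.
have := nrmD (phB Hy Hx) Hx; rewrite subrK (nrm_distC Hy Hx) => h2.
by apply/andP; split; lra.
Qed.

Lemma parallelogram x y : H x -> H y ->
  ip (x - y) (x - y) + ip (x + y) (x + y) = 2 * (ip x x + ip y y).
Proof.
move=> Hx Hy; rewrite !(ipBl, ipBr, ipDl ph, ipDr) ?phB ?(phD ph)//; first ring.
all: by [exact: phB|exact: (phD ph)].
Qed.

Lemma tendsP u x : tends u x <-> forall e : R, 0 < e ->
  exists N, forall n, (N <= n)%N -> nrm (u n - x) <= e.
Proof.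
split=> [/cvgr0Pnorm_le h e e0|h].
  have [N _ hN] := h _ e0; exists N => n Nn.
  exact: le_trans (ler_norm _) (hN n Nn).
apply/cvgr0Pnorm_le => e e0; have [N hN] := h _ e0.
by exists N => // n /hN; rewrite ger0_norm ?nrm_ge0.
Qed.

Lemma tends_ip u x y : (forall n, H (u n)) -> H x -> H y -> tends u x ->
  ip (u n) y @[n --> \oo] --> ip x y.
Proof.
move=> Hu Hx Hy /tendsP ux; apply/cvgrPdist_le => e e0.
have y1 : 0 < nrm y + 1 by rewrite ltr_wpDl ?nrm_ge0.
have [N hN] := ux _ (divr_gt0 e0 y1); exists N => // n /hN h.
rewrite -ipBl// (le_trans (cauchy_schwarz _ _))//; first exact: phB.
rewrite (nrm_distC Hx)// (le_trans (ler_wpM2r (nrm_ge0 _) h))//.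
rewrite mulrAC ler_pdivrMr// ler_pM2l//; have := nrm_ge0 y; lra.
Qed.

Lemma tends_nrm u x : (forall n, H (u n)) -> H x -> tends u x ->
  nrm (u n) @[n --> \oo] --> nrm x.
Proof.
move=> Hu Hx /tendsP ux; apply/cvgrPdist_le => e /ux[N hN].
exists N => // n /hN; apply: le_trans; rewrite (nrm_distC _ Hx)//.
exact: ler_nrmB.
Qed.

Lemma tends_cauchy u x : (forall n, H (u n)) -> H x -> tends u x -> cauchy_seq u.
Proof.
move=> Hu Hx /tendsP ux e e0; have [N hN] := ux _ (divr_gt0 e0 (ltr0n _ 2)).
exists N => m n Nm Nn; apply: le_trans (nrm_triangle _ Hx _) _ => //.
rewrite (nrm_distC Hx)//; have := hN _ Nm; have := hN _ Nn; lra.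
Qed.

End prehilbert.

Section hilbert.
Context {R : realType} {V : lmodType R}.
Variables (H : set V) (ip : V -> V -> R).
Hypothesis ph : prehilbert H ip.
Local Notation nrm := (nrm ip).
Local Notation tends := (tends ip).
Hypothesis complete : forall u, (forall n, H (u n)) -> cauchy_seq ip u ->
  exists2 x, H x & tends u x.

Definition seq_closed (C : set V) := forall u x, (forall n, C (u n)) -> H x ->
  tends u x -> C x.

(* The sublevel sets [J <= inf + 1/n] are nested, closed, convex and bounded;
   the parallelogram law makes elements of nearly minimal norm a Cauchy
   sequence, which spares weak compactness. *)
Lemma exists_minimizer (C : set V) (J : V -> R) (B : R) :
  C `<=` H -> C !=set0 -> seq_closed C ->
  (forall x y, C x -> C y -> C (2^-1 *: (x + y))) ->
  (forall x, C x -> 0 <= J x) ->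
  (forall x y m, C x -> C y -> J x <= m -> J y <= m -> J (2^-1 *: (x + y)) <= m) ->
  (forall u x m, (forall n, C (u n)) -> C x -> tends u x ->
    (forall n, J (u n) <= m) -> J x <= m) ->
  (forall x, C x -> J x <= inf (J @` C) + 1 -> nrm x <= B) ->
  exists2 x, C x & J x = inf (J @` C).
Proof.
move=> CH [c Cc] Ccl Cmid J0 Jmid Jcl Jco.
set m := inf (J @` C) in Jco *.
have hinf : has_inf (J @` C).
  by split; [exists (J c), c|exists 0 => _ [x Cx <-]; exact: J0].
have m_le x : C x -> m <= J x.
  by move=> Cx; apply: ge_inf; [case: hinf|exists x].
pose eps n : R := n.+1%:R^-1.
have eps0 n : 0 < eps n by rewrite invr_gt0 ltr0n.
have eps1 n : eps n <= 1 by rewrite invf_le1 ?ltr0n// ler1n.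
have epsle k n : (n <= k)%N -> eps k <= eps n.
  by move=> nk; rewrite lef_pV2 ?posrE ?ltr0n// ler_nat.
pose Cn n := [set x | C x /\ J x <= m + eps n].
pose sq n := [set ip x x | x in Cn n].
have sq_inf n : has_inf (sq n).
  split; last by exists 0 => _ [x [Cx _] <-]; apply: (ip_ge0 ph); exact: CH.
  have [_ [x Cx <-] Jx] := inf_adherent (eps0 n) hinf.
  by exists (ip x x), x => //; split => //; exact: ltW.
have B0 : 0 <= B.
  have [_ [x [Cx Jx] _]] := (sq_inf 0%N).1.
  apply: le_trans (nrm_ge0 ip x) (Jco x Cx _).
  by rewrite (le_trans Jx)// lerD2l.
pose d n := inf (sq n).
have d_le n x : Cn n x -> d n <= ip x x.
  by move=> Cx; apply: ge_inf; [case: (sq_inf n)|exists x].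
have d_nd k n : (n <= k)%N -> d n <= d k.
  move=> nk; apply: lb_le_inf; first by case: (sq_inf k).
  move=> _ [x [Cx Jx] <-]; apply: d_le; split => //.
  by rewrite (le_trans Jx)// lerD2l epsle.
have d_ub n : d n <= B ^+ 2.
  have [_ [x [Cx Jx] _]] := (sq_inf n).1.
  apply: (le_trans (d_le n x _)) => //.
  rewrite -(nrm_sqr ph); last exact: CH.
  rewrite ler_pXn2r ?nnegrE ?nrm_ge0//; apply: Jco => //.
  by rewrite (le_trans Jx)// lerD2l.
have /choice[u uP] n : exists x, Cn n x /\ ip x x <= d n + eps n.
  have [_ [x Cx <-] xd] := inf_adherent (eps0 n) (sq_inf n).
  by exists x; split => //; exact: ltW.
have Cu n : C (u n) by have [[]] := uP n.
have Hu n : H (u n) by exact: CH.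
have hD : has_sup (range d).
  by split; [exists (d 0), 0|exists (B ^+ 2) => _ [n _ <-]].
(* The midpoint lies in [Cn n], so its squared norm is at least [d n]. As [d] is nondecreasing and
   bounded, [sup (range d) - d n] tends to 0, which makes [u] a Cauchy sequence. *)
have uu n k : (n <= k)%N ->
    ip (u n - u k) (u n - u k) <= 2 * (sup (range d) - d n) + 4 * eps n.
  move=> nk.
  have mid : Cn n (2^-1 *: (u n + u k)).
    split; first exact: Cmid.
    have [[_ Jn] _] := uP n; have [[_ Jk] _] := uP k.
    by apply: Jmid => //; rewrite (le_trans Jk)// lerD2l epsle.
  have := d_le _ _ mid; have Huk := phD ph (Hu n) (Hu k).
  rewrite (ipZl ph)// ?(ipZr ph)//; last exact: (phZ ph).
  have := parallelogram ph (Hu n) (Hu k).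
  have := (uP n).2; have := (uP k).2; have := epsle _ _ nk.
  have : d k <= sup (range d) by apply: ub_le_sup; [case: hD|exists k].
  move: (ip (u n + u k) _) (ip (u n - u k) _) => X Y; lra.
have [x Hx ux] : exists2 x, H x & tends u x.
  apply: complete => // e e0.
  have e2 : 0 < e ^+ 2 / 8 by rewrite divr_gt0 ?exprn_gt0.
  have [_ [N1 _ <-] hN1] := sup_adherent e2 hD.
  have [N2 hN2] : exists N, eps N <= e ^+ 2 / 8.
    exists (Num.truncn (e ^+ 2 / 8)^-1); rewrite /eps -[leRHS]invrK.
    by rewrite lef_pV2 ?posrE ?ltr0n ?invr_gt0// ltW// truncnS_gt.
  pose N := maxn N1 N2.
  have {}uu n k : (N <= n)%N -> (n <= k)%N -> nrm (u n - u k) <= e.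
    move=> Nn nk; rewrite -(ler_pXn2r (n := 2))// ?nnegrE ?nrm_ge0// ?ltW//.
    rewrite (nrm_sqr ph); last exact: (phB ph).
    have := uu _ _ nk; have := epsle n N2 (leq_trans (leq_maxr _ _) Nn).
    have := d_nd n N1 (leq_trans (leq_maxl _ _) Nn); lra.
  exists N => n k Nn Nk; have [nk|/ltnW kn] := leqP n k; first exact: uu.
  by rewrite (nrm_distC ph)//; exact: uu.
have Cx : C x by exact: Ccl ux.
exists x => //; apply/eqP; rewrite eq_le m_le// andbT.
apply/ler_addgt0Pr => e e0.
pose N := Num.truncn e^-1.
have hN : eps N <= e.
  by rewrite /eps -[leRHS]invrK lef_pV2 ?posrE ?ltr0n ?invr_gt0// ltW// truncnS_gt.
apply: le_trans (_ : m + eps N <= _); last by rewrite lerD2l.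
apply: (Jcl (fun n => u (n + N)%N)) => //.
  by have := ux; rewrite /tends -(cvg_shiftn N).
move=> n; have [[_ h] _] := uP (n + N)%N.
by rewrite (le_trans h)// lerD2l epsle// leq_addl.
Qed.

Definition is_subspace (M : set V) :=
  [/\ M `<=` H, M 0, forall x y, M x -> M y -> M (x + y) &
      forall c x, M x -> M (c *: x)].

Lemma projection_exists (M : set V) f : is_subspace M -> seq_closed M -> H f ->
  exists2 g, M g & forall h, M h -> ip (f - g) h = 0.
Proof.
move=> [MH M0 MD MZ] Mcl Hf.
have Mf x : M x -> H (f - x) by move=> /MH Hx; exact: (phB ph).
have midE x y : f - 2^-1 *: (x + y) = 2^-1 *: (f - x) + 2^-1 *: (f - y).
  rewrite -scalerDr addrACA -opprD scalerBr; congr (_ - _).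
  by rewrite -mulr2n -scalerMnr scalerMnl -[X in X *: _]mulr_natr mulVf ?scale1r.
have [g Mg gm] : exists2 g, M g & nrm (f - g) = inf ((fun g => nrm (f - g)) @` M).
  apply: (@exists_minimizer M _ (nrm f + inf ((fun g => nrm (f - g)) @` M) + 1)).
  - exact: MH.
  - by exists 0.
  - exact: Mcl.
  - by move=> x y Mx My; apply: MZ; exact: MD.
  - by move=> x _; exact: nrm_ge0.
  - move=> x y m Mx My xm ym; rewrite midE.
    apply: le_trans (nrmD ph _ _) _; try by apply: (phZ ph); exact: Mf.
    rewrite !(nrmZ ph); try exact: Mf.
    by rewrite ger0_norm ?invr_ge0//; lra.
  - move=> u x m Mu Mx ux um.
    have Hu n : H (u n) by exact: MH.
    have Hx : H x by exact: MH.
    apply: (@cvgn_to_le _ (fun n => nrm (f - u n))) => //.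
    apply: (tends_nrm ph) => //; [by move=> n; exact: Mf|exact: Mf|].
    move/(tendsP ip) : ux => ux; apply/(tendsP ip) => e /ux[N hN].
    exists N => n /hN; have -> : f - u n - (f - x) = x - u n.
      by rewrite opprB addrC subrKA.
    by rewrite (nrm_distC ph).
  - move=> x Mx h; have Hx := MH _ Mx.
    have := nrmD ph Hf (phN ph (Mf x Mx)).
    by rewrite subKr (nrmN ph); [lra|exact: Mf].
exists g => // h Mh; have Hh := MH _ Mh; have Hfg := Mf _ Mg.
have key t : 0 <= 2 * t * ip (f - g) h + t ^+ 2 * ip h h.
  have Mt : M (g - t *: h) by rewrite -scaleNr; apply: MD => //; exact: MZ.
  have : nrm (f - g) <= nrm (f - (g - t *: h)).
    rewrite gm; apply: ge_inf; last by exists (g - t *: h).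
    by exists 0 => _ [x _ <-]; exact: nrm_ge0.
  rewrite -(ler_pXn2r (n := 2))// ?nnegrE ?nrm_ge0//.
  rewrite !(nrm_sqr ph)//; last exact: Mf.
  have Hth : H (t *: h) by exact: (phZ ph).
  have -> : f - (g - t *: h) = (f - g) + t *: h by rewrite opprB addrA addrAC.
  have Hs := phD ph Hfg Hth.
  rewrite (ipDl ph Hfg Hth Hs) !(ipDr ph Hfg Hth)//.
  rewrite !(ipZl ph)// !(ipZr ph)// (ipC ph Hh Hfg) => h'.
  suff -> : 2 * t * ip (f - g) h + t ^+ 2 * ip h h = t * ip (f - g) h +
    (t * ip (f - g) h + t * (t * ip h h)) by lra.
  by ring.
(* [h] may have norm 0 without being 0; [key] is then affine in t and its slope has to vanish. *)
have [h0|h0] := eqVneq (ip h h) 0.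
  have := key (- ip (f - g) h); rewrite h0 mulr0 addr0.
  move=> k; apply/eqP; rewrite -sqrf_eq0 eq_le sqr_ge0 andbT expr2; lra.
have hh : 0 < ip h h by rewrite lt_neqAle eq_sym h0 (ip_ge0 ph).
have := key (- ip (f - g) h / ip h h); rewrite -(pmulr_rge0 _ hh).
have -> : ip h h * (2 * (- ip (f - g) h / ip h h) * ip (f - g) h +
   (- ip (f - g) h / ip h h) ^+ 2 * ip h h) = - ip (f - g) h ^+ 2 by field.
by move=> k; apply/eqP; rewrite -sqrf_eq0 eq_le sqr_ge0 andbT; lra.
Qed.

End hilbert.

(** * Square-integrable functions *)

Section integral_ae.
Context d (T : measurableType d) (R : realType).
Variable mu : {measure set T -> \bar R}.
Local Open Scope ereal_scope.
Import HBNNSimple.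

(* No measurability is assumed: the integral of a nonnegative function is a
   supremum over the simple functions below it. *)
Lemma ge0_le_integral_ae (f g : T -> \bar R) :
  (forall x, 0 <= f x) -> (forall x, 0 <= g x) ->
  {ae mu, forall x, f x <= g x} -> \int[mu]_x f x <= \int[mu]_x g x.
Proof.
move=> f0 g0 [N [mN N0 fgN]].
rewrite ge0_integralTE// [leRHS]ge0_integralTE//.
apply: ge_ereal_sup => _ [h hf <-].
have mCN := measurableC mN; pose h' := proj_nnsfun h mCN.
have -> : sintegral mu h = sintegral mu h'.
  rewrite -!integralT_nnsfun//; apply: ae_eq_integral => //.
  - exact/measurable_EFinP.
  - exact/measurable_EFinP.
  exists N; split => // x /= h'x; apply: contrapT => Nx; apply: h'x => _ /=.
  by rewrite mindicE mem_set// mulr1.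
apply: ereal_sup_ubound; exists h' => //= x; rewrite mindicE.
have [Nx|Nx] := pselect (N x).
  by rewrite memNset ?mulr0//=; exact.
rewrite mem_set// mulr1 (le_trans (hf x))//.
by apply: contrapT => fgx; apply: Nx; exact: fgN.
Qed.

Lemma eq_integral_ae (f g : T -> \bar R) :
  {ae mu, forall x, f x = g x} -> \int[mu]_x f x = \int[mu]_x g x.
Proof.
move=> fg; rewrite integralE [RHS]integralE.
congr (_ - _); apply/eqP; rewrite eq_le; apply/andP; split;
  apply: ge0_le_integral_ae => //; apply: filterS fg => x fgx;
  by rewrite ?funeposE ?funenegE fgx.
Qed.

Lemma eq_Rintegral_ae (f g : T -> R) :
  {ae mu, forall x, f x = g x} -> (\int[mu]_x f x = \int[mu]_x g x)%R.
Proof.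
by move=> fg; congr fine; apply: eq_integral_ae; apply: filterS fg => x ->.
Qed.

End integral_ae.

Section integrable_real.
Context d (T : measurableType d) (R : realType).
Variable mu : {measure set T -> \bar R}.

Implicit Types f g : T -> R.

Definition itg f := mu.-integrable setT (EFin \o f).

Lemma itg_measurable f : itg f -> measurable_fun setT f.
Proof. by move/(measurable_int mu)/measurable_EFinP. Qed.

Lemma itgD f g : itg f -> itg g -> itg (fun x => f x + g x).
Proof.
move=> fi gi; rewrite /itg (_ : _ \o _ = (EFin \o f) \+ (EFin \o g))%E//.
exact: integrableD.
Qed.

Lemma itgB f g : itg f -> itg g -> itg (fun x => f x - g x).
Proof.
move=> fi gi; rewrite /itg (_ : _ \o _ = (EFin \o f) \- (EFin \o g))%E//.
exact: integrableB.
Qed.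

Lemma itgZ c f : itg f -> itg (fun x => c * f x).
Proof.
move=> fi; rewrite /itg (_ : _ \o _ = fun x => c%:E * (EFin \o f) x)%E//.
exact: integrableZl.
Qed.

Lemma itg_sum (I : Type) (s : seq I) (F : I -> T -> R) :
  (forall i, itg (F i)) -> itg (fun x => \sum_(i <- s) F i x).
Proof.
move=> iF; rewrite /itg (_ : _ \o _ = fun x => (\sum_(i <- s) (F i x)%:E)%E).
  by apply: integrable_sum => // i _; exact: iF.
by apply/funext => x /=; rewrite sumEFin.
Qed.

Lemma Rintegral_sum (I : Type) (s : seq I) (F : I -> T -> R) :
  (forall i, itg (F i)) ->
  \int[mu]_x \sum_(i <- s) F i x = \sum_(i <- s) \int[mu]_x F i x.
Proof.
move=> iF; elim: s => [|i s ih].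
  rewrite big_nil (_ : (fun x => _) = cst 0) ?Rintegral_cst ?mul0r//.
  by apply/funext => x; rewrite big_nil.
rewrite big_cons -ih -RintegralD//; [|exact: iF|exact: itg_sum].
by apply: eq_Rintegral => x _; rewrite big_cons.
Qed.

Lemma itg_le f g : measurable_fun setT f -> itg g ->
  (forall x, `|f x| <= g x) -> itg f.
Proof.
move=> mf ig fg; apply: (le_integrable measurableT _ _ ig) => //.
  exact/measurable_EFinP.
by move=> x _; rewrite lee_fin (le_trans (fg x))// ler_norm.
Qed.

Lemma itg_ae f g : measurable_fun setT g -> itg f -> {ae mu, forall x, f x = g x} -> itg g.
Proof.
move=> mg /integrableP[mf fi] fg; apply/integrableP; split; first exact/measurable_EFinP.
rewrite (eq_integral_ae (g := fun x => `|(f x)%:E|%E))//.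
by apply: filterS fg => x ->.
Qed.

Lemma le_Rintegral_itg f g : itg f -> itg g -> (forall x, f x <= g x) ->
  \int[mu]_x f x <= \int[mu]_x g x.
Proof. by move=> iff ig fg; apply: le_Rintegral => // x _. Qed.

Lemma Rintegral_eq0 f : itg f -> (forall x, 0 <= f x) -> \int[mu]_x f x = 0 ->
  {ae mu, forall x, f x = 0}.
Proof.
move=> fi f0 /eqP.
rewrite /Rintegral fine_eq0; last exact: integrable_fin_num.
move=> /eqP i0; have mf := measurable_int mu fi.
have : (\int[mu]_x `|(EFin \o f) x| = 0)%E.
  by rewrite -[RHS]i0; apply: eq_integral => x _; rewrite gee0_abs// lee_fin.
move/ae_eq_integral_abs => /(_ measurableT mf).
by apply: filterS => x /(_ I) [].
Qed.

Lemma Rdominated_cvg (f_ : nat -> T -> R) (f g : T -> R) :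
  (forall n, measurable_fun setT (f_ n)) -> measurable_fun setT f ->
  {ae mu, forall x, f_ n x @[n --> \oo] --> f x} -> itg g ->
  (forall n, {ae mu, forall x, `|f_ n x| <= g x}) ->
  itg f /\ \int[mu]_x f_ n x @[n --> \oo] --> \int[mu]_x f x.
Proof.
move=> mf_ mf ff ig fg.
suff [h1 _ h3] : [/\ itg f,
    [sequence (\int[mu]_x `|(f_ n x)%:E - (f x)%:E|)%E]_n @ \oo --> (0%E : \bar R) &
    [sequence (\int[mu]_x (f_ n x)%:E)%E]_n @ \oo --> (\int[mu]_x (f x)%:E)%E].
  split => //; apply: fine_cvg.
  by rewrite /Rintegral fineK//; exact: integrable_fin_num.
apply: (@dominated_convergence _ _ _ mu setT measurableT _ _ (EFin \o g)) => //.
- by move=> n; exact/measurable_EFinP.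
- exact/measurable_EFinP.
- by apply: filterS ff => x fx _; apply: cvg_EFin => //; exact: nearW.
- have h := ae_foralln fg; apply: filterS h => x h n _ /=.
  by rewrite lee_fin; exact: h.
Qed.

Lemma itg_ae_finite (f : T -> \bar R) : measurable_fun setT f ->
  (forall x, 0 <= f x)%E -> (\int[mu]_x f x < +oo)%E -> itg (fine \o f) /\
  {ae mu, forall x, f x = (fine (f x))%:E}.
Proof.
move=> mf f0 foo.
have fi : mu.-integrable setT f.
  apply/integrableP; split => //.
  by rewrite (eq_integral f)// => x _; rewrite gee0_abs.
have ffin := integrable_ae measurableT fi.
have fE : {ae mu, forall x, f x = (fine (f x))%:E}.
  by apply: filterS ffin => x /(_ I) h; rewrite fineK.
split => //; apply/integrableP; split.
  by apply/measurable_EFinP; exact: measurableT_comp.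
rewrite (eq_integral_ae (g := f))//.
by apply: filterS fE => x fx; rewrite compE -[EFin _]fx gee0_abs.
Qed.

End integrable_real.

Section square_integrable.
Context d (T : measurableType d) (R : realType).
Variable mu : {finite_measure set T -> \bar R}.
Implicit Types f g h : T -> R.
Local Notation itg := (itg mu).

Definition sqi f := measurable_fun setT f /\ itg (fun x => f x ^+ 2).

Definition ip f g := \int[mu]_x (f x * g x).

Lemma Lfun2P f : f \in Lfun mu 2%:E <-> sqi f.
Proof.
split=> [f2|[mf if2]].
  split; last exact: Lfun2_integrable_sqr.
  by move: f2; rewrite inE => /andP[]; rewrite inE.
rewrite inE; apply/andP; split; rewrite inE//=.
rewrite /finite_norm unlock.
suff -> : (\int[mu]_x (`|(EFin \o f) x| `^ 2) = \int[mu]_x (f x ^+ 2)%:E)%E.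
  by rewrite poweR_lty// integrable_lty.
by apply: eq_integral => x _ /=; rewrite powR_mulrn// real_normK ?num_real.
Qed.

Lemma itg_cst c : itg (cst c).
Proof. exact: finite_measure_integrable_cst. Qed.

Lemma itg_bounded f M : measurable_fun setT f -> (forall x, `|f x| <= M) -> itg f.
Proof. by move=> mf fM; exact: itg_le (itg_cst M) _. Qed.

Lemma sqi_bounded f M : measurable_fun setT f -> (forall x, `|f x| <= M) -> sqi f.
Proof.
move=> mf fM; split => //; apply: (@itg_bounded _ (M ^+ 2)).
  exact: measurable_funX.
by move=> x; rewrite normrX ler_pXn2r ?nnegrE// (le_trans _ (fM x)).
Qed.

Lemma sqi_mul_itg f g : sqi f -> sqi g -> itg (fun x => f x * g x).
Proof.
move=> [mf fi] [mg gi]; apply: itg_le (itgD fi gi) _.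
  exact: measurable_funM.
move=> x; have := sqr_ge0 (`|f x| - `|g x|).
rewrite sqrrB normrM !real_normK ?num_real// => h.
have := mulr_ge0 (normr_ge0 (f x)) (normr_ge0 (g x)); lra.
Qed.

Lemma sqi_cst c : sqi (cst c).
Proof. by apply: (@sqi_bounded _ `|c|) => //; exact: measurable_cst. Qed.

Lemma sqi_itg f : sqi f -> itg f.
Proof.
move=> sf; rewrite (_ : f = fun x => f x * cst 1 x).
  exact: sqi_mul_itg (sqi_cst 1).
by apply/funext => x; rewrite mulr1.
Qed.

Lemma sqi_dom f g : measurable_fun setT f -> itg g -> (forall x, f x ^+ 2 <= g x) ->
  sqi f.
Proof.
move=> mf gi fg; split => //; apply: itg_le gi _; first exact: measurable_funX.
by move=> x; rewrite ger0_norm ?sqr_ge0.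
Qed.

Lemma sqiD f g : sqi f -> sqi g -> sqi (f + g).
Proof.
move=> [mf fi] [mg gi]; apply: sqi_dom (itgZ 2 (itgD fi gi)) _.
  exact: measurable_funD.
move=> x /=; rewrite -[(f + g) x]/(f x + g x).
by have := sqr_ge0 (f x - g x); rewrite sqrrB sqrrD; lra.
Qed.

Lemma sqiZ c f : sqi f -> sqi (c *: f).
Proof.
move=> [mf fi]; apply: sqi_dom (itgZ (c ^+ 2) fi) _.
  exact: measurable_funM.
by move=> x; rewrite -[(c *: f) x]/(c * f x) exprMn.
Qed.

Lemma sqiM_bounded f g M : sqi f -> measurable_fun setT g ->
  (forall x, `|g x| <= M) -> sqi (fun x => g x * f x).
Proof.
move=> [mf fi] mg gM; apply: sqi_dom (itgZ (M ^+ 2) fi) _.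
  exact: measurable_funM.
move=> x; rewrite exprMn ler_wpM2r ?sqr_ge0//.
by rewrite -real_normK ?num_real// ler_pXn2r ?nnegrE// (le_trans _ (gM x)).
Qed.

Lemma sqi_prehilbert : prehilbert [set f | sqi f] ip.
Proof.
split => /=.
- exact: (sqi_cst 0).
- exact: sqiD.
- exact: sqiZ.
- by move=> f g _ _; apply: eq_Rintegral => x _; rewrite mulrC.
- move=> f g h sf sg sh; rewrite /ip -RintegralD//; try exact: sqi_mul_itg.
  by apply: eq_Rintegral => x _; rewrite -mulrDl.
- move=> c f h sf sh; rewrite /ip -RintegralZl//; last exact: sqi_mul_itg.
  by apply: eq_Rintegral => x _; rewrite mulrA.
- by move=> f _; apply: Rintegral_ge0 => x _; rewrite -expr2 sqr_ge0.
Qed.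

Lemma sqi0 : sqi 0. Proof. exact: (sqi_cst 0). Qed.
Lemma sqiN f : sqi f -> sqi (- f). Proof. exact: (phN sqi_prehilbert). Qed.
Lemma sqiB f g : sqi f -> sqi g -> sqi (f - g). Proof. exact: (phB sqi_prehilbert). Qed.

Lemma sqi_ae f g : measurable_fun setT g -> sqi f -> {ae mu, forall x, f x = g x} -> sqi g.
Proof.
move=> mg [mf fi] fg; split => //; apply: itg_ae fi _; first exact: measurable_funX.
by apply: filterS fg => x ->.
Qed.

Lemma eq_ip_ae f f' g g' : {ae mu, forall x, f x = f' x} ->
  {ae mu, forall x, g x = g' x} -> ip f g = ip f' g'.
Proof.
move=> ff' gg'; apply: eq_Rintegral_ae.
by apply: filterS2 ff' gg' => x -> ->.
Qed.

Lemma ip_eq0 f : sqi f -> ip f f = 0 -> {ae mu, forall x, f x = 0}.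
Proof.
move=> sf f0; have h x : 0 <= f x * f x by rewrite -expr2 sqr_ge0.
have := Rintegral_eq0 (sqi_mul_itg sf sf) h f0; apply: filterS => x /eqP.
by rewrite mulf_eq0 orbb => /eqP.
Qed.

Lemma nrm_eq0 f : sqi f -> nrm ip f = 0 -> {ae mu, forall x, f x = 0}.
Proof.
move=> sf f0; apply: ip_eq0 => //.
by rewrite -(nrm_sqr sqi_prehilbert)// f0 expr0n.
Qed.

Lemma nrm_ae0 f : {ae mu, forall x, f x = 0} -> nrm ip f = 0.
Proof.
move=> f0; rewrite /nrm (eq_ip_ae (f' := cst 0) (g' := cst 0)) /ip//.
under eq_Rintegral do rewrite mul0r.
by rewrite Rintegral_cst// mul0r sqrtr0.
Qed.

Lemma dominated_nrm_cvg (f_ : nat -> T -> R) f g :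
  (forall n, measurable_fun setT (f_ n)) -> measurable_fun setT f ->
  {ae mu, forall x, f_ n x @[n --> \oo] --> f x} -> itg g ->
  (forall n, {ae mu, forall x, (f_ n x - f x) ^+ 2 <= g x}) ->
  tends ip f_ f.
Proof.
move=> mf_ mf ff gi fg.
have [] := @Rdominated_cvg _ _ _ mu (fun n x => (f_ n x - f x) ^+ 2) (cst 0) g.
- by move=> n; apply: measurable_funX; exact: measurable_funB.
- exact: measurable_cst.
- apply: filterS ff => x fx; rewrite -[cst 0 x](expr0n R 2).
  have h : f_ n x - f x @[n --> \oo] --> (0 : R) by apply/subr_cvg0.
  by under eq_fun do rewrite expr2; rewrite expr2; exact: cvgM.
- exact: gi.
- by move=> n; apply: filterS (fg n) => x; rewrite ger0_norm ?sqr_ge0.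
move=> _; rewrite Rintegral_cst// mul0r => h.
have := cvgn_sqrt h; rewrite sqrtr0 /tends.
suff -> : (fun n => nrm ip (f_ n - f)) =
  Num.sqrt \o (fun n => \int[mu]_x (f_ n x - f x) ^+ 2) by [].
by apply/funext => n; congr Num.sqrt; apply: eq_Rintegral => x _; rewrite expr2.
Qed.

(** Riesz-Fischer: along a subsequence with increments of norm at most 2^-k, the sum of the absolute
    increments is square-integrable by monotone convergence. It is thus finite almost everywhere; it
    yields the pointwise limit and dominates the distance to it. *)
Lemma sqi_complete (u : nat -> T -> R) : (forall n, sqi (u n)) ->
  cauchy_seq ip u -> exists2 f, sqi f & tends ip u f.
Proof.
move=> su cu; pose P := sqi_prehilbert.
have /choice[N0 hN0] k : exists N, forall m n, (N <= m)%N -> (N <= n)%N ->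
    nrm ip (u m - u n) <= 2^-1 ^+ k by apply: cu; rewrite exprn_gt0.
(* The maximum makes the chosen indices nondecreasing while keeping [N0 k <= N k]. *)
pose N := fix N k := if k is k'.+1 then maxn (N k') (N0 k) else N0 0%N.
have N0N k : (N0 k <= N k)%N by case: k => //= k; rewrite leq_maxr.
have NS k : (N k <= N k.+1)%N by rewrite /= leq_maxl.
pose v k := u (N k); have sv k : sqi (v k) by exact: su.
have mv k : measurable_fun setT (v k) by exact: (sv k).1.
have hv k : nrm ip (v k.+1 - v k) <= 2^-1 ^+ k.
  by apply: hN0; [exact: leq_trans (NS k)|exact: N0N].
pose a k (x : T) : R := `|v k.+1 x - v k x|.
have sa k : sqi (a k).
  apply: sqi_dom (sqiB (sv k.+1) (sv k)).2 _ => [|x].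
    by apply: measurableT_comp => //; exact: measurable_funB.
  by rewrite /a real_normK ?num_real.
have na k : nrm ip (a k) <= 2^-1 ^+ k.
  apply: le_trans (hv k); rewrite /nrm ler_wsqrtr// /ip le_eqVlt; apply/orP; left.
  by apply/eqP/eq_Rintegral => x _; rewrite -!expr2 real_normK ?num_real.
pose g k : T -> R := \sum_(i < k) a i.
have gE k x : g k x = \sum_(i < k) a i x by rewrite /g fct_sumE.
have sg k : sqi (g k).
  rewrite /g; elim: k => [|k ih]; first by rewrite big_ord0; exact: sqi0.
  by rewrite big_ord_recr /=; exact: sqiD.
(* The bound is the sum of 2^-i over i < k. *)
have ng k : nrm ip (g k) <= 2 - 2 * 2^-1 ^+ k.
  elim: k => [|k ih]; first by rewrite /g big_ord0 expr0 mulr1 subrr (nrm_ae0)//; apply: aeW.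
  rewrite [g _]big_ord_recr /= -/(g k); apply: le_trans (nrmD P (sg k) (sa k)) _.
  by have := na k; rewrite exprS; lra.
have g0 k x : 0 <= g k x by rewrite gE sumr_ge0// => i _; exact: normr_ge0.
have gS k x : g k x <= g k.+1 x by rewrite !gE big_ord_recr /= lerDl normr_ge0.
have gmono k l x : (k <= l)%N -> g k x <= g l x.
  by move=> /subnK <-; elim: (l - k)%N => // n; move/le_trans; apply; exact: gS.
pose h k x := ((g k x) ^+ 2)%:E.
pose H x := limn (h ^~ x).
have mh k : measurable_fun setT (h k).
  by apply/measurable_EFinP; apply: measurable_funX; exact: (sg k).1.
have h0 k x : (0 <= h k x)%E by rewrite lee_fin sqr_ge0.
have hnd x : nondecreasing_seq (h ^~ x).
  by move=> k l kl; rewrite lee_fin ler_pXn2r ?nnegrE//; exact: gmono.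
have hcvg x : h ^~ x @ \oo --> H x by exact: ereal_nondecreasing_is_cvgn.
have hH k x : (h k x <= H x)%E.
  rewrite /H (cvg_lim _ (ereal_nondecreasing_cvgn (hnd x)))//.
  by apply: ereal_sup_ubound; exists k.
have mH : measurable_fun setT H by apply: (emeasurable_fun_cvg h) => // x _; exact: hcvg.
have H0 x : (0 <= H x)%E by apply: le_trans (hH 0%N x).
have iH : (\int[mu]_x H x <= 4%:E)%E.
  rewrite monotone_convergence//.
  apply: lime_le.
    apply: ereal_nondecreasing_is_cvgn => k l kl.
    by apply: ge0_le_integral => // x _; exact: hnd.
  apply: nearW => k; have h2 : nrm ip (g k) <= 2.
    have p0 : 0 <= 2^-1 ^+ k :> R by rewrite exprn_ge0// invr_ge0.
    by apply: le_trans (ng k) _; lra.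
  have -> : (\int[mu]_x h k x = (ip (g k) (g k))%:E)%E.
    rewrite /ip /Rintegral fineK; last by apply: integrable_fin_num => //; exact: sqi_mul_itg.
    by apply: eq_integral => x _; rewrite /h expr2.
  rewrite lee_fin -(nrm_sqr P)//; last exact: sg.
  by have := nrm_ge0 ip (g k); rewrite expr2; nra.
have [iD HD] := itg_ae_finite mH H0 (le_lt_trans iH (ltry _)).
pose A := [set x | H x < +oo]%E.
have mA : measurable A by rewrite /A -[X in measurable X]setTI; exact: emeasurable_fun_infty_o.
(* Cut to zero where the sum of the increments is infinite, so that [w] converges at every point and
   [limn] never takes a default value. *)
pose w k x := v k x * \1_A x.
have wE k x : A x -> w k x = v k x by move=> Ax; rewrite /w indicE mem_set// mulr1.
have wN k x : ~ A x -> w k x = 0 by move=> Ax; rewrite /w indicE memNset// mulr0.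
have bnd k l x : (k <= l)%N -> `|v l x - v k x| <= g l x - g k x.
  move=> /subnK <-; elim: (l - k)%N => [|n ih]; first by rewrite !subrr normr0.
  have -> : v (n.+1 + k)%N x - v k x = (v (n.+1 + k)%N x - v (n + k)%N x) +
     (v (n + k)%N x - v k x) by ring.
  apply: le_trans (ler_normD _ _) _.
  rewrite [g (n.+1 + k)%N x]gE addSn big_ord_recr /= -gE.
  by rewrite -/(a _ x); move: ih; lra.
have wcvg x : cvgn (w ^~ x).
  have [Ax|nAx] := pselect (A x); last first.
    rewrite (_ : w ^~ x = cst 0); first exact: is_cvg_cst.
    by apply/funext => k; exact: wN.
  rewrite (_ : w ^~ x = v ^~ x); last by apply/funext => k; exact: wE.
  have Hfin : H x = (fine (H x))%:E by rewrite fineK// ge0_fin_numE.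
  have gc : cvgn (g ^~ x).
    apply: nondecreasing_is_cvgn; first by move=> k l; exact: gmono.
    exists (fine (H x) + 1) => _ [k _ <-].
    have := hH k x; rewrite Hfin lee_fin; have := g0 k x; nra.
  apply/cauchy_cvgP; apply/cauchy_exP => /= e e0.
  have /cvgrPdist_lt/(_ _ e0)[K _ hK] := gc.
  exists (v K x); exists K => // l /= Kl.
  rewrite /ball/= distrC; apply: le_lt_trans (bnd _ _ x Kl) _.
  have := hK K (leqnn K); rewrite /= => hK1.
  have gl : g l x <= limn (g ^~ x).
    by apply: nondecreasing_cvgn_le; [move=> ? ?; exact: gmono|exact: gc].
  by move: hK1; rewrite ltr_norml => /andP[_]; lra.
pose f x := limn (w ^~ x).
have mw k : measurable_fun setT (w k).
  by apply: measurable_funM => //; exact: measurable_indic.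
have mf : measurable_fun setT f.
  by apply: (measurable_fun_cvg (h := w)) => // x _; exact: wcvg.
have wf k x : (w k x - f x) ^+ 2 <= fine (H x).
  have [Ax|nAx] := pselect (A x); last first.
    have -> : f x = 0.
      rewrite /f (_ : w ^~ x = cst 0) ?lim_cst//; apply/funext => j; exact: wN.
    by rewrite wN// subr0 expr0n fine_ge0.
  have Hfin : H x = (fine (H x))%:E by rewrite fineK// ge0_fin_numE.
  rewrite -[leRHS]sqr_sqrtr ?fine_ge0// -real_normK ?num_real//.
  rewrite ler_pXn2r ?nnegrE ?sqrtr_ge0//.
  apply: (@cvgn_to_le _ (fun l => `|w k x - w (l + k)%N x|)).
    apply: cvg_norm; apply: cvgB; first exact: cvg_cst.
    have : w ^~ x @ \oo --> f x by exact: wcvg.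
    by rewrite -(cvg_shiftn k).
  move=> l; rewrite !wE// distrC; apply: le_trans (bnd _ _ x (leq_addl l k)) _.
  have := hH (l + k)%N x; rewrite {1}Hfin lee_fin => hl.
  apply: (@le_trans _ _ (g (l + k)%N x)); first by rewrite gerBl.
  by rewrite -(ger0_norm (g0 _ x)) -sqrtr_sqr ler_wsqrtr.
have wtf : tends ip w f.
  apply: (@dominated_nrm_cvg w f (fine \o H)) => //.
    by apply: aeW => x; exact: wcvg.
  by move=> n; apply: aeW => x; exact: wf.
have Aae : {ae mu, forall x, A x}.
  by apply: filterS HD => x Hx; rewrite /A/= Hx ltry.
have sw k : sqi (w k).
  by apply: sqi_ae (sv k) _ => //; apply: filterS Aae => x Ax; rewrite wE.
have sf : sqi f.
  rewrite (_ : f = w 0%N - (w 0%N - f)); last by rewrite subKr.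
  apply: sqiB => //; apply: sqi_dom iD _ => [|x]; last exact: wf.
  exact: measurable_funB.
exists f => //; apply/tendsP => e e0.
have e2 : 0 < e / 2 by rewrite divr_gt0.
have [K1 hK1] := (tendsP _ _ _).1 wtf _ e2.
have /cvgr0_norm_le/(_ _ e2)[K2 _ hK2] : 2^-1 ^+ n @[n --> \oo] --> (0 : R).
  by apply: cvg_expr; rewrite ger0_norm ?invr_ge0// invf_lt1// ltr1n.
pose k := maxn K1 K2; exists (N0 k) => n Nn.
apply: le_trans (nrm_triangle P (su n) (sv k) sf) _.
have h1 : nrm ip (u n - v k) <= 2^-1 ^+ k by apply: hN0.
have := hK2 k (leq_maxr _ _); rewrite /= ger0_norm ?exprn_ge0 ?invr_ge0// => h2.
have : nrm ip (v k - f) <= e / 2.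
  rewrite (_ : nrm ip _ = nrm ip (w k - f)); first exact: hK1 (leq_maxl _ _).
  congr Num.sqrt; apply: eq_ip_ae; apply: filterS Aae => x Ax;
  by rewrite -[(v k - f) x]/(v k x - f x) -[(w k - f) x]/(w k x - f x) wE.
lra.
Qed.

End square_integrable.

(** * Borel sets and volumes of boxes in R^n *)

Section rV_borel.
Context {R : realType} (n : nat).
Local Notation E := 'rV[R]_n.

(** The sigma-algebra is the one generated by the coordinates. For the max norm, an open set is the
    union of the cubes with rational centre and radius 1 / (k + 1) that it contains, and these are
    countably many. *)
Lemma open_rV_measurable (U : set E) : open U -> measurable U.
Proof.
move=> oU.
pose B (p : 'rV[rat]_n * nat) : set E :=
  [set x | forall i, `|x ord0 i - ratr (p.1 ord0 i)| < p.2.+1%:R^-1].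
have mB p : measurable (B p).
  rewrite (_ : B p = \bigcap_(i in [set: 'I_n])
     (rV_coord i @^-1` (@ball R R (ratr (p.1 ord0 i)) p.2.+1%:R^-1))).
    apply: fin_bigcap_measurable => // i _.
    rewrite -[X in measurable X]setTI; apply: measurable_rV_coord => //.
    exact: measurable_ball.
  apply/seteqP; split => x /=; rewrite /B /= /rV_coord.
    by move=> h i _; rewrite /= /ball/= distrC.
  by move=> h i; have := h i I; rewrite /= /ball/= distrC.
pose F p := if pselect (B p `<=` U) then B p else set0.
rewrite (_ : U = \bigcup_p F p).
  apply: countable_bigcupT_measurable => [|p]; first exact: countableP.
  rewrite /F; case: pselect => [BU|nBU]; first exact: mB.
  exact: measurable0.
apply/seteqP; split => [x Ux|x [p _]]; last first.
  by rewrite /F; case: pselect => // h; exact: h.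
have /nbhs_ballP[e /= e0 xU] : nbhs x U by exact: open_nbhs_nbhs.
pose m := Num.truncn (2 / e).
have me : m.+1%:R^-1 < e / 2.
  rewrite -[ltRHS]invrK ltf_pV2 ?posrE ?ltr0n ?invr_gt0 ?divr_gt0//.
  by rewrite invf_div; exact: truncnS_gt.
have m0 : 0 < m.+1%:R^-1 :> R by rewrite invr_gt0 ltr0n.
have /choice[q hq] i : exists q : rat, `|x ord0 i - ratr q| < m.+1%:R^-1.
  have /rat_in_itvoo[q] : x ord0 i - m.+1%:R^-1 < x ord0 i + m.+1%:R^-1.
    by rewrite ltrBlDr -addrA ltrDl addr_gt0.
  rewrite in_itv/= => /andP[h1 h2]; exists q.
  by rewrite ltr_distl ltrBlDr h2 -ltrBlDr h1.
pose p := (\row_i q i, m); exists p => //.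
have Bx : B p x by move=> i; rewrite /= mxE.
rewrite /F; case: pselect => // -[] y By; apply: xU.
split => // i j; rewrite ord1 /ball/=; have := By j; have := Bx j.
rewrite /=; move: (ratr _) (m.+1%:R^-1) me => r c ce h1 h2.
apply: (@le_lt_trans _ _ (`|x ord0 j - r| + `|y ord0 j - r|)); last by lra.
by rewrite -(normrN (y _ _ - _)) (le_trans _ (ler_normD _ _))// opprB subrKA.
Qed.

Lemma continuous_rV_measurable (f : E -> R) : continuous f -> measurable_fun setT f.
Proof.
move=> cf; apply: (measurability _ (RGenOInfty.measurableE R)).
move=> /= _ [_ [a ->]] <-; rewrite setTI; apply: open_rV_measurable.
by apply: open_comp => // x _; exact: cf.
Qed.

Definition box (a b : R) : set E := [set x | forall i, a <= x ord0 i <= b].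

Lemma measurable_box a b : measurable (box a b).
Proof.
rewrite (_ : box a b = \bigcap_(i in [set: 'I_n]) (rV_coord i @^-1` `[a, b])).
  apply: fin_bigcap_measurable => // i _.
  by rewrite -[X in measurable X]setTI; apply: measurable_rV_coord.
apply/seteqP; split => x /=; rewrite /box /= /rV_coord.
  by move=> h i _ /=; rewrite in_itv/=.
by move=> h i; have := h i I; rewrite /= in_itv.
Qed.

End rV_borel.

Lemma rV_cons0 (R : realType) n (p : measurableTypeR R * 'rV[R]_n) :
  (rV_cons p : 'rV[R]_n.+1) ord0 ord0 = p.1.
Proof.
have -> : (ord0 : 'I_n.+1) = lshift n (ord0 : 'I_1) by exact: val_inj.
have /= -> := @row_mxEl R 1 1 n p.1%:M p.2 ord0 ord0.
by rewrite mxE eqxx.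
Qed.

Lemma rV_consS (R : realType) n (p : measurableTypeR R * 'rV[R]_n) (i : 'I_n) :
  (rV_cons p : 'rV[R]_n.+1) ord0 (lift ord0 i) = p.2 ord0 i.
Proof.
have -> : lift ord0 i = rshift 1 i :> 'I_n.+1 by exact: val_inj.
exact: (@row_mxEr R 1 1 n p.1%:M p.2 ord0 i).
Qed.

(** Boxes are the only sets whose volume is computed: they bound the ball from outside and from
    inside, and they contain the supports of the test fields. *)
Lemma rV_lebesgue_box (R : realType) n (a b : R) : a <= b ->
  rV_lebesgue R n (@box R n a b) = ((b - a) ^+ n)%:E.
Proof.
move=> ab; elim: n => [|n ih].
  rewrite (_ : box a b = setT); last by apply/seteqP; split => // x _ [].
  by rewrite /= diracT.
have e : @rV_cons R n @^-1` (@box R n.+1 a b) = `[a, b] `*` @box R n a b.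
  apply/seteqP; split => -[r v] /=.
    move=> h; split => [|i]; first by have := h ord0; rewrite rV_cons0 /= in_itv.
    by have := h (lift ord0 i); rewrite rV_consS.
  rewrite in_itv/= => -[h1 h2] i; case: (unliftP ord0 i) => [j ->|->].
    by rewrite rV_consS; exact: h2.
  by rewrite rV_cons0.
change (pushforward (@lebesgue_measure R \x rV_lebesgue R n)%E (@rV_cons R n)
  (@box R n.+1 a b) = ((b - a) ^+ n.+1)%:E).
rewrite /pushforward e product_measure1E//; last exact: measurable_box.
have h : @lebesgue_measure R `[a, b]%classic = (b - a)%:E.
  rewrite lebesgue_measure_itv /= lte_fin lt_neqAle ab andbT.
  by case: eqVneq => [->|_]; rewrite /= ?subrr// EFinB.
by rewrite ih [X in (X * _)%E]h exprS.
Qed.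

Lemma cvg_sumr (R : realType) (V : normedModType R) (T : Type)
    (F : set_system T) {FF : Filter F} (I : Type) (s : seq I) (f : I -> T -> V)
    (a : I -> V) :
  (forall i, f i x @[x --> F] --> a i) ->
  (\sum_(i <- s) f i x) @[x --> F] --> \sum_(i <- s) a i.
Proof.
move=> fa; elim: s => [|i s ih].
  by rewrite big_nil; under eq_fun do rewrite big_nil; exact: cvg_cst.
by rewrite big_cons; under eq_fun do rewrite big_cons; exact: cvgD.
Qed.

(** * Euclidean geometry of R^d and of the unit sphere *)

Section euclidean_facts.
Context {R : realType} {d : nat}.
Local Notation E := 'rV[R]_d.
Implicit Types x y z : E.

Lemma edotC x y : edot x y = edot y x.
Proof. by apply: eq_bigr => i _; rewrite mulrC. Qed.

Lemma edotDl x y z : edot (x + y) z = edot x z + edot y z.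
Proof. by rewrite -big_split; apply: eq_bigr => i _; rewrite mxE mulrDl. Qed.

Lemma edotZl c x z : edot (c *: x) z = c * edot x z.
Proof. by rewrite mulr_sumr; apply: eq_bigr => i _; rewrite mxE mulrA. Qed.

Lemma edotDr x y z : edot z (x + y) = edot z x + edot z y.
Proof. by rewrite edotC edotDl !(edotC z). Qed.

Lemma edotZr c x z : edot z (c *: x) = c * edot z x.
Proof. by rewrite edotC edotZl (edotC z). Qed.

Lemma edotNl x z : edot (- x) z = - edot x z.
Proof. by rewrite -scaleN1r edotZl mulN1r. Qed.

Lemma edotNr x z : edot z (- x) = - edot z x.
Proof. by rewrite edotC edotNl edotC. Qed.

Lemma edotBl x y z : edot (x - y) z = edot x z - edot y z.
Proof. by rewrite edotDl edotNl. Qed.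

Lemma edotBr x y z : edot z (x - y) = edot z x - edot z y.
Proof. by rewrite edotDr edotNr. Qed.

Lemma edot0l x : edot 0 x = 0.
Proof. by rewrite -(scale0r (0 : E)) edotZl mul0r. Qed.

Lemma edot_ge0 x : 0 <= edot x x.
Proof. by apply: sumr_ge0 => i _; rewrite -expr2 sqr_ge0. Qed.

Lemma edot_eq0 x : edot x x = 0 -> x = 0.
Proof.
move=> /eqP; rewrite psumr_eq0; last by move=> i _; rewrite -expr2 sqr_ge0.
move=> /allP h; apply/rowP => i; rewrite mxE.
have := h i; rewrite mem_index_enum => /(_ isT) /=.
by rewrite mulf_eq0 orbb => /eqP.
Qed.

Lemma edot_prehilbert : prehilbert [set: E] edot.
Proof.
split=> // [x y _ _|x y z _ _ _|c x z _ _|x _].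
- exact: edotC.
- exact: edotDl.
- exact: edotZl.
- exact: edot_ge0.
Qed.

Lemma enorm_ge0 x : 0 <= enorm x. Proof. exact: sqrtr_ge0. Qed.

Lemma enorm_sqr x : enorm x ^+ 2 = edot x x.
Proof. by rewrite sqr_sqrtr// edot_ge0. Qed.

Lemma enormZ c x : enorm (c *: x) = `|c| * enorm x.
Proof. exact: (nrmZ edot_prehilbert). Qed.

Lemma enorm_eq0 x : enorm x = 0 -> x = 0.
Proof. by move=> x0; apply: edot_eq0; rewrite -enorm_sqr x0 expr0n. Qed.

Lemma enorm0 : enorm (0 : E) = 0.
Proof. by rewrite /enorm edot0l sqrtr0. Qed.

Lemma enorm_gt0 x : x != 0 -> 0 < enorm x.
Proof.
move=> x0; rewrite lt_neqAle enorm_ge0 andbT eq_sym.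
by apply: contra x0 => /eqP/enorm_eq0 ->.
Qed.

Lemma enormD x y : enorm (x + y) <= enorm x + enorm y.
Proof. exact: (nrmD edot_prehilbert). Qed.

Lemma edot_cauchy x y : `|edot x y| <= enorm x * enorm y.
Proof. exact: (cauchy_schwarz edot_prehilbert). Qed.

Lemma edot_sphere x : sphere R d x -> edot x x = 1.
Proof. by rewrite /sphere /= => x1; rewrite -enorm_sqr x1 expr1n. Qed.

Lemma sphere_neq0 x : sphere R d x -> x != 0.
Proof.
move=> x1; apply: contra_eqN (x1) => /eqP ->.
by rewrite enorm0 eq_sym oner_eq0.
Qed.

Lemma radial_sphere x : sphere R d x -> radial x = x.
Proof. by rewrite /sphere /= /radial => ->; rewrite invr1 scale1r. Qed.

Lemma enorm_radial x : x != 0 -> enorm (radial x) = 1.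
Proof.
move=> /enorm_gt0 x0; rewrite enormZ ger0_norm ?invr_ge0 ?enorm_ge0//.
by rewrite mulVf// gt_eqF.
Qed.

Lemma radial0 : radial (0 : E) = 0. Proof. by rewrite /radial scaler0. Qed.

Lemma enorm_radial_le1 x : enorm (radial x) <= 1.
Proof.
by have [->|/enorm_radial ->//] := eqVneq x 0; rewrite radial0 enorm0.
Qed.

Lemma radial_idem x : radial (radial x) = radial x.
Proof.
have [->|x0] := eqVneq x 0; first by rewrite !radial0.
by apply: radial_sphere; exact: enorm_radial.
Qed.

Lemma edot_continuous y : continuous (fun x => edot x y).
Proof.
move=> x; apply: (@cvg_sumr _ _ _ (nbhs x)) => i.
by apply: (@cvgM _ _ (nbhs x)); [exact: coord_continuous|exact: cvg_cst].
Qed.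

Lemma edotxx_continuous : continuous (fun x => edot x x).
Proof.
move=> x; apply: (@cvg_sumr _ _ _ (nbhs x)) => i.
by apply: (@cvgM _ _ (nbhs x)); exact: coord_continuous.
Qed.

Lemma enorm_continuous : continuous (@enorm R d).
Proof.
move=> x; apply: (@continuous_comp _ _ _ (fun x => edot x x) Num.sqrt).
  exact: edotxx_continuous.
exact: sqrt_continuous.
Qed.

Lemma coord_le_enorm x i : `|x ord0 i| <= enorm x.
Proof.
rewrite -sqrtr_sqr ler_wsqrtr// /edot (bigD1 i)//= -expr2 lerDl.
by apply: sumr_ge0 => j _; rewrite -expr2 sqr_ge0.
Qed.

Lemma closed_sphere : closed (sphere R d).
Proof.
rewrite (_ : sphere R d = @enorm R d @^-1` [set 1])//.
by apply: preimage_closed => [x _|]; [exact: enorm_continuous|exact: closed_eq].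
Qed.

Lemma measurable_sphere : measurable (sphere R d).
Proof.
rewrite -[X in measurable X]setTI (_ : sphere R d = @enorm R d @^-1` [set 1])//.
exact: measurable_enorm.
Qed.

End euclidean_facts.

(** * The surface measure *)

Section omega_facts.
Context {R : realType} {d : nat}.
Local Notation E := 'rV[R]_d.
Local Notation lam := (rV_lebesgue R d).
Local Notation PB := (@punctured_ball R d).

Lemma omegaE (A : set E) :
  omega R d A = (d%:R%:E * lam (@radial R d @^-1` A `&` PB))%E.
Proof. by []. Qed.

Lemma lam_punctured_ball : (lam PB < +oo)%E.
Proof.
apply: (@le_lt_trans _ _ (lam (@box R d (-1) 1))).
  apply: le_measure; rewrite ?inE; [exact: measurable_punctured_ball|exact: measurable_box|].
  move=> x /andP[_ x1] i; rewrite -ler_norml; exact: le_trans (coord_le_enorm x i) x1.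
by rewrite rV_lebesgue_box ?ltry//; lra.
Qed.

Let omega_fin : fin_num_fun (omega R d).
Proof.
move=> A mA; rewrite ge0_fin_numE// omegaE; apply: lte_mul_pinfty => //.
apply: le_lt_trans lam_punctured_ball; apply: le_measure; rewrite ?inE.
- apply: measurableI; last exact: measurable_punctured_ball.
  by rewrite -[X in measurable X]setTI; exact: measurable_radial.
- exact: measurable_punctured_ball.
- exact: subIsetr.
Qed.

HB.instance Definition _ := Measure_isFinite.Build _ _ _ (omega R d) omega_fin.

(** Every vector of positive norm has a radial part of norm 1, so the cone over the complement of
    the sphere misses the punctured ball. This is what allows [radial x] to be replaced by [x] under
    integrals. *)
Lemma ae_sphere : {ae omega R d, forall x, sphere R d x}.
Proof.
have e : @radial R d @^-1` (~` sphere R d) `&` PB = set0.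
  rewrite -subset0 => x [/= h /andP[x0 _]]; apply: h.
  by apply: enorm_radial; apply: contraTneq x0 => ->; rewrite enorm0 ltxx.
exists (~` sphere R d); split.
- by apply: measurableC; exact: measurable_sphere.
- by rewrite omegaE e measure0 mule0.
- by [].
Qed.

Lemma integral_mrestr (D : set E) (mD : measurable D) (f : E -> \bar R) :
  measurable_fun setT f -> (forall x, 0 <= f x)%E ->
  (\int[mrestr lam mD]_x f x = \int[lam]_(x in D) f x)%E.
Proof.
move=> mf f0; have mCD := measurableC mD.
rewrite -(setUv D) ge0_integral_setU//; last 2 first.
- by rewrite setUv.
- exact/disj_setPCl.
have -> : (\int[mrestr lam mD]_(x in ~` D) f x = 0)%E.
  apply: null_set_integral => //; first exact: measurable_funTS.
  by change (lam (~` D `&` D) = 0)%E; rewrite setICl measure0.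
rewrite adde0; apply: eq_measure_integral => A mA AD.
by change (lam (A `&` D) = lam A); rewrite (setIidl AD).
Qed.

Lemma integral_omega_ge0 (f : E -> \bar R) :
  measurable_fun setT f -> (forall x, 0 <= f x)%E ->
  (\int[omega R d]_x f x = d%:R%:E * \int[lam]_(x in PB) f (radial x))%E.
Proof.
move=> mf f0; rewrite ge0_integral_mscale//; congr (_ * _)%E.
rewrite ge0_integral_pushforward//; last exact: measurable_radial.
rewrite preimage_setT; apply: integral_mrestr => [|x]; last exact: f0.
by apply: measurableT_comp => //; exact: measurable_radial.
Qed.

(** The change of variables is first known for nonnegative functions: it is applied to f + M, and
    the integral of the constant M is subtracted from both sides. *)
Lemma Rintegral_omega (f : E -> R) M :
  measurable_fun setT f -> (forall x, `|f x| <= M) ->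
  \int[omega R d]_x f x = d%:R * \int[lam]_(x in PB) f (radial x).
Proof.
move=> mf fM; have mPB := @measurable_punctured_ball R d.
have mfr : measurable_fun setT (fun x => f (radial x)).
  by apply: measurableT_comp => //; exact: measurable_radial.
have fi : itg (omega R d) f by exact: itg_bounded mf fM.
have bnd (g : E -> R) : (forall x, `|g x| <= M) -> [bounded g x | x in PB].
  by move=> gM; exists M; split; rewrite ?num_real// => K MK x _; exact: le_trans (gM x) (ltW MK).
have ri (g : E -> R) : measurable_fun setT g -> (forall x, `|g x| <= M) ->
    lam.-integrable PB (EFin \o g).
  move=> mg gM; apply: measurable_bounded_integrable => //.
  - exact: lam_punctured_ball.
  - exact: measurable_funTS.
  - exact: bnd.
have M0 : 0 <= M by exact: le_trans (normr_ge0 _) (fM 0).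
have ci : lam.-integrable PB (EFin \o cst M).
  by apply: ri => // x; rewrite ger0_norm.
have fri : lam.-integrable PB (EFin \o (fun x => f (radial x))).
  by apply: ri => // x; exact: fM.
have pos : \int[omega R d]_x (f x + M) =
    d%:R * \int[lam]_(x in PB) (f (radial x) + M).
  rewrite /Rintegral integral_omega_ge0.
  - rewrite fineM//; apply: integrable_fin_num => //.
    rewrite (_ : (fun _ => _) = (EFin \o (fun x => f (radial x))) \+ (EFin \o cst M))%E//.
    exact: integrableD.
  - by apply/measurable_EFinP; exact: measurable_funD.
  - by move=> x; rewrite lee_fin; have := fM x; rewrite ler_norml; lra.
move: pos; rewrite RintegralD//; last exact: itg_cst.
rewrite RintegralD// !Rintegral_cst// mulrDr.
have -> : fine (omega R d setT) = d%:R * fine (lam PB).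
  rewrite omegaE preimage_setT setTI fineM// ge0_fin_numE//.
  exact: lam_punctured_ball.
by move=> h; apply: (@addIr _ (M * (d%:R * fine (lam PB)))); rewrite h; ring.
Qed.

Lemma omega_d_ge0 : 0 <= omega_d R d. Proof. exact: fine_ge0. Qed.

Lemma omega_setT : omega R d setT = (omega_d R d)%:E.
Proof.
rewrite /omega_d fineK; last by apply: fin_num_measure; exact: measurable_sphere.
have N0 : omega R d (~` sphere R d) = 0%E.
  rewrite omegaE (_ : _ `&` _ = set0) ?measure0 ?mule0//.
  rewrite -subset0 => x [/= h /andP[x0 _]]; apply: h.
  by apply: enorm_radial; apply: contraTneq x0 => ->; rewrite enorm0 ltxx.
have mS := @measurable_sphere R d.
have /esym := @measureU _ _ _ (omega R d) _ _ mS (measurableC mS) (setICr _).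
by rewrite setUv => <-; rewrite [X in (_ + X)%E]N0 adde0.
Qed.

Lemma omega_d_gt0 : (0 < d)%N -> 0 < omega_d R d.
Proof.
move=> d0; rewrite -lte_fin -omega_setT omegaE preimage_setT setTI.
have dR : 0 < d%:R :> R by rewrite ltr0n.
apply: mule_gt0; first by rewrite lte_fin.
(* The cube [1/(2d), 1/d]^d avoids 0, and its points satisfy x_i^2 <= 1/d, hence have norm at most
   1. *)
apply: (@lt_le_trans _ _ (lam (@box R d (d%:R^-1 / 2) d%:R^-1))).
  rewrite rV_lebesgue_box; last by have := invr_gt0 (d%:R : R); rewrite dR => h; lra.
  by rewrite lte_fin exprn_gt0// subr_gt0; have := invr_gt0 (d%:R : R); rewrite dR => h; lra.
apply: le_measure; rewrite ?inE; [exact: measurable_box|exact: measurable_punctured_ball|].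
move=> x hx; apply/andP; split.
  have i0 : 'I_d by exact: Ordinal d0.
  apply: lt_le_trans (coord_le_enorm x i0); have /andP[h _] := hx i0.
  by rewrite normr_gt0 gt_eqF// (lt_le_trans _ h)// divr_gt0// invr_gt0.
rewrite -(ler_pXn2r (n := 2))// ?nnegrE ?enorm_ge0// enorm_sqr expr1n.
have -> : 1 = \sum_(i < d) d%:R^-1 :> R.
  by rewrite sumr_const card_ord -[RHS]mulr_natr mulVf// gt_eqF.
apply: ler_sum => i _; have /andP[h1 h2] := hx i.
have x0 : 0 <= x ord0 i by apply: le_trans h1; rewrite divr_ge0// invr_ge0.
have d1 : d%:R^-1 <= 1 :> R by rewrite invf_le1// ler1n.
by nra.
Qed.

End omega_facts.

(** * Divergence theorem on the sphere *)

Section derivative_lemmas.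
Context {R : realType}.

(* The difference quotient of [f \o A] at [x] along [v] is that of [f] at [A x]
   along [w] as soon as A (h v + x) = h w + A x. *)
Lemma is_derive_affine (U V W : normedModType R) (f : V -> W) (A : U -> V)
    (x v : U) (w : V) (df : W) : (forall h : R, A (h *: v + x) = h *: w + A x) ->
  is_derive (A x) w f df -> is_derive x v (f \o A) df.
Proof.
move=> hA [fd fE].
have e : (fun h : R => h^-1 *: (((f \o A) \o shift x) (h *: v) - (f \o A) x)) =
    (fun h => h^-1 *: ((f \o shift (A x)) (h *: w) - f (A x))).
  by apply/funext => h /=; rewrite hA.
split; first by move: fd; rewrite /derivable e.
by rewrite -fE /derive e.
Qed.

Lemma is_derive_line (V W : normedModType R) (f : V -> W) (x v : V) (t : R) (df : W) :
  is_derive (t *: v + x) v f df -> is_derive t 1 (fun s : R => f (s *: v + x)) df.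
Proof.
move=> fd; apply: (@is_derive_affine _ _ _ f (fun s : R => s *: v + x) t 1 v) => //.
by move=> h; rewrite -[h *: 1]/(h * 1) mulr1 scalerDl addrA.
Qed.

(** Brings a directional derivative back to one real variable, where the chain rule and the mean
    value theorem apply. *)
Lemma is_derive_along (V W : normedModType R) (f : V -> W) (x v : V) (df : W) :
  is_derive x v f df <-> is_derive (0 : R) 1 (fun s : R => f (s *: v + x)) df.
Proof.
split=> [h|[h1 h2]]; first by apply: is_derive_line; rewrite scale0r add0r.
have e : (fun h : R => h^-1 *: ((f \o shift x) (h *: v) - f x)) =
    (fun h => h^-1 *: (((fun s : R => f (s *: v + x)) \o shift 0) (h *: 1) -
       f (0 *: v + x))).
  apply/funext => h /=; rewrite -[h *: 1]/(h * 1) mulr1 addr0.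
  by rewrite scale0r add0r.
by split; [move: h1; rewrite /derivable -e|rewrite -h2 /derive -e].
Qed.

Lemma is_derive_continuous (f : R -> R) x df : is_derive x (1 : R) f df ->
  {for x, continuous f}.
Proof. by case => /derivable1_diffP/differentiable_continuous. Qed.

Lemma FTC_real (f g : R -> R) (a b : R) : a < b ->
  (forall x, is_derive x (1 : R) f (g x)) -> continuous g ->
  \int[lebesgue_measure]_(x in `[a, b]) g x = f b - f a.
Proof.
move=> ab fg cg; rewrite /Rintegral (@continuous_FTC2 _ g f)//.
- exact: continuous_subspaceT.
- split => [x _||].
  + by case: (fg x).
  + apply: cvg_at_right_filter; exact: is_derive_continuous (fg a).
  + apply: cvg_at_left_filter; exact: is_derive_continuous (fg b).
- by move=> x _; rewrite derive1E; case: (fg x).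
Qed.

Lemma compact_continuous_bounded (T : topologicalType) (A : set T) (f : T -> R) :
  compact A -> {in A, continuous f} -> exists M, forall x, A x -> `|f x| <= M.
Proof.
move=> cA cf.
have /compact_bounded[M [_ hM]] : compact (f @` A).
  by apply: continuous_compact => //; exact: continuous_in_subspaceT.
by exists (M + 1) => x Ax; apply: (hM (M + 1)); rewrite ?ltrDl//; exists x.
Qed.

End derivative_lemmas.

Section partial_integration.
Context {R : realType}.

Lemma compact_box n (a b : R) : compact (@box R n a b).
Proof.
have := @rV_compact R n (fun=> `[a, b]%classic) (fun=> @segment_compact R a b).
congr compact; apply/seteqP; split => x h i; have := h i; rewrite /= in_itv/=; exact.
Qed.

Lemma continuous_support_itg n (g : 'rV[R]_n -> R) (M : R) : 0 <= M ->
  continuous g -> (forall x, ~ box (- M) M x -> g x = 0) ->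
  itg (rV_lebesgue R n) g.
Proof.
move=> M0 cg gM.
have [B hB] := @compact_continuous_bounded _ _ _ g (@compact_box n (- M) M)
  (fun x _ => cg x).
have mb := @measurable_box R n (- M) M.
apply: (@itg_le _ _ _ _ _ (cst B \_ (box (- M) M))).
- exact: continuous_rV_measurable.
- rewrite /itg -restrict_EFin; apply/(integrable_mkcond _ mb).
  apply: measurable_bounded_integrable => //.
    have : (rV_lebesgue R n (box (- M) M) < +oo)%E by rewrite rV_lebesgue_box ?ltry//; lra.
    exact.
  exists `|B|; split; first by rewrite num_real.
  by move=> K BK x _; exact: ltW.
- move=> x; rewrite patchE; have [bx|nbx] := pselect (box (- M) M x).
    by rewrite mem_set// hB.
  by rewrite memNset// gM// normr0.
Qed.

Lemma lebesgue_integral_derivative_eq0 (f g : R -> R) (M : R) :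
  (forall x, is_derive x (1 : R) f (g x)) -> continuous g ->
  (forall x, M < `|x| -> f x = 0) -> (forall x, M < `|x| -> g x = 0) ->
  \int[lebesgue_measure]_x g x = 0.
Proof.
move=> fg cg fM gM; pose N := `|M| + 1.
have N0 : 0 < N by rewrite ltr_wpDl.
have MN : M < N by rewrite /N (le_lt_trans (ler_norm M))// ltrDl.
transitivity (\int[@lebesgue_measure R]_(x in `[- N, N]) g x).
  rewrite [RHS]Rintegral_mkcond; apply: eq_Rintegral => x _.
  rewrite patchE; case: ifPn => //; rewrite notin_setE /= in_itv/= => /negP.
  by rewrite -ler_norml -ltNge => Nx; apply: gM; exact: lt_trans Nx.
rewrite (@FTC_real _ f)//; last by lra.
by rewrite !fM ?subr0// ?normrN gtr0_norm.
Qed.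

Lemma rV_cons_continuous n (r : R) :
  continuous (fun v : 'rV[R]_n => (rV_cons (r : measurableTypeR R, v) : 'rV[R]_n.+1)).
Proof.
move=> v A /= [P hP PA]; pose P' (i : 'I_1) (j : 'I_n) := P ord0 (lift ord0 j).
exists P' => [i j|w hw]; first by rewrite (ord1 i); have := hP ord0 (lift ord0 j); rewrite rV_consS.
apply: PA => i j; rewrite ord1; case: (unliftP ord0 j) => [k ->|->].
  by rewrite rV_consS; have := hw ord0 k.
by rewrite rV_cons0; have /nbhs_singleton := hP ord0 ord0; rewrite rV_cons0.
Qed.

Lemma rV_cons_continuous1 n (v : 'rV[R]_n) :
  continuous (fun r : R => (rV_cons (r : measurableTypeR R, v) : 'rV[R]_n.+1)).
Proof.
move=> r A /= [P hP PA].
have : nbhs r (P ord0 ord0) by have := hP ord0 ord0; rewrite rV_cons0.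
apply: filterS => s hs; apply: PA => i j; rewrite ord1; case: (unliftP ord0 j) => [k ->|->].
  by rewrite rV_consS; have /nbhs_singleton := hP ord0 (lift ord0 k); rewrite rV_consS.
by rewrite rV_cons0.
Qed.

(** Fubini and induction on the dimension. If i is not the first coordinate, the integral over each
    slice vanishes by induction. If it is the first, the integral along that coordinate vanishes by
    the fundamental theorem of calculus, the boundary terms being off the support. *)
Lemma integral_partial_derivative_eq0 n (i : 'I_n) (f g : 'rV[R]_n -> R) (M : R) :
  0 <= M -> (forall x, is_derive x (delta_mx ord0 i) f (g x)) -> continuous g ->
  (forall x, ~ box (- M) M x -> f x = 0) -> (forall x, ~ box (- M) M x -> g x = 0) ->
  \int[rV_lebesgue R n]_x g x = 0.
Proof.
move=> M0; elim: n i f g => [[]//|n ih] i f g fg cg fM gM.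
have gi := continuous_support_itg M0 cg gM.
have mcons := @measurable_rV_cons R n.
have mg : measurable_fun setT (EFin \o g) by apply/measurable_EFinP; exact: continuous_rV_measurable.
pose P := (@lebesgue_measure R \x rV_lebesgue R n)%E.
have mgc : measurable_fun setT ((EFin \o g) \o @rV_cons R n) by exact: measurableT_comp.
have gPi : P.-integrable setT ((EFin \o g) \o @rV_cons R n).
  apply/integrableP; split => //.
  move/integrableP : gi => [_]; apply: le_lt_trans.
  change (\int[P]_x `|((EFin \o g) \o @rV_cons R n) x| <=
    \int[pushforward P (@rV_cons R n)]_x `|(EFin \o g) x|)%E.
  rewrite ge0_integral_pushforward//.
  exact: measurableT_comp.
have bc r v : box (- M) M (rV_cons (r, v) : 'rV[R]_n.+1) <->
    (- M <= r <= M) /\ box (- M) M v.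
  split=> [h|[h1 h2] j].
    split=> [|j]; first by have := h ord0; rewrite rV_cons0.
    by have := h (lift ord0 j); rewrite rV_consS.
  case: (unliftP ord0 j) => [k ->|->]; last by rewrite rV_cons0.
  by rewrite rV_consS; exact: h2.
rewrite /Rintegral.
change (fine (\int[pushforward P (@rV_cons R n)]_x (EFin \o g) x)%E = 0).
rewrite integral_pushforward// preimage_setT.
case: (unliftP ord0 i) => [j ij|i0].
  rewrite -integral12_prod_meas1// /fubini_F integral0_eq// => r _.
  rewrite [X in X = _](_ : _ = (\int[rV_lebesgue R n]_v (g (rV_cons (r, v))))%:E%R).
    congr EFin; apply: (ih j (fun v => f (rV_cons (r, v)))).
    - move=> v; apply: (@is_derive_affine _ _ _ _ f
        (fun v => (rV_cons (r, v) : 'rV[R]_n.+1)) v _ (delta_mx ord0 i)) => // h.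
      apply/matrixP => k' k; rewrite (ord1 k') [RHS]mxE [X in _ = X + _]mxE.
      rewrite [delta_mx _ _ _ _]mxE; case: (unliftP ord0 k) => [l ->|->].
        by rewrite !rV_consS /= mxE [in LHS]mxE [delta_mx _ _ _ _]mxE ij (inj_eq lift_inj).
      by rewrite !rV_cons0 ij/= mulr0 add0r.
    - move=> v; apply: (@continuous_comp _ _ _
        (fun v => (rV_cons (r, v) : 'rV[R]_n.+1)) g); last exact: cg.
      exact: rV_cons_continuous.
    - by move=> v nv; apply: fM; move=> /bc[].
    - by move=> v nv; apply: gM; move=> /bc[].
  rewrite /Rintegral fineK//; apply: integrable_fin_num => //.
  apply: (@continuous_support_itg _ (fun v => g (rV_cons (r, v))) M) => //.
    move=> v; apply: (@continuous_comp _ _ _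
        (fun v => (rV_cons (r, v) : 'rV[R]_n.+1)) g); last exact: cg.
    exact: rV_cons_continuous.
  by move=> v nv; apply: gM; move=> /bc[].
rewrite -integral21_prod_meas1// /fubini_G integral0_eq// => v _.
have gr0 r : M < `|r| -> g (rV_cons (r : measurableTypeR R, v)) = 0.
  move=> Mr; apply: gM => /bc[h _]; move: Mr; rewrite ltNge => /negP; apply.
  by rewrite ler_norml.
have cgr : continuous (fun r : R => g (rV_cons (r : measurableTypeR R, v))).
  move=> r; apply: (@continuous_comp _ _ _
    (fun r : R => (rV_cons (r : measurableTypeR R, v) : 'rV[R]_n.+1)) g); last exact: cg.
  exact: rV_cons_continuous1.
rewrite [X in X = _](_ : _ =
    (\int[lebesgue_measure]_r (g (rV_cons (r : measurableTypeR R, v))))%:E%R).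
  congr EFin; apply: (@lebesgue_integral_derivative_eq0
    (fun r => f (rV_cons (r : measurableTypeR R, v))) _ M) => //.
    move=> r; apply: (@is_derive_affine _ _ _ _ f
      (fun r : R => (rV_cons (r : measurableTypeR R, v) : 'rV[R]_n.+1)) r _
      (delta_mx ord0 i)) => // h.
    apply/matrixP => k' k; rewrite (ord1 k') [RHS]mxE [X in _ = X + _]mxE.
    rewrite [delta_mx _ _ _ _]mxE i0; case: (unliftP ord0 k) => [l ->|->].
      by rewrite !rV_consS/= mulr0 add0r.
    by rewrite !rV_cons0.
  move=> r Mr; apply: fM => /bc[h _]; move: Mr; rewrite ltNge => /negP; apply.
  by rewrite ler_norml.
rewrite /Rintegral fineK//; apply: integrable_fin_num => //.
have iN : (@lebesgue_measure R).-integrable `[- M, M]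
    (EFin \o (fun r : R => g (rV_cons (r : measurableTypeR R, v)))).
  apply: continuous_compact_integrable; first exact: segment_compact.
  exact: continuous_subspaceT.
move/integrable_mkcond : iN => /(_ (measurable_itv _)).
apply: eq_integrable => // r _; rewrite patchE; case: ifPn => //.
rewrite notin_setE /= in_itv/= => /negP; rewrite -ler_norml -ltNge => Mr.
by rewrite gr0.
Qed.

End partial_integration.

Section pointwise_derivatives.
Context {R : realType} {V : normedModType R}.
Implicit Types (f g : V -> R) (x v : V).

Lemma derD f g x v df dg : is_derive x v f df -> is_derive x v g dg ->
  is_derive x v (fun y => f y + g y) (df + dg).
Proof. exact: is_deriveD. Qed.

Lemma derB f g x v df dg : is_derive x v f df -> is_derive x v g dg ->
  is_derive x v (fun y => f y - g y) (df - dg).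
Proof. exact: is_deriveB. Qed.

Lemma derN f x v df : is_derive x v f df -> is_derive x v (fun y => - f y) (- df).
Proof. exact: is_deriveN. Qed.

Lemma derM f g x v df dg : is_derive x v f df -> is_derive x v g dg ->
  is_derive x v (fun y => f y * g y) (df * g x + f x * dg).
Proof.
move=> fd gd; apply: is_derive_eq (is_deriveM fd gd) _.
by rewrite /GRing.scale /= addrC mulrC.
Qed.

Lemma derC c x v : is_derive x v (fun=> c : R) 0.
Proof. exact: is_derive_cst. Qed.

Lemma derZ c f x v df : is_derive x v f df ->
  is_derive x v (fun y => c * f y) (c * df).
Proof. by move=> fd; apply: is_derive_eq (derM (derC c x v) fd) _; rewrite mul0r add0r. Qed.

Lemma derX n f x v df : is_derive x v f df ->
  is_derive x v (fun y => f y ^+ n) (n%:R * f x ^+ n.-1 * df).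
Proof.
move=> fd; elim: n => [|n ih]; first by rewrite !mul0r; exact: derC.
have -> : (fun y => f y ^+ n.+1) = (fun y => f y * f y ^+ n).
  by apply/funext => y; rewrite exprS.
apply: is_derive_eq (derM fd ih) _; case: n {ih} => [|n] /=.
  by rewrite !mul0r mulr0 expr0; ring.
by rewrite exprS -[in RHS]natr1; ring.
Qed.

Lemma der_sum n (f : 'I_n -> V -> R) (df : 'I_n -> R) x v :
  (forall i, is_derive x v (f i) (df i)) ->
  is_derive x v (fun y => \sum_(i < n) f i y) (\sum_(i < n) df i).
Proof.
move=> fd; have := is_derive_sum fd.
by rewrite (_ : \sum_(i < n) f i = fun y => \sum_(i < n) f i y)// fct_sumE.
Qed.

Lemma der_comp (h : R -> R) f x v dh df : is_derive (f x) (1 : R) h dh ->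
  is_derive x v f df -> is_derive x v (fun y => h (f y)) (dh * df).
Proof.
move=> hd /is_derive_along fd; apply/is_derive_along.
by apply: is_derive1_comp fd; rewrite scale0r add0r.
Qed.

End pointwise_derivatives.

(** * Smooth bumps and cutoffs *)

Section bump.
Context {R : realType}.
Implicit Types (q : {poly R}) (t : R).

(* [bump 1 t] is [exp (-1/t)] for [t > 0] and [0] for [t <= 0]; the polynomial
   factor makes the family closed under derivation. *)
Definition bump q t : R := if 0 < t then q.[t^-1] * expR (- t^-1) else 0.

(** With x = 1/t, the derivative in t of q(x) e^(-x) is x^2 (q - q')(x) e^(-x). *)
Definition bump_deriv q : {poly R} := 'X^2 * (q - q^`()).

Lemma bump_le0 q t : t <= 0 -> bump q t = 0.
Proof. by rewrite /bump; case: ltP. Qed.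

(** The exponential beats a polynomial of size q by two more powers of 1/t: x^n <= n! e^x with n =
    size q + 2. Vanishing to second order is what makes the difference quotient at 0 tend to 0. *)
Lemma bump_bound q : exists2 C, 0 <= C & forall t, t <= 1 -> `|bump q t| <= C * t ^+ 2.
Proof.
pose n := (size q).+2; pose S := \sum_(i < size q) `|q`_i|.
have S0 : 0 <= S by apply: sumr_ge0.
exists (S * n`!%:R) => [|t t1]; first by rewrite mulr_ge0.
have [t0|t0] := leP t 0.
  by rewrite bump_le0// normr0; apply: mulr_ge0; [exact: mulr_ge0|exact: sqr_ge0].
rewrite /bump t0 normrM [`|expR _|]gtr0_norm ?expR_gt0//.
set x := t^-1; have x1 : 1 <= x by rewrite /x invf_ge1.
have x0 : 0 < x by rewrite invr_gt0.
have h1 : `|q.[x]| <= S * x ^+ (size q).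
  rewrite horner_coef mulr_suml; apply: le_trans (ler_norm_sum _ _ _) _.
  apply: ler_sum => i _; rewrite normrM normrX [`|x|]gtr0_norm//.
  by rewrite ler_wpM2l// ler_weXn2l// ltnW.
have h2 : x ^+ n <= n`!%:R * expR x.
  have := expR_ge1Dxn (size q).+1 (ltW x0).
  rewrite -ler_pdivrMl ?ltr0n ?fact_gt0// mulrC; lra.
rewrite expRN.
apply: le_trans (ler_wpM2r _ h1) _; first by rewrite invr_ge0 expR_ge0.
rewrite -!mulrA ler_wpM2l//.
have -> : t = x^-1 by rewrite /x invrK.
rewrite ler_pdivrMr ?expR_gt0// -(ler_pM2r (exprn_gt0 2 x0)).
apply: le_trans (_ : x ^+ n <= _); first by rewrite /n -exprD addn2.
apply: le_trans h2 _; rewrite le_eqVlt; apply/orP; left; apply/eqP.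
by field; rewrite gt_eqF.
Qed.

Lemma is_derive_bump q t : is_derive t (1 : R) (bump q) (bump (bump_deriv q) t).
Proof.
have [t0|t0|->] := ltgtP t 0.
- rewrite bump_le0 ?ltW//; apply: (near_eq_is_derive _ (derC 0 t 1)).
  near=> s; rewrite bump_le0//; apply: ltW; near: s; exact: lt_nbhsl.
- have d : is_derive t (1 : R) (fun s : R => q.[s^-1] * expR (- s^-1))
      (bump (bump_deriv q) t).
    have dV : is_derive t (1 : R) (fun s : R => s^-1) (- t^-2).
      apply: is_derive_eq (@is_deriveV R id t 1 1 _ _) _ => //.
        by rewrite gt_eqF.
      by rewrite /GRing.scale /= mulr1.
    have d1 := der_comp (is_derive_poly q t^-1) dV.
    have d2 : is_derive t (1 : R) (fun s : R => expR (- s^-1)) (expR (- t^-1) * - - t^-2).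
      by apply: (@der_comp _ _ expR (fun s : R => - s^-1)); exact: derN.
    apply: is_derive_eq (derM d1 d2) _.
    by rewrite /bump t0 /bump_deriv hornerM hornerXn hornerD hornerN exprVn; ring.
  apply: near_eq_is_derive d; near=> s.
  by rewrite /bump ifT//; near: s; exact: lt_nbhsr.
- rewrite bump_le0//; have [C C0 hC] := bump_bound q.
  have h : h^-1 *: ((bump q \o shift 0) (h *: (1 : R)) - bump q 0) @[h --> 0^'] --> (0 : R).
    apply/cvgrPdist_le => e e0; near=> h.
    rewrite /= [h%:A]mulr1 addr0 (bump_le0 _ (lexx 0)) subr0 sub0r normrN normrM.
    have h0 : h != 0 by near: h; exact: nbhs_dnbhs_neq.
    have hn : 0 < `|h| by rewrite normr_gt0.
    rewrite normfV mulrC ler_pdivrMr//.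
    have h1 : `|h| <= 1 by near: h; exact: dnbhs0_le.
    have h2 : `|h| <= e / (C + 1) by near: h; apply: dnbhs0_le; rewrite divr_gt0// ltr_wpDl.
    apply: le_trans (hC h (le_trans (ler_norm _) h1)) _.
    rewrite -real_normK ?num_real// expr2 mulrA ler_wpM2r//.
    apply: le_trans (ler_wpM2l C0 h2) _; rewrite mulrCA ler_piMr// ?ltW//.
    by rewrite ltr_pdivrMr ?ltr_wpDl// mul1r ltrDl.
  by split; [apply/cvg_ex; exists 0|apply/cvg_lim].
Unshelve. all: by end_near. Qed.

Lemma bump_continuous q : continuous (bump q).
Proof. by move=> t; exact: is_derive_continuous (is_derive_bump q t). Qed.

Lemma bump1_ge0 t : 0 <= bump 1 t.
Proof. by rewrite /bump; case: ifP => // _; rewrite hornerC mul1r expR_ge0. Qed.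

Lemma bump1_le1 t : bump 1 t <= 1.
Proof.
rewrite /bump; case: ifP => // t0; rewrite hornerC mul1r.
by rewrite -expR0 ler_expR oppr_le0 invr_ge0 ltW.
Qed.

Lemma bump1_gt0 t : 0 < t -> 0 < bump 1 t.
Proof. by rewrite /bump => ->; rewrite hornerC mul1r expR_gt0. Qed.

End bump.

Section cutoff.
Context {R : realType}.

(* A C^1 approximation of the square root times the indicator of ]0, 1]. *)
Definition theta n (s : R) : R :=
  bump 1 (n.+1%:R * s - 1) * bump 1 (n.+1%:R ^+ 2 * (1 - s) + n.+1%:R).

Definition theta' n (s : R) : R :=
  (bump (bump_deriv 1) (n.+1%:R * s - 1) * n.+1%:R) *
    bump 1 (n.+1%:R ^+ 2 * (1 - s) + n.+1%:R) +
  bump 1 (n.+1%:R * s - 1) *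
    (bump (bump_deriv 1) (n.+1%:R ^+ 2 * (1 - s) + n.+1%:R) * - n.+1%:R ^+ 2).

Lemma is_derive_theta n s : is_derive s (1 : R) (theta n) (theta' n s).
Proof.
have did : is_derive s (1 : R) (fun t : R => t) 1 by exact: is_derive_id.
apply: derM.
  apply: der_comp (is_derive_bump _ _) _.
  apply: is_derive_eq (derB (derZ n.+1%:R did) (derC 1 _ _)) _.
  by rewrite mulr1 subr0.
apply: der_comp (is_derive_bump _ _) _.
apply: is_derive_eq (derD (derZ (n.+1%:R ^+ 2) (derB (derC 1 _ _) did)) (derC n.+1%:R _ _)) _.
by rewrite sub0r mulrN1 addr0.
Qed.

Lemma theta'_continuous n : continuous (theta' n).
Proof.
have lin (q : {poly R}) a b : continuous (fun s : R => bump q (a * s + b)).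
  move=> s; apply: (@continuous_comp _ _ _ (fun s : R => a * s + b) (bump q)).
    by apply: cvgD; [apply: cvgM; [exact: cvg_cst|exact: cvg_id]|exact: cvg_cst].
  exact: bump_continuous.
have lin2 (q : {poly R}) a b : continuous (fun s : R => bump q (a * (1 - s) + b)).
  rewrite (_ : (fun _ => _) = (fun s => bump q (- a * s + (a + b)))); first exact: lin.
  by apply/funext => s; congr bump; ring.
move=> s; apply: cvgD; apply: cvgM.
- by apply: cvgM; [exact: lin|exact: cvg_cst].
- exact: lin2.
- exact: lin.
- by apply: cvgM; [exact: lin2|exact: cvg_cst].
Qed.

Lemma theta_small n s : s <= n.+1%:R^-1 -> theta n s = 0 /\ theta' n s = 0.
Proof.
move=> sn; have h : n.+1%:R * s - 1 <= 0.
  by rewrite subr_le0 -ler_pdivlMl ?ltr0n// mulr1.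
by rewrite /theta /theta' !(bump_le0 _ h) !mul0r addr0.
Qed.

Lemma theta_large n s : 2 <= s -> theta n s = 0 /\ theta' n s = 0.
Proof.
move=> s2; have h : n.+1%:R ^+ 2 * (1 - s) + n.+1%:R <= 0.
  have : 1 <= n.+1%:R :> R by rewrite ler1n.
  move: (n.+1%:R) => k k1; rewrite expr2; nra.
by rewrite /theta /theta' !(bump_le0 _ h) mul0r !mulr0 addr0.
Qed.

Lemma theta_bound n s : 0 <= theta n s <= 1.
Proof.
rewrite /theta mulr_ge0 ?bump1_ge0//= -[leRHS]mulr1.
by rewrite ler_pM ?bump1_ge0 ?bump1_le1.
Qed.

Lemma cvg_bump1 (u : nat -> R) :
  (forall M, exists N, forall n, (N <= n)%N -> M <= u n) ->
  bump 1 (u n) @[n --> \oo] --> (1 : R).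
Proof.
move=> uoo; apply/cvgrPdist_le => e e0.
have [N hN] := uoo e^-1; exists N => // n /= /hN un.
have ei : 0 < e^-1 by rewrite invr_gt0.
have u0 : 0 < u n by exact: lt_le_trans un.
rewrite /bump u0 hornerC mul1r ger0_norm; last first.
  by rewrite subr_ge0 -expR0 ler_expR oppr_le0 invr_ge0 ltW.
have := expR_ge1Dx (- (u n)^-1).
have : (u n)^-1 <= e by rewrite -[leRHS]invrK lef_pV2.
lra.
Qed.

(** With k = n + 1, the argument k^2 (1 - s) + k of the second factor tends to infinity for s = 1 as
    well, thanks to the added k, whereas for s > 1 the square wins and the factor vanishes from some
    rank on. The square root enters only later, as the factor [enorm x] of the vector field. *)
Lemma theta_cvg s : theta n s @[n --> \oo] --> ((0 < s <= 1)%R%:R : R).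
Proof.
have nat_large (M : R) : exists N, forall n, (N <= n)%N -> M <= n.+1%:R.
  exists (Num.truncn M) => n Nn; apply: le_trans (ltW (truncnS_gt M)) _.
  by rewrite ler_nat.
have [s0|s0] /= := leP s 0.
  rewrite (_ : (fun n => theta n s) = cst 0); first exact: cvg_cst.
  apply/funext => n; apply: (theta_small _).1; apply: le_trans s0 _.
  by rewrite invr_ge0.
have h1 : bump 1 (n.+1%:R * s - 1) @[n --> \oo] --> (1 : R).
  apply: cvg_bump1 => M; have [N hN] := nat_large ((M + 1) / s).
  by exists N => n /hN; rewrite ler_pdivrMr// lerBrDr.
have [s1|s1] /= := leP s 1.
  rewrite -[X in _ --> X](mulr1 (1 : R)); apply: cvgM => //.
  apply: cvg_bump1 => M; have [N hN] := nat_large M.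
  exists N => n /hN h; apply: le_trans h _.
  by rewrite lerDr mulr_ge0// ?subr_ge0// exprn_ge0.
apply/cvgrPdist_le => e e0; have [N hN] := nat_large (s - 1)^-1.
exists N => // n /= /hN; rewrite invf_ple ?posrE ?subr_gt0 ?ltr0n// => h.
rewrite /theta (bump_le0 _ (t := n.+1%:R ^+ 2 * (1 - s) + n.+1%:R)).
  by rewrite mulr0 subrr normr0 ltW.
have : 0 < n.+1%:R :> R by rewrite ltr0n.
move: (n.+1%:R : R) h => k h k0.
have hk : 1 <= k * (s - 1) by rewrite mulrC -ler_pdivrMr// div1r.
rewrite expr2; nra.
Qed.

End cutoff.

Section row_curves.
Context {R : realType} {d : nat}.
Local Notation E := 'rV[R]_d.
Local Notation basis := (@Defs.basis R d).

Lemma cvg_rV (T : Type) (F : set_system T) {FF : Filter F} (u : T -> E) (l : E) :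
  (forall i, u t ord0 i @[t --> F] --> l ord0 i) -> u t @[t --> F] --> l.
Proof.
move=> ul A /= [P hP PA].
have : \forall t \near F, forall i, P ord0 i (u t ord0 i).
  by apply: filter_forall => i; apply: ul; exact: hP.
by apply: filterS => t ht; apply: PA => i j; rewrite (ord1 i).
Qed.

Lemma MVT_between (f g : R -> R) (a b : R) : (forall x, is_derive x (1 : R) f (g x)) ->
  exists2 c, `|c - a| <= `|b - a| & f b - f a = g c * (b - a).
Proof.
move=> fg; have cf : continuous f by move=> x; exact: is_derive_continuous (fg x).
have [ab|ba] := leP a b.
  have [c] := MVT_segment ab (fun x _ => fg x) (continuous_subspaceT cf).
  rewrite in_itv/= => /andP[ac cb] h; exists c => //.
  by rewrite !ger0_norm ?subr_ge0//; lra.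
have ba' := ltW ba.
have [c] := MVT_segment ba' (fun x _ => fg x) (continuous_subspaceT cf).
rewrite in_itv/= => /andP[ac cb] h; exists c.
  by rewrite !ler0_norm ?subr_le0//; lra.
by rewrite -[LHS]opprB h -mulrN opprB.
Qed.

(* Chain rule along a curve: the increment of [f] is split coordinate by
   coordinate and the mean value theorem is applied on each piece. *)
Lemma is_derive_curve (f : E -> R) (c : R -> E) (c' : E) :
  (forall x i, derivable f x (basis i)) ->
  (forall i, continuous (fun x => 'D_(basis i) f x)) ->
  (forall i, is_derive (0 : R) (1 : R) (fun t => c t ord0 i) (c' ord0 i)) ->
  is_derive (0 : R) (1 : R) (fun t => f (c t))
    (\sum_i 'D_(basis i) f (c 0) * c' ord0 i).
Proof.
move=> fd cD cd.
pose p m t : E := \row_k (if (k < m)%N then c t ord0 k else c 0 ord0 k).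
have p0 t : p 0%N t = c 0 by apply/rowP => k; rewrite mxE ltn0.
have pd t : p d t = c t by apply/rowP => k; rewrite mxE ltn_ord.
pose q (m : 'I_d) t := c t ord0 m - c 0 ord0 m.
have pS (m : 'I_d) t : p m.+1 t = q m t *: basis m + p m t.
  apply/rowP => k; rewrite !mxE ltnS eqxx/=; have [->|km] := eqVneq k m.
    by rewrite leqnn ltnn mulr1 subrK.
  by rewrite mulr0 add0r leq_eqVlt (negbTE (_ : k != m :> nat)).
have /(_ _)/choice xiP (m : 'I_d) : forall t, exists z : E,
    (forall k, `|z ord0 k - c 0 ord0 k| <= `|c t ord0 k - c 0 ord0 k|) /\
    f (p m.+1 t) - f (p m t) = 'D_(basis m) f z * q m t.
  move=> t.
  have fl s : is_derive s (1 : R) (fun s => f (s *: basis m + p m t))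
      ('D_(basis m) f (s *: basis m + p m t)).
    by apply: is_derive_line; apply: DeriveDef.
  have [s] := MVT_between 0 (q m t) fl.
  rewrite !subr0 scale0r add0r -pS => hs e; exists (s *: basis m + p m t); split => // k.
  rewrite !mxE eqxx/=; have [->|km] := eqVneq k m; first by rewrite mulr1 ltnn addrK.
  by rewrite mulr0 add0r; case: ifP => // _; rewrite subrr normr0.
have cc k : c t ord0 k @[t --> (0 : R)^'] --> c 0 ord0 k.
  apply: cvg_trans (is_derive_continuous (cd k)); apply: cvg_app; exact: cvg_within.
have qq k : h^-1 * q k h @[h --> (0 : R)^'] --> c' ord0 k.
  have [h1 h2] := cd k; have /cvg_ex[l hl] := h1.
  have <- : l = c' ord0 k by rewrite -h2; apply/esym/cvg_lim.
  move: hl; apply: cvg_trans; apply: near_eq_cvg; near=> h.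
  by rewrite /= [h%:A]mulr1 addr0.
have step (m : 'I_d) : h^-1 * (f (p m.+1 h) - f (p m h)) @[h --> (0 : R)^'] -->
    'D_(basis m) f (c 0) * c' ord0 m.
  have [z hz] := xiP m.
  rewrite (_ : (fun h => _) = (fun h => 'D_(basis m) f (z h) * (h^-1 * q m h))); last first.
    by apply/funext => h; rewrite (hz h).2; ring.
  apply: cvgM; last exact: qq.
  apply: (@continuous_cvg _ _ _ _ _ z (fun x => 'D_(basis m) f x)); first exact: cD.
  apply: cvg_rV => k; apply/cvgrPdist_le => e e0.
  have /cvgrPdist_le/(_ e e0) := cc k; apply: filterS => t h.
  by rewrite distrC (le_trans ((hz t).1 k))// distrC.
have tele h : f (c h) - f (c 0) = \sum_(m < d) (f (p m.+1 h) - f (p m h)).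
  by rewrite -(big_mkord xpredT (fun m => f (p m.+1 h) - f (p m h))) telescope_sumr// pd p0.
have lim : h^-1 *: (((fun t => f (c t)) \o shift 0) (h *: (1 : R)) - f (c 0)) @[h --> (0 : R)^']
    --> \sum_i 'D_(basis i) f (c 0) * c' ord0 i.
  rewrite (_ : (fun h => _) = (fun h => \sum_(m < d) h^-1 * (f (p m.+1 h) - f (p m h)))).
    by apply: cvg_sumr => m; exact: step.
  by apply/funext => h; rewrite /= [h%:A]mulr1 addr0 tele -mulr_sumr.
by split; [apply/cvg_ex; eexists; exact: lim|apply/cvg_lim].
Unshelve. all: by end_near. Qed.

End row_curves.

(** * Tangential calculus and the divergence theorem on the sphere *)

Section sphere_calculus.
Context {R : realType} {d : nat}.
Local Notation E := 'rV[R]_d.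
Local Notation basis := (@Defs.basis R d).
Implicit Types (u w : E -> R) (G H : E -> E) (x y v : E).

(* [u], seen as a function on the sphere, is C^1 with tangential gradient [G]:
   its 0-homogeneous extension has gradient G(x/|x|)/|x|. *)
Definition sC1 u G : Prop := forall x, x != 0 ->
  [/\ {for x, continuous (u \o @radial R d)},
      forall v, is_derive x v (u \o @radial R d) ((enorm x)^-1 * edot (G (radial x)) v) &
      forall i, {for x, continuous (fun z => G (radial z) ord0 i)}].

Lemma is_derive_enormV x v : x != 0 ->
  is_derive x v (fun z => (enorm z)^-1) (- (enorm x)^-3 * edot x v).
Proof.
move=> x0; have x1 := enorm_gt0 x0.
have e : 0 < edot x x by rewrite -enorm_sqr exprn_gt0.
have d1 : is_derive x v (fun z => edot z z) (2 * edot x v).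
  have h i : is_derive x v (fun z : E => z ord0 i * z ord0 i)
      (v ord0 i * x ord0 i + x ord0 i * v ord0 i).
    apply: derM; apply/is_derive_along;
    have -> : (fun s : R => (s *: v + x) ord0 i) = (fun s => s * v ord0 i + x ord0 i)
      by [apply/funext => s; rewrite !mxE];
    apply: is_derive_eq (derD (derM (is_derive_id _ _) (derC _ _ _)) (derC _ _ _)) _;
    by rewrite mul1r mulr0 !addr0.
  apply: is_derive_eq (der_sum h) _; rewrite mulr_sumr.
  by apply: eq_bigr => i _; ring.
have d2 : is_derive x v (fun z => Num.sqrt (edot z z)) ((2 * enorm x)^-1 * (2 * edot x v)).
  by apply: (@der_comp _ _ Num.sqrt) => //; exact: is_derive1_sqrt.
have d3 := @der_comp _ _ (fun t : R => t^-1) (@enorm R d) x v _ _ _ d2.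
apply: is_derive_eq (d3 (- (enorm x)^-2) _) _.
  apply: is_derive_eq (@is_deriveV R id (enorm x) 1 1 _ _) _ => //=.
    by rewrite gt_eqF.
  by rewrite /GRing.scale /= mulr1.
by field; rewrite gt_eqF.
Qed.

Lemma radial_continuous x : x != 0 -> {for x, continuous (@radial R d)}.
Proof.
move=> x0; apply: (@cvg_rV _ _ _ (nbhs x)) => i.
rewrite (_ : (fun z : E => radial z ord0 i) = (fun z => (enorm z)^-1 * z ord0 i)).
  rewrite mxE; apply: (@cvgM _ _ (nbhs x)); last exact: coord_continuous.
  by apply: (@cvgV _ _ (nbhs x)); [rewrite gt_eqF// enorm_gt0|exact: enorm_continuous].
by apply/funext => z; rewrite mxE.
Qed.

Lemma is_derive_coord x v (i : 'I_d) : is_derive x v (fun z : E => z ord0 i) (v ord0 i).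
Proof.
apply/is_derive_along.
have -> : (fun s : R => (s *: v + x) ord0 i) = (fun s => s * v ord0 i + x ord0 i).
  by apply/funext => s; rewrite !mxE.
apply: is_derive_eq (derD (derM (is_derive_id _ _) (derC _ _ _)) (derC _ _ _)) _.
by rewrite mul1r mulr0 !addr0.
Qed.

Lemma is_derive_radial x v (i : 'I_d) : x != 0 ->
  is_derive x v (fun z : E => radial z ord0 i)
    ((enorm x)^-1 * (v ord0 i - edot (radial x) v * radial x ord0 i)).
Proof.
move=> x0; have x1 := enorm_gt0 x0.
rewrite (_ : (fun z : E => radial z ord0 i) = (fun z => (enorm z)^-1 * z ord0 i)).
  apply: is_derive_eq (derM (is_derive_enormV v x0) (is_derive_coord x v i)) _.
  by rewrite edotZl mxE; field; rewrite gt_eqF.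
by apply/funext => z; rewrite mxE.
Qed.

Lemma edot_basis x i : edot x (basis i) = x ord0 i.
Proof.
rewrite /edot (bigD1 i)//= !mxE !eqxx mulr1 big1 ?addr0// => j ji.
by rewrite !mxE (negbTE ji) mulr0.
Qed.

Lemma sC1_coord i : sC1 (fun x => x ord0 i) (fun x => basis i - x ord0 i *: x).
Proof.
move=> x x0; split => [|v|j].
- apply: (@continuous_comp _ _ _ (@radial R d) (fun z : E => z ord0 i)).
    exact: radial_continuous.
  exact: coord_continuous.
- apply: is_derive_eq (is_derive_radial v i x0) _; congr (_ * _).
  by rewrite edotBl edotZl (edotC (basis i)) edot_basis mulrC.
- rewrite (_ : (fun z => _) = (fun z => basis i ord0 j - radial z ord0 i * radial z ord0 j)).
    have c k : {for x, continuous (fun z : E => radial z ord0 k)}.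
      apply: (@continuous_comp _ _ _ (@radial R d) (fun z : E => z ord0 k)).
        exact: radial_continuous.
      exact: coord_continuous.
    apply: (@cvgB _ _ _ (nbhs x)); first exact: cvg_cst.
    by apply: (@cvgM _ _ (nbhs x)); exact: c.
  by apply/funext => z; rewrite !mxE.
Qed.

Lemma sC1_cst c : sC1 (fun=> c) (fun=> 0).
Proof.
move=> x x0; split => [|v|i]; [exact: (@cvg_cst _ c _ (nbhs x))| |exact: (@cvg_cst _ _ _ (nbhs x))].
by apply: is_derive_eq (derC c x v) _; rewrite edot0l mulr0.
Qed.

Lemma sC1D u w G H : sC1 u G -> sC1 w H -> sC1 (fun x => u x + w x) (fun x => G x + H x).
Proof.
move=> uG wH x x0; have [c1 d1 g1] := uG x x0; have [c2 d2 g2] := wH x x0.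
split => [|v|i]; first by apply: (@cvgD _ _ _ (nbhs x)); [exact: c1|exact: c2].
  by apply: is_derive_eq (derD (d1 v) (d2 v)) _; rewrite edotDl mulrDr.
rewrite (_ : (fun z => _) = (fun z => G (radial z) ord0 i + H (radial z) ord0 i)).
  by apply: (@cvgD _ _ _ (nbhs x)); [exact: g1|exact: g2].
by apply/funext => z; rewrite mxE.
Qed.

Lemma sC1M u w G H : sC1 u G -> sC1 w H ->
  sC1 (fun x => u x * w x) (fun x => w x *: G x + u x *: H x).
Proof.
move=> uG wH x x0; have [c1 d1 g1] := uG x x0; have [c2 d2 g2] := wH x x0.
split => [|v|i]; first by apply: (@cvgM _ _ (nbhs x)); [exact: c1|exact: c2].
  apply: is_derive_eq (derM (d1 v) (d2 v)) _.
  by rewrite /= edotDl !edotZl; ring.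
rewrite (_ : (fun z => _) = (fun z => w (radial z) * G (radial z) ord0 i +
   u (radial z) * H (radial z) ord0 i)).
  apply: (@cvgD _ _ _ (nbhs x)); apply: (@cvgM _ _ (nbhs x)).
  - exact: c2.
  - exact: g1.
  - exact: c1.
  - exact: g2.
by apply/funext => z; rewrite !mxE.
Qed.

Lemma sC1_sum (I : Type) (s : seq I) (u : I -> E -> R) (G : I -> E -> E) :
  (forall i, sC1 (u i) (G i)) ->
  sC1 (fun x => \sum_(i <- s) u i x) (fun x => \sum_(i <- s) G i x).
Proof.
move=> h; elim: s => [|i s ih].
  have := sC1_cst 0; rewrite (_ : (fun=> 0) = (fun x => \sum_(i <- [::]) u i x)).
    rewrite (_ : (fun=> 0) = (fun x => \sum_(i <- [::]) G i x))//.
    by apply/funext => x; rewrite big_nil.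
  by apply/funext => x; rewrite big_nil.
have := sC1D (h i) ih; rewrite (_ : (fun x => u i x + _) = (fun x => \sum_(j <- i :: s) u j x)).
  rewrite (_ : (fun x => G i x + _) = (fun x => \sum_(j <- i :: s) G j x))//.
  by apply/funext => x; rewrite big_cons.
by apply/funext => x; rewrite big_cons.
Qed.

Lemma sC1_comp (h h' : R -> R) u G :
  (forall x, sphere R d x -> is_derive (u x) (1 : R) h (h' (u x))) ->
  (forall x, sphere R d x -> {for u x, continuous h'}) ->
  sC1 u G -> sC1 (fun x => h (u x)) (fun x => h' (u x) *: G x).
Proof.
move=> hd hc uG x x0; have [c1 d1 g1] := uG x x0.
have Sx : sphere R d (radial x) by exact: enorm_radial.
split => [|v|i].
- apply: (@continuous_comp _ _ _ (u \o @radial R d) h) => //.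
  exact: is_derive_continuous (hd _ Sx).
- apply: is_derive_eq (der_comp (hd _ Sx) (d1 v)) _.
  by rewrite /= edotZl; ring.
- rewrite (_ : (fun z => _) = (fun z => h' (u (radial z)) * G (radial z) ord0 i)).
    apply: (@cvgM _ _ (nbhs x)); last exact: g1.
    by apply: (@continuous_comp _ _ _ (u \o @radial R d) h') => //; exact: hc.
  by apply/funext => z; rewrite mxE.
Qed.

Lemma sC1_edot y : sC1 (fun x => edot x y) (fun x => y - edot x y *: x).
Proof.
have := sC1_sum (index_enum 'I_d) (fun i => sC1M (sC1_coord i) (sC1_cst (y ord0 i))).
rewrite (_ : (fun x => \sum_(i <- _) _) = (fun x => edot x y))//.
rewrite (_ : (fun x => \sum_(i <- _) _) = (fun x => y - edot x y *: x))//.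
apply/funext => x.
have -> : y - edot x y *: x =
    \sum_i y ord0 i *: basis i - \sum_i (x ord0 i * y ord0 i) *: x.
  by rewrite -row_sum_delta scaler_suml.
rewrite -sumrB.
by apply: eq_bigr => i _; rewrite scaler0 addr0 scalerBr scalerA mulrC.
Qed.

Lemma sC1_smooth u : continuous u -> (forall x i, derivable u x (basis i)) ->
  (forall i, continuous (fun x => 'D_(basis i) u x)) -> sC1 u (sgrad u).
Proof.
move=> cu ud uc x x0.
have cr k : {for x, continuous (fun z : E => radial z ord0 k)}.
  apply: (@continuous_comp _ _ _ (@radial R d) (fun z : E => z ord0 k)).
    exact: radial_continuous.
  exact: coord_continuous.
have cD k : {for x, continuous (fun z : E => 'D_(basis k) u (radial z))}.
  apply: (@continuous_comp _ _ _ (@radial R d) (fun z : E => 'D_(basis k) u z)).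
    exact: radial_continuous.
  exact: uc.
have der v : is_derive x v (u \o @radial R d)
    ((enorm x)^-1 * edot (sgrad u (radial x)) v).
  apply/is_derive_along.
  have := @is_derive_curve _ _ u (fun s => radial (s *: v + x))
    ((enorm x)^-1 *: (v - edot (radial x) v *: radial x)) ud uc.
  rewrite scale0r add0r => H; apply: is_derive_eq (H _) _.
    move=> i; have /is_derive_along h := is_derive_radial v i x0.
    by apply: is_derive_eq h _; rewrite !mxE.
  rewrite /sgrad edotBl edotZl.
  have -> : \sum_i 'D_(basis i) u (radial x) *
     ((enorm x)^-1 *: (v - edot (radial x) v *: radial x)) ord0 i =
     edot (gradient u (radial x)) ((enorm x)^-1 *: (v - edot (radial x) v *: radial x)).
    by apply: eq_bigr => i _; rewrite /gradient [X in _ = X * _]mxE.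
  rewrite edotZr edotBr edotZr (edotC _ (radial x)); ring.
split => // [|i].
  apply: (@continuous_comp _ _ _ (@radial R d) u); last exact: cu.
  exact: radial_continuous.
rewrite (_ : (fun z => _) = (fun z => 'D_(basis i) u (radial z) -
    (\sum_j radial z ord0 j * 'D_(basis j) u (radial z)) * radial z ord0 i)).
  apply: (@cvgB _ _ _ (nbhs x)); first exact: cD.
  apply: (@cvgM _ _ (nbhs x)); last exact: cr.
  by apply: (@cvg_sumr _ _ _ (nbhs x)) => j; apply: (@cvgM _ _ (nbhs x)); [exact: cr|exact: cD].
apply/funext => z; rewrite /sgrad !mxE /edot.
by congr (_ - _ * _); apply: eq_bigr => j _; rewrite [X in _ * X = _]mxE.
Qed.

End sphere_calculus.

Section divergence.
Context {R : realType} {d : nat}.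
Local Notation E := 'rV[R]_d.
Local Notation basis := (@Defs.basis R d).
Local Notation lam := (rV_lebesgue R d).
Local Notation PB := (@punctured_ball R d).
Implicit Types (x y : E).

(** Functions composed with [radial] may jump at 0, so continuity is asked only off this point,
    which is itself a measurable set. *)
Lemma continuous_off0_measurable (h : E -> R) :
  (forall x, x != 0 -> {for x, continuous h}) -> measurable_fun setT h.
Proof.
move=> ch; apply: (measurability _ (RGenOInfty.measurableE R)).
move=> /= _ [_ [a ->]] <-; rewrite setTI; set V := `]a, +oo[%classic.
have oV : open V by rewrite /V set_itvE; exact: open_gt.
have mU : measurable ((h @^-1` V) `\ (0 : E)).
  apply: open_rV_measurable; rewrite openE => x [Vx /= /eqP x0].
  have h1 : nbhs x (h @^-1` V) by apply: (ch x x0); exact: open_nbhs_nbhs.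
  have h2 : nbhs x (~` [set (0 : E)]).
    apply: open_nbhs_nbhs; split; last by move=> /= /eqP; rewrite (negbTE x0).
    apply: closed_openC; rewrite (_ : [set 0] = @enorm R d @^-1` [set 0]).
      apply: preimage_closed => [z _|]; [exact: enorm_continuous|exact: closed_eq].
    by apply/seteqP; split => z /= => [->|/enorm_eq0 //]; rewrite enorm0.
  exact: filterI h1 h2.
have m0 : measurable [set (0 : E)].
  rewrite -[X in measurable X]setTI (_ : [set 0] = @enorm R d @^-1` [set 0]).
    exact: measurable_enorm.
  by apply/seteqP; split => z /= => [->|/enorm_eq0 //]; rewrite enorm0.
have [V0|V0] := pselect ((h @^-1` V) 0).
  rewrite (_ : h @^-1` V = ((h @^-1` V) `\ (0 : E)) `|` [set 0]).
    exact: measurableU.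
  by rewrite setUC setD1K.
by rewrite (_ : h @^-1` V = (h @^-1` V) `\ (0 : E))// not_setD1.
Qed.

Lemma compact_sphere : compact (sphere R d).
Proof.
apply: (subclosed_compact closed_sphere (@compact_box R d (-1) 1)).
move=> x; rewrite /sphere/= => x1 i.
by rewrite -ler_norml -x1 coord_le_enorm.
Qed.

Lemma radial_fun_bounded (f : E -> R) :
  (forall x, x != 0 -> {for x, continuous (f \o @radial R d)}) ->
  exists M, forall x, `|f (radial x)| <= M.
Proof.
move=> cf; have [M hM] := @compact_continuous_bounded R _ _ (f \o @radial R d)
  compact_sphere (fun x Sx => cf x (sphere_neq0 (set_mem Sx))).
exists (Num.max M `|f 0|) => x; have [->|x0] := eqVneq x 0.
  by rewrite radial0 le_max lexx orbT.
rewrite le_max; apply/orP; left; rewrite -radial_idem.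
by apply: hM; exact: enorm_radial.
Qed.

(** The field theta_n(|x|^2) |x| Z(x/|x|) on R^d has compact support, so its divergence has integral
    0. The factor |x| cancels the 1/|x| of the gradient of a 0-homogeneous function, and the
    derivatives of theta_n and of |x| multiply x . Z = 0; there remains theta_n(|x|^2) times the
    trace of G at x/|x|. As n grows, theta_n tends to the indicator of the punctured ball, which is
    the cone definition of [omega]. *)
Theorem sphere_divergence (Z : 'I_d -> E -> R) (G : 'I_d -> E -> E) :
  (forall i, sC1 (Z i) (G i)) ->
  (forall x, sphere R d x -> \sum_i x ord0 i * Z i x = 0) ->
  \int[omega R d]_x \sum_i G i x ord0 i = 0.
Proof.
move=> ZG Ztan; pose f x := \sum_i G i x ord0 i.
have cf x : x != 0 -> {for x, continuous (f \o @radial R d)}.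
  move=> x0; apply: (@cvg_sumr _ _ _ (nbhs x)) => i.
  by have [_ _ h] := ZG i x x0; exact: h.
have [B hB] := radial_fun_bounded cf.
have B0 : 0 <= B by exact: le_trans (normr_ge0 _) (hB 0).
have mf : measurable_fun setT (f \o @radial R d) by exact: continuous_off0_measurable.
have -> : \int[omega R d]_x f x = \int[omega R d]_x (f \o @radial R d) x.
  by apply: eq_Rintegral_ae; apply: filterS ae_sphere => x Sx /=; rewrite radial_sphere.
rewrite (Rintegral_omega mf hB).
under eq_Rintegral do rewrite /= radial_idem.
suff -> : \int[lam]_(x in PB) f (radial x) = 0 by rewrite mulr0.
pose r2 x := edot x x.
have r2pos x : x != 0 -> 0 < r2 x by move=> /enorm_gt0 x0; rewrite /r2 -enorm_sqr exprn_gt0.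
have cr2 : continuous r2 by exact: edotxx_continuous.
have sqE x : Num.sqrt (r2 x) = enorm x by [].
have near0 n : \forall x \near (0 : E), r2 x < n.+1%:R^-1.
  have : r2 0 < n.+1%:R^-1 by rewrite /r2 edot0l invr_gt0 ltr0n.
  by move=> h; exact: (cr2 0 _ (lt_nbhsl h)).
pose Y n i x := theta n (r2 x) * (enorm x * Z i (radial x)).
pose Y' n i x := (theta' n (r2 x) * (2 * x ord0 i)) * (enorm x * Z i (radial x)) +
  theta n (r2 x) * (radial x ord0 i * Z i (radial x) + G i (radial x) ord0 i).
have dY n i x : is_derive x (basis i) (Y n i) (Y' n i x).
  have [->|x0] := eqVneq x 0.
    have Y'0 : 0 = Y' n i 0.
      have [h1 h2] := @theta_small R n (r2 0) (ltW (nbhs_singleton (near0 n))).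
      by rewrite /Y' h1 h2 !mul0r addr0.
    apply: is_derive_eq Y'0; apply: near_eq_is_derive (derC 0 _ _); near=> z.
    rewrite /Y (theta_small _).1 ?mul0r//; apply: ltW.
    by near: z; exact: near0.
  have [_ dZ _] := ZG i x x0.
  have dr2 : is_derive x (basis i) r2 (2 * x ord0 i).
    have h j : is_derive x (basis i) (fun z : E => z ord0 j * z ord0 j)
        (basis i ord0 j * x ord0 j + x ord0 j * basis i ord0 j).
      by apply: derM; exact: is_derive_coord.
    apply: is_derive_eq (der_sum h) _.
    rewrite -[x ord0 i]edot_basis /edot mulr_sumr.
    by apply: eq_bigr => j _; ring.
  have de : is_derive x (basis i) (@enorm R d) ((enorm x)^-1 * x ord0 i).
    have x1 := enorm_gt0 x0.
    have := @der_comp _ _ Num.sqrt r2 x (basis i) _ _ (is_derive1_sqrt (r2pos x x0)) dr2.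
    by move=> h; apply: is_derive_eq h _; rewrite sqE; field; rewrite gt_eqF.
  apply: is_derive_eq (derM (der_comp (is_derive_theta n (r2 x)) dr2) (derM de (dZ (basis i)))) _.
  rewrite /Y' edot_basis /= mxE; have x1 := enorm_gt0 x0.
  by field; rewrite gt_eqF.
have cY n i : continuous (Y' n i).
  move=> x; have [->|x0] := eqVneq x 0.
    have e : \forall z \near (0 : E), 0 = Y' n i z.
      apply: filterS (near0 n) => z hz; have [h1 h2] := @theta_small R n (r2 z) (ltW hz).
      by rewrite /Y' h1 h2 !mul0r addr0.
    suff : Y' n i z @[z --> (0 : E)] --> (0 : R) by rewrite {1}(nbhs_singleton e).
    by apply: cvg_trans (near_eq_cvg e) _; exact: (@cvg_cst _ _ _ (nbhs (0 : E))).
  have [cZ _ cG] := ZG i x x0.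
  have cth : {for x, continuous (fun z => theta n (r2 z))}.
    apply: (@continuous_comp _ _ _ r2 (theta n)); first exact: cr2.
    exact: is_derive_continuous (is_derive_theta n _).
  have cth' : {for x, continuous (fun z => theta' n (r2 z))}.
    by apply: (@continuous_comp _ _ _ r2 (theta' n)); [exact: cr2|exact: theta'_continuous].
  have cx : {for x, continuous (fun z : E => z ord0 i)} by exact: coord_continuous.
  have cr : {for x, continuous (fun z : E => radial z ord0 i)}.
    apply: (@continuous_comp _ _ _ (@radial R d) (fun z : E => z ord0 i)).
      exact: radial_continuous.
    exact: coord_continuous.
  apply: (@cvgD _ _ _ (nbhs x)); apply: (@cvgM _ _ (nbhs x)).
  - apply: (@cvgM _ _ (nbhs x)) => //; apply: (@cvgM _ _ (nbhs x)) => //.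
    exact: (@cvg_cst _ _ _ (nbhs x)).
  - by apply: (@cvgM _ _ (nbhs x)) => //; exact: enorm_continuous.
  - exact: cth.
  - by apply: (@cvgD _ _ _ (nbhs x)) => //; [apply: (@cvgM _ _ (nbhs x))|exact: cG].
have big x : ~ box (-2) 2 x -> 2 <= r2 x.
  move=> nx; rewrite leNgt; apply/negP => h; apply: nx => i.
  rewrite -ler_norml; apply: le_trans (coord_le_enorm x i) _.
  rewrite -(ler_pXn2r (n := 2))// ?nnegrE ?enorm_ge0// enorm_sqr; move: h; rewrite /r2; lra.
have Y0 n i x : ~ box (-2) 2 x -> Y n i x = 0.
  by move=> /big h; rewrite /Y (theta_large n h).1 mul0r.
have Y'0 n i x : ~ box (-2) 2 x -> Y' n i x = 0.
  by move=> /big h; have [h1 h2] := theta_large n h; rewrite /Y' h1 h2 !mul0r addr0.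
have IY n i : \int[lam]_x Y' n i x = 0.
  exact: (integral_partial_derivative_eq0 (ler0n R 2) (dY n i) (cY n i)
    (@Y0 n i) (@Y'0 n i)).
have itgY n i : itg lam (Y' n i).
  exact: (continuous_support_itg (ler0n R 2) (cY n i) (@Y'0 n i)).
have SY n x : \sum_i Y' n i x = theta n (r2 x) * f (radial x).
  have [->|x0] := eqVneq x 0.
    have [h1 h2] := @theta_small R n (r2 0) (ltW (nbhs_singleton (near0 n))).
    by rewrite h1 mul0r big1// => i _; rewrite /Y' h1 h2 !mul0r addr0.
  have x1 := enorm_gt0 x0.
  have T := Ztan (radial x) (enorm_radial x0).
  rewrite big_split /= -mulr_sumr big_split /= T add0r -/(f _).
  rewrite [X in X + _](_ : _ = 2 * theta' n (r2 x) * enorm x ^+ 2 *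
      \sum_i radial x ord0 i * Z i (radial x)); first by rewrite T mulr0 add0r.
  rewrite mulr_sumr; apply: eq_bigr => i _; rewrite mxE.
  by field; rewrite gt_eqF.
have I0 n : \int[lam]_x (theta n (r2 x) * f (radial x)) = 0.
  under eq_Rintegral do rewrite -SY.
  by rewrite Rintegral_sum// big1.
have mth n : measurable_fun setT (fun x => theta n (r2 x) * f (radial x)).
  by under eq_fun do rewrite -SY; apply: itg_measurable (itg_sum _ (itgY n)).
have mPB := @measurable_punctured_ball R d.
have mb := @measurable_box R d (-2) 2.
have PBE x : (x \in PB) = (0 < r2 x <= 1).
  apply/idP/idP.
    rewrite inE => /andP[x0 x1]; rewrite /r2 -enorm_sqr exprn_gt0//=.
    by rewrite expr_le1 ?enorm_ge0.
  rewrite inE /r2 -enorm_sqr => /andP[x0 x1]; apply/andP; split.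
    by rewrite lt_neqAle enorm_ge0 andbT; apply: contraTneq x0 => <-; rewrite expr0n ltxx.
  by move: x1; rewrite expr_le1 ?enorm_ge0.
have [||||n|_] := @Rdominated_cvg _ _ _ lam (fun n x => theta n (r2 x) * f (radial x))
  (fun x => (f \o @radial R d) x * \1_PB x) (cst B \_ (box (-2) 2)).
- exact: mth.
- by apply: measurable_funM => //; exact: measurable_indic.
- apply: aeW => x; rewrite mulrC indicE PBE; apply: cvgM; last exact: cvg_cst.
  exact: theta_cvg.
- rewrite /itg -restrict_EFin; apply/(integrable_mkcond _ mb).
  apply: measurable_bounded_integrable => //.
    have : (lam (box (-2) 2) < +oo)%E by rewrite rV_lebesgue_box ?ltry//; lra.
    exact.
  by exists `|B|; split => [|K BK x _]; [rewrite num_real|exact: ltW].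
- apply: aeW => x; rewrite patchE; case: ifPn => [_|].
    rewrite normrM -[leRHS]mul1r; have /andP[t0 t1] := theta_bound n (r2 x).
    by rewrite ler_pM// ger0_norm.
  by rewrite notin_setE => /big h; rewrite (theta_large n h).1 mul0r normr0.
rewrite (_ : (fun n => _) = cst 0); last by apply/funext => n; exact: I0.
have -> : \int[lam]_(x in PB) f (radial x) = \int[lam]_x ((f \o @radial R d) x * \1_PB x).
  rewrite Rintegral_mkcond; apply: eq_Rintegral => x _; rewrite patchE indicE /=.
  by case: ifP => _; rewrite ?mulr1 ?mulr0.
by move=> h; apply/esym/(cvg_unique _ (cvg_cst 0) h).
Unshelve. all: by end_near. Qed.

End divergence.

(** * Zonal functions and Green's formula *)

Section zonal.
Context {R : realType} {d : nat}.
Local Notation E := 'rV[R]_d.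
Local Notation basis := (@Defs.basis R d).
Implicit Types (x y z : E) (u : E -> R).

Lemma edot_radial_le1 x y : sphere R d y -> `|edot (radial x) y| <= 1.
Proof.
rewrite /sphere/= => y1; apply: le_trans (edot_cauchy _ _) _.
by rewrite y1 mulr1 enorm_radial_le1.
Qed.

Lemma edot_sphere_le1 x y : sphere R d x -> sphere R d y -> `|edot x y| <= 1.
Proof. by rewrite /sphere/= => x1 y1; have := edot_cauchy x y; rewrite x1 y1 mulr1. Qed.

(* [h] is C^1 on [-1, 1], with two-sided derivatives at the end points. *)
Definition zC1 (h h' : R -> R) := forall s, `|s| <= 1 ->
  is_derive s (1 : R) h (h' s) /\ {for s, continuous h'}.

Lemma zC1_cont h h' s : zC1 h h' -> `|s| <= 1 -> {for s, continuous h}.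
Proof. by move=> hh /hh[h1 _]; exact: is_derive_continuous h1. Qed.

Lemma sC1_zonal (h h' : R -> R) y : sphere R d y -> zC1 h h' ->
  sC1 (fun x => h (edot x y)) (fun x => h' (edot x y) *: (y - edot x y *: x)).
Proof.
move=> Sy hh; apply: (@sC1_comp _ _ h h' (fun x => edot x y)); last exact: sC1_edot.
- by move=> x Sx; have [] := hh _ (edot_sphere_le1 Sx Sy).
- by move=> x Sx; have [] := hh _ (edot_sphere_le1 Sx Sy).
Qed.

Lemma edot_radial_continuous x y : x != 0 ->
  {for x, continuous (fun z : E => edot (radial z) y)}.
Proof.
move=> x0; apply: (@continuous_comp _ _ _ (@radial R d) (fun z : E => edot z y)).
  exact: radial_continuous.
exact: edot_continuous.
Qed.

Lemma zonal_bounded (h : R -> R) : (forall s, `|s| <= 1 -> {for s, continuous h}) ->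
  exists M, forall x y, sphere R d y -> `|h (edot (radial x) y)| <= M.
Proof.
move=> hc; have := @compact_continuous_bounded R R (`[-1, 1]%classic : set R) h (@segment_compact R _ _).
have c : {in (`[-1, 1]%classic : set R), continuous h}.
  by move=> s; rewrite inE/= in_itv/= -ler_norml; exact: hc.
move=> /(_ c)[M hM]; exists M => x y Sy; apply: hM.
by rewrite /= in_itv/= -ler_norml; exact: edot_radial_le1.
Qed.

Lemma zonal_measurable (h : R -> R) y : (forall s, `|s| <= 1 -> {for s, continuous h}) ->
  sphere R d y -> measurable_fun setT (fun x => h (edot (radial x) y)).
Proof.
move=> hc Sy; apply: continuous_off0_measurable => x x0.
apply: (@continuous_comp _ _ _ (fun z : E => edot (radial z) y) h).
  exact: edot_radial_continuous.
by apply: hc; exact: edot_radial_le1.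
Qed.

Lemma Rintegral_radial (f : E -> R) :
  \int[omega R d]_x f (radial x) = \int[omega R d]_x f x.
Proof.
by apply: eq_Rintegral_ae; apply: filterS ae_sphere => x Sx; rewrite radial_sphere.
Qed.

Lemma divergence_mul u G (W : 'I_d -> E -> R) (H : 'I_d -> E -> E) :
  sC1 u G -> (forall i, sC1 (W i) (H i)) ->
  (forall x, sphere R d x -> \sum_i x ord0 i * W i x = 0) ->
  \int[omega R d]_x ((\sum_i W i x * G x ord0 i) + u x * \sum_i H i x ord0 i) = 0.
Proof.
move=> uG WH Wt; have := sphere_divergence (fun i => sC1M uG (WH i)).
move=> h; rewrite -[RHS]h.
  apply: eq_Rintegral => x _; rewrite mulr_sumr -big_split.
  by apply: eq_bigr => i _; rewrite !mxE.
move=> x Sx; transitivity (u x * \sum_i x ord0 i * W i x); last by rewrite Wt// mulr0.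
by rewrite mulr_sumr; apply: eq_bigr => i _; ring.
Qed.

Variable y : E.
Hypothesis Sy : sphere R d y.

(** The tangential part of y, written with sums and products only, so that [sC1D] and [sC1M] produce
    the gradient [Gw] as it stands. *)
Let w i x : R := y ord0 i + (- 1) * (edot x y * x ord0 i).
Let Gw i x : E := 0 + ((edot x y * x ord0 i) *: (0 : E) +
  (- 1) *: (x ord0 i *: (y - edot x y *: x) + edot x y *: (basis i - x ord0 i *: x))).

Let sC1_w i : sC1 (w i) (Gw i).
Proof.
apply: sC1D; first exact: sC1_cst.
apply: sC1M; first exact: sC1_cst.
by apply: sC1M; [exact: sC1_edot|exact: sC1_coord].
Qed.

Let wE i x : w i x = (y - edot x y *: x) ord0 i.
Proof. by rewrite /w !mxE mulN1r. Qed.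

Let w_tangent x : sphere R d x -> \sum_i x ord0 i * w i x = 0.
Proof.
move=> Sx; transitivity (edot x (y - edot x y *: x)).
  by apply: eq_bigr => i _; rewrite wE.
by rewrite edotBr edotZr (edot_sphere Sx) mulr1 subrr.
Qed.

Let trace_w x : sphere R d x -> \sum_i Gw i x ord0 i = - ((d%:R - 1) * edot x y).
Proof.
move=> Sx; have e := edot_sphere Sx.
have g i : Gw i x ord0 i =
    - (x ord0 i * (y - edot x y *: x) ord0 i) - edot x y * (1 - x ord0 i * x ord0 i).
  by rewrite !mxE !eqxx /=; ring.
rewrite (eq_bigr _ (fun i _ => g i)) sumrB sumrN -mulr_sumr sumrB -!/(edot _ _).
by rewrite edotBr edotZr e sumr_const card_ord; ring.
Qed.

(* The Laplace-Beltrami operator on zonal functions [x |-> h (x . y)]. *)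
Definition zlap (h' h'' : R -> R) s := (1 - s ^+ 2) * h'' s - (d%:R - 1) * s * h' s.

Variables (h' h'' : R -> R).
Hypothesis hh' : zC1 h' h''.

(** The integrand is the divergence of u times the gradient h'(s) w of a zonal function, where s = x
    . y. Indeed |w|^2 = 1 - s^2 and div w = - (d - 1) s give h'' |w|^2 + h' div w = [zlap]. *)
Lemma zonal_divergence u G : sC1 u G ->
  \int[omega R d]_x (h' (edot x y) * edot (G x) (y - edot x y *: x) +
    u x * zlap h' h'' (edot x y)) = 0.
Proof.
move=> uG; have S1 := sC1_zonal Sy hh'.
rewrite -[RHS](divergence_mul uG (fun i => sC1M S1 (sC1_w i))); last first.
  move=> x Sx; transitivity (h' (edot x y) * \sum_i x ord0 i * w i x).
    by rewrite mulr_sumr; apply: eq_bigr => i _; ring.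
  by rewrite w_tangent// mulr0.
apply: eq_Rintegral_ae; apply: filterS ae_sphere => x Sx; congr (_ + _ * _).
  by rewrite mulr_sumr; apply: eq_bigr => i _; rewrite wE; ring.
have e := edot_sphere Sx.
transitivity (h'' (edot x y) * edot (y - edot x y *: x) (y - edot x y *: x) +
   h' (edot x y) * \sum_i Gw i x ord0 i).
  rewrite trace_w// /zlap !(edotBl, edotBr, edotZl, edotZr) e (edot_sphere Sy) (edotC y x).
  ring.
rewrite {1}/edot !mulr_sumr -big_split /=; apply: eq_bigr => i _.
rewrite [RHS]mxE [X in _ = X + _]mxE [X in _ = _ + X]mxE [X in _ = _ * X + _]mxE wE.
ring.
Qed.

End zonal.
Arguments zlap {R} d h' h'' s.

Section green.
Context {R : realType} {d : nat}.
Local Notation E := 'rV[R]_d.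
Implicit Types (x y z : E) (f : E -> R).

Lemma itg_radial f : (forall x, x != 0 -> {for x, continuous (f \o @radial R d)}) ->
  itg (omega R d) (fun x => f (radial x)).
Proof.
move=> cf; have [M hM] := radial_fun_bounded cf.
by apply: itg_bounded hM; exact: continuous_off0_measurable.
Qed.

Lemma radial_cont x y : x != 0 -> {for x, continuous (fun z => edot (radial z) y)}.
Proof. exact: edot_radial_continuous. Qed.

Lemma zonal_cont (h : R -> R) x y : x != 0 -> sphere R d y ->
  (forall s, `|s| <= 1 -> {for s, continuous h}) ->
  {for x, continuous (fun z => h (edot (radial z) y))}.
Proof.
move=> x0 Sy hc; apply: (@continuous_comp _ _ _ (fun z => edot (radial z) y) h).
  exact: radial_cont.
by apply: hc; exact: edot_radial_le1.
Qed.

Lemma zlap_cont (h h' h'' : R -> R) s : zC1 h' h'' -> `|s| <= 1 ->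
  {for s, continuous (zlap d h' h'')}.
Proof.
move=> hh' s1; have [_ c2] := hh' s s1; have c1 := zC1_cont hh' s1.
apply: (@cvgB _ _ _ (nbhs s)); apply: (@cvgM _ _ (nbhs s)) => //.
  apply: (@cvgB _ _ _ (nbhs s)); first exact: (@cvg_cst _ _ _ (nbhs s)).
  exact: exprn_continuous.
by apply: (@cvgM _ _ (nbhs s)); [exact: (@cvg_cst _ _ _ (nbhs s))|exact: cvg_id].
Qed.

(** On the sphere y . z - (x . y)(x . z) is the product of the tangential parts of y and z. The
    right-hand side is symmetric in the two functions, so two uses of this formula move the
    Laplacian from one zonal function to the other. *)
Lemma zonal_green (a' a'' b b' : R -> R) y z : sphere R d y -> sphere R d z ->
  zC1 a' a'' -> zC1 b b' ->
  \int[omega R d]_x (zlap d a' a'' (edot (radial x) y) * b (edot (radial x) z)) =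
  - \int[omega R d]_x (a' (edot (radial x) y) * b' (edot (radial x) z) *
      (edot y z - edot (radial x) y * edot (radial x) z)).
Proof.
move=> Sy Sz aa' bb.
have := zonal_divergence Sy aa' (sC1_zonal Sz bb).
rewrite -Rintegral_radial RintegralD//.
- move=> /eqP; rewrite addrC addr_eq0 => /eqP h.
  transitivity (- (\int[omega R d]_x (a' (edot (radial x) y) *
     edot (b' (edot (radial x) z) *: (z - edot (radial x) z *: radial x))
       (y - edot (radial x) y *: radial x)))).
    by rewrite -h; apply: eq_Rintegral => x _; rewrite mulrC.
  congr (- _); apply: eq_Rintegral_ae; apply: filterS ae_sphere => x Sx.
  rewrite (radial_sphere Sx) edotZl !(edotBl, edotBr, edotZl, edotZr) (edot_sphere Sx).
  by rewrite (edotC z y) (edotC z x); ring.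
- apply: (@itg_radial (fun x => a' (edot x y) *
     edot (b' (edot x z) *: (z - edot x z *: x)) (y - edot x y *: x))) => x x0.
  rewrite (_ : _ \o _ = fun v => a' (edot (radial v) y) * (b' (edot (radial v) z) *
    (edot z y - edot (radial v) y * edot (radial v) z - edot (radial v) z *
      (edot (radial v) y - edot (radial v) y * edot (radial v) (radial v))))); last first.
    apply/funext => v /=; move: (radial v) => r.
    by rewrite !(edotBl, edotBr, edotZl, edotZr) (edotC z r); ring.
  apply: (@cvgM _ _ (nbhs x)).
    by apply: zonal_cont => // s /aa'; case => /is_derive_continuous.
  apply: (@cvgM _ _ (nbhs x)).
    by apply: zonal_cont => // s /bb; case.
  have cy := @radial_cont x y x0; have cz := @radial_cont x z x0.
  have cr : {for x, continuous (fun v => edot (radial v) (radial v))}.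
    apply: (@continuous_comp _ _ _ (@radial R d) (fun v : E => edot v v)).
      exact: radial_continuous.
    exact: edotxx_continuous.
  apply: (@cvgB _ _ _ (nbhs x)).
    by apply: (@cvgB _ _ _ (nbhs x)); [exact: (@cvg_cst _ _ _ (nbhs x))|exact: (@cvgM _ _ (nbhs x))].
  apply: (@cvgM _ _ (nbhs x)) => //; apply: (@cvgB _ _ _ (nbhs x)) => //.
  exact: (@cvgM _ _ (nbhs x)).
- apply: (@itg_radial (fun x => b (edot x z) * zlap d a' a'' (edot x y))) => x x0.
  apply: (@cvgM _ _ (nbhs x)).
    by apply: zonal_cont => // s; exact: zC1_cont bb.
  by apply: zonal_cont => // s; exact: zlap_cont.
Qed.

Lemma smooth_C1 (X : E -> E) : smooth X -> forall i,
  [/\ continuous (fun x => X x ord0 i),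
      forall x v, derivable (fun x => X x ord0 i) x v,
      forall v, continuous (fun x => 'D_v (fun x => X x ord0 i) x) &
      forall x v, 'D_v X x ord0 i = 'D_v (fun x => X x ord0 i) x].
Proof.
move=> sX i; have [cX dX] := sX [::].
have cc (F : E -> E) : continuous F -> continuous (fun x => F x ord0 i).
  move=> cF x; apply: (@continuous_comp _ _ _ F (fun z : E => z ord0 i)); first exact: cF.
  exact: coord_continuous.
have e x v : 'D_v X x ord0 i = 'D_v (fun x => X x ord0 i) x.
  by rewrite derive_mx ?mxE//; exact: dX.
split => // [|x v|v]; first exact: cc.
- exact: (derivable_mxP _ _ _).1 (dX x v) ord0 i.
- rewrite (_ : (fun x => _) = (fun x => 'D_v X x ord0 i)).
    by apply: cc; have [] := sX [:: v].
  by apply/funext => x; rewrite e.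
Qed.

Lemma derive_sum_basis f x v : (forall x i, derivable f x (@Defs.basis R d i)) ->
  (forall i, continuous (fun x => 'D_(@Defs.basis R d i) f x)) ->
  'D_v f x = \sum_i 'D_(@Defs.basis R d i) f x * v ord0 i.
Proof.
move=> fd fc; have := @is_derive_curve R d f (fun s => s *: v + x) v fd fc.
rewrite scale0r add0r => h.
by have [] := (is_derive_along f x v _).2 (h (fun i => (is_derive_along _ _ _ _).1
  (is_derive_coord x v i))).
Qed.

(** Relates [sdiv], written with an ambient derivative along x, to the trace of the tangential
    gradients of the components, which is what [sphere_divergence] integrates. *)
Lemma trace_sgrad (X : E -> E) x : smooth X ->
  \sum_i sgrad (fun x => X x ord0 i) x ord0 i = sdiv X x.
Proof.
move=> sX; rewrite /sdiv /edot.
have -> : \sum_(i < d) x ord0 i * 'D_x X x ord0 i =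
    \sum_(i < d) edot x (gradient (fun x => X x ord0 i) x) * x ord0 i.
  apply: eq_bigr => i _; have [_ h1 h2 ->] := smooth_C1 sX i.
  rewrite derive_sum_basis// mulrC /edot; congr (_ * _).
  by apply: eq_bigr => j _; rewrite [gradient _ _ _ _]mxE mulrC.
rewrite -sumrB; apply: eq_bigr => i _; have [_ _ _ e] := smooth_C1 sX i.
by rewrite /sgrad !mxE e.
Qed.

Lemma sdiv_radial_cont (X : E -> E) x : smooth X -> x != 0 ->
  {for x, continuous (sdiv X \o @radial R d)}.
Proof.
move=> sX x0; rewrite (_ : _ \o _ = fun z =>
   \sum_i sgrad (fun x => X x ord0 i) (radial z) ord0 i).
  apply: (@cvg_sumr _ _ _ (nbhs x)) => i; have [h1 h2 h3 _] := smooth_C1 sX i.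
  have /(_ x x0)[_ _] := sC1_smooth h1 (fun x i => h2 x _) (fun i => h3 _).
  exact.
by apply/funext => z; rewrite /= trace_sgrad.
Qed.

Lemma zonal_green_field (h h' : R -> R) (X : E -> E) y : sphere R d y ->
  zC1 h h' -> smooth_tangent X ->
  \int[omega R d]_x (h (edot (radial x) y) * sdiv X (radial x)) =
  - \int[omega R d]_x (h' (edot (radial x) y) *
     edot (X (radial x)) (y - edot (radial x) y *: radial x)).
Proof.
move=> Sy hh [sX tX].
have XC i := smooth_C1 sX i.
have XS i : sC1 (fun x => X x ord0 i) (sgrad (fun x => X x ord0 i)).
  have [h1 h2 h3 _] := XC i; exact: sC1_smooth.
have := divergence_mul (sC1_zonal Sy hh) XS tX.
rewrite -Rintegral_radial RintegralD//.
- move=> /eqP; rewrite addrC addr_eq0 => /eqP H.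
  transitivity (\int[omega R d]_x (h (edot (radial x) y) *
     \sum_i sgrad (fun x => X x ord0 i) (radial x) ord0 i)).
    by apply: eq_Rintegral => x _; rewrite trace_sgrad.
  rewrite H; congr (- _); apply: eq_Rintegral => x _.
  by rewrite mulr_sumr; apply: eq_bigr => i _; rewrite [X in _ * X = _]mxE; ring.
- apply: (@itg_radial (fun x => \sum_i X x ord0 i *
     (h' (edot x y) *: (y - edot x y *: x)) ord0 i)) => x x0.
  apply: (@cvg_sumr _ _ _ (nbhs x)) => i; apply: (@cvgM _ _ (nbhs x)).
    have [h1 _ _] := XS i x x0; exact: h1.
  by have [_ _ h3] := sC1_zonal Sy hh x0; exact: h3.
- apply: (@itg_radial (fun x => h (edot x y) *
     \sum_i sgrad (fun x => X x ord0 i) x ord0 i)) => x x0.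
  apply: (@cvgM _ _ (nbhs x)).
    by apply: zonal_cont => // s; exact: zC1_cont hh.
  apply: (@cvg_sumr _ _ _ (nbhs x)) => i.
  by have [_ _ h3] := XS i x x0; exact: h3.
Qed.

End green.

(** * Zonal kernels *)

Section kernel.
Context {R : realType}.
Implicit Types (p r s : R).

(* |x - r y|^2 for unit vectors with x . y = s. *)
Definition kq r s : R := 1 + r ^+ 2 - 2 * r * s.
(** The real power |x - r y|^(-2p), by exponentials because 2p may be odd. As [ln] is 0 at
    nonpositive arguments, the value on the diagonal r = s = 1 is 1 and not infinity. *)
Definition kQ p r s : R := expR (- p * ln (kq r s)).

Lemma kq_ge r s : `|s| <= 1 -> (1 - `|r|) ^+ 2 <= kq r s.
Proof.
rewrite ler_norml => /andP[s1 s2]; rewrite /kq sqrrB expr1n mul1r real_normK ?num_real//.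
suff : r * s <= `|r| by rewrite -mulr_natl; lra.
apply: le_trans (ler_norm _) _; rewrite normrM ler_piMr//.
by rewrite ler_norml s1 s2.
Qed.

Lemma kq_gt0 r s : `|r| < 1 -> `|s| <= 1 -> 0 < kq r s.
Proof.
by move=> r1 /kq_ge h; apply: lt_le_trans (h r); rewrite exprn_gt0// subr_gt0.
Qed.

Lemma kQ_gt0 p r s : 0 < kQ p r s. Proof. exact: expR_gt0. Qed.

Lemma kQS p r s : 0 < kq r s -> kQ p r s = kq r s * kQ (p + 1) r s.
Proof.
move=> q0; rewrite /kQ -{2}[kq r s]lnK ?posrE// -expRD; congr expR; ring.
Qed.

Lemma kQ_mono p r s r' s' : 0 <= p -> 0 < kq r' s' -> kq r' s' <= kq r s ->
  kQ p r s <= kQ p r' s'.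
Proof.
move=> p0 q0 qq; rewrite ler_expR !mulNr lerN2 ler_wpM2l// ler_ln ?posrE//.
exact: lt_le_trans qq.
Qed.

Lemma kQ_bound p r s r1 : 0 <= p -> `|r| <= r1 -> r1 < 1 -> `|s| <= 1 ->
  kQ p r s <= kQ p r1 1.
Proof.
move=> p0 rr r11 s1; have r10 : 0 <= r1 := le_trans (normr_ge0 r) rr.
have e : kq r1 1 = (1 - r1) ^+ 2 by rewrite /kq; ring.
apply: kQ_mono => //; first by rewrite e exprn_gt0// subr_gt0.
apply: le_trans (kq_ge r s1); rewrite e ler_pXn2r ?nnegrE ?subr_ge0 ?lerD2l ?lerN2//.
  exact: ltW.
exact: le_trans rr (ltW r11).
Qed.

Lemma is_derive_kQ_s p r s : 0 < kq r s ->
  is_derive s (1 : R) (kQ p r) (2 * r * p * kQ (p + 1) r s).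
Proof.
move=> q0.
have d1 : is_derive s (1 : R) (kq r) (- (2 * r)).
  apply: is_derive_eq (derB (derC (1 + r ^+ 2) _ _) (derZ (2 * r) (is_derive_id s 1))) _.
  by rewrite mulr1 sub0r.
have d2 := @der_comp R R (@ln R) (kq r) s 1 _ _ (is_derive1_ln q0) d1.
have d3 := @der_comp R R (@expR R) (fun t => - p * ln (kq r t)) s 1 _ _
  (is_derive_expR _) (derZ (- p) d2).
apply: is_derive_eq d3 _; rewrite -/(kQ p r s) (kQS p q0).
by field; rewrite gt_eqF.
Qed.

Lemma is_derive_kQ_r p r s : 0 < kq r s ->
  is_derive r (1 : R) (fun r => kQ p r s) (- p * (2 * r - 2 * s) * kQ (p + 1) r s).
Proof.
move=> q0.
have d1 : is_derive r (1 : R) (fun r => kq r s) (2 * r - 2 * s).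
  apply: is_derive_eq (derB (derD (derC 1 _ _) (derX 2 (is_derive_id r 1)))
    (derM (derZ 2 (is_derive_id r 1)) (derC s _ _))) _.
  by rewrite /= expr1 mulr0; ring.
have d2 := @der_comp R R (@ln R) (fun t => kq t s) r 1 _ _ (is_derive1_ln q0) d1.
have d3 := @der_comp R R (@expR R) (fun t => - p * ln (kq t s)) r 1 _ _
  (is_derive_expR _) (derZ (- p) d2).
apply: is_derive_eq d3 _; rewrite -/(kQ p r s) (kQS p q0).
by field; rewrite gt_eqF.
Qed.

Lemma zC1_kQ p r : `|r| < 1 -> zC1 (kQ p r) (fun s => 2 * r * p * kQ (p + 1) r s).
Proof.
move=> r1 s s1; have q0 := kq_gt0 r1 s1.
split; first exact: is_derive_kQ_s.
apply: (@cvgM _ _ (nbhs s)); first exact: (@cvg_cst _ _ _ (nbhs s)).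
exact: is_derive_continuous (is_derive_kQ_s _ q0).
Qed.

Lemma zC1Z c h h' : zC1 h h' -> zC1 (fun s => c * h s) (fun s => c * h' s : R).
Proof.
move=> hh s s1; have [h1 h2] := hh s s1; split; first exact: derZ.
by apply: (@cvgM _ _ (nbhs s)) => //; exact: (@cvg_cst _ _ _ (nbhs s)).
Qed.

Variable a : R.
Hypothesis a0 : 0 < a.

Definition kN r s := kQ a r s.
(* The Poisson kernel of the ball when [a = (d - 2) / 2]. *)
Definition kP r s := (1 - r ^+ 2) * kQ (a + 1) r s.
Definition kN' r s := 2 * r * a * kQ (a + 1) r s.
Definition kN'' r s := 2 * r * a * (2 * r * (a + 1) * kQ (a + 1 + 1) r s).
Definition kDN r s := - a * (2 * r - 2 * s) * kQ (a + 1) r s.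
Definition kDP r s := - (2 * r) * kQ (a + 1) r s +
  (1 - r ^+ 2) * (- (a + 1) * (2 * r - 2 * s) * kQ (a + 1 + 1) r s).

Lemma zC1_kN r : `|r| < 1 -> zC1 (kN r) (kN' r).
Proof. exact: zC1_kQ. Qed.

Lemma zC1_kN' r : `|r| < 1 -> zC1 (kN' r) (kN'' r).
Proof. by move=> r1; apply: zC1Z; exact: zC1_kQ. Qed.

Lemma kP_cont r s : `|r| < 1 -> `|s| <= 1 -> {for s, continuous (kP r)}.
Proof.
move=> r1 s1.
apply: (@cvgM _ _ (nbhs s)); first exact: (@cvg_cst _ _ _ (nbhs s)).
exact: is_derive_continuous (is_derive_kQ_s _ (kq_gt0 r1 s1)).
Qed.

Lemma is_derive_kN_r r s : `|r| < 1 -> `|s| <= 1 ->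
  is_derive r (1 : R) (fun r => kN r s) (kDN r s).
Proof. by move=> r1 s1; apply: is_derive_kQ_r; exact: kq_gt0. Qed.

Lemma is_derive_kP_r r s : `|r| < 1 -> `|s| <= 1 ->
  is_derive r (1 : R) (fun r => kP r s) (kDP r s).
Proof.
move=> r1 s1; apply: is_derive_eq (derM (derB (derC 1 _ _) (derX 2 (is_derive_id r 1)))
  (is_derive_kQ_r (a + 1) (kq_gt0 r1 s1))) _.
by rewrite /kDP /= expr1; ring.
Qed.

(** This equation and that of [kP_ode] express the multipliers a r^l / (l + a), r^l and - l (l + 2a)
    of N_r, P_r and Delta. Here both are pointwise algebra in [kq]. *)
Lemma kN_ode r s : `|r| < 1 -> `|s| <= 1 -> r * kDN r s = a * kP r s - a * kN r s.
Proof.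
move=> r1 s1; rewrite /kDN /kP /kN (kQS a (kq_gt0 r1 s1)) /kq; ring.
Qed.

Lemma kP_ode d r s : d%:R = 2 * a + 2 -> `|r| < 1 -> `|s| <= 1 ->
  r * kDP r s = a * kN r s - a^-1 * zlap d (kN' r) (kN'' r) s - a * kP r s.
Proof.
move=> da r1 s1; have q0 := kq_gt0 r1 s1.
rewrite /kDP /zlap /kN' /kN'' /kN /kP da (kQS a q0) (kQS (a + 1) q0) /kq.
by field; rewrite gt_eqF.
Qed.

Lemma kernel_bounds r1 : 0 <= r1 -> r1 < 1 -> exists2 C, 0 <= C & forall r s, `|r| <= r1 ->
  `|s| <= 1 -> [/\ `|kN r s| <= C, `|kP r s| <= C, `|kDN r s| <= C & `|kDP r s| <= C].
Proof.
move=> r10 r11; pose c0 := kQ a r1 1; pose c1 := kQ (a + 1) r1 1.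
pose c2 := kQ (a + 1 + 1) r1 1.
have [p0 p1 p2] : [/\ 0 < c0, 0 < c1 & 0 < c2] by rewrite !kQ_gt0.
have k1 : 0 <= a * c1 by rewrite mulr_ge0// ltW.
have k2 : 0 <= a * c2 by rewrite mulr_ge0// ltW.
exists (c0 + (4 * a + 3) * c1 + 4 * (a + 1) * c2); first by lra.
move=> r s rr s1.
have a1 : 0 < a + 1 by rewrite addr_gt0.
have a2 : 0 < a + 1 + 1 by rewrite addr_gt0.
have q0 : 0 < kQ a r s <= c0 by rewrite kQ_gt0 kQ_bound// ltW.
have q1 : 0 < kQ (a + 1) r s <= c1 by rewrite kQ_gt0 kQ_bound// ltW.
have q2 : 0 < kQ (a + 1 + 1) r s <= c2 by rewrite kQ_gt0 kQ_bound// ltW.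
have rr1 : `|r| <= 1 by apply: le_trans rr (ltW r11).
have r2 : `|1 - r ^+ 2| <= 1.
  have : 0 <= r ^+ 2 <= 1.
    by rewrite sqr_ge0/= -real_normK ?num_real// expr_le1.
  by move=> /andP[? ?]; rewrite ger0_norm; lra.
have rs : `|2 * r - 2 * s| <= 4.
  rewrite ler_norml; move: rr1 s1; rewrite !ler_norml; lra.
have bQ (x c q : R) : 0 < q <= c -> `|x * q| <= `|x| * c.
  by move=> /andP[h1 h2]; rewrite normrM (gtr0_norm h1) ler_wpM2l.
have hP : `|kP r s| <= c1.
  by apply: le_trans (bQ _ _ _ q1) _; rewrite ler_piMl// ltW.
split.
- by rewrite /kN gtr0_norm ?kQ_gt0//; case/andP: q0; lra.
- by lra.
- apply: le_trans (bQ _ _ _ q1) _; rewrite normrM normrN (gtr0_norm a0).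
  have : a * `|2 * r - 2 * s| * c1 <= a * 4 * c1.
    by apply: ler_wpM2r; [exact: ltW|apply: ler_wpM2l; [exact: ltW|]].
  lra.
- apply: le_trans (ler_normD _ _) _.
  have h1 : `|- (2 * r) * kQ (a + 1) r s| <= 2 * c1.
    apply: le_trans (bQ _ _ _ q1) _; apply: ler_wpM2r; first exact: ltW.
    by rewrite normrN normrM ger0_norm//; lra.
  have h2 : `|(1 - r ^+ 2) * (- (a + 1) * (2 * r - 2 * s) * kQ (a + 1 + 1) r s)|
      <= (a + 1) * 4 * c2.
    rewrite normrM; apply: (@le_trans _ _ (1 * `|- (a + 1) * (2 * r - 2 * s) * kQ (a + 1 + 1) r s|)).
      by rewrite ler_wpM2r.
    rewrite mul1r; apply: le_trans (bQ _ _ _ q2) _; apply: ler_wpM2r; first exact: ltW.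
    rewrite normrM normrN (gtr0_norm a1); apply: ler_wpM2l; [exact: ltW|exact: rs].
  lra.
Qed.

End kernel.

Section under_integral.
Context {R : realType} dsp (T : measurableType dsp) (mu : {finite_measure set T -> \bar R}).

Lemma is_derive_integral (k kd : R -> T -> R) (u v l C : R) : u < l < v ->
  (forall t x, u < t < v -> is_derive t (1 : R) (fun t => k t x) (kd t x)) ->
  (forall t, u < t < v -> measurable_fun setT (k t)) ->
  (forall t x, u < t < v -> `|k t x| <= C) ->
  (forall t x, u < t < v -> `|kd t x| <= C) ->
  is_derive l (1 : R) (fun t => \int[mu]_x k t x) (\int[mu]_x kd l x).
Proof.
move=> ulv dk mk bk bkd.
have C0 : 0 <= C by exact: le_trans (normr_ge0 _) (bk l point ulv).
have I1 t : (`]u, v[%classic : set R) t -> u < t < v by rewrite /= in_itv.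
have Il : (`]u, v[%classic : set R) l by rewrite /= in_itv.
have i1 t : (`]u, v[%classic : set R) t -> mu.-integrable setT (EFin \o k t).
  by move=> /I1 h; apply: (@itg_bounded _ _ _ mu (k t) C (mk t h)) => x; exact: bk.
have i2 t x : (`]u, v[%classic : set R) t -> setT x -> derivable (k ^~ x) t 1.
  by move=> /I1 h _; case: (dk t x h).
have i3 : mu.-integrable setT (EFin \o cst C) by exact: itg_cst.
have kdE t x : u < t < v -> partial1of2 k t x = kd t x.
  by move=> h; rewrite partial1of2E; case: (dk t x h).
have i4 t x : (`]u, v[%classic : set R) t -> setT x -> `|partial1of2 k t x| <= cst C x.
  by move=> /I1 h _; rewrite kdE//; exact: bkd.
have H := @cvg_differentiation_under_integral R _ _ mu k setT measurableT l u v Il i1 i2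
  (cst C) (fun _ => C0) i3 i4.
have e : \int[mu]_x partial1of2 k l x = \int[mu]_x kd l x.
  by apply: eq_Rintegral => x _; rewrite kdE.
rewrite e in H.
have {}H : h^-1 *: (((fun t => \int[mu]_x k t x) \o shift l) (h *: (1 : R)) -
    \int[mu]_x k l x) @[h --> 0^'] --> \int[mu]_x kd l x.
  apply: cvg_trans H; apply: near_eq_cvg; apply: nearW => h /=.
  by rewrite [h%:A]mulr1.
by split; [apply/cvg_ex; eexists; exact: H|apply/cvg_lim].
Qed.

End under_integral.

Section ode.
Context {R : realType}.

Lemma MVT_const (f : R -> R) (u v b c : R) : u < b -> b <= c -> c < v ->
  (forall t, u < t < v -> is_derive t (1 : R) f 0) -> f b = f c.
Proof.
move=> ub bc cv df.
have h t : t \in `]b, c[ -> is_derive t (1 : R) f 0.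
  by rewrite in_itv/= => /andP[t1 t2]; apply: df; rewrite (lt_trans ub t1) (lt_trans t2 cv).
have hc : {within `[b, c], continuous f}.
  apply: continuous_in_subspaceT => t; rewrite inE/= in_itv/= => /andP[t1 t2].
  apply: is_derive_continuous (df t _).
  by rewrite (lt_le_trans ub t1) (le_lt_trans t2 cv).
have [z _] := MVT_segment bc h hc.
by rewrite mul0r => /eqP; rewrite subr_eq0 => /eqP ->.
Qed.

(** t^m y(t) has derivative 0, hence is constant, and it is at most C t for small t because m >
    0. *)
Lemma ode_vanish (y y' : R -> R) (m : nat) (v C : R) : 1 < v -> (0 < m)%N ->
  (forall t, 0 < t < v -> is_derive t (1 : R) y (y' t)) ->
  (forall t, 0 < t < v -> t * y' t = - m%:R * y t) ->
  (forall t, 0 < t < v -> `|y t| <= C) -> y 1 = 0.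
Proof.
move=> v1 m0 dy ode by_.
have d t : 0 < t < v -> is_derive t (1 : R) (fun t => t ^+ m * y t) 0.
  move=> tv; apply: is_derive_eq (derM (derX m (is_derive_id t 1)) (dy t tv)) _.
  case: m m0 ode => // n _ ode; rewrite /= mulr1 exprS.
  by transitivity (t ^+ n * (n.+1%:R * y t + t * y' t)); [ring|rewrite ode//; ring].
have C0 : 0 <= C by apply: le_trans (by_ 1 _); rewrite ?v1 ?ltr01.
apply/eqP; rewrite -normr_le0; apply/ler_addgt0Pr => e e0; rewrite add0r.
pose t := Num.min 1 (e / (C + 1)).
have C1 : 0 < C + 1 by rewrite ltr_wpDl.
have t0 : 0 < t by rewrite /t lt_min ltr01 divr_gt0.
have t1 : t <= 1 by rewrite /t ge_min lexx.
have te : t <= e / (C + 1) by rewrite /t ge_min lexx orbT.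
have := MVT_const t0 t1 v1 d; rewrite /= expr1n mul1r => <-.
have tv : 0 < t < v by rewrite t0 (le_lt_trans t1 v1).
rewrite normrM normrX (gtr0_norm t0).
have h1 : t ^+ m <= t.
  by case: m m0 {ode d} => // n _; rewrite exprS ler_piMr ?(ltW t0)// exprn_ile1// ltW.
apply: (@le_trans _ _ (t * C)); first by rewrite ler_pM ?exprn_ge0 ?(ltW t0)// by_.
apply: (@le_trans _ _ (e / (C + 1) * C)); first by rewrite ler_wpM2r.
by rewrite mulrAC ler_pdivrMr// ler_pM2l// lerDl.
Qed.

End ode.

Section kernel_identities.
Context {R : realType} {d : nat}.
Hypothesis hd : (3 <= d)%N.
Local Notation E := 'rV[R]_d.
Local Notation om := (omega R d).

(* The exponent: |x - y|^(2 - d) = (|x - y|^2)^(-a). *)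
Definition ka : R := (d%:R - 2) / 2.
Local Notation a := ka.
Local Notation N := (kN a).
Local Notation P := (kP a).
Local Notation N' := (kN' a).
Local Notation N'' := (kN'' a).

Lemma ka_gt0 : 0 < a.
Proof.
by rewrite /ka divr_gt0// subr_gt0 (ltr_nat R 2 d).
Qed.

Lemma ka_dim : d%:R = 2 * a + 2.
Proof. by rewrite /ka; field. Qed.
Local Notation a0 := ka_gt0.
Local Notation da := ka_dim.

(* [a^2 - Delta] on zonal functions. *)
Definition zop (h h' h'' : R -> R) s := a ^+ 2 * h s - zlap d h' h'' s.

Lemma kN_cont r s : `|r| < 1 -> `|s| <= 1 -> {for s, continuous (N r)}.
Proof. by move=> r1 s1; exact: zC1_cont (zC1_kN a r1) s1. Qed.

Lemma zonal_pair_measurable (h g : R -> R) (y z : E) : sphere R d y -> sphere R d z ->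
  (forall s, `|s| <= 1 -> {for s, continuous h}) ->
  (forall s, `|s| <= 1 -> {for s, continuous g}) ->
  measurable_fun setT (fun x => h (edot (radial x) y) * g (edot (radial x) z)).
Proof. by move=> Sy Sz hc gc; apply: measurable_funM; exact: zonal_measurable. Qed.

Lemma zonal_pair_itg (h g : R -> R) (y z : E) : sphere R d y -> sphere R d z ->
  (forall s, `|s| <= 1 -> {for s, continuous h}) ->
  (forall s, `|s| <= 1 -> {for s, continuous g}) ->
  itg om (fun x => h (edot (radial x) y) * g (edot (radial x) z)).
Proof.
move=> Sy Sz hc gc; have [M1 h1] := @zonal_bounded R d h hc.
have [M2 h2] := @zonal_bounded R d g gc.
apply: (@itg_bounded _ _ _ _ _ (M1 * M2)); first exact: zonal_pair_measurable.
by move=> x; rewrite normrM; apply: ler_pM => //; [exact: h1|exact: h2].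
Qed.

Lemma zlap_sym (y z : E) r p : sphere R d y -> sphere R d z -> `|r| < 1 -> `|p| < 1 ->
  \int[om]_x (zlap d (N' r) (N'' r) (edot (radial x) y) * N p (edot (radial x) z)) =
  \int[om]_x (N r (edot (radial x) y) * zlap d (N' p) (N'' p) (edot (radial x) z)).
Proof.
move=> Sy Sz r1 p1.
rewrite (zonal_green Sy Sz (zC1_kN' a r1) (zC1_kN a p1)).
under [RHS]eq_Rintegral do rewrite mulrC.
rewrite (zonal_green Sz Sy (zC1_kN' a p1) (zC1_kN a r1)) edotC.
by congr (- _); apply: eq_Rintegral => x _; ring.
Qed.

(* As a function of the dilation parameter, the difference of the two sides is a solution of
   [t z' = -2a z] bounded near [0]. *)
Lemma kernel_exchange (y z : E) r p : sphere R d y -> sphere R d z -> `|r| < 1 -> `|p| < 1 ->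
  \int[om]_x (P r (edot (radial x) y) * N p (edot (radial x) z)) =
  \int[om]_x (N r (edot (radial x) y) * P p (edot (radial x) z)).
Proof.
move=> Sy Sz r1 p1.
have I (h g : R -> R) : (forall s, `|s| <= 1 -> {for s, continuous h}) ->
    (forall s, `|s| <= 1 -> {for s, continuous g}) ->
    itg om (fun x => h (edot (radial x) y) * g (edot (radial x) z)).
  by move=> ? ?; exact: zonal_pair_itg.
apply/eqP; rewrite -subr_eq0 -RintegralB//; last first.
- by apply: I => s s1; [exact: kN_cont|exact: kP_cont].
- by apply: I => s s1; [exact: kP_cont|exact: kN_cont].
pose m := Num.max `|r| `|p|.
have m1 : m < 1 by rewrite /m gt_max r1.
have m0 : 0 <= m by rewrite /m le_max normr_ge0.
(* Chosen so that 1 < v and v m < 1: t = 1 is interior to ]0, v[ while t r and t p stay away from 1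
   in absolute value. *)
pose v := 2 / (1 + m).
have m2 : 0 < 1 + m by rewrite ltr_wpDr.
have v0 : 0 < v by rewrite divr_gt0.
have v1 : 1 < v by rewrite ltr_pdivlMr//; lra.
have vm : v * m < 1 by rewrite mulrAC ltr_pdivrMr//; lra.
have vm0 : 0 <= v * m by rewrite mulr_ge0// ltW.
have lrv t q : 0 < t < v -> `|q| <= m -> `|t * q| <= v * m.
  move=> /andP[t0 tv] qm; rewrite normrM (gtr0_norm t0).
  by apply: ler_pM => //; exact: ltW.
have lr t : 0 < t < v -> `|t * r| <= v * m.
  by move=> /lrv; apply; rewrite /m le_max lexx.
have lp t : 0 < t < v -> `|t * p| <= v * m.
  by move=> /lrv; apply; rewrite /m le_max lexx orbT.
have lr1 t : 0 < t < v -> `|t * r| < 1 by move=> /lr /le_lt_trans; apply.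
have lp1 t : 0 < t < v -> `|t * p| < 1 by move=> /lp /le_lt_trans; apply.
have [C C0 bC] := kernel_bounds a0 vm0 vm.
pose k t (x : E) := P (t * r) (edot (radial x) y) * N (t * p) (edot (radial x) z) -
  N (t * r) (edot (radial x) y) * P (t * p) (edot (radial x) z).
pose kd t (x : E) := (kDP a (t * r) (edot (radial x) y) * r) * N (t * p) (edot (radial x) z) +
  P (t * r) (edot (radial x) y) * (kDN a (t * p) (edot (radial x) z) * p) -
  ((kDN a (t * r) (edot (radial x) y) * r) * P (t * p) (edot (radial x) z) +
   N (t * r) (edot (radial x) y) * (kDP a (t * p) (edot (radial x) z) * p)).
have Sy1 (x : E) : `|edot (radial x) y| <= 1 by exact: edot_radial_le1.
have Sz1 (x : E) : `|edot (radial x) z| <= 1 by exact: edot_radial_le1.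
have dl q t : is_derive t (1 : R) (fun t => t * q) q.
  by apply: is_derive_eq (derM (is_derive_id t 1) (derC q _ _)) _; ring.
have dk t x : 0 < t < v -> is_derive t (1 : R) (fun t => k t x) (kd t x).
  move=> tv.
  have h1 := @der_comp R R (fun r => P r (edot (radial x) y)) _ t 1 _ _
    (is_derive_kP_r a (lr1 t tv) (Sy1 x)) (dl r t).
  have h2 := @der_comp R R (fun r => N r (edot (radial x) z)) _ t 1 _ _
    (is_derive_kN_r a (lp1 t tv) (Sz1 x)) (dl p t).
  have h3 := @der_comp R R (fun r => N r (edot (radial x) y)) _ t 1 _ _
    (is_derive_kN_r a (lr1 t tv) (Sy1 x)) (dl r t).
  have h4 := @der_comp R R (fun r => P r (edot (radial x) z)) _ t 1 _ _
    (is_derive_kP_r a (lp1 t tv) (Sz1 x)) (dl p t).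
  apply: is_derive_eq (derB (derM h1 h2) (derM h3 h4)) _.
  by rewrite /kd; ring.
have mk t : 0 < t < v -> measurable_fun setT (k t).
  move=> tv; apply: measurable_funB; apply: zonal_pair_measurable => // s s1;
    solve [apply: kP_cont => //; by [exact: lr1|exact: lp1] |
           apply: kN_cont => //; by [exact: lr1|exact: lp1]].
have bk t x : 0 < t < v -> `|k t x| <= C * C + C * C.
  move=> tv; have [b1 b2 _ _] := bC _ _ (lr t tv) (Sy1 x).
  have [b3 b4 _ _] := bC _ _ (lp t tv) (Sz1 x).
  by apply: le_trans (ler_normB _ _) _; apply: lerD; rewrite normrM ler_pM.
have bkd t x : 0 < t < v -> `|kd t x| <= C * C + C * C + (C * C + C * C).
  move=> tv; have [b1 b2 b5 b6] := bC _ _ (lr t tv) (Sy1 x).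
  have [b3 b4 b7 b8] := bC _ _ (lp t tv) (Sz1 x).
  have mC A q : `|A| <= C -> `|q| < 1 -> `|A * q| <= C.
    by move=> h /ltW q1; rewrite normrM; apply: le_trans h; rewrite ler_piMr.
  apply: le_trans (ler_normB _ _) _; apply: lerD; apply: le_trans (ler_normD _ _) _;
    by apply: lerD; rewrite normrM ler_pM// mC.
have dZ t : 0 < t < v -> is_derive t (1 : R) (fun t => \int[om]_x k t x) (\int[om]_x kd t x).
  move=> tv; apply: (@is_derive_integral _ _ _ om k kd 0 v t
    (C * C + C * C + (C * C + C * C))) => // s x sv.
    by apply: le_trans (bk s x sv) _; rewrite lerDl addr_ge0// mulr_ge0.
have m3 : (0 < d - 2)%N by rewrite subn_gt0.
apply/eqP; rewrite (_ : (fun x => _) = k 1); last by apply/funext => x; rewrite /k !mul1r.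
apply: (@ode_vanish _ _ (fun t => \int[om]_x kd t x) (d - 2) v
  (\int[om]_x cst (C * C + C * C) x) v1 m3 dZ) => t tv; last first.
  apply: (@le_trans _ _ (\int[om]_x `|k t x|)).
    apply: le_normr_Rintegral => //.
    by apply: (@itg_bounded _ _ _ om (k t) _ (mk t tv)) => x; exact: bk.
  apply: le_Rintegral_itg.
  - by apply: (@itg_bounded _ _ _ om _ (C * C + C * C)) => [|x]; [
      by apply: measurableT_comp => //; exact: mk|rewrite normr_id; exact: bk].
  - exact: itg_cst.
  - by move=> x; exact: bk.
(* The equations in r turn t dk/dt into - 2a k, with 2a = d - 2, plus Laplacian terms whose
   integrals cancel by [zlap_sym]. *)
have e x : t * kd t x = - (d - 2)%:R * k t x + a^-1 *
    (N (t * r) (edot (radial x) y) * zlap d (N' (t * p)) (N'' (t * p)) (edot (radial x) z) -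
     zlap d (N' (t * r)) (N'' (t * r)) (edot (radial x) y) * N (t * p) (edot (radial x) z)).
  have o1 := kN_ode a (lr1 t tv) (Sy1 x).
  have o2 := kN_ode a (lp1 t tv) (Sz1 x).
  have o3 := kP_ode a0 da (lr1 t tv) (Sy1 x).
  have o4 := kP_ode a0 da (lp1 t tv) (Sz1 x).
  rewrite natrB ?(ltnW hd)// da /k /kd.
  set n1 := N _ _ in o1 o2 o3 o4 *; set n2 := N _ _ in o1 o2 o3 o4 *.
  set q1 := P _ _ in o1 o2 o3 o4 *; set q2 := P _ _ in o1 o2 o3 o4 *.
  set l1 := zlap _ _ _ _ in o1 o2 o3 o4 *; set l2 := zlap _ _ _ _ in o1 o2 o3 o4 *.
  set e1 := kDN _ _ _ in o1 o2 o3 o4 *; set e2 := kDN _ _ _ in o1 o2 o3 o4 *.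
  set e3 := kDP _ _ _ in o1 o2 o3 o4 *; set e4 := kDP _ _ _ in o1 o2 o3 o4 *.
  transitivity ((t * r * e3) * n2 + q1 * (t * p * e2) - ((t * r * e1) * q2 + n1 * (t * p * e4))).
    by ring.
  by rewrite o1 o2 o3 o4; ring.
have zc q s : `|q| < 1 -> `|s| <= 1 -> {for s, continuous (zlap d (N' q) (N'' q))}.
  by move=> q1 s1; exact: zlap_cont (zC1_kN' a q1) s1.
have i1 : itg om (fun x => N (t * r) (edot (radial x) y) *
    zlap d (N' (t * p)) (N'' (t * p)) (edot (radial x) z)).
  by apply: I => s s1; [exact: kN_cont (lr1 t tv) s1|exact: zc (lp1 t tv) s1].
have i2 : itg om (fun x => zlap d (N' (t * r)) (N'' (t * r)) (edot (radial x) y) *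
    N (t * p) (edot (radial x) z)).
  by apply: I => s s1; [exact: zc (lr1 t tv) s1|exact: kN_cont (lp1 t tv) s1].
have ik : itg om (k t).
  by apply: (@itg_bounded _ _ _ om (k t) _ (mk t tv)) => x; exact: bk.
have ikd : itg om (fun x => t * kd t x).
  rewrite (funext e).
  by apply: itgD; [exact: itgZ|apply: itgZ; exact: itgB].
transitivity (\int[om]_x (t * kd t x)).
  rewrite RintegralZl//.
  have -> : kd t = fun x => t^-1 * (t * kd t x).
    by apply/funext => x; rewrite mulrA mulVf ?mul1r//; case/andP: tv => /gt_eqF ->.
  by apply: itgZ.
under eq_Rintegral do rewrite e.
rewrite RintegralD//; [|exact: itgZ|by apply: itgZ; exact: itgB].
rewrite RintegralZl// RintegralZl//; last exact: itgB.
rewrite [X in _ + _ * X](_ : _ = 0) ?mulr0 ?addr0//.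
by rewrite RintegralB// zlap_sym ?subrr//; [exact: lr1|exact: lp1].
Qed.

Lemma kQ0 q (s : R) : kQ q 0 s = 1.
Proof. by rewrite /kQ /kq expr0n/= mulr0 mul0r subr0 addr0 ln1 mulr0 expR0. Qed.

Lemma Rintegral_zonal_cst (c : R) : (\int[om]_x (cst c) x = c * omega_d R d)%R.
Proof. by rewrite Rintegral_cst//= omega_setT. Qed.

(** Exchange with second parameter 0, at which both kernels are the constant 1. *)
Lemma integral_kP_kN (y : E) r : sphere R d y -> `|r| < 1 ->
  \int[om]_x P r (edot (radial x) y) = \int[om]_x N r (edot (radial x) y).
Proof.
move=> Sy r1; have z1 : `|0 : R| < 1 by rewrite normr0.
have := @kernel_exchange y y r 0 Sy Sy r1 z1.
rewrite /kP /kN; under eq_Rintegral do rewrite kQ0 mulr1.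
by move=> ->; apply: eq_Rintegral => x _; rewrite kQ0 expr0n subr0 !mulr1.
Qed.

(** Green's formula for s, an eigenfunction of the Laplacian with eigenvalue - (d - 1), against the
    constant 1. *)
Lemma integral_edot (y : E) : sphere R d y -> \int[om]_x edot (radial x) y = 0.
Proof.
move=> Sy; have z0 (c : R) : zC1 (cst c) (cst 0).
  by move=> s _; split; [exact: derC|exact: (@cvg_cst _ _ _ (nbhs s))].
have := zonal_green Sy Sy (z0 1) (z0 1).
rewrite /zlap /=; under eq_Rintegral do rewrite mulr0 sub0r mulr1 mulr1 -mulNr.
have i1 : itg om (fun x => edot (radial x) y).
  have idc (s : R) : `|s| <= 1 -> {for s, continuous (fun t : R => t)} by move=> _; exact: cvg_id.
  have oc (s : R) : `|s| <= 1 -> {for s, continuous (fun t : R => 1 : R)}.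
    by move=> _; exact: (@cvg_cst _ _ _ (nbhs s)).
  have := zonal_pair_itg Sy Sy idc oc.
  by rewrite (_ : (fun x => _ * 1) = (fun x => edot (radial x) y))//; apply/funext => x; rewrite mulr1.
rewrite RintegralZl//; under [X in _ = - X]eq_Rintegral do rewrite mulr0 mul0r.
rewrite (Rintegral_zonal_cst 0) mul0r oppr0 => /eqP; rewrite mulf_eq0 oppr_eq0 subr_eq0.
by rewrite (eqr_nat _ d 1) gtn_eqF ?(ltnW hd)//= => /eqP.
Qed.

Lemma is_derive_integral_kN (y : E) r : sphere R d y -> `|r| < 1 ->
  is_derive r (1 : R) (fun r => \int[om]_x N r (edot (radial x) y))
    (\int[om]_x kDN a r (edot (radial x) y)).
Proof.
move=> Sy r1; pose v := (1 + `|r|) / 2.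
have v1 : v < 1 by rewrite /v; lra.
have v0 : 0 <= v by rewrite divr_ge0// addr_ge0.
have rv : `|r| < v by rewrite /v; lra.
have [C C0 bC] := kernel_bounds a0 v0 v1.
have tv t : - v < t < v -> `|t| <= v by rewrite -ltr_norml => /ltW.
have tv1 t : - v < t < v -> `|t| < 1 by move=> /tv /le_lt_trans; apply.
apply: (@is_derive_integral _ _ _ om (fun r x => N r (edot (radial x) y))
  (fun r x => kDN a r (edot (radial x) y)) (- v) v r C).
- by rewrite -ltr_norml.
- by move=> t x h; apply: is_derive_kN_r; [exact: tv1|exact: edot_radial_le1].
- by move=> t h; apply: zonal_measurable => // s s1; exact: kN_cont (tv1 t h) s1.
- by move=> t x h; have [] := bC t (edot (radial x) y) (tv t h) (edot_radial_le1 x Sy).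
- by move=> t x h; have [] := bC t (edot (radial x) y) (tv t h) (edot_radial_le1 x Sy).
Qed.

(** The integral does not depend on r and N_0 = 1. For t != 0 its derivative vanishes by [kN_ode]
    and [integral_kP_kN]; at t = 0 the derivative of the kernel is 2a s, which has mean zero. *)
Lemma integral_kN (y : E) r : sphere R d y -> 0 <= r < 1 ->
  \int[om]_x N r (edot (radial x) y) = omega_d R d.
Proof.
move=> Sy /andP[r0 r1].
have d0 (t : R) : -1 < t < 1 -> is_derive t (1 : R) (fun r => \int[om]_x N r (edot (radial x) y)) 0.
  rewrite -ltr_norml => t1; apply: is_derive_eq (is_derive_integral_kN Sy t1) _.
  have [->|t0] := eqVneq t 0.
    under eq_Rintegral do rewrite /kDN kQ0 mulr0 sub0r mulr1 mulrN mulNr opprK mulrA.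
    rewrite RintegralZl ?integral_edot ?mulr0//.
    have idc (s : R) : `|s| <= 1 -> {for s, continuous (fun t : R => t)} by move=> _; exact: cvg_id.
    have [M hM] := @zonal_bounded R d _ idc.
    apply: (@itg_bounded _ _ _ _ _ M) => [|x]; last exact: hM.
    exact: (@zonal_measurable _ _ (fun s => s)).
  have Nc s : `|s| <= 1 -> {for s, continuous (N t)} by move=> s1; exact: kN_cont.
  have Pc s : `|s| <= 1 -> {for s, continuous (P t)} by move=> s1; exact: kP_cont.
  have iz (h : R -> R) : (forall s, `|s| <= 1 -> {for s, continuous h}) ->
      itg om (fun x => h (edot (radial x) y)).
    move=> hc; have [M hM] := @zonal_bounded R d h hc.
    by apply: (@itg_bounded _ _ _ _ _ M) => [|x]; [exact: zonal_measurable|exact: hM].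
  have e x : kDN a t (edot (radial x) y) =
      t^-1 * a * (P t (edot (radial x) y) - N t (edot (radial x) y)).
    apply: (mulfI t0); rewrite (kN_ode a t1 (edot_radial_le1 x Sy)).
    by field.
  under eq_Rintegral do rewrite e.
  rewrite RintegralZl//; last by apply: itgB; exact: iz.
  by rewrite RintegralB ?integral_kP_kN ?subrr ?mulr0//; exact: iz.
have /= <- := @MVT_const _ (fun r => \int[om]_x N r (edot (radial x) y)) (-1) 1 0 r
  (ltrN10 R) r0 r1 d0.
under eq_Rintegral do rewrite /kN kQ0.
by rewrite (Rintegral_zonal_cst 1) mul1r.
Qed.

Lemma integral_kP (y : E) r : sphere R d y -> 0 <= r < 1 ->
  \int[om]_x P r (edot (radial x) y) = omega_d R d.
Proof.
move=> Sy r1; rewrite integral_kP_kN ?integral_kN//.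
by case/andP: r1 => r0 r1; rewrite ger0_norm.
Qed.

Lemma kQ_cont q r s : `|r| < 1 -> `|s| <= 1 -> {for s, continuous (@kQ R q r)}.
Proof.
by move=> r1 s1; exact: is_derive_continuous (is_derive_kQ_s q (kq_gt0 r1 s1)).
Qed.

Let affine_cont (c q s : R) : {for s, continuous (fun s : R => c * (2 * q - 2 * s))}.
Proof.
exact: is_derive_continuous (derZ c (derB (derC (2 * q) _ _) (derZ 2 (is_derive_id s 1)))).
Qed.

Lemma kDN_cont r s : `|r| < 1 -> `|s| <= 1 -> {for s, continuous (kDN a r)}.
Proof.
by move=> r1 s1; apply: (@cvgM _ _ (nbhs s)); [exact: affine_cont|exact: kQ_cont].
Qed.

Lemma kDP_cont r s : `|r| < 1 -> `|s| <= 1 -> {for s, continuous (kDP a r)}.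
Proof.
move=> r1 s1; apply: (@cvgD _ _ _ (nbhs s)); apply: (@cvgM _ _ (nbhs s));
  try exact: (@cvg_cst _ _ _ (nbhs s)); first exact: kQ_cont.
by apply: (@cvgM _ _ (nbhs s)); [exact: affine_cont|exact: kQ_cont].
Qed.

(** Differentiate [kernel_exchange] in p, multiply by p and insert the two differential equations:
    the mixed integrals of P and N cancel by [kernel_exchange] itself. *)
Lemma kernel_square (y z : E) r p : sphere R d y -> sphere R d z -> `|r| < 1 -> `|p| < 1 ->
  a ^+ 2 * \int[om]_x (P r (edot (radial x) y) * P p (edot (radial x) z)) =
  \int[om]_x (N r (edot (radial x) y) * zop (N p) (N' p) (N'' p) (edot (radial x) z)).
Proof.
move=> Sy Sz r1 p1; pose v := (1 + `|p|) / 2.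
have v1 : v < 1 by rewrite /v; lra.
have v0 : 0 <= v by rewrite divr_ge0// addr_ge0.
have pv : - v < p < v by rewrite -ltr_norml /v; lra.
have [C C0 bC] := kernel_bounds a0 v0 v1.
have [C' C'0 bC'] := kernel_bounds a0 (normr_ge0 r) r1.
have tv t : - v < t < v -> `|t| <= v by rewrite -ltr_norml => /ltW.
have tv1 t : - v < t < v -> `|t| < 1 by move=> /tv /le_lt_trans; apply.
have Nc q s : `|q| < 1 -> `|s| <= 1 -> {for s, continuous (N q)} by move=> q1; exact: kN_cont.
have Pc q s : `|q| < 1 -> `|s| <= 1 -> {for s, continuous (P q)} by move=> q1; exact: kP_cont.
have d1 : is_derive p (1 : R)
    (fun p => \int[om]_x (P r (edot (radial x) y) * N p (edot (radial x) z)))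
    (\int[om]_x (P r (edot (radial x) y) * kDN a p (edot (radial x) z))).
  apply: (@is_derive_integral _ _ _ om
    (fun p x => P r (edot (radial x) y) * N p (edot (radial x) z))
    (fun p x => P r (edot (radial x) y) * kDN a p (edot (radial x) z)) (- v) v p (C' * C)).
  - exact: pv.
  - move=> t x h; apply: derZ; apply: is_derive_kN_r; [exact: tv1|exact: edot_radial_le1].
  - by move=> t h; apply: zonal_pair_measurable => // s s1; [exact: Pc|exact: Nc (tv1 t h) s1].
  - move=> t x h; have [? ? ? ?] := bC t (edot (radial x) z) (tv t h) (edot_radial_le1 x Sz).
    have [? ? ? ?] := bC' r (edot (radial x) y) (lexx _) (edot_radial_le1 x Sy).
    by rewrite normrM; apply: ler_pM.
  - move=> t x h; have [? ? ? ?] := bC t (edot (radial x) z) (tv t h) (edot_radial_le1 x Sz).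
    have [? ? ? ?] := bC' r (edot (radial x) y) (lexx _) (edot_radial_le1 x Sy).
    by rewrite normrM; apply: ler_pM.
have d2 : is_derive p (1 : R)
    (fun p => \int[om]_x (N r (edot (radial x) y) * P p (edot (radial x) z)))
    (\int[om]_x (N r (edot (radial x) y) * kDP a p (edot (radial x) z))).
  apply: (@is_derive_integral _ _ _ om
    (fun p x => N r (edot (radial x) y) * P p (edot (radial x) z))
    (fun p x => N r (edot (radial x) y) * kDP a p (edot (radial x) z)) (- v) v p (C' * C)).
  - exact: pv.
  - move=> t x h; apply: derZ; apply: is_derive_kP_r; [exact: tv1|exact: edot_radial_le1].
  - by move=> t h; apply: zonal_pair_measurable => // s s1; [exact: Nc|exact: Pc (tv1 t h) s1].
  - move=> t x h; have [? ? ? ?] := bC t (edot (radial x) z) (tv t h) (edot_radial_le1 x Sz).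
    have [? ? ? ?] := bC' r (edot (radial x) y) (lexx _) (edot_radial_le1 x Sy).
    by rewrite normrM; apply: ler_pM.
  - move=> t x h; have [? ? ? ?] := bC t (edot (radial x) z) (tv t h) (edot_radial_le1 x Sz).
    have [? ? ? ?] := bC' r (edot (radial x) y) (lexx _) (edot_radial_le1 x Sy).
    by rewrite normrM; apply: ler_pM.
have e : \int[om]_x (P r (edot (radial x) y) * kDN a p (edot (radial x) z)) =
    \int[om]_x (N r (edot (radial x) y) * kDP a p (edot (radial x) z)).
  have d3 : is_derive p (1 : R)
      (fun p => \int[om]_x (P r (edot (radial x) y) * N p (edot (radial x) z)) -
        \int[om]_x (N r (edot (radial x) y) * P p (edot (radial x) z))) 0.
    apply: (@near_eq_is_derive _ _ _ (fun=> 0 : R) _ _ _ _ _ (derC (0 : R) p 1)).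
    have : nbhs p (`]- v, v[%classic : set R) by apply: open_nbhs_nbhs; split => //; rewrite /= in_itv.
    apply: filterS => t; rewrite /= in_itv/= => h.
    by rewrite kernel_exchange ?subrr//=; exact: tv1.
  by apply/eqP; rewrite -subr_eq0; have [_ <-] := derB d1 d2; have [_ /eqP] := d3.
have zc s : `|s| <= 1 -> {for s, continuous (zlap d (N' p) (N'' p))}.
  by move=> s1; exact: zlap_cont (zC1_kN' a p1) s1.
have i1 : itg om (fun x => P r (edot (radial x) y) * P p (edot (radial x) z)).
  by apply: zonal_pair_itg => // s s1; exact: Pc.
have i2 : itg om (fun x => P r (edot (radial x) y) * N p (edot (radial x) z)).
  by apply: zonal_pair_itg => // s s1; [exact: Pc|exact: Nc].
have i3 : itg om (fun x => N r (edot (radial x) y) * P p (edot (radial x) z)).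
  by apply: zonal_pair_itg => // s s1; [exact: Nc|exact: Pc].
have i4 : itg om (fun x => N r (edot (radial x) y) *
    zop (N p) (N' p) (N'' p) (edot (radial x) z)).
  apply: zonal_pair_itg => // s s1; first exact: Nc.
  apply: (@cvgB _ _ _ (nbhs s)); last exact: zc.
  by apply: (@cvgM _ _ (nbhs s)); [exact: (@cvg_cst _ _ _ (nbhs s))|exact: Nc].
have e1 : p * \int[om]_x (P r (edot (radial x) y) * kDN a p (edot (radial x) z)) =
    a * \int[om]_x (P r (edot (radial x) y) * P p (edot (radial x) z)) -
    a * \int[om]_x (P r (edot (radial x) y) * N p (edot (radial x) z)).
  rewrite -RintegralZl//; last by apply: zonal_pair_itg => // s s1; [exact: Pc|exact: kDN_cont].
  rewrite -RintegralZl// -RintegralZl// -RintegralB//; try exact: itgZ.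
  apply: eq_Rintegral => x _; rewrite mulrCA (kN_ode a p1 (edot_radial_le1 x Sz)); ring.
have e2 : p * \int[om]_x (N r (edot (radial x) y) * kDP a p (edot (radial x) z)) =
    a^-1 * \int[om]_x (N r (edot (radial x) y) * zop (N p) (N' p) (N'' p) (edot (radial x) z)) -
    a * \int[om]_x (N r (edot (radial x) y) * P p (edot (radial x) z)).
  rewrite -RintegralZl//; last by apply: zonal_pair_itg => // s s1; [exact: Nc|exact: kDP_cont].
  rewrite -RintegralZl// -RintegralZl// -RintegralB//; try exact: itgZ.
  apply: eq_Rintegral => x _; rewrite mulrCA (kP_ode a0 da p1 (edot_radial_le1 x Sz)) /zop.
  by field; rewrite gt_eqF// a0.
move: e1; rewrite e e2 kernel_exchange// => /addIr/esym h.
by rewrite expr2 -mulrA h mulrA mulfV ?mul1r// gt_eqF// a0.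
Qed.

End kernel_identities.

(** * Integral operators on L^2 *)

Section schur.
Context {R : realType} dsp (T : measurableType dsp) (mu : {finite_measure set T -> \bar R}).
Implicit Types (K : T -> T -> R) (f g w : T -> R) (m : R).

(* The hypotheses of Schur's test. *)
Definition schur K m := [/\ measurable_fun setT (fun p : T * T => K p.1 p.2),
  forall x, (\int[mu]_y (`|K x y|)%:E <= m%:E)%E &
  forall y, (\int[mu]_x (`|K x y|)%:E <= m%:E)%E].

Definition iop K f : T -> R := fun x => \int[mu]_y (K x y * f y).

Lemma schur_tr K m : schur K m -> schur (fun x y => K y x) m.
Proof.
case=> mK K1 K2; split => //.
rewrite (_ : (fun p => _) = (fun p : T * T => K p.1 p.2) \o (fun p : T * T => (p.2, p.1)))//.
by apply: measurableT_comp => //; exact: measurable_swap.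
Qed.

Lemma schur_bounded K C : measurable_fun setT (fun p : T * T => K p.1 p.2) ->
  (forall x y, `|K x y| <= C) -> schur K (C * fine (mu setT)).
Proof.
move=> mK KC.
have h (u : T -> R) : measurable_fun setT u -> (forall y, `|u y| <= C) ->
    (\int[mu]_y (`|u y|)%:E <= (C * fine (mu setT))%:E)%E.
  move=> mu_ uC; apply: (@le_trans _ _ (\int[mu]_y (cst C%:E y))%E).
    apply: ge0_le_integral => //.
    - by apply/measurable_EFinP; exact: measurableT_comp.
    - by move=> y _; rewrite lee_fin.
  by rewrite integral_cst// EFinM fineK// fin_num_measure.
split => // [x|y].
- by apply: h => //; exact: (measurableT_comp mK (pair1_measurable x)).
- by apply: h => //; exact: (measurableT_comp mK (pair2_measurable y)).
Qed.

Lemma schur_section K m x : schur K m -> measurable_fun setT (K x).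
Proof. by case=> mK _ _; exact: (measurableT_comp mK (pair1_measurable x)). Qed.

Lemma schur_tonelli K m w : schur K m -> measurable_fun setT w -> (forall x, 0 <= w x) ->
  (\int[mu]_x \int[mu]_y (`|K x y| * w y)%:E <= m%:E * \int[mu]_y (w y)%:E)%E.
Proof.
move=> sK mw w0; have [mK K1 K2] := sK.
have mf : measurable_fun setT (fun p : T * T => (`|K p.1 p.2| * w p.2)%:E).
  apply/measurable_EFinP; apply: measurable_funM; first exact: measurableT_comp.
  exact: measurableT_comp.
rewrite (@fubini_tonelli _ _ _ _ _ mu mu (fun p => (`|K p.1 p.2| * w p.2)%:E))//=; last first.
  by move=> p; rewrite lee_fin mulr_ge0.
have [x0|nT] := pselect (exists x : T, True); last first.
  have e : setT = set0 :> set T by apply/seteqP; split => // y; case: nT; exists y.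
  by rewrite e !integral_set0 mule0.
have [y0 _] := x0.
have m0 : (0 <= m%:E)%E by apply: le_trans (K1 y0); exact: integral_ge0.
rewrite -ge0_integralZl//; try solve [by apply/measurable_EFinP|by move=> y _; rewrite lee_fin].
  apply: ge0_le_integral => //.
  - by move=> y _; apply: integral_ge0 => x _; rewrite lee_fin mulr_ge0.
  - apply: (@measurable_fun_fubini_tonelli_G _ _ _ _ _ mu _ mf) => p.
    by rewrite lee_fin mulr_ge0.
  - by apply: emeasurable_funM => //; exact/measurable_EFinP.
  - move=> y _; under eq_integral do rewrite EFinM.
    rewrite ge0_integralZr//; first by apply: lee_wpmul2r => //; rewrite lee_fin.
    apply/measurable_EFinP; apply: measurableT_comp => //.
    exact: (measurableT_comp mK (pair2_measurable y)).
  by rewrite lee_fin.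
Qed.

(** Used with w = f^2 for the L^2 bound and with w = 1 for the integrability of the sections of the
    kernel. *)
Lemma schur_weight K m w : schur K m -> itg mu w -> (forall x, 0 <= w x) ->
  [/\ itg mu (iop (fun x y => `|K x y|) w),
      {ae mu, forall x, itg mu (fun y => `|K x y| * w y)} &
      \int[mu]_x iop (fun x y => `|K x y|) w x <= m * \int[mu]_x w x].
Proof.
move=> sK iw w0; have mw := itg_measurable iw; have [mK _ _] := sK.
have mf : measurable_fun setT (fun p : T * T => (`|K p.1 p.2| * w p.2)%:E).
  apply/measurable_EFinP; apply: measurable_funM; first exact: measurableT_comp.
  exact: measurableT_comp.
pose F x := (\int[mu]_y (`|K x y| * w y)%:E)%E.
have F0 x : (0 <= F x)%E by apply: integral_ge0 => y _; rewrite lee_fin mulr_ge0.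
have mF : measurable_fun setT F.
  by apply: (@measurable_fun_fubini_tonelli_F _ _ _ _ _ mu _ mf) => p; rewrite lee_fin mulr_ge0.
have ew : (\int[mu]_y (w y)%:E = (\int[mu]_y w y)%:E)%E.
  by rewrite /Rintegral fineK//; exact: integrable_fin_num iw.
have bF : (\int[mu]_x F x <= (m * \int[mu]_x w x)%:E)%E.
  by rewrite EFinM -ew; exact: schur_tonelli.
have Foo : (\int[mu]_x F x < +oo)%E by apply: le_lt_trans bF _; rewrite ltry.
have [iF aF] := itg_ae_finite mF F0 Foo.
split.
- exact: iF.
- apply: filterS aF => x eF; apply/integrableP; split.
    apply/measurable_EFinP; apply: measurable_funM => //.
    by apply: measurableT_comp => //; exact: schur_section sK.
  rewrite (_ : (\int[mu]_y _)%E = F x); first by rewrite eF ltry.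
  by apply: eq_integral => y _; rewrite gee0_abs// lee_fin mulr_ge0.
- rewrite -lee_fin; apply: le_trans bF; rewrite /Rintegral.
  rewrite fineK; last exact: integrable_fin_num iF.
  by rewrite (@eq_integral_ae _ _ _ mu F (fun x => (iop (fun x y => `|K x y|) w x)%:E)).
Qed.

(** |K f| <= |K| (f^2 + 1), and both terms have integrable sections almost everywhere. Where a
    section is not integrable [iop] has no meaning, which is why its linearity holds almost
    everywhere only. *)
Lemma schur_ae K m f : schur K m -> sqi mu f ->
  {ae mu, forall x, itg mu (fun y => `|K x y| * f y ^+ 2) /\ itg mu (fun y => K x y * f y)}.
Proof.
move=> sK sf; have [mf i2] := sf.
have [_ a1 _] := schur_weight sK i2 (fun x => sqr_ge0 (f x)).
have [_ a2 _] := schur_weight sK (itg_cst mu 1) (fun=> ler01).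
apply: filterS2 a1 a2 => x h1 h2; split => //.
apply: itg_le (itgD h1 h2) _.
  by apply: measurable_funM => //; exact: schur_section sK.
move=> y; rewrite normrM /= -mulrDr ler_wpM2l// -real_normK ?num_real//.
by have := sqr_ge0 (`|f y| - 2^-1); lra.
Qed.

Lemma sqi_dom_ae f g : measurable_fun setT f -> itg mu g ->
  {ae mu, forall x, f x ^+ 2 <= g x} -> sqi mu f.
Proof.
move=> mf ig fg; split => //; apply/integrableP; split.
  by apply/measurable_EFinP; exact: measurable_funX.
have /integrableP[mg goo] := ig.
apply: le_lt_trans goo; apply: ge0_le_integral_ae => //.
by apply: filterS fg => x fg; rewrite /= lee_fin ger0_norm ?sqr_ge0// (le_trans fg)// ler_norm.
Qed.

Lemma le_Rintegral_itg_ae f g : itg mu f -> itg mu g -> {ae mu, forall x, f x <= g x} ->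
  \int[mu]_x f x <= \int[mu]_x g x.
Proof.
move=> iff ig fg.
have mm : measurable_fun setT (fun x => Num.min (f x) (g x)).
  by apply: measurable_minr; apply: itg_measurable; [exact: iff|exact: ig].
have im : itg mu (fun x => Num.min (f x) (g x)).
  apply: (itg_ae mm iff); apply: filterS fg => x h.
  by rewrite min_l.
rewrite (@eq_Rintegral_ae _ _ _ mu f (fun x => Num.min (f x) (g x))).
  by apply: le_Rintegral_itg => // x; rewrite ge_min lexx orbT.
by apply: filterS fg => x h; rewrite min_l.
Qed.

(** |K f g| <= |K| f^2 + |K| g^2; each of the two terms is integrable by one half of Schur's
    hypotheses. *)
Lemma schur_pair_integrable K m f g : schur K m -> sqi mu f -> sqi mu g ->
  (mu \x mu)%E.-integrable setT (fun p : T * T => (K p.1 p.2 * f p.2 * g p.1)%:E).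
Proof.
move=> sK [mf i2f] [mg i2g]; have [mK _ _] := sK.
have m1 : measurable_fun setT (fun p : T * T => (`|K p.1 p.2| * f p.2 ^+ 2)%:E).
  apply/measurable_EFinP; apply: measurable_funM; first exact: measurableT_comp.
  by apply: measurable_funX; exact: measurableT_comp.
have m2 : measurable_fun setT (fun p : T * T => (`|K p.1 p.2| * g p.1 ^+ 2)%:E).
  apply/measurable_EFinP; apply: measurable_funM; first exact: measurableT_comp.
  by apply: measurable_funX; exact: measurableT_comp.
have fin (w : T -> R) : itg mu w -> (forall x, 0 <= w x) -> (m%:E * \int[mu]_y (w y)%:E < +oo)%E.
  by move=> iw w0; rewrite -[X in (_ * X)%E]fineK ?integrable_fin_num// -EFinM ltry.
have i1 : (mu \x mu)%E.-integrable setT (fun p : T * T => (`|K p.1 p.2| * f p.2 ^+ 2)%:E).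
  apply/(integrable12ltyP mu mu m1); rewrite /=.
  apply: le_lt_trans (fin _ i2f (fun x => sqr_ge0 (f x))).
  apply: le_trans _ (schur_tonelli sK _ (fun x => sqr_ge0 (f x))); last exact: measurable_funX.
  rewrite le_eqVlt; apply/orP; left; apply/eqP.
  apply: eq_integral => x _; apply: eq_integral => y _.
  by rewrite ger0_norm// mulr_ge0// sqr_ge0.
have i2 : (mu \x mu)%E.-integrable setT (fun p : T * T => (`|K p.1 p.2| * g p.1 ^+ 2)%:E).
  apply/(integrable21ltyP mu mu m2); rewrite /=.
  apply: le_lt_trans (fin _ i2g (fun x => sqr_ge0 (g x))).
  apply: le_trans _ (schur_tonelli (schur_tr sK) _ (fun x => sqr_ge0 (g x))); last exact: measurable_funX.
  rewrite le_eqVlt; apply/orP; left; apply/eqP.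
  apply: eq_integral => x _; apply: eq_integral => y _.
  by rewrite ger0_norm// mulr_ge0// sqr_ge0.
apply: (le_integrable measurableT _ _ (integrableD measurableT i1 i2)).
  apply/measurable_EFinP; apply: measurable_funM; last exact: measurableT_comp.
  by apply: measurable_funM => //; exact: measurableT_comp.
move=> p _; rewrite -EFinD /= lee_fin -mulrDr -mulrA !normrM [`|_ + _|]ger0_norm ?addr_ge0 ?sqr_ge0//.
rewrite normr_id; apply: ler_wpM2l => //.
rewrite -(real_normK (num_real (f _))) -(real_normK (num_real (g _))).
have := sqr_ge0 (`|f p.2| - `|g p.1|); have := mulr_ge0 (normr_ge0 (f p.2)) (normr_ge0 (g p.1)).
rewrite sqrrB; lra.
Qed.

Lemma iop_measurable K m f : schur K m -> sqi mu f -> measurable_fun setT (iop K f).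
Proof.
move=> sK sf; have i := schur_pair_integrable sK sf (sqi_cst mu 1).
have mF := measurable_fubini_F i.
rewrite (_ : iop K f = fine \o fubini_F mu (fun p : T * T => (K p.1 p.2 * f p.2 * cst 1 p.1)%:E)).
  by apply: measurableT_comp => //; exact: fine_measurable.
by apply/funext => x; congr fine; apply: eq_integral => y _ /=; rewrite mulr1.
Qed.

Lemma iop_sqr_le K m f : 0 < m -> schur K m -> sqi mu f ->
  {ae mu, forall x, iop K f x ^+ 2 <= m * iop (fun x y => `|K x y|) (fun y => f y ^+ 2) x}.
Proof.
move=> m0 sK sf; have [_ a2 _] := schur_weight sK (itg_cst mu 1) (fun=> ler01).
have a1 := schur_ae sK sf; apply: filterS2 a1 a2 => x [i2 i1] i0.
set J := iop _ (fun y => f y ^+ 2) x.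
pose M := \int[mu]_y (`|K x y| * 1).
have M0 : M <= m.
  have [_ K1 _] := sK; rewrite -lee_fin; apply: le_trans (K1 x).
  rewrite /M /Rintegral fineK ?integrable_fin_num//.
  rewrite le_eqVlt; apply/orP; left; apply/eqP.
  by apply: eq_integral => y _; rewrite mulr1.
(* The minimizer of J - 2 t I + t^2 m, where I is [iop K f x]. This is the Cauchy-Schwarz inequality
   for the weight |K x y|, by nonnegativity of the integral of |K| (|f| - |t|)^2. *)
pose t := iop K f x / m.
have i3 : itg mu (fun y => t ^+ 2 * (`|K x y| * 1)) by exact: itgZ.
have i4 : itg mu (fun y => - (2 * t) * (K x y * f y)) by exact: itgZ.
have : 0 <= \int[mu]_y (`|K x y| * f y ^+ 2 + - (2 * t) * (K x y * f y) + t ^+ 2 * (`|K x y| * 1)).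
  apply: Rintegral_ge0 => y _.
  have h := sqr_ge0 (`|f y| - `|t|).
  apply: (@le_trans _ _ (`|K x y| * (`|f y| - `|t|) ^+ 2)); first by rewrite mulr_ge0.
  rewrite sqrrB !real_normK ?num_real// mulr1.
  have : t * (K x y * f y) <= `|K x y| * (`|f y| * `|t|).
    by apply: le_trans (ler_norm _) _; rewrite !normrM le_eqVlt; apply/orP; left; apply/eqP; ring.
  by rewrite mulr2n mulrDr mulrBr mulrDr; lra.
rewrite RintegralD//; last exact: itgD.
rewrite RintegralD// RintegralZl// RintegralZl// -/M -/(iop K f x).
rewrite -[X in 0 <= X + _ + _]/J.
have tm : iop K f x = t * m by rewrite /t mulfVK// gt_eqF.
clearbody t; rewrite tm => h; have := sqr_ge0 t => t0.
have : t ^+ 2 * M <= t ^+ 2 * m by rewrite ler_wpM2l.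
move=> tM; rewrite (_ : (t * m) ^+ 2 = m * (t ^+ 2 * m)); last by ring.
rewrite ler_pM2l//; move: h.
rewrite (_ : - (2 * t) * (t * m) = - (2 * (t ^+ 2 * m))); last by ring.
lra.
Qed.

Lemma iop_sqi K m f : 0 < m -> schur K m -> sqi mu f ->
  sqi mu (iop K f) /\ nrm (ip mu) (iop K f) <= m * nrm (ip mu) f.
Proof.
move=> m0 sK sf; have b := iop_sqr_le m0 sK sf; have [mf i2] := sf.
have [i3 _ i4] := schur_weight sK i2 (fun x => sqr_ge0 (f x)).
have s : sqi mu (iop K f).
  exact: sqi_dom_ae (iop_measurable sK sf) (itgZ m i3) b.
split => //; rewrite -ler_sqr ?nnegrE ?mulr_ge0 ?nrm_ge0 ?(ltW m0)//.
rewrite exprMn !(nrm_sqr (sqi_prehilbert mu))//.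
apply: (@le_trans _ _ (\int[mu]_x (m * iop (fun x y => `|K x y|) (fun y => f y ^+ 2) x))).
  apply: le_Rintegral_itg_ae; [exact: sqi_mul_itg|exact: itgZ|].
  by apply: filterS b => x; rewrite expr2.
rewrite (_ : ip mu f f = \int[mu]_x (f x ^+ 2)).
  by rewrite RintegralZl// expr2 -mulrA ler_wpM2l ?(ltW m0)//.
by apply: eq_Rintegral => x _; rewrite expr2.
Qed.

Lemma iopD K m f g : schur K m -> sqi mu f -> sqi mu g ->
  {ae mu, forall x, iop K (f + g) x = iop K f x + iop K g x}.
Proof.
move=> sK sf sg; apply: filterS2 (schur_ae sK sf) (schur_ae sK sg) => x [_ i1] [_ i2].
rewrite /iop -RintegralD//; apply: eq_Rintegral => y _.
by rewrite -[(f + g) y]/(f y + g y) mulrDr.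
Qed.

Lemma iopZ K m c f : schur K m -> sqi mu f ->
  {ae mu, forall x, iop K (c *: f) x = c * iop K f x}.
Proof.
move=> sK sf; apply: filterS (schur_ae sK sf) => x [_ i1].
rewrite /iop -RintegralZl//; apply: eq_Rintegral => y _.
by rewrite -[(c *: f) y]/(c * f y) mulrCA.
Qed.

Lemma iop_swap K m f g : schur K m -> sqi mu f -> sqi mu g ->
  ip mu (iop K f) g = ip mu f (iop (fun x y => K y x) g).
Proof.
move=> sK sf sg; have i := schur_pair_integrable sK sf sg.
have := Fubini i; rewrite /= => e.
rewrite /ip /Rintegral.
transitivity (fine (\int[mu]_x \int[mu]_y (K x y * f y * g x)%:E))%E.
  congr fine; apply: eq_integral_ae; apply: filterS (schur_ae sK sf) => x [_ i1].
  have i3 : itg mu (fun y => K x y * f y * g x).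
    by have := itgZ (g x) i1; congr (itg _ _); apply/funext => y; rewrite mulrC.
  rewrite mulrC /iop -RintegralZl// /Rintegral fineK; last first.
    by apply: integrable_fin_num => //; exact: itgZ.
  by apply: eq_integral => y _; rewrite mulrC.
rewrite e; congr fine; apply: eq_integral_ae.
apply: filterS (schur_ae (schur_tr sK) sg) => y [_ i1].
rewrite /iop -RintegralZl// /Rintegral fineK; last first.
  by apply: integrable_fin_num => //; exact: itgZ.
by apply: eq_integral => x _; congr (_%:E); ring.
Qed.

End schur.

(** * Density of bounded continuous functions in L^2 *)

Section continuous_dense.
Context {R : realType} {n : nat}.
Local Notation E := 'rV[R]_n.

(** Suited to Dynkin's theorem: these sets are stable under intersection, they generate the Borel
    sets, and their indicators are pointwise limits of bounded continuous functions min(1, k max(f,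
    0)). *)
Definition cozero_sets : set (set E) :=
  [set A | exists2 f : E -> R, continuous f & A = [set x | 0 < f x]].

Lemma measurable_cozero : @measurable _ E = <<s cozero_sets >>.
Proof.
apply/seteqP; split => [A mA|]; last first.
  apply: smallest_sub; first exact: sigma_algebra_measurable.
  move=> A [f cf ->]; have := continuous_rV_measurable cf measurableT (measurable_itv `]0, +oo[).
  by rewrite setTI; congr measurable; apply/seteqP; split => x; rewrite /= in_itv/= andbT.
pose T' := g_sigma_algebraType cozero_sets.
have mid : measurable_fun [set: T'] (fun x : T' => (x : E)).
  apply: measurable_fun_rV => i; apply: (measurability _ (RGenOInfty.measurableE R)).
  move=> /= _ [_ [c ->]] <-; rewrite setTI; apply: sub_sigma_algebra.
  exists (fun x : E => x ord0 i - c).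
    by move=> x; apply: (@cvgB _ _ _ (nbhs x)); [exact: coord_continuous|exact: (@cvg_cst _ _ _ (nbhs x))].
  by apply/seteqP; split => x; rewrite /= in_itv/= andbT subr_gt0.
by have := mid measurableT A mA; rewrite setTI.
Qed.

Variable mu : {finite_measure set E -> \bar R}.

Lemma cozero_approx (f : E -> R) x :
  Num.min 1 (k%:R * Num.max (f x) 0) @[k --> \oo] --> (\1_[set x | 0 < f x] x : R).
Proof.
rewrite indicE; have [f0|f0] := ltP 0 (f x); last first.
  rewrite memNset /=; last by apply/negP; rewrite -leNgt.
  by rewrite (_ : (fun k => _) = fun=> 0) ?mulr0n; [exact: cvg_cst|apply/funext => k; rewrite mulr0 min_r].
rewrite mem_set//=; apply: cvg_near_cst; exists (Num.bound (f x)^-1) => // k /= Nk.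
rewrite min_l//; apply: ltW; rewrite -ltr_pdivrMr// mul1r.
apply: lt_le_trans (archi_boundP _) _; first by rewrite invr_ge0 ltW.
by rewrite ler_nat.
Qed.

(** The Borel sets over which g has integral 0 form a Dynkin system containing [cozero_sets]. Hence
    all Borel sets have this property, in particular the sets where g > 0 and where g < 0. *)
Lemma continuous_dense (g : E -> R) : sqi mu g ->
  (forall f M, continuous f -> (forall x, `|f x| <= M) -> ip mu f g = 0) ->
  {ae mu, forall x, g x = 0}.
Proof.
move=> sg g0; have ig := sqi_itg sg; have mg := itg_measurable ig.
pose P (A : set E) := \int[mu]_x (\1_A x * g x) = 0.
have mind (A : set E) : measurable A -> measurable_fun setT (\1_A : E -> R).
  by move=> mA; exact: measurable_indic.
have ind1 (A : set E) x : `|\1_A x : R| <= 1.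
  by rewrite indicE; case: (x \in A); rewrite ?normr1 ?normr0.
have iA (A : set E) : measurable A -> itg mu (fun x => \1_A x * g x).
  move=> mA; apply: sqi_mul_itg sg; apply: (@sqi_bounded _ _ _ mu _ 1) => //; exact: mind.
have PT : P setT.
  rewrite /P; under eq_Rintegral do rewrite indicT /=.
  by apply: (g0 (cst 1) 1) => [x|x]; [exact: (@cvg_cst _ _ _ (nbhs x))|rewrite normr1].
have dom (f_ : nat -> E -> R) (A : set E) : (forall k, measurable_fun setT (f_ k)) ->
    measurable A -> (forall k x, `|f_ k x| <= 1) ->
    (forall x, f_ k x @[k --> \oo] --> (\1_A x : R)) ->
    (forall k, \int[mu]_x (f_ k x * g x) = 0) -> P A.
  move=> mf_ mA f1 fA f0.
  have [] := @Rdominated_cvg _ _ _ mu (fun k x => f_ k x * g x) (fun x => \1_A x * g x)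
    (fun x => `|g x|).
  - by move=> k; exact: measurable_funM.
  - by apply: measurable_funM => //; exact: mind.
  - by apply: nearW => x; apply: cvgM => //; exact: cvg_cst.
  - by rewrite /itg; have := integrable_abse ig; apply: eq_integrable.
  - by move=> k; apply: nearW => x; rewrite normrM ler_piMl.
  move=> _; under eq_fun do rewrite f0.
  by move/(cvg_lim (@norm_hausdorff _ _)); rewrite lim_cst.
have PA A : measurable A -> P A.
  rewrite measurable_cozero; apply: dynkin_induction => //.
  - by rewrite measurable_cozero.
  - move=> _ _ [f cf ->] [h ch ->]; exists (fun x => Num.min (f x) (h x)).
      by move=> x; apply: continuous_min; [exact: cf|exact: ch].
    by apply/seteqP; split => x /=; rewrite lt_min => /andP.
  - move=> _ [f cf ->].
    have cfk k : continuous (fun x => Num.min 1 (k%:R * Num.max (f x) 0)).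
      move=> x; apply: (@continuous_min _ _ (fun=> 1) (fun x => k%:R * Num.max (f x) 0)).
        exact: (@cvg_cst _ _ _ (nbhs x)).
      apply: (@cvgM _ _ (nbhs x)); first exact: (@cvg_cst _ _ _ (nbhs x)).
      by apply: (@continuous_max _ _ f (fun=> 0)); [exact: cf|exact: (@cvg_cst _ _ _ (nbhs x))].
    have fk1 k x : `|Num.min 1 (k%:R * Num.max (f x) 0)| <= 1.
      rewrite ger0_norm ?ge_min ?lexx// le_min ler01 mulr_ge0//.
      by rewrite le_max lexx orbT.
    apply: (dom (fun k x => Num.min 1 (k%:R * Num.max (f x) 0))) => //.
    + by move=> k; apply: continuous_rV_measurable; exact: cfk.
    + rewrite measurable_cozero; apply: sub_sigma_algebra; by exists f.
    + by move=> x; exact: cozero_approx.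
    + by move=> k; apply: (g0 _ 1); [exact: cfk|exact: fk1].
  - move=> S mS PS; rewrite /P.
    have e x : \1_(~` S) x * g x = \1_setT x * g x - \1_S x * g x :> R.
      by rewrite indicT /= indicC indicE; case: (x \in S); rewrite /= ?mul1r ?mul0r ?subr0 ?subrr.
    under eq_Rintegral do rewrite e.
    by rewrite RintegralB//; [rewrite PS PT subrr|exact: iA|exact: iA].
  - move=> F mF tF PF.
    have mU k : measurable (\bigcup_(i < k) F i) by exact: bigcup_measurable.
    apply: (dom (fun k => \1_(\bigcup_(i < k) F i))) => //.
    + exact: bigcup_measurable.
    + move=> x; have [[N _ FN]|nF] := pselect ((\bigcup_k F k) x).
        rewrite indicE mem_set; last by exists N.
        apply: cvg_near_cst; exists N.+1 => // k /= Nk.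
        by rewrite indicE mem_set//; exists N.
      rewrite indicE memNset//; apply: cvg_near_cst; apply: nearW => k.
      by rewrite indicE memNset// => -[i _ Fi]; apply: nF; exists i.
    + elim=> [|k IH].
        by rewrite bigcup_mkord big_ord0; under eq_Rintegral do rewrite indic0 mul0r;
          rewrite Rintegral_cst// mul0r.
      have e x : \1_(\bigcup_(i < k.+1) F i) x * g x =
          \1_(\bigcup_(i < k) F i) x * g x + \1_(F k) x * g x :> R.
        rewrite -mulrDl; congr (_ * _); rewrite !indicE.
        have [Fk|nFk] := pselect (F k x).
          rewrite [x \in F k]mem_set// [x \in \bigcup_(i < k) F i]memNset; last first.
            move=> -[i /= ik Fi]; move/trivIsetP: tF => /(_ i k I I (negbT (ltn_eqF ik))).
            by move/seteqP => [/(_ x) h _]; apply: h.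
          by rewrite mem_set ?add0r//; exists k => /=.
        rewrite [x \in F k]memNset// addr0; congr (_%:R); congr nat_of_bool.
        apply/idP/idP; rewrite !inE => -[i /= ik Fi]; exists i => //=.
          by move: ik; rewrite ltnS leq_eqVlt => /orP[/eqP ik|//]; rewrite -ik in nFk.
        by rewrite (ltn_trans ik).
      under eq_Rintegral do rewrite e.
      by rewrite RintegralD//; [rewrite IH PF addr0|exact: iA|exact: iA].
have mp : measurable [set x | 0 < g x].
  have := mg measurableT _ (measurable_itv `]0, +oo[); rewrite setTI.
  by congr measurable; apply/seteqP; split => x; rewrite /= in_itv/= andbT.
have mn : measurable [set x | g x < 0].
  have := mg measurableT _ (measurable_itv `]-oo, 0[); rewrite setTI.
  by congr measurable; apply/seteqP; split => x; rewrite /= in_itv.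
have h1 := PA _ mp; have h2 := PA _ mn.
have h3 : \int[mu]_x (- (\1_[set x | g x < 0] x * g x)) = 0.
  by under eq_Rintegral do rewrite -mulN1r; rewrite RintegralZl ?h2 ?mulr0//; exact: iA.
have i3 : itg mu (fun x => - (\1_[set x | g x < 0] x * g x)).
  have := itgZ (-1) (iA _ mn); congr (itg _ _); apply/funext => x; by rewrite mulN1r.
have a1 := Rintegral_eq0 (iA _ mp) _ h1.
have a2 := Rintegral_eq0 i3 _ h3.
apply: filterS2 (a1 _) (a2 _) => [x|x|x].
- rewrite !indicE; case: (ltgtP (g x) 0) => g0x //.
  + by rewrite [x \in [set x | g x < 0]]mem_set//= mul1r => _ /eqP; rewrite oppr_eq0 => /eqP.
  + by rewrite mem_set//= mul1r.
- rewrite indicE; case: (boolP (x \in _)) => [|_]; last by rewrite mul0r.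
  by rewrite inE/= mul1r => /ltW.
- rewrite indicE; case: (boolP (x \in _)) => [|_]; last by rewrite mul0r oppr0.
  by rewrite inE/= mul1r oppr_ge0 => /ltW.
Qed.

End continuous_dense.

(** * Integral operators with zonal kernels *)

Section zonal_kernels.
Context {R : realType} {d : nat}.
Local Notation E := 'rV[R]_d.
Local Notation om := (omega R d).
Local Notation w := (omega_d R d).

Lemma edot_radial2_le1 (x y : E) : `|edot (radial x) (radial y)| <= 1.
Proof.
by apply: le_trans (edot_cauchy _ _) _; rewrite mulr_ile1 ?enorm_radial_le1// sqrtr_ge0.
Qed.

(** Both arguments are normalized, so the argument of k has absolute value at most 1 for all x and
    y, on the sphere or not. *)
Definition zK (k : R -> R) (x y : E) := k (edot (radial x) (radial y)).

Lemma zK_sym k x y : zK k x y = zK k y x.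
Proof. by rewrite /zK edotC. Qed.

Lemma measurable_radial_coord i : measurable_fun setT (fun x : E => radial x ord0 i).
Proof. exact: (measurableT_comp (measurable_rV_coord i) measurable_radial). Qed.

Lemma measurable_edot_radial :
  measurable_fun setT (fun p : E * E => edot (radial p.1) (radial p.2)).
Proof.
apply: measurable_sum => i; apply: measurable_funM.
  exact: (measurableT_comp (measurable_radial_coord i) measurable_fst).
exact: (measurableT_comp (measurable_radial_coord i) measurable_snd).
Qed.

Lemma zK_measurable k : measurable_fun setT k ->
  measurable_fun setT (fun p : E * E => zK k p.1 p.2).
Proof. by move=> mk; apply: measurableT_comp => //; exact: measurable_edot_radial. Qed.

Lemma kQ_measurable (p r : R) : measurable_fun setT (kQ p r).
Proof.
apply: measurableT_comp; first exact: measurable_expR.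
apply: measurable_funM => //; apply: measurableT_comp; first exact: measurable_ln.
by apply: measurable_funB => //; exact: measurable_funM.
Qed.

Lemma radial_sphere_or0 (x : E) : radial x = 0 \/ sphere R d (radial x).
Proof.
have [->|x0] := eqVneq x 0; first by left; exact: radial0.
by right; rewrite /sphere/= enorm_radial.
Qed.

Lemma schur_zK_bounded (k : R -> R) C : measurable_fun setT k -> (forall s, `|s| <= 1 -> `|k s| <= C) ->
  schur om (zK k) (C * w).
Proof.
move=> mk kC; have := @schur_bounded _ _ _ om (zK k) C (zK_measurable mk).
move=> h; have -> : C * w = C * fine (om setT) by rewrite omega_setT.
by apply: h => x y; apply: kC; exact: edot_radial2_le1.
Qed.

(** If [radial x] is 0, the section of the kernel is the constant k(0); the bound [k 0 <= 1] covers
    this point, since Schur's test is stated for every x. *)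
Lemma schur_zK (k : R -> R) : measurable_fun setT k -> (forall s, `|s| <= 1 -> 0 <= k s) -> k 0 <= 1 ->
  (forall z : E, sphere R d z -> \int[om]_y (k (edot (radial y) z))%:E <= w%:E)%E ->
  schur om (zK k) w.
Proof.
move=> mk k0 k01 kw.
have h (x : E) : (\int[om]_y `|zK k x y|%:E <= w%:E)%E.
  have [x0|Sx] := radial_sphere_or0 x.
    under eq_integral do rewrite /zK x0 edot0l.
    rewrite integral_cst//= omega_setT -EFinM lee_fin ger0_norm ?k0 ?normr0//.
    by rewrite ler_piMl// omega_d_ge0.
  apply: le_trans (kw _ Sx); rewrite le_eqVlt; apply/orP; left; apply/eqP.
  apply: eq_integral => y _; rewrite /zK ger0_norm ?k0 ?edot_radial2_le1//.
  by rewrite edotC.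
split => //; first exact: zK_measurable.
by move=> y; under eq_integral do rewrite zK_sym; exact: h.
Qed.

Definition zT k f : E -> R := fun x => w^-1 * iop om (zK k) f x.

Hypothesis hd : (3 <= d)%N.
Local Notation a := (@ka R d).
Let a0 : 0 < a := ka_gt0 hd.
Let w0 : 0 < w. Proof. by apply: omega_d_gt0; exact: leq_trans hd. Qed.

Lemma zT_sqi k m f : 0 < m -> schur om (zK k) m -> sqi om f -> sqi om (zT k f).
Proof. by move=> m0 sK sf; apply: (sqiZ w^-1); have [] := iop_sqi m0 sK sf. Qed.

Lemma zT_nrm k f : schur om (zK k) w -> sqi om f -> nrm (ip om) (zT k f) <= nrm (ip om) f.
Proof.
move=> sK sf; have [h1 h2] := iop_sqi w0 sK sf.
rewrite (_ : zT k f = w^-1 *: iop om (zK k) f)// (nrmZ (sqi_prehilbert om))//.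
by rewrite ger0_norm ?invr_ge0 ?(ltW w0)// mulrC ler_pdivrMr// mulrC.
Qed.

Lemma zT_sym k m f g : 0 < m -> schur om (zK k) m -> sqi om f -> sqi om g ->
  ip om (zT k f) g = ip om f (zT k g).
Proof.
move=> m0 sK sf sg; have := iop_swap sK sf sg.
rewrite (_ : (fun x y => zK k y x) = zK k); last by apply/funext => x; apply/funext => y; exact: zK_sym.
have [sF _] := iop_sqi m0 sK sf; have [sG _] := iop_sqi m0 sK sg; move=> e.
have ph := sqi_prehilbert om.
rewrite (_ : zT k f = w^-1 *: iop om (zK k) f)// (_ : zT k g = w^-1 *: iop om (zK k) g)//.
by rewrite (ipZl ph)// (ipZr ph)// e.
Qed.

Lemma zTB k m f g : schur om (zK k) m -> sqi om f -> sqi om g ->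
  {ae om, forall x, zT k (f - g) x = zT k f x - zT k g x}.
Proof.
move=> sK sf sg; have sg' := sqiN sg.
have h1 := iopD sK sf sg'; have h2 := iopZ (-1) sK sg.
apply: filterS2 h1 h2 => x h1 h2; rewrite /zT h1 -mulrBr; congr (_ * (_ + _)).
by rewrite -mulN1r -h2 scaleN1r.
Qed.

Lemma zTD k m f g : schur om (zK k) m -> sqi om f -> sqi om g ->
  {ae om, forall x, zT k (f + g) x = zT k f x + zT k g x}.
Proof.
by move=> sK sf sg; apply: filterS (iopD sK sf sg) => x h1; rewrite /zT h1 mulrDr.
Qed.

Lemma zTZ k m c f : schur om (zK k) m -> sqi om f ->
  {ae om, forall x, zT k (c *: f) x = c * zT k f x}.
Proof.
by move=> sK sf; apply: filterS (iopZ c sK sf) => x h1; rewrite /zT h1 mulrCA.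
Qed.

Lemma zT_ae k f g : {ae om, forall x, f x = g x} -> zT k f = zT k g.
Proof.
move=> fg; apply/funext => x; congr (_ * _); apply: eq_Rintegral_ae.
by apply: filterS fg => y ->.
Qed.

Lemma zonal_itg_bounded (k : R -> R) C (z : E) : measurable_fun setT k ->
  (forall s, `|s| <= 1 -> `|k s| <= C) -> sphere R d z ->
  itg om (fun y => k (edot (radial y) z)).
Proof.
move=> mk kC Sz; apply: (@itg_bounded _ _ _ om _ C); last first.
  by move=> x; apply: kC; exact: edot_radial_le1.
apply: measurableT_comp => //; rewrite (_ : (fun x => _) = fun x : E => \sum_i radial x ord0 i * z ord0 i)//.
by apply: measurable_sum => i; apply: measurable_funM => //; exact: measurable_radial_coord.
Qed.

Lemma schur_zK_integral (k : R -> R) C : measurable_fun setT k -> (forall s, `|s| <= 1 -> 0 <= k s <= C) ->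
  k 0 <= 1 -> (forall z : E, sphere R d z -> \int[om]_y k (edot (radial y) z) = w) ->
  schur om (zK k) w.
Proof.
move=> mk kC k1 kw; apply: schur_zK => //; first by move=> s /kC /andP[].
move=> z Sz; rewrite -(kw z Sz) /Rintegral fineK//.
apply: integrable_fin_num => //; apply: (zonal_itg_bounded (C := C)) => //.
by move=> s /kC /andP[? ?]; rewrite ger0_norm.
Qed.

Lemma kQ1_le1 p r : 0 <= p -> kQ p r 0 <= (1 : R).
Proof.
move=> p0; rewrite /kQ /kq mulr0 subr0 -[leRHS]expR0 ler_expR mulNr oppr_le0.
by rewrite mulr_ge0// ln_ge0// lerDl sqr_ge0.
Qed.

Lemma schur_kN r : 0 <= r < 1 -> schur om (zK (kN a r)) w.
Proof.
move=> r01; have /andP[r0 r1] := r01.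
apply: (@schur_zK_integral _ (kQ a r 1)); first exact: kQ_measurable.
- move=> s s1; rewrite ltW ?kQ_gt0//=; apply: kQ_bound => //; rewrite ?ger0_norm//; exact: ltW.
- by apply: kQ1_le1; exact: ltW.
- by move=> z Sz; exact: integral_kN.
Qed.

Lemma schur_kP r : 0 <= r < 1 -> schur om (zK (kP a r)) w.
Proof.
move=> r01; have /andP[r0 r1] := r01.
have a1 : 0 <= a + 1 by rewrite addr_ge0// ltW.
have r2 : 0 <= 1 - r ^+ 2 <= 1.
  by rewrite subr_ge0 expr_le1//= (ltW r1) gerBl sqr_ge0.
have [r3 r4] := andP r2.
apply: (@schur_zK_integral _ (kQ (a + 1) r 1)).
- by apply: measurable_funM => //; exact: kQ_measurable.
- move=> s s1; rewrite /kP mulr_ge0 ?(ltW (kQ_gt0 _ _ _))//=.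
  apply: le_trans (@kQ_bound _ _ _ s _ a1 _ r1 s1); last by rewrite ger0_norm.
  by rewrite ler_piMl// ltW// kQ_gt0.
- by rewrite /kP mulr_ile1// ?kQ1_le1// ltW// kQ_gt0.
- by move=> z Sz; exact: integral_kP.
Qed.

(* The total mass of N_r stays bounded while N_r(1) tends to infinity, so points are null. *)
Lemma ae_edot_lt1 (x : E) : {ae om, forall y, edot (radial x) (radial y) < 1}.
Proof.
have [x0|Sx] := radial_sphere_or0 x.
  by apply: nearW => y; rewrite x0 edot0l.
have mS : measurable_fun setT (fun y : E => edot (radial x) (radial y)).
  exact: (measurableT_comp measurable_edot_radial (pair1_measurable x)).
pose A := [set y : E | 1 <= edot (radial x) (radial y)].
have mA : measurable A.
  have := mS measurableT _ (measurable_itv `[1, +oo[); rewrite setTI.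
  by congr measurable; apply/seteqP; split => y; rewrite /= in_itv/= andbT.
have A0 : om A = 0%E; last first.
  by exists A; split => // y /=; rewrite /A /= leNgt => /negP.
have Afin : om A \is a fin_num by exact: fin_num_measure.
pose c := fine (om A).
have c0 : 0 <= c by rewrite fine_ge0.
suff cw t : 0 <= t -> (1 + 2 * a * t) * c <= w.
  rewrite -(fineK Afin) -/c; congr (_%:E); apply/eqP; rewrite eq_le c0 andbT leNgt.
  apply/negP => cp; have ap : 0 < 2 * a * c.
    by apply: mulr_gt0 => //; apply: mulr_gt0 => //; exact: a0.
  have := cw (w / (2 * a * c)) (divr_ge0 (ltW w0) (ltW ap)).
  rewrite mulrDl mul1r -[X in _ <= X]add0r.
  rewrite (_ : 2 * a * (w / (2 * a * c)) * c = w); last first.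
    by field; rewrite !gt_eqF.
  by rewrite lerD2r leNgt cp.
(* For this r the value N_r(1) is e^(2at), at least 1 + 2at, while the integral of N_r remains
   [w]. *)
move=> t0; pose r := 1 - expR (- t).
have r01 : 0 <= r < 1 by rewrite /r subr_ge0 gtrBl expR_gt0 -expR0 ler_expR oppr_le0 t0.
have [r0 r1] := andP r01.
have q1 : kq r 1 = expR (- t) ^+ 2 by rewrite /kq /r; ring.
have qQ : kQ a r 1 = expR (2 * a * t).
  by rewrite /kQ q1 -expRM_natl expRK; congr expR; ring.
have iN : itg om (fun y => kN a r (edot (radial y) (radial x))).
  apply: (@zonal_itg_bounded _ (kQ a r 1)) => //; first exact: kQ_measurable.
  move=> s s1; rewrite gtr0_norm ?kQ_gt0//; apply: kQ_bound => //; rewrite ?ger0_norm//; exact: ltW.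
rewrite -(integral_kN hd Sx r01).
apply: (@le_trans _ _ (\int[om]_y (kQ a r 1 * \1_A y))).
  rewrite RintegralZl//; last first.
    by apply: (@itg_bounded _ _ _ om _ 1) => [|y]; [exact: measurable_indic|
      rewrite indicE; case: (_ \in _); rewrite ?normr1 ?normr0].
  rewrite (_ : \int[om]_y \1_A y = c) ?ler_wpM2r//; last first.
    by rewrite /Rintegral integral_indic// setIT.
  by rewrite qQ expR_ge1Dx.
apply: le_Rintegral_itg => // [|y].
  apply: itgZ; apply: (@itg_bounded _ _ _ om _ 1) => [|y]; [exact: measurable_indic|].
  by rewrite indicE; case: (_ \in _); rewrite ?normr1 ?normr0.
rewrite indicE; case: (boolP (y \in A)) => [|_]; last by rewrite mulr0 ltW ?kQ_gt0.
rewrite inE /A /= => y1; rewrite mulr1 edotC -(radial_idem y).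
have -> : edot (radial x) (radial (radial y)) = 1; last by [].
apply/eqP; rewrite eq_le radial_idem y1 andbT.
by apply: le_trans (edot_radial2_le1 x y); exact: ler_norm.
Qed.

(** Starting at 1/2 keeps r_n >= 1/2, which bounds [kq (rn n) s] from below away from the
    diagonal. *)
Definition rn n : R := 1 - n.+2%:R^-1.

Lemma rn_bounds n : 2^-1 <= rn n < 1.
Proof.
rewrite /rn gtrBl invr_gt0 ltr0n andbT lerBrDr -lerBrDl.
apply: (@le_trans _ _ 2^-1); last by lra.
by rewrite lef_pV2 ?posrE// ler_nat.
Qed.

Lemma rn_01 n : 0 <= rn n < 1.
Proof. by have /andP[h ->] := rn_bounds n; rewrite andbT (le_trans _ h). Qed.

Lemma rn_cvg : rn n @[n --> \oo] --> (1 : R).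
Proof.
rewrite -[X in _ --> X]subr0; apply: cvgB; first exact: cvg_cst.
have := @cvg_harmonic R; rewrite -(cvg_shiftn 1) /=.
by under eq_fun do rewrite addn1.
Qed.

Lemma kN_cvg s : `|s| <= 1 -> s < 1 -> kN a (rn n) s @[n --> \oo] --> kN a 1 s.
Proof.
move=> _ s1; have q0 : 0 < kq 1 s by rewrite /kq; lra.
have c := is_derive_continuous (is_derive_kQ_r a q0).
exact: (@cvg_comp _ _ _ rn (fun r => kQ a r s) _ _ _ rn_cvg c).
Qed.

Definition c4 : R := expR (a * ln 4).

(** [c4] is 4^a: |x - y|^2 <= 4 |x - r y|^2 for every r >= 0. So the singular kernel itself
    dominates the regularized ones, which is the domination needed as r tends to 1. *)
Lemma kN_le_kN1 r s : 0 <= r -> `|s| <= 1 -> s < 1 -> kN a r s <= c4 * kN a 1 s.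
Proof.
move=> r0 s1 s2; rewrite /kN /kQ /c4 -expRD ler_expR.
have q1 : 0 < kq 1 s by rewrite /kq; lra.
have q2 : 4^-1 * kq 1 s <= kq r s.
  move: s1; rewrite ler_norml /kq expr1n => /andP[s3 _].
  have [s0|s0] := leP 0 s.
    have := sqr_ge0 (r - s); rewrite sqrrB => h.
    have : s ^+ 2 <= s by rewrite expr2 ler_piMl// ltW.
    by lra.
  have : r * s <= 0 by rewrite mulr_ge0_le0// ltW.
  by have := sqr_ge0 r; lra.
have q3 : 0 < kq r s by apply: lt_le_trans q2; rewrite mulr_gt0.
have : ln (kq 1 s) - ln 4 <= ln (kq r s).
  rewrite -ln_div ?posrE// ler_ln ?posrE ?divr_gt0//.
  by rewrite mulrC.
rewrite -(ler_pM2l a0); lra.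
Qed.

(** Fatou's lemma along r_n, as all N_r with r < 1 have the same integral [w] and converge off the
    diagonal, which is a null set. *)
Lemma schur_kN1 : schur om (zK (kN a 1)) w.
Proof.
apply: schur_zK; first exact: kQ_measurable.
- by move=> s _; rewrite ltW// kQ_gt0.
- by apply: kQ1_le1; exact: ltW.
move=> z Sz; pose f n (y : E) := (kN a (rn n) (edot (radial y) z))%:E.
have Sz' : radial z = z by exact: radial_sphere.
have mf n : measurable_fun setT (f n).
  apply/measurable_EFinP; apply: itg_measurable.
  apply: (@zonal_itg_bounded _ (kQ a (rn n) 1)) => //; first exact: kQ_measurable.
  have /andP[r0 r1] := rn_01 n.
  move=> s s1; rewrite gtr0_norm ?kQ_gt0//; apply: kQ_bound => //; rewrite ?ger0_norm//; exact: ltW.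
have f0 n x : setT x -> (0 <= f n x)%E by rewrite lee_fin ltW// kQ_gt0.
have := fatou om measurableT mf f0.
have -> : (\int[om]_x limn_einf (f ^~ x) = \int[om]_y (kN a 1 (edot (radial y) z))%:E)%E.
  apply: eq_integral_ae; have := ae_edot_lt1 z; apply: filterS => y.
  rewrite Sz' edotC => s1.
  have c : f n y @[n --> \oo] --> (kN a 1 (edot (radial y) z))%:E.
    by apply: cvg_EFin; [exact: nearW|apply: kN_cvg => //; exact: edot_radial_le1].
  rewrite is_cvg_limn_einfE; last by apply/cvg_ex; eexists; exact: c.
  exact/cvg_lim.
have -> : (fun n => \int[om]_x f n x)%E = cst w%:E.
  apply/funext => n; rewrite /= -(integral_kN hd Sz (rn_01 n)) /Rintegral fineK//.
  apply: integrable_fin_num => //.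
  apply: (@zonal_itg_bounded _ (kQ a (rn n) 1)) => //; first exact: kQ_measurable.
  have /andP[r0 r1] := rn_01 n.
  move=> s s1; rewrite gtr0_norm ?kQ_gt0//; apply: kQ_bound => //; rewrite ?ger0_norm//; exact: ltW.
rewrite is_cvg_limn_einfE; last exact: is_cvg_cst.
by rewrite lim_cst.
Qed.

(* [Gop] is [2 K] and [- 2 a S]. *)
Definition Gop f : E -> R := zT (kN a 1) f.

End zonal_kernels.

Section L2_limits.
Context {R : realType} dsp (T : measurableType dsp) (mu : {finite_measure set T -> \bar R}).
Local Notation ph := (sqi_prehilbert mu).

Lemma eq_nrm_ae f g : {ae mu, forall x, f x = g x} -> nrm (ip mu) f = nrm (ip mu) g.
Proof. by move=> fg; rewrite /nrm (eq_ip_ae fg fg). Qed.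

Lemma sqi_projection (M : set (T -> R)) f : is_subspace (sqi mu) (M) ->
  seq_closed (sqi mu) (ip mu) M -> sqi mu f ->
  exists2 g, M g & forall h, M h -> ip mu (f - g) h = 0.
Proof. exact: (projection_exists ph (@sqi_complete _ _ _ mu)). Qed.

Lemma tends_unique (u : nat -> T -> R) f g : (forall n, sqi mu (u n)) -> sqi mu f -> sqi mu g ->
  tends (ip mu) u f -> tends (ip mu) u g -> {ae mu, forall x, f x = g x}.
Proof.
move=> su sf sg uf ug; have sB := sqiB sf sg.
have n0 : nrm (ip mu) (f - g) = 0.
  move/tendsP: uf => h1'; move/tendsP: ug => h2'.
  apply/eqP; rewrite eq_le nrm_ge0 andbT; apply/ler_addgt0Pr => e e0; rewrite add0r.
  have [N1 h1] := h1' _ (divr_gt0 e0 (ltr0n _ 2)).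
  have [N2 h2] := h2' _ (divr_gt0 e0 (ltr0n _ 2)).
  have k1 := h1 _ (leq_maxl N1 N2); have k2 := h2 _ (leq_maxr N1 N2).
  apply: le_trans (nrm_triangle ph sf (su (maxn N1 N2)) sg) _.
  by rewrite (nrm_distC ph sf (su _)); lra.
by apply: filterS (nrm_eq0 sB n0) => x /eqP; rewrite -[(f - g) x]/(f x - g x) subr_eq0 => /eqP.
Qed.

Lemma tends_ae (u v : nat -> T -> R) f g : (forall n, {ae mu, forall x, u n x = v n x}) ->
  {ae mu, forall x, f x = g x} -> tends (ip mu) u f -> tends (ip mu) v g.
Proof.
move=> uv fg; rewrite /tends.
rewrite (_ : (fun n => nrm (ip mu) (v n - g)) = fun n => nrm (ip mu) (u n - f))//.
apply/funext => n; apply/esym; apply: eq_nrm_ae; apply: filterS2 (uv n) fg => x h1 h2.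
by rewrite -[(u n - f) x]/(u n x - f x) h1 h2.
Qed.

Lemma tendsD (u v : nat -> T -> R) f g : (forall n, sqi mu (u n)) -> (forall n, sqi mu (v n)) ->
  sqi mu f -> sqi mu g -> tends (ip mu) u f -> tends (ip mu) v g ->
  tends (ip mu) (fun n => u n + v n) (f + g).
Proof.
move=> su sv sf sg uf vg; apply: (@cvgn_squeeze0 _ _ (fun n => nrm (ip mu) (u n - f) + nrm (ip mu) (v n - g))).
  move=> n; rewrite nrm_ge0/= (_ : u n + v n - (f + g) = (u n - f) + (v n - g)).
    by apply: (nrmD ph); exact: sqiB.
  by rewrite opprD addrACA.
by rewrite -[X in _ --> X]addr0; apply: cvgD.
Qed.

Lemma tendsZ c (u : nat -> T -> R) f : (forall n, sqi mu (u n)) -> sqi mu f ->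
  tends (ip mu) u f -> tends (ip mu) (fun n => c *: u n) (c *: f).
Proof.
move=> su sf uf; apply: (@cvgn_squeeze0 _ _ (fun n => `|c| * nrm (ip mu) (u n - f))).
  by move=> n; rewrite nrm_ge0/= -scalerBr (nrmZ ph)//; exact: sqiB.
by rewrite -[X in _ --> X](mulr0 `|c|); apply: cvgM => //; exact: cvg_cst.
Qed.

(* Uniformly bounded, almost everywhere linear operators that converge to the identity on a set
   with trivial orthogonal complement converge to the identity on L^2. *)
Lemma approx_identity (S : nat -> (T -> R) -> T -> R) (D : set (T -> R)) :
  (forall n f, sqi mu f -> sqi mu (S n f) /\ nrm (ip mu) (S n f) <= nrm (ip mu) f) ->
  (forall n f g, sqi mu f -> sqi mu g -> {ae mu, forall x, S n (f + g) x = S n f x + S n g x}) ->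
  (forall n c f, sqi mu f -> {ae mu, forall x, S n (c *: f) x = c * S n f x}) ->
  (forall n f g, {ae mu, forall x, f x = g x} -> S n f = S n g) ->
  (forall g, sqi mu g -> (forall f, D f -> ip mu f g = 0) -> {ae mu, forall x, g x = 0}) ->
  D `<=` sqi mu -> (forall f, D f -> tends (ip mu) (S ^~ f) f) ->
  forall f, sqi mu f -> tends (ip mu) (S ^~ f) f.
Proof.
move=> Sn SD SZ Sae Dperp Dsq DS.
pose V := [set f | sqi mu f /\ tends (ip mu) (S ^~ f) f].
have SnS n f : sqi mu f -> sqi mu (S n f) by move=> /(Sn n)[].
have Vsub : is_subspace (sqi mu) V.
  split.
  - by move=> f [].
  - split; first exact: sqi0.
    have e n : {ae mu, forall x, S n 0 x = 0 x}.
      by have := SZ n 0 0 (sqi0 mu); rewrite scale0r; apply: filterS => x ->; rewrite mul0r.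
    apply: (@cvgn_squeeze0 _ _ (cst 0)) => [n|]; last exact: cvg_cst.
    by rewrite nrm_ge0/= subr0 (nrm_ae0 (e n)).
  - move=> f g [sf tf] [sg tg]; split; first exact: sqiD.
    apply: (@tends_ae (fun n => S n f + S n g) _ (f + g) _ _ _ (tendsD (fun n => SnS n f sf) (fun n => SnS n g sg) sf sg tf tg)); last exact: nearW.
    by move=> n; apply: filterS (SD n f g sf sg) => x ->.
  - move=> c f [sf tf]; split; first exact: sqiZ.
    apply: (@tends_ae (fun n => c *: S n f) _ (c *: f) _ _ _ (tendsZ c (fun n => SnS n f sf) sf tf)); last exact: nearW.
    by move=> n; apply: filterS (SZ n c f sf) => x ->.
have Vcl : seq_closed (sqi mu) (ip mu) V.
  move=> u f uV sf uf; split => //; apply/tendsP => e e0.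
  have su n : sqi mu (u n) by have [] := uV n.
  move/tendsP: uf => h1'; have [N1 h1] := h1' _ (divr_gt0 e0 (ltr0n _ 3)).
  have [_ /tendsP/(_ _ (divr_gt0 e0 (ltr0n _ 3)))[N2 h2]] := uV N1.
  exists N2 => n /h2 k2; have k1 := h1 N1 (leqnn _).
  have sB := sqiB sf (su N1).
  have e1 : nrm (ip mu) (S n f - S n (u N1)) <= nrm (ip mu) (f - u N1).
    have [_] := Sn n _ sB; apply: le_trans; rewrite le_eqVlt; apply/orP; left; apply/eqP.
    apply: eq_nrm_ae; have h3 := SD n (f - u N1) (u N1) sB (su N1).
    by apply: filterS h3 => x; rewrite subrK -[(S n f - _) x]/(S n f x - _) => ->; rewrite addrK.
  apply: le_trans (nrm_triangle ph (SnS n f sf) (SnS n _ (su N1)) sf) _.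
  have := nrm_triangle ph (SnS n _ (su N1)) (su N1) sf.
  rewrite (nrm_distC ph sf (su N1)) in e1; lra.
(* [f - g] is orthogonal to V, which contains D, hence it is null. *)
move=> f sf; have [g [sg tg] gV] := sqi_projection Vsub Vcl sf.
have sB := sqiB sf sg.
have fg : {ae mu, forall x, f x = g x}.
  apply: filterS (Dperp _ sB _) => [x /eqP|h Dh].
    by rewrite -[(f - g) x]/(f x - g x) subr_eq0 => /eqP.
  rewrite (ipC ph)//; last exact: Dsq.
  by apply: gV; split; [exact: Dsq|exact: DS].
apply: (@tends_ae (S ^~ g) _ g _ _ _ tg); last by apply: filterS fg => x ->.
by move=> n; apply: nearW => x; rewrite (Sae n f g fg).
Qed.

End L2_limits.

Section schur_sup.
Context {R : realType} dsp (T : measurableType dsp) (mu : {finite_measure set T -> \bar R}).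

Lemma schur_sup (K : T -> T -> R) m (g : T -> R) M x : schur mu K m -> measurable_fun setT g ->
  (forall y, `|g y| <= M) -> `|iop mu K g x| <= M * m.
Proof.
move=> sK mg gM; have M0 : 0 <= M := le_trans (normr_ge0 _) (gM x).
have mK : measurable_fun setT (K x) by exact: schur_section sK.
have [_ K1 _] := sK.
have iK : itg mu (fun y => `|K x y|).
  apply/integrableP; split; first by apply/measurable_EFinP; exact: measurableT_comp.
  apply: le_lt_trans (_ : _ <= m%:E)%E (ltry _).
  by under eq_integral do rewrite /= normr_id; exact: K1.
have iKg : itg mu (fun y => K x y * g y).
  apply: (itg_le _ (itgZ M iK)); first exact: measurable_funM.
  by move=> y; rewrite normrM mulrC ler_wpM2r.
apply: (@le_trans _ _ (\int[mu]_y `|K x y * g y|)); first exact: le_normr_Rintegral.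
apply: (@le_trans _ _ (\int[mu]_y (M * `|K x y|))).
  apply: le_Rintegral_itg => [||y]; last by rewrite normrM mulrC ler_wpM2r.
    by have := integrable_abse iKg; exact: eq_integrable.
  exact: itgZ.
rewrite RintegralZl// ler_wpM2l// -lee_fin; apply: le_trans (K1 x).
by rewrite /Rintegral fineK// integrable_fin_num.
Qed.

End schur_sup.

(** * Limits of the operators as the dilation parameter tends to 1 *)

Section zonal_limits.
Context {R : realType} {d : nat}.
Local Notation E := 'rV[R]_d.
Local Notation om := (omega R d).
Local Notation w := (omega_d R d).
Hypothesis hd : (3 <= d)%N.
Local Notation a := (@ka R d).
Local Notation N := (kN a).
Local Notation P := (kP a).
Local Notation rn := (@rn R).
Let a0 : 0 < a := ka_gt0 hd.
Let w0 : 0 < w. Proof. by apply: omega_d_gt0; exact: leq_trans hd. Qed.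

Let sN1 : schur om (zK (N 1)) w := schur_kN1 hd.
Let r01 n : 0 <= rn n < 1 := rn_01 n.
Let sN n : schur om (zK (N (rn n))) w := schur_kN hd (r01 n).
Let sP n : schur om (zK (P (rn n))) w := schur_kP hd (r01 n).

Lemma zT_kN_cvg f : sqi om f -> tends (ip om) (fun n => zT (N (rn n)) f) (Gop f).
Proof.
move=> sf; have s1 := sN1; have sn := sN.
have [mf i2f] := sf; pose J := iop om (fun x y => `|zK (N 1) x y|) (fun y => f y ^+ 2).
have [iJ _ _] := schur_weight s1 i2f (fun x => sqr_ge0 (f x)).
have c40 : 0 < @c4 R d by exact: expR_gt0.
have mN (r s : R) : 0 <= N r s by rewrite ltW ?kQ_gt0.
(* With A and B the integrals for r_n and for 1, (A - B)^2 <= 2 A^2 + 2 B^2, where A^2 <= w c4 J and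
   B^2 <= w J almost everywhere; the normalization divides by w^2. *)
apply: (@dominated_nrm_cvg _ _ _ om _ _ (fun x => 2 * w^-1 * (@c4 R d + 1) * J x)).
- by move=> n; have [] := zT_sqi w0 (sn n) sf.
- by have [] := zT_sqi w0 s1 sf.
- apply: filterS (schur_ae s1 sf) => x [_ i1]; apply: cvgM; first exact: cvg_cst.
  have [] := @Rdominated_cvg _ _ _ om (fun n y => zK (N (rn n)) x y * f y)
    (fun y => zK (N 1) x y * f y) (fun y => @c4 R d * `|zK (N 1) x y * f y|) => //.
  + by move=> n; apply: measurable_funM => //; exact: schur_section (sn n).
  + by apply: measurable_funM => //; exact: schur_section s1.
  + apply: filterS (ae_edot_lt1 hd x) => y xy; apply: cvgM; last exact: cvg_cst.
    by apply: kN_cvg => //; exact: edot_radial2_le1.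
  + apply: itgZ; have := integrable_abse i1; exact: eq_integrable.
  + move=> n; apply: filterS (ae_edot_lt1 hd x) => y xy.
    rewrite !normrM mulrA ler_wpM2r// !ger0_norm ?mN//.
    by apply: kN_le_kN1 => //; [have /andP[] := r01 n|exact: edot_radial2_le1].
- exact: itgZ.
move=> n; have b1 := iop_sqr_le w0 (sn n) sf; have b2 := iop_sqr_le w0 s1 sf.
have b3 := schur_ae (sn n) sf; have b4 := schur_ae s1 sf.
apply: filterS3 b1 b2 (filterI b3 b4) => x h1 h2 [[h3 _] [h4 _]].
have h5 : iop om (fun x y => `|zK (N (rn n)) x y|) (fun y => f y ^+ 2) x <= @c4 R d * J x.
  rewrite /J /iop -RintegralZl//; apply: le_Rintegral_itg_ae => //; first exact: itgZ.
  apply: filterS (ae_edot_lt1 hd x) => y xy.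
  rewrite mulrA ler_wpM2r ?sqr_ge0// !ger0_norm ?mN//.
  by apply: kN_le_kN1 => //; [have /andP[] := r01 n|exact: edot_radial2_le1].
rewrite /Gop /zT -mulrBr exprMn; move: h1 h2.
set A := iop _ _ _ x; set B := iop _ _ f x; rewrite -/J => h1 h2.
have : (A - B) ^+ 2 <= 2 * w * (@c4 R d + 1) * J x.
  have := sqr_ge0 (A + B); rewrite sqrrD sqrrB => h6.
  have : w * iop om (fun x y => `|zK (N (rn n)) x y|) (fun y => f y ^+ 2) x <= w * (@c4 R d * J x).
    by apply: (ler_wpM2l (ltW w0)); exact: h5.
  by lra.
move=> h6; have : w^-1 ^+ 2 * (A - B) ^+ 2 <= w^-1 ^+ 2 * (2 * w * (@c4 R d + 1) * J x).
  by rewrite ler_wpM2l ?sqr_ge0.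
move/le_trans; apply; rewrite le_eqVlt; apply/orP; left; apply/eqP; field.
by rewrite gt_eqF.
Qed.

Lemma kP_approx (f : E -> R) M x : continuous f -> (forall y, `|f y| <= M) -> sphere R d x ->
  zT (P (rn n)) f x @[n --> \oo] --> f x.
Proof.
move=> cf fM Sx; have M0 : 0 <= M := le_trans (normr_ge0 _) (fM x).
have mf := continuous_rV_measurable cf.
apply/cvgrPdist_le => e e0.
have [del del0 hdel] : exists2 del : R, 0 < del & forall y, sphere R d y ->
    1 - del ^+ 2 / 2 < edot x y -> `|f y - f x| <= e / 2.
  have /cvgrPdist_le/(_ _ (divr_gt0 e0 (ltr0n _ 2))) := cf x.
  move=> /nbhs_ballP[del /= del0 hb]; exists del => // y Sy xy.
  rewrite distrC; apply: hb; split => // i j; rewrite /ball/= !ord1.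
  apply: le_lt_trans (_ : enorm (x - y) < del).
    by have := coord_le_enorm (x - y) j; rewrite !mxE.
  rewrite -(ltr_pXn2r (n := 2))// ?nnegrE ?sqrtr_ge0 ?(ltW del0)//.
  rewrite enorm_sqr edotBl !edotBr !edot_sphere// [edot y x]edotC; lra.
(* On the sphere |x - y|^2 = 2 - 2 (x . y), so x . y > 1 - eta means |x - y| < del. Farther away,
   r_n >= 1/2 gives [kq] >= eta, and the Poisson kernel is at most 2 C (1 - r_n). *)
pose eta := del ^+ 2 / 2; have eta0 : 0 < eta by rewrite divr_gt0 ?exprn_gt0.
pose C := expR (- (a + 1) * ln eta).
have C0 : 0 < C by exact: expR_gt0.
have Rx : radial x = x by exact: radial_sphere.
have bd n : `|zT (P (rn n)) f x - f x| <= e / 2 + 4 * M * C * (1 - rn n).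
  have /andP[r0 r1] := r01 n; have /andP[r2 _] : 2^-1 <= rn n < 1 by exact: rn_bounds.
  have P0 s : 0 <= P (rn n) s.
    by rewrite mulr_ge0 ?(ltW (kQ_gt0 _ _ _))// subr_ge0 expr_le1// ltW.
  have mP : measurable_fun setT (zK (P (rn n)) x) by exact: schur_section (sP n).
  have bP (y : E) : `|zK (P (rn n)) x y| <= kQ (a + 1) (rn n) 1.
    rewrite ger0_norm ?P0// /zK /kP; apply: (@le_trans _ _ (kQ (a + 1) (rn n) (edot (radial x) (radial y)))).
      by rewrite ler_piMl ?(ltW (kQ_gt0 _ _ _))// gerBl sqr_ge0.
    apply: kQ_bound; [|by rewrite ger0_norm|exact: r1|exact: edot_radial2_le1].
    by apply: addr_ge0 => //; exact: ltW.
  have iP : itg om (zK (P (rn n)) x) by exact: itg_bounded mP bP.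
  have iPf (g : E -> R) K : measurable_fun setT g -> (forall y, `|g y| <= K) ->
      itg om (fun y => zK (P (rn n)) x y * g y).
    move=> mg gK; apply: (@itg_bounded _ _ _ om _ (kQ (a + 1) (rn n) 1 * K)).
      exact: measurable_funM.
    by move=> y; rewrite normrM ler_pM.
  have Pw : \int[om]_y zK (P (rn n)) x y = w.
    rewrite -(integral_kP hd Sx (r01 n)); apply: eq_Rintegral => y _.
    by rewrite /zK Rx edotC.
  have ifx : itg om (fun y => zK (P (rn n)) x y * (f y - f x)).
    apply: (@iPf (fun y => f y - f x) (M + M)); first exact: measurable_funB.
    by move=> y; apply: le_trans (ler_normB _ _) _; exact: lerD.
  have -> : zT (P (rn n)) f x - f x = w^-1 * \int[om]_y (zK (P (rn n)) x y * (f y - f x)).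
    rewrite /zT /iop; under [in RHS]eq_Rintegral do rewrite mulrBr.
    rewrite RintegralB//; [|exact: iPf fM|by apply: (@iPf (cst (f x)) M) => // y; exact: fM].
    by rewrite RintegralZr// Pw; field; rewrite gt_eqF.
  rewrite normrM ger0_norm ?invr_ge0 ?(ltW w0)// mulrC ler_pdivrMr//.
  apply: (@le_trans _ _ (\int[om]_y `|zK (P (rn n)) x y * (f y - f x)|)).
    exact: le_normr_Rintegral.
  apply: (@le_trans _ _ (\int[om]_y ((e / 2) * zK (P (rn n)) x y + 4 * M * C * (1 - rn n)))).
    apply: le_Rintegral_itg_ae.
    - by have := integrable_abse ifx; exact: eq_integrable.
    - by apply: itgD; [exact: itgZ|exact: itg_cst].
    apply: filterS ae_sphere => y Sy; rewrite normrM ger0_norm ?P0//.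
    have Q0 : 0 <= 4 * M * C * (1 - rn n).
      by rewrite !mulr_ge0 ?(ltW C0)// subr_ge0 ltW.
    have [xy|xy] := ltP (1 - eta) (edot x y).
      apply: (@le_trans _ _ (e / 2 * zK (P (rn n)) x y)); last by rewrite lerDl.
      by rewrite mulrC ler_wpM2r ?P0// hdel.
    apply: (@le_trans _ _ (4 * M * C * (1 - rn n))); last first.
      by rewrite lerDr mulr_ge0 ?P0// ltW// divr_gt0.
    have h1 : `|f y - f x| <= 2 * M.
      by apply: le_trans (ler_normB _ _) _; rewrite mulr_natl mulr2n; exact: lerD.
    have q0 : eta <= kq (rn n) (edot x y).
      rewrite /kq; have := sqr_ge0 (1 - rn n); rewrite sqrrB expr1n mul1r.
      have : 2 * 2^-1 * eta <= 2 * rn n * (1 - edot x y).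
        apply: ler_pM; rewrite ?ler_wpM2l ?mulr_ge0 ?(ltW eta0)//; lra.
      by lra.
    have h2 : zK (P (rn n)) x y <= 2 * C * (1 - rn n).
      rewrite /zK Rx (radial_sphere Sy) /kP.
      have -> : 2 * C * (1 - rn n) = (2 * (1 - rn n)) * C by ring.
      apply: ler_pM; rewrite ?(ltW (kQ_gt0 _ _ _))//.
      - by rewrite subr_ge0 expr_le1// ltW.
      - rewrite (_ : 1 - rn n ^+ 2 = (1 + rn n) * (1 - rn n)); last by ring.
        by rewrite ler_wpM2r ?subr_ge0 ?(ltW r1)//; lra.
      - rewrite /kQ /C ler_expR !mulNr lerN2 ler_wpM2l ?addr_ge0 ?(ltW a0)//.
        by rewrite ler_ln ?posrE// (lt_le_trans eta0).
    have -> : 4 * M * C * (1 - rn n) = (2 * C * (1 - rn n)) * (2 * M) by ring.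
    by apply: ler_pM => //; exact: P0.
  rewrite RintegralD//; [|exact: itgZ|exact: itg_cst].
  rewrite RintegralZl// Pw (Rintegral_zonal_cst (4 * M * C * (1 - rn n))) -mulrDl//.
have lim0 : e / 2 + 4 * M * C * (1 - rn n) @[n --> \oo] --> e / 2.
  rewrite -[X in _ --> X]addr0; apply: cvgD; first exact: cvg_cst.
  rewrite -(mulr0 (4 * M * C)); apply: cvgM; first exact: cvg_cst.
  by rewrite -(subrr (1 : R)); apply: cvgB; [exact: cvg_cst|exact: rn_cvg].
have : \forall n \near \oo, e / 2 + 4 * M * C * (1 - rn n) <= e.
  have e2 : 0 < e / 2 by rewrite divr_gt0.
  have /cvgrPdist_le/(_ _ e2) := lim0; apply: filterS => n.
  by rewrite ler_norml => /andP[]; lra.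
apply: filterS => n; rewrite distrC; exact: le_trans (bd n).
Qed.

Lemma zT_kP_cvg f : sqi om f -> tends (ip om) (fun n => zT (P (rn n)) f) f.
Proof.
apply: (@approx_identity _ _ _ om (fun n f => zT (P (rn n)) f)
  [set f | continuous f /\ exists M, forall y, `|f y| <= M]).
- by move=> n g sg; split; [exact: zT_sqi w0 (sP n) sg|exact: zT_nrm].
- by move=> n g h; exact: zTD (sP n).
- by move=> n c g; exact: zTZ (sP n).
- by move=> n g h; exact: zT_ae.
- by move=> g sg gD; apply: continuous_dense sg _ => h M ch hM; apply: gD; split => //; exists M.
- by move=> g [cg [M gM]]; apply: (@sqi_bounded _ _ _ om g M) => //; exact: continuous_rV_measurable.
move=> g [cg [M gM]]; have mg := continuous_rV_measurable cg.
have sg : sqi om g by apply: (@sqi_bounded _ _ _ om g M).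
have M0 : 0 <= M := le_trans (normr_ge0 _) (gM 0).
apply: (@dominated_nrm_cvg _ _ _ om _ _ (cst ((2 * M) ^+ 2))).
- by move=> n; have [] := zT_sqi w0 (sP n) sg.
- exact: mg.
- by apply: filterS ae_sphere => x Sx; exact: kP_approx.
- exact: itg_cst.
move=> n; apply: nearW => x /=.
have h : `|zT (P (rn n)) g x| <= M.
  rewrite /zT normrM ger0_norm ?invr_ge0 ?(ltW w0)// mulrC ler_pdivrMr//.
  exact: schur_sup (sP n) mg gM.
rewrite -real_normK ?num_real// ler_pXn2r ?nnegrE ?mulr_ge0//.
apply: le_trans (ler_normB _ _) _; rewrite mulr_natl mulr2n; exact: lerD.
Qed.

End zonal_limits.

Section iop_compositions.
Context {R : realType} dsp (T : measurableType dsp) (mu : {finite_measure set T -> \bar R}).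

Lemma iop_comp (K K' : T -> T -> R) m (f : T -> R) x : 0 < m -> schur mu K' m -> sqi mu f ->
  sqi mu (K x) -> iop mu K (iop mu K' f) x = ip mu f (fun z => \int[mu]_y (K' y z * K x y)).
Proof.
move=> m0 sK' sf sKx; have [s _] := iop_sqi m0 sK' sf.
by rewrite -(iop_swap sK' sf sKx) (ipC (sqi_prehilbert mu)).
Qed.

Lemma ip_iop_pair (K K' : T -> T -> R) m m' (f : T -> R) : 0 < m -> 0 < m' ->
  schur mu K m -> schur mu K' m' -> sqi mu f ->
  ip mu (iop mu K f) (iop mu K' f) = ip mu f (iop mu (fun y x => K x y) (iop mu K' f)).
Proof.
by move=> m0 m'0 sK sK' sf; have [s _] := iop_sqi m'0 sK' sf; rewrite (iop_swap sK sf s).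
Qed.

End iop_compositions.

(** * The identity G G (a^2 - Delta) = a^2 on zonal functions *)

Section parametrix.
Context {R : realType} {d : nat}.
Local Notation E := 'rV[R]_d.
Local Notation om := (omega R d).
Local Notation w := (omega_d R d).
Hypothesis hd : (3 <= d)%N.
Local Notation a := (@ka R d).
Local Notation N := (kN a).
Local Notation P := (kP a).
Local Notation N' := (kN' a).
Local Notation N'' := (kN'' a).
Local Notation rn := (@rn R).
Local Notation zop := (@zop R d).
Let a0 : 0 < a := ka_gt0 hd.
Let w0 : 0 < w. Proof. by apply: omega_d_gt0; exact: leq_trans hd. Qed.
Let sN1 : schur om (zK (N 1)) w := schur_kN1 hd.
Let r01 n : 0 <= rn n < 1 := rn_01 n.
Let sN n : schur om (zK (N (rn n))) w := schur_kN hd (r01 n).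
Let sP n : schur om (zK (P (rn n))) w := schur_kP hd (r01 n).
Let ph := sqi_prehilbert om.

Lemma zT_tends k (u : nat -> E -> R) f : schur om (zK k) w -> (forall n, sqi om (u n)) ->
  sqi om f -> tends (ip om) u f -> tends (ip om) (fun n => zT k (u n)) (zT k f).
Proof.
move=> sk su sf uf; apply: (cvgn_squeeze0 _ uf) => n; rewrite nrm_ge0/=.
apply: le_trans (zT_nrm hd sk (sqiB (su n) sf)); rewrite le_eqVlt; apply/orP; left; apply/eqP.
by apply: eq_nrm_ae; apply: filterS (zTB sk (su n) sf) => x ->.
Qed.

Lemma zT_zT k k' f : schur om (zK k) w -> schur om (zK k') w -> sqi om f ->
  {ae om, forall x, zT k (zT k' f) x = w^-1 ^+ 2 * iop om (zK k) (iop om (zK k') f) x}.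
Proof.
move=> sk sk' sf; have [s _] := iop_sqi w0 sk' sf.
have := zTZ w^-1 sk s; apply: filterS => x h.
by rewrite (_ : zT k' f = w^-1 *: iop om (zK k') f)// h /zT expr2 mulrA.
Qed.

Lemma rn_lt1 n : `|rn n| < 1.
Proof. by have /andP[h1 h2] := r01 n; rewrite ger0_norm. Qed.

Section bump.
Variables (h h' h'' : R -> R) (z0 : E).
Hypotheses (Sz0 : sphere R d z0) (hh' : zC1 h h') (hh'' : zC1 h' h'').
Let b (x : E) := h (edot (radial x) z0).
Let c (x : E) := zop h h' h'' (edot (radial x) z0).

Lemma zonal_sqi (k : R -> R) : (forall s, `|s| <= 1 -> {for s, continuous k}) ->
  sqi om (fun x => k (edot (radial x) z0)).
Proof.
move=> kc; have [M kM] := @zonal_bounded R d k kc.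
by apply: (@sqi_bounded _ _ _ om _ M) => [|x]; [exact: zonal_measurable|exact: kM].
Qed.

Lemma h_cont s : `|s| <= 1 -> {for s, continuous h}. Proof. exact: zC1_cont hh'. Qed.
Lemma c_cont s : `|s| <= 1 -> {for s, continuous (zop h h' h'')}.
Proof.
move=> s1; apply: (@cvgB _ _ _ (nbhs s)); last exact: zlap_cont hh'' s1.
by apply: (@cvgM _ _ (nbhs s)); [exact: (@cvg_cst _ _ _ (nbhs s))|exact: h_cont].
Qed.

Lemma sqi_b : sqi om b. Proof. exact: zonal_sqi h_cont. Qed.
Lemma sqi_c : sqi om c. Proof. exact: zonal_sqi c_cont. Qed.

Lemma zopN_cont p s : `|p| < 1 -> `|s| <= 1 ->
  {for s, continuous (zop (N p) (N' p) (N'' p))}.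
Proof.
move=> p1 s1; apply: (@cvgB _ _ _ (nbhs s)); last exact: zlap_cont (zC1_kN' a p1) s1.
by apply: (@cvgM _ _ (nbhs s)); [exact: (@cvg_cst _ _ _ (nbhs s))|exact: kN_cont].
Qed.

Lemma zopN_measurable p : measurable_fun setT (zop (N p) (N' p) (N'' p)).
Proof.
have mQ q : measurable_fun setT (kQ q p) by exact: kQ_measurable.
apply: measurable_funB; first by apply: measurable_funM => //; exact: mQ.
apply: measurable_funB.
  apply: measurable_funM; first by apply: measurable_funB => //; exact: measurable_funX.
  by apply: measurable_funM => //; apply: measurable_funM => //; exact: mQ.
apply: measurable_funM; first exact: measurable_funM.
by apply: measurable_funM => //; exact: mQ.
Qed.

Lemma unit_bounded (k : R -> R) : (forall s, `|s| <= 1 -> {for s, continuous k}) ->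
  exists2 M, 0 < M & forall s, `|s| <= 1 -> `|k s| <= M.
Proof.
move=> kc; have := @compact_continuous_bounded R R (`[-1, 1]%classic : set R) k (@segment_compact R _ _).
case=> [s|M hM].
  by rewrite inE/= in_itv/= -ler_norml; exact: kc.
exists (`|M| + 1); first by rewrite ltr_wpDl.
move=> s; rewrite ler_norml => s1; apply: (@le_trans _ _ M).
  by apply: hM; rewrite /= in_itv.
by rewrite (le_trans (ler_norm M))// lerDl.
Qed.

Lemma schur_cont (k : R -> R) : measurable_fun setT k ->
  (forall s, `|s| <= 1 -> {for s, continuous k}) ->
  exists2 m, 0 < m & schur om (zK k) m.
Proof.
move=> mk kc; have [M M0 kM] := unit_bounded kc.
by exists (M * w); [exact: mulr_gt0|exact: schur_zK_bounded].
Qed.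

Lemma zK_sqi (k : R -> R) x : measurable_fun setT k ->
  (forall s, `|s| <= 1 -> {for s, continuous k}) -> sqi om (zK k x).
Proof.
move=> mk kc; have [m m0 sk] := schur_cont mk kc; have [M M0 kM] := unit_bounded kc.
apply: (@sqi_bounded _ _ _ om _ M); first exact: schur_section sk.
by move=> y; apply: kM; exact: edot_radial2_le1.
Qed.

Lemma kN_measurable p : measurable_fun setT (N p). Proof. exact: kQ_measurable. Qed.

Lemma kP_measurable p : measurable_fun setT (P p).
Proof. by apply: measurable_funM => //; exact: kQ_measurable. Qed.

(** Green's formula moves a^2 - Delta from the zonal function onto the kernel, which is regular
    because r_n < 1. *)
Lemma iop_kN_zop n y : sphere R d y ->
  iop om (zK (N (rn n))) c y =
  iop om (zK (zop (N (rn n)) (N' (rn n)) (N'' (rn n)))) b y.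
Proof.
move=> Sy; have p1 := rn_lt1 n; have Ry : radial y = y by exact: radial_sphere.
have zc (k k' k'' : R -> R) : zC1 k k' -> zC1 k' k'' -> forall s, `|s| <= 1 ->
    {for s, continuous (zlap d k' k'')}.
  by move=> _ k2 s s1; exact: zlap_cont k2 s1.
have nN := zC1_kN a p1; have nN' := zC1_kN' a p1.
have i1 := zonal_pair_itg Sz0 Sy h_cont (fun s => @kN_cont _ d _ s p1).
have i2 := zonal_pair_itg Sz0 Sy (zc _ _ _ hh' hh'') (fun s => @kN_cont _ d _ s p1).
have i3 := zonal_pair_itg Sy Sz0 (zc _ _ _ nN nN') h_cont.
transitivity (a ^+ 2 * \int[om]_x (h (edot (radial x) z0) * N (rn n) (edot (radial x) y)) -
  \int[om]_x (zlap d h' h'' (edot (radial x) z0) * N (rn n) (edot (radial x) y))).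
  rewrite -RintegralZl// -RintegralB//; last exact: itgZ.
  by apply: eq_Rintegral => x _; rewrite /c /zop /zK Ry [edot y _]edotC; ring.
rewrite (zonal_green Sz0 Sy hh'' nN).
have -> : - (\int[om]_x (h' (edot (radial x) z0) * N' (rn n) (edot (radial x) y) *
    (edot z0 y - edot (radial x) z0 * edot (radial x) y))) =
    \int[om]_x (zlap d (N' (rn n)) (N'' (rn n)) (edot (radial x) y) * h (edot (radial x) z0)).
  rewrite (zonal_green Sy Sz0 nN' hh'); congr (- _); apply: eq_Rintegral => x _.
  by rewrite [edot z0 y]edotC; ring.
rewrite -RintegralZl// -RintegralB//; last exact: itgZ.
by apply: eq_Rintegral => x _; rewrite /b /zop /zK Ry [edot y _]edotC; ring.
Qed.

Lemma kernel_square_iop n m x : sphere R d x ->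
  iop om (zK (N (rn n))) (iop om (zK (N (rn m))) c) x =
  a ^+ 2 * iop om (zK (P (rn n))) (iop om (zK (P (rn m))) b) x.
Proof.
move=> Sx; have p1 := rn_lt1 m; have r1 := rn_lt1 n.
have Rx : radial x = x by exact: radial_sphere.
have zN := zopN_measurable (rn m); have zNc := fun s => @zopN_cont (rn m) s p1.
have [K K0 sK] := schur_cont zN zNc; have sb := sqi_b.
have kNc := fun s => @kN_cont _ d _ s r1; have kPc := fun s => @kP_cont _ a _ s r1.
have -> : iop om (zK (N (rn n))) (iop om (zK (N (rn m))) c) x =
    iop om (zK (N (rn n))) (iop om (zK (zop (N (rn m)) (N' (rn m)) (N'' (rn m)))) b) x.
  apply: eq_Rintegral_ae; apply: filterS ae_sphere => y Sy.
  by rewrite iop_kN_zop.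
rewrite (iop_comp K0 sK sb) ?(iop_comp w0 (sP m) sb); last first.
- by apply: zK_sqi => //; exact: kN_measurable.
- by apply: zK_sqi => //; exact: kP_measurable.
have sM : sqi om (fun z => \int[om]_y (zK (P (rn m)) y z * zK (P (rn n)) x y)).
  have [] := iop_sqi w0 (schur_tr (sP m)) (zK_sqi x (@kP_measurable (rn n)) kPc).
  by move=> + _; apply.
rewrite -(ipZr ph)//; apply: eq_ip_ae; first exact: nearW.
apply: filterS ae_sphere => z Sz; have Rz : radial z = z by exact: radial_sphere.
transitivity (\int[om]_y (N (rn n) (edot (radial y) x) *
    zop (N (rn m)) (N' (rn m)) (N'' (rn m)) (edot (radial y) z))).
  by apply: eq_Rintegral => y _; rewrite /zK Rx Rz [edot x _]edotC mulrC.
rewrite -(kernel_square hd Sx Sz r1 p1).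
rewrite -[RHS]/(a ^+ 2 * \int[om]_y (zK (P (rn m)) y z * zK (P (rn n)) x y)).
by under [in RHS]eq_Rintegral => y _ do rewrite /zK Rx Rz [edot x _]edotC mulrC.
Qed.

(** For regularized kernels, N_n N_m c = a^2 P_n P_m b by [kernel_square_iop]. First n tends to
    infinity with m fixed, then m: the N's tend to G and the P's to the identity. Limits in L^2 are
    unique almost everywhere. *)
Lemma parametrix : {ae om, forall x, Gop (Gop c) x = a ^+ 2 * b x}.
Proof.
have sb := sqi_b; have sc := sqi_c.
have sG f : sqi om f -> sqi om (Gop f) by exact: zT_sqi w0 sN1.
have sZN m f : sqi om f -> sqi om (zT (N (rn m)) f) by exact: zT_sqi w0 (sN m).
have sZP m f : sqi om f -> sqi om (zT (P (rn m)) f) by exact: zT_sqi w0 (sP m).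
have e m : {ae om, forall x, Gop (zT (N (rn m)) c) x = (a ^+ 2 *: zT (P (rn m)) b) x}.
  apply: (@tends_unique _ _ _ om (fun n => zT (N (rn n)) (zT (N (rn m)) c))).
  - by move=> n; apply: (sZN); exact: sZN.
  - by apply: (sG); exact: sZN.
  - by apply: sqiZ; exact: sZP.
  - by apply: zT_kN_cvg => //; exact: sZN.
  have := tendsZ (a ^+ 2) (fun n => sZP n _ (sZP m _ sb)) (sZP m _ sb) (zT_kP_cvg hd (sZP m _ sb)).
  apply: tends_ae => [n|]; last exact: nearW.
  apply: filterS3 ae_sphere (zT_zT (sN n) (sN m) sc) (zT_zT (sP n) (sP m) sb) => x Sx h1 h2.
  rewrite h1 kernel_square_iop// -[(a ^+ 2 *: _) x]/(a ^+ 2 * zT _ _ x) h2.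
  by rewrite mulrCA.
suff : {ae om, forall x, Gop (Gop c) x = (a ^+ 2 *: b) x} by apply: filterS => x ->.
apply: (@tends_unique _ _ _ om (fun m => Gop (zT (N (rn m)) c))).
- by move=> n; apply: (sG); exact: sZN.
- by apply: (sG); exact: sG.
- exact: sqiZ.
- by apply: zT_tends => //; [move=> n; exact: sZN|exact: sG|exact: zT_kN_cvg].
have := tendsZ (a ^+ 2) (fun n => sZP n _ sb) sb (zT_kP_cvg hd sb).
by apply: tends_ae => [n|]; [apply: filterS (e n) => x ->|exact: nearW].
Qed.

End bump.

Lemma Gop_sym f g : sqi om f -> sqi om g -> ip om (Gop f) g = ip om f (Gop g).
Proof. exact: zT_sym w0 sN1. Qed.

Lemma Gop_sqi f : sqi om f -> sqi om (Gop f).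
Proof. exact: zT_sqi w0 sN1. Qed.

(* N_1 is bounded below by c = 4^(-a), so N_1 - c satisfies Schur's test with a smaller constant:
   if Gg = -g then ||g|| <= ||g + c mean(g)|| = ||(G - c mean) g|| <= (1 - c) ||g||. *)
Lemma Gop_opp_eq0 g : sqi om g -> {ae om, forall x, Gop g x = - g x} ->
  {ae om, forall x, g x = 0}.
Proof.
move=> sg Gg; pose c := expR (- a * ln 4) : R.
have c0 : 0 < c by exact: expR_gt0.
have l4 : 0 < ln 4 :> R by rewrite ln_gt0// ltr1n.
have c1 : c < 1 by rewrite -expR0 ltr_expR mulNr oppr_lt0 mulr_gt0.
have cN s : `|s| <= 1 -> c <= N 1 s.
  rewrite ler_norml => /andP[s1 s2]; rewrite /kN /kQ ler_expR !mulNr lerN2 ler_wpM2l ?(ltW a0)//.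
  have [q0|q0] := ltP 0 (kq 1 s); last by rewrite (ln0 q0) ltW.
  by rewrite ler_ln ?posrE// /kq expr1n; lra.
pose k s := N 1 s - c; pose m := (1 - c) * w.
have m0 : 0 < m by rewrite mulr_gt0// subr_gt0.
have mk : measurable_fun setT k by apply: measurable_funB => //; exact: kQ_measurable.
have sk : schur om (zK k) m.
  have [_ K1 _] := sN1.
  have h (x : E) : (\int[om]_y `|zK k x y|%:E <= m%:E)%E.
    have iN : itg om (fun y => zK (N 1) x y).
      apply/integrableP; split; first by apply/measurable_EFinP; exact: schur_section sN1.
      by apply: le_lt_trans (K1 x) (ltry _).
    have e : (\int[om]_y `|zK k x y|%:E = (\int[om]_y (zK (N 1) x y - c))%:E)%E.
      rewrite /Rintegral fineK; last first.
        by apply: integrable_fin_num => //; apply: itgB => //; exact: itg_cst.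
      apply: eq_integral => y _; rewrite ger0_norm// subr_ge0; apply: cN.
      exact: edot_radial2_le1.
    rewrite e lee_fin RintegralB//; last exact: itg_cst.
    rewrite (Rintegral_zonal_cst c) /m mulrBl mul1r lerD2r -lee_fin.
    apply: le_trans (K1 x); rewrite /Rintegral fineK ?integrable_fin_num//.
    rewrite le_eqVlt; apply/orP; left; apply/eqP; apply: eq_integral => y _.
    by rewrite ger0_norm// ltW// kQ_gt0.
  split; [exact: zK_measurable|exact: h|].
  by move=> y; under eq_integral do rewrite zK_sym; exact: h.
have [_ b1] := iop_sqi m0 sk sg.
pose I := \int[om]_y g y.
have e1 : {ae om, forall x, iop om (zK k) g x = - (w *: (g + cst (c * I / w))) x}.
  apply: filterS2 (schur_ae sN1 sg) Gg => x [_ i1] h.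
  rewrite /iop /zK /k; under eq_Rintegral do rewrite mulrBl.
  rewrite RintegralB//; last by apply: itgZ; exact: sqi_itg.
  rewrite RintegralZl//; last exact: sqi_itg.
  rewrite -[RHS]/(- (w * (g x + c * I / w))) -/I.
  have -> : g x = - Gop g x by rewrite h opprK.
  rewrite /Gop /zT /iop /zK; move: (\int[om]_y _) => J; move: I => I0.
  by rewrite mulrDr mulrN mulVKf ?gt_eqF// [w * _]mulrC mulfVK ?gt_eqF// opprD opprK.
have e2 : nrm (ip om) (iop om (zK k) g) = w * nrm (ip om) (g + cst (c * I / w)).
  rewrite (eq_nrm_ae (g := - (w *: (g + cst (c * I / w))))); last by apply: filterS e1 => x ->.
  have sc : sqi om (g + cst (c * I / w)) by apply: sqiD => //; exact: sqi_cst.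
  by rewrite (nrmN ph) ?(nrmZ ph) ?ger0_norm ?(ltW w0)//; exact: sqiZ.
have e3 : nrm (ip om) g <= nrm (ip om) (g + cst (c * I / w)).
  have sc : sqi om (cst (c * I / w) : E -> R) by exact: sqi_cst.
  rewrite ler_wsqrtr// (ipDl ph)//; last exact: sqiD.
  rewrite !(ipDr ph)// (ipC ph sc sg) addrA -!addrA lerDl.
  have -> : ip om g (cst (c * I / w)) = c * I ^+ 2 / w.
    rewrite /ip (_ : (fun x => g x * _) = fun x => g x * (c * I / w))//.
    rewrite RintegralZr//; last exact: sqi_itg.
    rewrite (_ : \int[om]_x g x = I)//; by rewrite expr2 !mulrA [I * c]mulrC.
  by rewrite !addr_ge0 ?(ip_ge0 ph)// divr_ge0 ?(ltW w0)// mulr_ge0 ?sqr_ge0// ltW.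
apply: nrm_eq0 => //; apply/eqP; rewrite eq_le nrm_ge0 andbT.
have : w * nrm (ip om) g <= (1 - c) * w * nrm (ip om) g.
  by apply: le_trans b1; rewrite e2 ler_wpM2l ?(ltW w0).
by move=> h; rewrite -(pmulr_rle0 _ (mulr_gt0 c0 w0)); lra.
Qed.

End parametrix.

Section gram.
Context {R : realType} dsp (T : measurableType dsp) (mu : {finite_measure set T -> \bar R}).
Let ph := sqi_prehilbert mu.

(** Turns an identity between composed kernels into one between inner products: every term is the
    pairing of f with an iterated integral of f, whose kernel is a composition. *)
Lemma iop_gram (J : finType) (K K' : J -> T -> T -> R) (P P' N N' : T -> T -> R)
    (M M' w b : R) (f : T -> R) : 0 < M -> 0 < M' -> 0 < w ->
  (forall i, schur mu (K i) M) -> (forall i, schur mu (K' i) M') ->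
  schur mu P w -> schur mu P' w -> schur mu N w -> schur mu N' w -> sqi mu f ->
  (forall i y, sqi mu (fun x => K i x y)) -> (forall y, sqi mu (fun x => P x y)) ->
  (forall y, sqi mu (fun x => N x y)) ->
  {ae mu, forall y, {ae mu, forall z, \sum_i \int[mu]_x (K' i x z * K i x y) =
    b * \int[mu]_x (P' x z * P x y) - b * \int[mu]_x (N' x z * N x y)}} ->
  \sum_i ip mu (iop mu (K i) f) (iop mu (K' i) f) =
  b * ip mu (iop mu P f) (iop mu P' f) - b * ip mu (iop mu N f) (iop mu N' f).
Proof.
move=> M0 M'0 w0 sK sK' sP sP' sN sN' sf sKy sPy sNy H.
have sI (L : T -> T -> R) mm : 0 < mm -> schur mu L mm -> forall g, sqi mu g -> sqi mu (iop mu L g).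
  by move=> mm0 sL g sg; have [] := iop_sqi mm0 sL sg.
pose A i := iop mu (fun y x => K i x y) (iop mu (K' i) f).
pose B := iop mu (fun y x => P x y) (iop mu P' f).
pose C := iop mu (fun y x => N x y) (iop mu N' f).
have sA i : sqi mu (A i).
  exact: (sI _ _ M0 (schur_tr (sK i)) _ (sI _ _ M'0 (sK' i) _ sf)).
have sB : sqi mu B by exact: (sI _ _ w0 (schur_tr sP) _ (sI _ _ w0 sP' _ sf)).
have sC : sqi mu C by exact: (sI _ _ w0 (schur_tr sN) _ (sI _ _ w0 sN' _ sf)).
have ipsum (g : T -> R) (G : J -> T -> R) : sqi mu g -> (forall i, sqi mu (G i)) ->
    \sum_i ip mu g (G i) = ip mu g (fun x => \sum_i G i x).
  move=> sg' sG; rewrite /ip -Rintegral_sum; last by move=> i; exact: sqi_mul_itg.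
  by apply: eq_Rintegral => x _; rewrite mulr_sumr.
under eq_bigr do rewrite (ip_iop_pair M0 M'0 (sK _) (sK' _) sf) -/(A _).
rewrite (ip_iop_pair w0 w0 sP sP' sf) -/B (ip_iop_pair w0 w0 sN sN' sf) -/C.
pose A' y i z := \int[mu]_x (K' i x z * K i x y).
pose B' y z := \int[mu]_x (P' x z * P x y); pose C' y z := \int[mu]_x (N' x z * N x y).
have eA y i : A i y = ip mu f (A' y i).
  exact: (iop_comp (K := fun y x => K i x y) M'0 (sK' i) sf (sKy i y)).
have eB y : B y = ip mu f (B' y).
  exact: (iop_comp (K := fun y x => P x y) w0 sP' sf (sPy y)).
have eC y : C y = ip mu f (C' y).
  exact: (iop_comp (K := fun y x => N x y) w0 sN' sf (sNy y)).
have s1 y i : sqi mu (A' y i) by exact: (sI _ _ M'0 (schur_tr (sK' i)) _ (sKy i y)).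
have s2 y : sqi mu (B' y) by exact: (sI _ _ w0 (schur_tr sP') _ (sPy y)).
have s3 y : sqi mu (C' y) by exact: (sI _ _ w0 (schur_tr sN') _ (sNy y)).
have {}H : {ae mu, forall y, {ae mu, forall z, \sum_i A' y i z = b * B' y z - b * C' y z}}.
  exact: H.
clearbody A B C A' B' C'.
have comb (G : J -> T -> R) g1 g2 : (forall i, sqi mu (G i)) -> sqi mu g1 -> sqi mu g2 ->
    {ae mu, forall z, \sum_i G i z = b * g1 z - b * g2 z} ->
    \sum_i ip mu f (G i) = b * ip mu f g1 - b * ip mu f g2.
  move=> sG sg1 sg2 h.
  rewrite (ipsum _ _ sf sG) -(ipZr ph _ sg1 sf) -(ipZr ph _ sg2 sf).
  rewrite -(ipBr ph (sqiZ _ sg1) (sqiZ _ sg2) sf).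
  by apply: eq_ip_ae => //; exact: nearW.
apply: (comb) => //; apply: filterS H => y Hy.
by under eq_bigr do rewrite eA; rewrite eB eC; exact: comb.
Qed.

End gram.

(** * The weak surface gradient of G f *)

Section weak_gradient.
Context {R : realType} {d : nat}.
Local Notation E := 'rV[R]_d.
Local Notation om := (omega R d).
Local Notation w := (omega_d R d).
Hypothesis hd : (3 <= d)%N.
Local Notation a := (@ka R d).
Local Notation N := (kN a).
Local Notation P := (kP a).
Local Notation N' := (kN' a).
Local Notation N'' := (kN'' a).
Local Notation rn := (@rn R).
Local Notation zop := (@zop R d).
Let a0 : 0 < a := ka_gt0 hd.
Let w0 : 0 < w. Proof. by apply: omega_d_gt0; exact: leq_trans hd. Qed.
Let r01 n : 0 <= rn n < 1 := rn_01 n.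
Let sN n : schur om (zK (N (rn n))) w := schur_kN hd (r01 n).
Let sP n : schur om (zK (P (rn n))) w := schur_kP hd (r01 n).
Let ph := sqi_prehilbert om.
Local Opaque kQ kN kP kN' kN'' zlap omega Rintegral.

(** The i-th component of the surface gradient in x of N_r(x . y). *)
Definition gK r (i : 'I_d) (x y : E) : R := N' r (edot (radial x) (radial y)) *
  (radial y ord0 i - edot (radial x) (radial y) * radial x ord0 i).

Lemma kN'_cont p s : `|p| < 1 -> `|s| <= 1 -> {for s, continuous (N' p)}.
Proof. by move=> p1 s1; exact: zC1_cont (zC1_kN' a p1) s1. Qed.

Lemma kN'_measurable p : measurable_fun setT (N' p).
Proof. by apply: measurable_funM => //; exact: kQ_measurable. Qed.

Lemma radial_coord_le1 (x : E) i : `|radial x ord0 i| <= 1.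
Proof. exact: le_trans (coord_le_enorm _ _) (enorm_radial_le1 _). Qed.

Lemma gK_measurable r i : measurable_fun setT (fun p : E * E => gK r i p.1 p.2).
Proof.
apply: measurable_funM; first exact: (zK_measurable (kN'_measurable r)).
apply: measurable_funB.
  exact: (measurableT_comp (measurable_radial_coord i) measurable_snd).
apply: measurable_funM; first exact: measurable_edot_radial.
exact: (measurableT_comp (measurable_radial_coord i) measurable_fst).
Qed.

Lemma schur_gK n : exists2 m, 0 < m & forall i,
  schur om (gK (rn n) i) m /\ forall x y, `|gK (rn n) i x y| <= m / w.
Proof.
have [M M0 hM] := unit_bounded (fun s => @kN'_cont (rn n) s (rn_lt1 n)).
have b i x y : `|gK (rn n) i x y| <= M * 2.
  rewrite /gK normrM; apply: ler_pM => //; first by apply: hM; exact: edot_radial2_le1.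
  apply: le_trans (ler_normB _ _) _; have := radial_coord_le1 y i => h1.
  suff : `|edot (radial x) (radial y) * radial x ord0 i| <= 1 by lra.
  by rewrite normrM mulr_ile1// ?edot_radial2_le1// radial_coord_le1.
exists (M * 2 * w) => [|i]; first by rewrite !mulr_gt0.
rewrite mulfK ?gt_eqF//; split => //.
rewrite (_ : w = fine (om setT)); last by rewrite omega_setT.
by apply: schur_bounded => //; exact: gK_measurable.
Qed.

Definition gT n i f : E -> R := w^-1 *: iop om (gK (rn n) i) f.

Lemma gT_sqi n i f : sqi om f -> sqi om (gT n i f).
Proof.
move=> sf; have [m m0 /(_ i)[sK _]] := schur_gK n.
by apply: sqiZ; have [] := iop_sqi m0 sK sf.
Qed.

(** By Green's formula the left-hand side is the integral of N_n (- Delta) N_m, and [kernel_square]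
    trades this Laplacian for Poisson kernels. Gradients of nearly singular kernels are thus
    controlled by an approximate identity. *)
Lemma gK_sum (y z : E) n m : sphere R d y -> sphere R d z ->
  \sum_i \int[om]_x (gK (rn m) i x z * gK (rn n) i x y) =
  a ^+ 2 * \int[om]_x (zK (P (rn m)) x z * zK (P (rn n)) x y) -
  a ^+ 2 * \int[om]_x (zK (N (rn m)) x z * zK (N (rn n)) x y).
Proof.
move=> Sy Sz; have Ry : radial y = y by exact: radial_sphere.
have Rz : radial z = z by exact: radial_sphere.
have r1 := rn_lt1 (R := R) n; have p1 := rn_lt1 (R := R) m.
have iK i : itg om (fun x => gK (rn m) i x z * gK (rn n) i x y).
  have [M M0 /(_ i)[_ hM]] := schur_gK m; have [M' M'0 /(_ i)[_ hM']] := schur_gK n.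
  apply: (@itg_bounded _ _ _ om _ (M / w * (M' / w))).
    apply: measurable_funM.
      exact: (measurableT_comp (gK_measurable (rn m) i) (pair2_measurable z)).
    exact: (measurableT_comp (gK_measurable (rn n) i) (pair2_measurable y)).
  by move=> x; rewrite normrM; apply: ler_pM.
rewrite -Rintegral_sum//.
have kc q : `|q| < 1 -> forall s, `|s| <= 1 -> {for s, continuous (N q)}.
  by move=> q1 s s1; exact: kN_cont.
have lc q : `|q| < 1 -> forall s, `|s| <= 1 -> {for s, continuous (zlap d (N' q) (N'' q))}.
  by move=> q1 s s1; exact: zlap_cont (zC1_kN' a q1) s1.
have iNN : itg om (fun x => N (rn n) (edot (radial x) y) * N (rn m) (edot (radial x) z)).
  exact: zonal_pair_itg Sy Sz (kc _ r1) (kc _ p1).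
have iNL : itg om (fun x => N (rn n) (edot (radial x) y) * zlap d (N' (rn m)) (N'' (rn m)) (edot (radial x) z)).
  exact: zonal_pair_itg Sy Sz (kc _ r1) (lc _ p1).
have -> : \int[om]_x (zK (P (rn m)) x z * zK (P (rn n)) x y) =
    \int[om]_x (P (rn n) (edot (radial x) y) * P (rn m) (edot (radial x) z)).
  by apply: eq_Rintegral => x _; rewrite /zK Ry Rz mulrC.
rewrite (kernel_square hd Sy Sz r1 p1).
have -> : \int[om]_x (N (rn n) (edot (radial x) y) *
      zop (N (rn m)) (N' (rn m)) (N'' (rn m)) (edot (radial x) z)) =
    a ^+ 2 * \int[om]_x (zK (N (rn m)) x z * zK (N (rn n)) x y) -
    \int[om]_x (N (rn n) (edot (radial x) y) * zlap d (N' (rn m)) (N'' (rn m)) (edot (radial x) z)).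
  have e : \int[om]_x (zK (N (rn m)) x z * zK (N (rn n)) x y) =
      \int[om]_x (N (rn n) (edot (radial x) y) * N (rn m) (edot (radial x) z)).
    by apply: eq_Rintegral => x _; rewrite /zK Ry Rz mulrC.
  rewrite e -(RintegralZl _ measurableT iNN) -(RintegralB measurableT (itgZ _ iNN) iNL).
  by apply: eq_Rintegral => x _; rewrite /zop; ring.
rewrite addrAC subrr add0r.
under [in RHS]eq_Rintegral do rewrite mulrC.
rewrite (zonal_green Sz Sy (zC1_kN' a p1) (zC1_kN a r1)) opprK.
apply: eq_Rintegral_ae; apply: filterS ae_sphere => x Sx.
have Rx : radial x = x by exact: radial_sphere.
rewrite /gK Rx Ry Rz.
set s := edot x y; set s' := edot x z.
transitivity (N' (rn m) s' * N' (rn n) s * edot (z - s' *: x) (y - s *: x)).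
  by rewrite /edot mulr_sumr; apply: eq_bigr => i _; rewrite !mxE; ring.
congr (_ * _); rewrite edotBl !edotBr !edotZl !edotZr (edot_sphere Sx) -/s.
by rewrite [edot z x]edotC -/s' ; ring.
Qed.

Lemma gT_ip n m f : sqi om f ->
  \sum_i ip om (gT n i f) (gT m i f) =
  a ^+ 2 * ip om (zT (P (rn n)) f) (zT (P (rn m)) f) -
  a ^+ 2 * ip om (zT (N (rn n)) f) (zT (N (rn m)) f).
Proof.
move=> sf; have [M M0 hM] := schur_gK n; have [M' M'0 hM'] := schur_gK m.
have sw K mm : 0 < mm -> schur om K mm -> sqi om (iop om K f).
  by move=> mm0 sK; have [] := iop_sqi mm0 sK sf.
have eZ (K K' : E -> E -> R) mm mm' : 0 < mm -> 0 < mm' -> schur om K mm -> schur om K' mm' ->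
    ip om (w^-1 *: iop om K f) (w^-1 *: iop om K' f) = w^-1 ^+ 2 * ip om (iop om K f) (iop om K' f).
  move=> m0 m'0 sK sK'; have s1 := sw _ _ m0 sK; have s2 := sw _ _ m'0 sK'.
  by rewrite (ipZl ph _ s1 (sqiZ w^-1 s2)) (ipZr ph _ s2 s1) mulrA -expr2.
have sPy y : sqi om (fun x => zK (P (rn n)) x y).
  rewrite (_ : (fun x => _) = zK (P (rn n)) y); last by apply/funext => x; exact: zK_sym.
  by apply: (zK_sqi hd) => [|s s1]; [exact: kP_measurable|exact: kP_cont (rn_lt1 n) s1].
have sNy y : sqi om (fun x => zK (N (rn n)) x y).
  rewrite (_ : (fun x => _) = zK (N (rn n)) y); last by apply/funext => x; exact: zK_sym.
  by apply: (zK_sqi hd) => [|s s1]; [exact: kN_measurable|exact: kN_cont (rn_lt1 n) s1].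
have sKy i y : sqi om (fun x => gK (rn n) i x y).
  have [h1 h2] := hM i; apply: (@sqi_bounded _ _ _ om _ (M / w)); last by move=> x; exact: h2.
  exact: schur_section (schur_tr h1).
have := @iop_gram _ _ _ om 'I_d (gK (rn n)) (gK (rn m)) (zK (P (rn n))) (zK (P (rn m)))
  (zK (N (rn n))) (zK (N (rn m))) M M' w (a ^+ 2) f M0 M'0 w0 (fun i => (hM i).1)
  (fun i => (hM' i).1) (sP n) (sP m) (sN n) (sN m) sf sKy sPy sNy.
move=> H; under eq_bigr => i _.
  have e : ip om (gT n i f) (gT m i f) = _ := eZ _ _ _ _ M0 M'0 (hM i).1 (hM' i).1.
  rewrite e; over.
rewrite -mulr_sumr H.
  by rewrite (eZ _ _ _ _ w0 w0 (sP n) (sP m)) (eZ _ _ _ _ w0 w0 (sN n) (sN m)); ring.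
by apply: filterS ae_sphere => y Sy; apply: filterS ae_sphere => z Sz; exact: gK_sum.
Qed.

(** By [gT_ip], the squared distance of two regularized gradients, summed over the components, is
    a^2 times that of the Poisson means minus a^2 times that of the means by N. Dropping the
    subtracted term leaves Poisson means, which converge. *)
Lemma gT_cauchy f i : sqi om f -> cauchy_seq (ip om) (fun n => gT n i f).
Proof.
move=> sf; pose p n := zT (P (rn n)) f; pose q n := zT (N (rn n)) f.
pose g n j := gT n j f.
have sp n : sqi om (p n) by exact: zT_sqi w0 (sP n) sf.
have sq n : sqi om (q n) by exact: zT_sqi w0 (sN n) sf.
have sg n j : sqi om (g n j) by exact: gT_sqi.
have c : cauchy_seq (ip om) p by exact: (tends_cauchy ph sp sf (zT_kP_cvg hd sf)).
have H n m : \sum_j ip om (g n j) (g m j) = a ^+ 2 * ip om (p n) (p m) - a ^+ 2 * ip om (q n) (q m).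
  exact: gT_ip.
change (cauchy_seq (ip om) (fun n => g n i)).
clearbody g p q => e e0; have [K hK] := c _ (divr_gt0 e0 a0).
exists K => m n Km Kn; have := hK m n Km Kn.
rewrite ler_pdivlMr// => h; apply: le_trans h.
have ipB (u v : E -> R) : sqi om u -> sqi om v ->
    nrm (ip om) (u - v) ^+ 2 = ip om u u - ip om u v - (ip om v u - ip om v v).
  by move=> su sv; rewrite (nrm_sqr ph) ?(ipBl ph) ?(ipBr ph)//; exact: sqiB.
rewrite -(ler_pXn2r (n := 2))// ?nnegrE ?nrm_ge0//; last first.
  by apply: mulr_ge0; [exact: nrm_ge0|exact: ltW a0].
apply: (@le_trans _ _ (\sum_j nrm (ip om) (g m j - g n j) ^+ 2)).
  by rewrite (bigD1 i)//= lerDl; apply: sumr_ge0 => j _; exact: sqr_ge0.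
under eq_bigr do rewrite ipB//.
rewrite !sumrB !H [leRHS]exprMn.
have := ipB _ _ (sp m) (sp n); have := ipB _ _ (sq m) (sq n) => h1 h2.
have := sqr_ge0 (nrm (ip om) (q m - q n)).
rewrite h2 h1 => h3; have := mulr_ge0 (sqr_ge0 a) h3; lra.
Qed.

Lemma smooth_coord_sqi (X : E -> E) i : smooth X -> sqi om (fun x => X (radial x) ord0 i).
Proof.
move=> sX; have [h1 _ _ _] := smooth_C1 sX i.
have hc x : x != 0 -> {for x, continuous ((fun x => X x ord0 i) \o @radial R d)}.
  by move=> x0; apply: continuous_comp; [exact: radial_continuous|exact: h1].
have [M hM] := radial_fun_bounded hc.
by apply: (@sqi_bounded _ _ _ om _ M) => //; exact: continuous_off0_measurable hc.
Qed.

Lemma sdiv_sqi (X : E -> E) : smooth X -> sqi om (fun x => sdiv X (radial x)).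
Proof.
move=> sX; have hc x : x != 0 -> {for x, continuous (sdiv X \o @radial R d)} by exact: sdiv_radial_cont.
have [M hM] := radial_fun_bounded hc.
by apply: (@sqi_bounded _ _ _ om _ M) => //; exact: continuous_off0_measurable hc.
Qed.

Lemma gT_weak f X n : sqi om f -> smooth_tangent X ->
  \sum_i ip om (gT n i f) (fun x => X (radial x) ord0 i) =
  - ip om (zT (N (rn n)) f) (fun x => sdiv X (radial x)).
Proof.
move=> sf sX; have [smX tX] := sX; have [M M0 hM] := schur_gK n.
have sXi i := smooth_coord_sqi i smX; have sdX := sdiv_sqi smX.
have sI K mm : 0 < mm -> schur om K mm -> forall g, sqi om g -> sqi om (iop om K g).
  by move=> mm0 sK g sg; have [] := iop_sqi mm0 sK sg.
have e1 i : ip om (gT n i f) (fun x => X (radial x) ord0 i) =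
    w^-1 * ip om f (iop om (fun y x => gK (rn n) i x y) (fun x => X (radial x) ord0 i)).
  have [h1 _] := hM i; rewrite /gT (ipZl ph _ (sI _ _ M0 h1 _ sf) (sXi i)).
  by rewrite (iop_swap h1 sf (sXi i)).
under eq_bigr do rewrite e1.
rewrite -mulr_sumr.
have sA i : sqi om (iop om (fun y x => gK (rn n) i x y) (fun x => X (radial x) ord0 i)).
  by have [h1 _] := hM i; exact: (sI _ _ M0 (schur_tr h1) _ (sXi i)).
have -> : \sum_i ip om f (iop om (fun y x => gK (rn n) i x y) (fun x => X (radial x) ord0 i)) =
    ip om f (fun y => \sum_i iop om (fun y x => gK (rn n) i x y) (fun x => X (radial x) ord0 i) y).
  rewrite /ip -Rintegral_sum; last by move=> i; exact: sqi_mul_itg.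
  by apply: eq_Rintegral => x _; rewrite mulr_sumr.
rewrite (_ : zT (N (rn n)) f = w^-1 *: iop om (zK (N (rn n))) f)// (ipZl ph _ (sI _ _ w0 (sN n) _ sf) sdX).
rewrite (iop_swap (sN n) sf sdX) -mulrN -(ipNr ph (sI _ _ w0 (schur_tr (sN n)) _ sdX) sf).
congr (_ * _); apply: eq_ip_ae; first exact: nearW.
apply: filterS ae_sphere => y Sy; have Ry : radial y = y by exact: radial_sphere.
have iK i : itg om (fun x => gK (rn n) i x y * X (radial x) ord0 i).
  have [h1 h2] := hM i; apply: sqi_mul_itg (sXi i).
  apply: (@sqi_bounded _ _ _ om _ (M / w)) => //; exact: schur_section (schur_tr h1).
rewrite /iop -Rintegral_sum//.
transitivity (\int[om]_x (N' (rn n) (edot (radial x) y) *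
     edot (X (radial x)) (y - edot (radial x) y *: radial x))).
  apply: eq_Rintegral => x _; rewrite /gK Ry; move: (radial x) => u.
  by rewrite {4}/edot mulr_sumr; apply: eq_bigr => i _; rewrite !mxE; ring.
have := zonal_green_field Sy (zC1_kN a (rn_lt1 n)) sX.
move/(congr1 (fun z => - z)); rewrite opprK => <-.
rewrite -[RHS]/(- iop om (fun x y => zK (N (rn n)) y x) (fun x => sdiv X (radial x)) y).
by apply: congr1; apply: eq_Rintegral => x _; rewrite /zK Ry.
Qed.

Lemma weak_sgrad_Gop f : sqi om f -> exists F, weak_sgrad (Gop f) F.
Proof.
move=> sf; have sg n i := gT_sqi n i sf.
have /choice[F hF] i : exists F, sqi om F /\ tends (ip om) (fun n => gT n i f) F.
  by have [F sF tF] := sqi_complete (fun n => sg n i) (gT_cauchy i sf); exists F.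
have sGf := Gop_sqi hd sf.
(* The radial part of the limit. Subtracting it makes the field tangent without taking tangency to
   the limit, and changes no pairing with a tangent field. *)
pose q x := \sum_i F i x * radial x ord0 i.
have sR (u : E -> R) i : sqi om u -> sqi om (fun x => radial x ord0 i * u x).
  move=> su; apply: (@sqiM_bounded _ _ _ om u _ 1) => //; first exact: measurable_radial_coord.
  by move=> x; exact: radial_coord_le1.
have ssum (G : 'I_d -> E -> R) : (forall i, sqi om (G i)) -> sqi om (fun x => \sum_i G i x).
  move=> sG; rewrite (_ : (fun x => _) = \sum_i G i); last first.
    by apply/funext => x; rewrite (@fct_sumE _ _ _ _ _ G).
  elim/big_ind : _ => // [|u v su sv]; [exact: sqi0|exact: sqiD].
have sq : sqi om q.
  by apply: ssum => i; have := sR _ i (hF i).1; congr (sqi _ _); apply/funext => x; rewrite mulrC.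
exists (fun x => \row_i (F i x - q x * radial x ord0 i)); split; [split|].
- move=> i; apply/Lfun2P.
  rewrite (_ : (fun x => _) = F i - (fun x => radial x ord0 i * q x)).
    by apply: sqiB; [exact: (hF i).1|exact: sR].
  by apply/funext => x; rewrite mxE mulrC.
- apply: filterS ae_sphere => x Sx; have Rx : radial x = x by exact: radial_sphere.
  rewrite /edot; under eq_bigr do rewrite mxE mulrBr.
  rewrite sumrB.
  have -> : \sum_i x ord0 i * (q x * radial x ord0 i) = q x.
    rewrite -[RHS]mulr1 -(edot_sphere Sx) /edot mulr_sumr; apply: eq_bigr => i _.
    by rewrite Rx; ring.
  have -> : \sum_i x ord0 i * F i x = q x; last by rewrite subrr.
  by apply: eq_bigr => i _; rewrite Rx mulrC.
move=> X sX; have [smX tX] := sX.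
transitivity (\sum_i ip om (F i) (fun x => X (radial x) ord0 i)).
  rewrite /ip -Rintegral_sum; last first.
    by move=> i; apply: sqi_mul_itg; [exact: (hF i).1|exact: smooth_coord_sqi].
  apply: eq_Rintegral_ae; apply: filterS ae_sphere => x Sx.
  have Rx : radial x = x by exact: radial_sphere.
  rewrite /edot; under eq_bigr do rewrite mxE mulrBl.
  rewrite sumrB.
  have -> : \sum_i q x * radial x ord0 i * X x ord0 i = q x * edot x (X x).
    rewrite /edot [RHS]mulr_sumr; apply: eq_bigr => i _; rewrite Rx; ring.
  by rewrite tX// mulr0 subr0 Rx.
transitivity (- ip om (Gop f) (fun x => sdiv X (radial x))); last first.
  apply: congr1; apply: eq_Rintegral_ae; apply: filterS ae_sphere => x Sx.
  by rewrite (radial_sphere Sx).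
have c1 : \sum_i ip om (gT n i f) (fun x => X (radial x) ord0 i) @[n --> \oo] -->
    \sum_i ip om (F i) (fun x => X (radial x) ord0 i).
  apply: cvg_sumr => i.
  exact: (tends_ip ph (fun n => sg n i) (hF i).1 (smooth_coord_sqi i smX) (hF i).2).
have c2 : - ip om (zT (N (rn n)) f) (fun x => sdiv X (radial x)) @[n --> \oo] -->
    - ip om (Gop f) (fun x => sdiv X (radial x)).
  apply: cvgN; have sz n : sqi om (zT (N (rn n)) f) by exact: zT_sqi w0 (sN n) sf.
  exact: (tends_ip ph sz sGf (sdiv_sqi smX) (zT_kN_cvg hd sf)).
rewrite (_ : (fun n => \sum_i _) = fun n => - ip om (zT (N (rn n)) f) (fun x => sdiv X (radial x))) in c1.
  exact: (cvg_unique _ c1 c2).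
by apply/funext => n; exact: gT_weak.
Qed.

End weak_gradient.

(** * Layer potentials and the space D_Sigma *)

Section smoothness.
Context {R : realType} {d : nat}.
Local Notation E := 'rV[R]_d.
Local Notation basis := (@Defs.basis R d).

Lemma is_derive_row (X : E -> E) x v (df : 'I_d -> R) :
  (forall i, is_derive x v (fun z => X z ord0 i) (df i)) -> is_derive x v X (\row_i df i).
Proof.
move=> dX.
have c : h^-1 *: ((X \o shift x) (h *: v) - X x) @[h --> (0 : R)^'] --> \row_i df i.
  apply: cvg_rV => i; have [/cvg_ex[l hl] e] := dX i.
  have -> : (\row_i df i) ord0 i = l by rewrite mxE -e; apply/cvg_lim.
  by apply: cvg_trans hl; apply: near_eq_cvg; apply: nearW => h; rewrite !mxE.
by split; [apply/cvg_ex; eexists; exact: c|apply/cvg_lim].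
Qed.

(* A class of functions that are continuous and derivable and is stable under derivation consists
   of smooth functions. *)
Section smooth_class.
Variable C : (E -> R) -> Prop.
Hypothesis HC : forall u, C u -> [/\ continuous u, forall x v, derivable u x v &
  forall v, C ('D_v u)].

Lemma class_iter u vs : C u -> C (iter_derive vs u).
Proof. by move=> Cu; elim: vs => //= v vs /HC[_ _]; apply. Qed.

Lemma class_smooth u : C u -> smooth u.
Proof. by move=> Cu vs; have [h1 h2 _] := HC (class_iter vs Cu). Qed.

Lemma class_smooth_row (X : E -> E) : (forall i, C (fun x => X x ord0 i)) -> smooth X.
Proof.
move=> CX vs.
suff h : forall i, C (fun x => iter_derive vs X x ord0 i).
  split=> [x|x v]; first by apply: (@cvg_rV R d _ (nbhs x)) => i; have [h1 _ _] := HC (h i); exact: h1.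
  have [] := @is_derive_row (iter_derive vs X) x v (fun i => 'D_v (fun x => iter_derive vs X x ord0 i) x).
    by move=> i; have [_ h2 _] := HC (h i); exact: DeriveDef (h2 x v) erefl.
  by [].
elim: vs => //= v vs IH i; have [_ _ h3] := HC (IH i).
rewrite (_ : (fun x => _) = 'D_v (fun x => iter_derive vs X x ord0 i)); first exact: h3.
apply/funext => x.
have [_ ->] := @is_derive_row (iter_derive vs X) x v (fun i => 'D_v (fun x => iter_derive vs X x ord0 i) x)
  (fun i => DeriveDef (let: And3 _ h2 _ := HC (IH i) in h2 x v) erefl).
by rewrite mxE.
Qed.

End smooth_class.

(** The algebra generated by the coordinates and the iterated derivatives of phi. It is stable under
    derivation and contains the components of [sgrad phi]. *)
Inductive sgen (phi : E -> R) : (E -> R) -> Prop :=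
| sgen_iter vs : sgen phi (iter_derive vs phi)
| sgen_coord i : sgen phi (fun x => x ord0 i)
| sgen_cst c : sgen phi (fun=> c)
| sgen_add u v : sgen phi u -> sgen phi v -> sgen phi (fun x => u x + v x)
| sgen_mul u v : sgen phi u -> sgen phi v -> sgen phi (fun x => u x * v x).

Lemma derivable_is_derive (u : E -> R) x v : derivable u x v -> is_derive x v u ('D_v u x).
Proof. by move=> h; exact: DeriveDef h erefl. Qed.

Lemma sgen_class phi : smooth phi -> forall u, sgen phi u ->
  [/\ continuous u, forall x v, derivable u x v & forall v, sgen phi ('D_v u)].
Proof.
move=> sphi u; elim=> {u} [vs|i|c|u v gu [cu du Du] gv [cv dv Dv]|u v gu [cu du Du] gv [cv dv Dv]].
- have [h1 h2] := sphi vs; split => // v; exact: (sgen_iter phi (v :: vs)).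
- split=> [|x v|v]; first exact: coord_continuous.
    by have [] := is_derive_coord x v i.
  rewrite (_ : 'D_v _ = fun=> v ord0 i); first exact: sgen_cst.
  by apply/funext => x; have [_ ->] := is_derive_coord x v i.
- split=> [x|x v|v]; first exact: (@cvg_cst _ _ _ (nbhs x)).
    by have [] := derC c x v.
  rewrite (_ : 'D_v _ = fun=> 0); first exact: sgen_cst.
  by apply/funext => x; have [_ ->] := derC c x v.
- have dd x v0 := derD (derivable_is_derive (du x v0)) (derivable_is_derive (dv x v0)).
  split=> [x|x v0|v0]; first by apply: (@cvgD _ _ _ (nbhs x)); [exact: cu|exact: cv].
    by have [] := dd x v0.
  rewrite (_ : 'D_v0 _ = fun x => 'D_v0 u x + 'D_v0 v x).
    by apply: sgen_add; [exact: Du|exact: Dv].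
  by apply/funext => x; have [_ ->] := dd x v0.
- have dd x v0 := derM (derivable_is_derive (du x v0)) (derivable_is_derive (dv x v0)).
  split=> [x|x v0|v0]; first by apply: (@cvgM _ _ (nbhs x)); [exact: cu|exact: cv].
    by have [] := dd x v0.
  have [F FE] : exists F, F = fun x => 'D_v0 u x * v x + u x * 'D_v0 v x by eexists.
  rewrite (_ : 'D_v0 _ = F).
    by rewrite FE; apply: sgen_add; apply: sgen_mul.
  by apply/funext => x; rewrite FE; have [_ ->] := dd x v0; ring.
Qed.

Lemma sgen_sum phi (I : Type) (s : seq I) (F : I -> E -> R) : (forall i, sgen phi (F i)) ->
  sgen phi (fun x => \sum_(i <- s) F i x).
Proof.
move=> gF; elim: s => [|i s IH].
  by rewrite (_ : (fun x => _) = fun=> 0); [exact: sgen_cst|apply/funext => x; rewrite big_nil].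
rewrite (_ : (fun x => _) = fun x => F i x + \sum_(j <- s) F j x); first exact: sgen_add.
by apply/funext => x; rewrite big_cons.
Qed.

Lemma smooth_sgrad (phi : E -> R) : smooth phi -> smooth_tangent (sgrad phi).
Proof.
move=> sphi; split; last first.
  move=> x Sx; rewrite /sgrad edotBr edotZr (edot_sphere Sx); ring.
apply: (class_smooth_row (sgen_class sphi)) => i.
rewrite (_ : (fun x => _) = fun x => iter_derive [:: basis i] phi x +
    ((-1) * \sum_(j < d) (x ord0 j * iter_derive [:: basis j] phi x)) * x ord0 i).
  apply: sgen_add; first exact: (sgen_iter phi [:: basis i]).
  apply: sgen_mul; last exact: sgen_coord.
  apply: sgen_mul; first exact: sgen_cst.
  apply: sgen_sum => j; apply: sgen_mul; [exact: sgen_coord|exact: (sgen_iter phi [:: basis j])].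
apply/funext => x; rewrite /sgrad /gradient /= !mxE mulN1r mulNr; congr (_ - _ * _).
by apply: eq_bigr => j _; rewrite mxE.
Qed.

Lemma is_derive_edot (x v y : E) : is_derive x v (fun z => edot z y) (edot v y).
Proof.
apply: is_derive_eq (der_sum (fun i => derM (is_derive_coord x v i) (derC (y ord0 i) x v))) _.
by apply: eq_bigr => i _; rewrite mulr0; ring.
Qed.

Section zonal.
Variables (h h' h'' : R -> R) (y : E).
Hypothesis dh : forall s, is_derive s (1 : R) h (h' s).
Hypothesis dh' : forall s, is_derive s (1 : R) h' (h'' s).
Hypothesis Sy : sphere R d y.

Lemma is_derive_zonal x v : is_derive x v (fun z => h (edot z y)) (h' (edot x y) * edot v y).
Proof. exact: (der_comp (dh _) (is_derive_edot x v y)). Qed.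

Lemma basis_edot i (z : E) : edot (basis i) z = z ord0 i.
Proof. by rewrite edotC edot_basis. Qed.

Lemma sgrad_zonal x : sgrad (fun z => h (edot z y)) x = h' (edot x y) *: (y - edot x y *: x).
Proof.
have e : gradient (fun z => h (edot z y)) x = h' (edot x y) *: y.
  apply/rowP => i; rewrite !mxE; have [_ ->] := is_derive_zonal x (basis i).
  by rewrite basis_edot.
by rewrite /sgrad e edotZr scalerBr scalerA.
Qed.
End zonal.

(** Computed in ambient coordinates; it identifies the one-variable operator [zlap] with the
    divergence of the gradient used in the definition of [D_]. *)
Lemma sdiv_sgrad_zonal (h h' h'' : R -> R) (y : E) x :
  (forall s, is_derive s (1 : R) h (h' s)) -> (forall s, is_derive s (1 : R) h' (h'' s)) ->
  sphere R d y -> sphere R d x ->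
  sdiv (sgrad (fun z => h (edot z y))) x = zlap d h' h'' (edot x y).
Proof.
move=> dh dh' Sy Sx.
rewrite (_ : sgrad _ = fun x => h' (edot x y) *: (y - edot x y *: x)); last first.
  by apply/funext => z; exact: sgrad_zonal.
pose D (v : E) i := h'' (edot x y) * edot v y * (y ord0 i - edot x y * x ord0 i) -
  h' (edot x y) * (edot v y * x ord0 i + edot x y * v ord0 i).
have dX v : is_derive x v (fun x => h' (edot x y) *: (y - edot x y *: x)) (\row_i D v i).
  apply: is_derive_row => i.
  rewrite (_ : (fun z => _) = fun z => h' (edot z y) * (y ord0 i - edot z y * z ord0 i)); last first.
    by apply/funext => z; rewrite !mxE.
  apply: is_derive_eq (derM (is_derive_zonal y dh' x v) (derB (derC _ _ _)
    (derM (is_derive_edot x v y) (is_derive_coord x v i)))) _.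
  by rewrite /D; ring.
have DE v : 'D_v (fun x => h' (edot x y) *: (y - edot x y *: x)) x = \row_i D v i.
  by have [_ ->] := dX v.
rewrite /sdiv; under eq_bigr do rewrite DE mxE.
rewrite DE /zlap; set s := edot x y.
have e1 : \sum_(i < d) D (basis i) i = h'' s * (1 - s ^+ 2) - h' s * (s + d%:R * s).
  rewrite /D -/s; under eq_bigr do rewrite basis_edot mxE !eqxx.
  transitivity (h'' s * (edot y y - s * edot x y) - h' s * (edot x y + \sum_(i < d) s)).
    rewrite /edot !mulr_sumr -sumrB -big_split/= !mulr_sumr -sumrB.
    by apply: eq_bigr => i _; ring.
  by rewrite (edot_sphere Sy) -/s sumr_const card_ord expr2 mulr_natl.
have key (A B c : R) : \sum_(i < d) x ord0 i * (A * (y ord0 i - c * x ord0 i) -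
    B * (c * x ord0 i + c * x ord0 i)) =
    A * (edot x y - c * edot x x) - B * (c * edot x x + c * edot x x).
  rewrite /edot !mulr_sumr -sumrB -big_split/= !mulr_sumr -sumrB.
  by apply: eq_bigr => i _; ring.
have e2 : edot x (\row_i D x i) = - (2 * s * h' s).
  transitivity (\sum_(i < d) x ord0 i * (h'' s * s * (y ord0 i - s * x ord0 i) -
    h' s * (s * x ord0 i + s * x ord0 i))).
    by apply: eq_bigr => i _; rewrite mxE.
  by rewrite key (edot_sphere Sx) -/s; ring.
by rewrite e1 e2; ring.
Qed.

Lemma smooth_bump (q : {poly R}) (al be : R) (y : E) :
  smooth (fun x => bump q (al * edot x y + be)).
Proof.
pose C (u : E -> R) := exists c q, u = fun x => c * bump q (al * edot x y + be).
apply: (@class_smooth C); last first.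
  by exists 1, q; apply/funext => x; rewrite mul1r.
move=> _ [c [q0 ->]].
have dB x v : is_derive x v (fun x => c * bump q0 (al * edot x y + be))
    (c * (bump (bump_deriv q0) (al * edot x y + be) * (al * edot v y))).
  apply: derZ; apply: der_comp (is_derive_bump _ _) _.
  by apply: is_derive_eq (derD (derZ al (is_derive_edot x v y)) (derC be x v)) _; rewrite addr0.
have ce (z : E) : {for z, continuous (fun x => al * edot x y + be)}.
  apply: (@cvgD _ _ _ (nbhs z)); last exact: (@cvg_cst _ _ _ (nbhs z)).
  apply: (@cvgM _ _ (nbhs z)); first exact: (@cvg_cst _ _ _ (nbhs z)).
  exact: edot_continuous.
split=> [x|x v|v]; last 1 first.
- exists (c * (al * edot v y)), (bump_deriv q0); apply/funext => x; have [_ ->] := dB x v; ring.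
- apply: (@cvgM _ _ (nbhs x)); first exact: (@cvg_cst _ _ _ (nbhs x)).
  apply: (@continuous_comp _ _ _ (fun x : E => al * edot x y + be) (bump q0)); first exact: ce.
  exact: bump_continuous.
- by have [] := dB x v.
Qed.

End smoothness.

Section link.
Context {R : realType} {d : nat}.
Local Notation E := 'rV[R]_d.
Local Notation om := (omega R d).
Local Notation w := (omega_d R d).
Hypothesis hd : (3 <= d)%N.
Local Notation a := (@ka R d).
Let a0 : 0 < a := ka_gt0 hd.
Let ph := sqi_prehilbert om.

Lemma L2P f : L2 f <-> sqi om f. Proof. exact: Lfun2P. Qed.

(** phi vanishes near x on the sphere only, so its ambient gradient may be nonzero at x. Its
    extension [phi \o radial] vanishes in a full neighbourhood of x, and the gradient of this
    extension at x is [sgrad phi x]. *)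
Lemma sgrad_off_support (phi : E -> R) x : smooth phi -> sphere R d x ->
  ~ surface_support phi x -> sgrad phi x = 0.
Proof.
move=> sphi Sx nx; have x0 := sphere_neq0 Sx; have Rx : radial x = x by exact: radial_sphere.
have [c1 d1] := sphi [::].
have sC : sC1 phi (sgrad phi).
  apply: sC1_smooth => [|y i|i]; [exact: c1|exact: d1|].
  by have [c2 _] := sphi [:: @Defs.basis R d i].
have [_ dr _] := sC x x0.
have zr : \forall z \near x, phi (radial z) = 0.
  have oU : open (~` surface_support phi) by apply: closed_openC; exact: closed_closure.
  have nU : nbhs (radial x) (~` surface_support phi).
    by rewrite Rx; apply: open_nbhs_nbhs.
  have c0 : {for x, continuous (@radial R d)} by exact: radial_continuous.
  have n0 : \forall z \near x, z != 0.
    have oU' : open (@enorm R d @^-1` [set t | 0 < t]).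
      by apply: open_comp; [move=> z _; exact: enorm_continuous|exact: open_gt].
    have : nbhs x (@enorm R d @^-1` [set t | 0 < t]).
      by apply: open_nbhs_nbhs; split => //=; exact: enorm_gt0.
    by apply: filterS => z /=; apply: contraTneq => ->; rewrite enorm0 ltxx.
  apply: filterS2 n0 (c0 _ nU) => z z0 /= h; apply: contrapT => /eqP phiz.
  by apply: h; apply: subset_closure; split => //; rewrite /sphere/= enorm_radial.
have e v : edot (sgrad phi x) v = 0.
  have d0 : is_derive x v (phi \o @radial R d) 0.
    apply: near_eq_is_derive (derC (0 : R) x v).
    by apply: filterS zr => z /= ->.
  have [_ <-] := d0; have [_ ->] := dr v.
  by rewrite Rx; move: Sx; rewrite /sphere/= => ->; rewrite invr1 mul1r.
exact: edot_eq0 (e _).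
Qed.

Lemma enorm_sub_sphere (x y : E) : sphere R d x -> sphere R d y ->
  enorm (x - y) ^+ 2 = kq 1 (edot x y).
Proof.
move=> Sx Sy; rewrite enorm_sqr edotBl !edotBr !edot_sphere// [edot y x]edotC /kq; ring.
Qed.

Lemma enorm_pow (x y : E) : sphere R d x -> sphere R d y -> edot x y < 1 ->
  (enorm (x - y) ^+ (d - 2))^-1 = kN a 1 (edot x y).
Proof.
move=> Sx Sy xy; have q0 : 0 < kq 1 (edot x y) by rewrite /kq; lra.
have e : enorm (x - y) = expR (ln (kq 1 (edot x y)) / 2).
  apply/eqP; rewrite -(eqrXn2 (n := 2))// ?sqrtr_ge0 ?expR_ge0//.
  by rewrite enorm_sub_sphere// -expRM_natl mulrC mulfVK// lnK.
rewrite e -expRM_natl -expRN /kN /kQ natrB ?(ltnW hd)//; congr expR.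
by rewrite /ka; field.
Qed.

Lemma single_layerE f x : sphere R d x -> single_layer f x = - (2 * a)^-1 * Gop f x.
Proof.
move=> Sx; have Rx : radial x = x by exact: radial_sphere.
have e : \int[om]_y (f y / enorm (x - y) ^+ (d - 2)) = iop om (zK (kN a 1)) f x.
  apply: eq_Rintegral_ae; apply: filterS2 ae_sphere (ae_edot_lt1 hd x) => y Sy.
  by rewrite /zK Rx (radial_sphere Sy) => xy; rewrite enorm_pow// mulrC.
have da : d%:R - 2 = 2 * a by rewrite /ka mulrC divfK.
rewrite /single_layer e /Gop /zT da invfM; move: (iop om _ f x) (2 * a) => J t; ring.
Qed.

(** On the sphere the kernel y . (x - y) / |x - y|^d is - |x - y|^(2 - d) / 2, so the singularity is
    weak. Wherever the integral converges absolutely, dominated convergence removes the principal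
    value. *)
Lemma double_layer_cvg f x : sphere R d x ->
  itg om (fun y => zK (kN a 1) x y * f y) -> measurable_fun setT f ->
  double_layer f x = 2^-1 * Gop f x.
Proof.
move=> Sx iNf mf; have Rx : radial x = x by exact: radial_sphere.
pose g y := zK (kN a 1) x y * f y; have mg := itg_measurable iNf.
pose I r : E -> R := \1_[set y | r < enorm (x - y)].
have oD r : open [set y : E | r < enorm (x - y)].
  have cD : continuous (fun y : E => enorm (x - y)).
    move=> y; apply: (@continuous_comp _ _ _ (fun y : E => x - y) (@enorm R d)).
      by apply: (@cvgB _ _ _ (nbhs y)); [exact: (@cvg_cst _ _ _ (nbhs y))|exact: cvg_id].
    exact: enorm_continuous.
  rewrite (_ : [set y | _] = (fun y => enorm (x - y)) @^-1` [set t | r < t])//.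
  by apply: open_comp; [move=> y _; exact: cD|exact: open_gt].
have mI r : measurable_fun setT (I r).
  by apply: measurable_indic; exact: open_rV_measurable.
have e r : - w^-1 * \int[om]_(y in [set y | r < enorm (x - y)])
      (edot (normal y) (x - y) / enorm (x - y) ^+ d * f y) =
    w^-1 * 2^-1 * \int[om]_y (I r y * g y).
  rewrite Rintegral_mkcond mulNr -mulrN -mulrA; apply: congr1.
  have iI : itg om (fun y => I r y * g y).
    have iN : itg om (fun y => `|g y|) by have := integrable_abse iNf; exact: eq_integrable.
    apply: (itg_le _ iN); first exact: measurable_funM.
    move=> y; rewrite normrM /I indicE.
    by case: (y \in _); rewrite ?normr1 ?mul1r// normr0 mul0r.
  have -> : \int[om]_y (((fun y => edot (normal y) (x - y) / enorm (x - y) ^+ d * f y) \_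
      [set y | r < enorm (x - y)]) y) = \int[om]_y (- 2^-1 * (I r y * g y)).
    apply: eq_Rintegral_ae; apply: filterS2 ae_sphere (ae_edot_lt1 hd x) => y Sy.
    rewrite Rx (radial_sphere Sy) => xy; rewrite patchE /I indicE.
    case: (y \in _); last by rewrite mul0r mulr0.
    rewrite mul1r /g /zK Rx (radial_sphere Sy) -enorm_pow// /normal edotBr (edot_sphere Sy) [edot y x]edotC.
    have q0 : 0 < kq 1 (edot x y) by rewrite /kq; lra.
    have q1 := enorm_sub_sphere Sx Sy.
    have n0 : enorm (x - y) != 0 by apply: contraTneq q0 => n0; rewrite -q1 n0 expr0n ltxx.
    have -> : enorm (x - y) ^+ d = enorm (x - y) ^+ (d - 2) * kq 1 (edot x y).
      by rewrite -q1 -exprD subnK// ltnW.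
    have m0 : enorm (x - y) ^+ (d - 2) != 0 by rewrite expf_neq0.
    move: (enorm (x - y) ^+ (d - 2)) m0 => m m0.
    have -> : kq 1 (edot x y) = 2 * (1 - edot x y) by rewrite /kq; ring.
    have s0 : 1 - edot x y != 0 by rewrite subr_eq0 gt_eqF.
    by field; rewrite s0 m0.
  by rewrite (RintegralZl _ measurableT iI) mulNr opprK.
have c : (w^-1 * 2^-1 * \int[om]_y (I r y * g y)) @[r --> 0^'+] --> 2^-1 * Gop f x.
  apply/cvg_at_rightP => u [u0 cu].
  rewrite (_ : 2^-1 * Gop f x = w^-1 * 2^-1 * \int[om]_y g y); last first.
    by rewrite /Gop /zT /iop mulrCA mulrA.
  apply: cvgM; first exact: cvg_cst.
  have [] := @Rdominated_cvg _ _ _ om (fun n y => I (u n) y * g y) g (fun y => `|g y|).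
  - by move=> n; exact: measurable_funM.
  - exact: mg.
  - apply: filterS2 ae_sphere (ae_edot_lt1 hd x) => y Sy; rewrite Rx (radial_sphere Sy) => xy.
    have q0 : 0 < kq 1 (edot x y) by rewrite /kq; lra.
    have n0 : 0 < enorm (x - y).
      rewrite lt_neqAle sqrtr_ge0 andbT eq_sym; apply: contraTneq q0 => n0.
      by rewrite -enorm_sub_sphere// n0 expr0n ltxx.
    apply: cvg_near_cst; move/cvgrPdist_lt: cu => /(_ _ n0); apply: filterS => n.
    rewrite sub0r normrN gtr0_norm// => h; rewrite /I indicE mem_set ?mul1r//.
  - by have := integrable_abse iNf; exact: eq_integrable.
  - move=> n; apply: nearW => y; rewrite normrM /I indicE.
    by case: (y \in _); rewrite ?normr1 ?mul1r// normr0 mul0r.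
  by [].
rewrite /double_layer (_ : (fun r => _) = fun r => w^-1 * 2^-1 * \int[om]_y (I r y * g y)).
  exact/cvg_lim.
by apply/funext => r; exact: e.
Qed.

Definition Kh f : E -> R := 2^-1 *: (f + Gop f).

Lemma Kh_sqi f : sqi om f -> sqi om (Kh f).
Proof. by move=> sf; apply: sqiZ; apply: sqiD => //; exact: Gop_sqi. Qed.

Lemma KhalfE f : sqi om f -> {ae om, forall x, Khalf f x = Kh f x}.
Proof.
move=> sf; have [mf _] := sf.
apply: filterS2 ae_sphere (schur_ae (schur_kN1 hd) sf) => x Sx [_ i1].
rewrite /Khalf double_layer_cvg// -[RHS]/(2^-1 * (f x + Gop f x)); ring.
Qed.

(** The set of candidates depends on f only through integrals, so [get] selects the same
    representative: an equality of functions and not only almost everywhere. *)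
Lemma orthoproj_ae H (f f' : E -> R) : {ae om, forall x, f x = f' x} ->
  orthoproj H f = orthoproj H f'.
Proof.
move=> ff'; rewrite /orthoproj; congr get; apply/seteqP; split => g [Hg gP]; split => // h Hh;
  rewrite -(gP _ Hh); apply: eq_Rintegral_ae; apply: filterS ff' => x e;
  by rewrite -[(f - g) x]/(f x - g x) -[(f' - g) x]/(f' x - g x) e.
Qed.

Lemma is_orthoproj_unique H f g g' : is_subspace (sqi om) H -> sqi om f ->
  is_orthoproj H f g -> is_orthoproj H f g' -> {ae om, forall x, g x = g' x}.
Proof.
move=> [Hs H0 HD HZ] sf [Hg gP] [Hg' gP'].
have sg := Hs _ Hg; have sg' := Hs _ Hg'.
have HB : H (g - g') by rewrite -scaleN1r; apply: HD => //; exact: HZ.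
have sB := sqiB sg sg'.
have e : ip om (g - g') (g - g') = 0.
  have h1 : ip om (f - g) (g - g') = 0 by exact: gP.
  have h2 : ip om (f - g') (g - g') = 0 by exact: gP'.
  rewrite (ipBl ph sf sg sB) in h1; rewrite (ipBl ph sf sg' sB) in h2.
  by rewrite (ipBl ph sg sg' sB); lra.
by apply: filterS (ip_eq0 sB e) => x /eqP; rewrite -[(g - g') x]/(g x - g' x) subr_eq0 => /eqP.
Qed.

Lemma orthoprojP H f : is_subspace (sqi om) H -> seq_closed (sqi om) (ip om) H -> sqi om f ->
  is_orthoproj H f (orthoproj H f).
Proof.
move=> Hs Hc sf; have [g Hg gP] := sqi_projection Hs Hc sf.
by apply: (@getI _ [set g | is_orthoproj H f g] g).
Qed.

Section Sigma.
Variable Sigma : set E.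
Hypothesis Sopen : sphere_open Sigma.

Lemma Sigma_measurable : measurable Sigma.
Proof.
have [U oU ->] := Sopen; apply: measurableI; [exact: measurable_sphere|exact: open_rV_measurable].
Qed.

Definition restr f : E -> R := fun x => \1_Sigma x * f x.

Lemma restr_sqi f : sqi om f -> sqi om (restr f).
Proof.
move=> sf; apply: (@sqiM_bounded _ _ _ om f _ 1) => //.
  by apply: measurable_indic; exact: Sigma_measurable.
by move=> x; rewrite indicE; case: (_ \in _); rewrite ?normr1 ?normr0.
Qed.

Lemma restr_in f x : Sigma x -> restr f x = f x.
Proof. by move=> Sx; rewrite /restr indicE mem_set// mul1r. Qed.

Lemma restr_out f x : ~ Sigma x -> restr f x = 0.
Proof. by move=> Sx; rewrite /restr indicE memNset// mul0r. Qed.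

Lemma L2on_subspace : is_subspace (sqi om) (L2on Sigma).
Proof.
split.
- by move=> f [/L2P].
- by split; [apply/L2P; exact: sqi0|apply: nearW].
- move=> f g [/L2P sf f0] [/L2P sg g0]; split; first by apply/L2P; exact: sqiD.
  by apply: filterS2 f0 g0 => x fx gx nx; rewrite -[(f + g) x]/(f x + g x) fx// gx// addr0.
- move=> c f [/L2P sf f0]; split; first by apply/L2P; exact: sqiZ.
  by apply: filterS f0 => x fx nx; rewrite -[(c *: f) x]/(c * f x) fx// mulr0.
Qed.

Lemma restr_L2on f : sqi om f -> L2on Sigma (restr f).
Proof.
by move=> sf; split; [apply/L2P; exact: restr_sqi|apply: nearW => x; exact: restr_out].
Qed.

Lemma P_E f : sqi om f -> {ae om, forall x, P_ Sigma f x = restr f x}.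
Proof.
move=> sf; have h : is_orthoproj (L2on Sigma) f (restr f).
  split; first exact: restr_L2on.
  move=> h [_ h0]; rewrite /L2dot (@eq_Rintegral_ae _ _ _ om _ (cst 0)); first by rewrite Rintegral_cst// mul0r.
  apply: filterS h0 => x hx; rewrite -[(f - restr f) x]/(f x - restr f x).
  by have [Sx|nSx] := pselect (Sigma x); [rewrite restr_in// subrr mul0r|rewrite hx// mulr0].
apply: (is_orthoproj_unique L2on_subspace sf _ h).
exact: (@getI _ [set g | is_orthoproj (L2on Sigma) f g] (restr f)).
Qed.

Lemma P_L2on f : sqi om f -> L2on Sigma (P_ Sigma f).
Proof.
move=> sf; have h : is_orthoproj (L2on Sigma) f (restr f).
  split; first exact: restr_L2on.
  move=> h [_ h0]; rewrite /L2dot (@eq_Rintegral_ae _ _ _ om _ (cst 0)); first by rewrite Rintegral_cst// mul0r.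
  apply: filterS h0 => x hx; rewrite -[(f - restr f) x]/(f x - restr f x).
  by have [Sx|nSx] := pselect (Sigma x); [rewrite restr_in// subrr mul0r|rewrite hx// mulr0].
by have [] := @getI _ [set g | is_orthoproj (L2on Sigma) f g] (restr f) h.
Qed.

(* The Laplace-Beltrami operator. *)
Definition slaplacian (phi : E -> R) : E -> R := fun x => sdiv (sgrad phi) (radial x).

Lemma slaplacian_sqi phi : smooth phi -> sqi om (slaplacian phi).
Proof. by move=> /smooth_sgrad[sX _]; exact: sdiv_sqi. Qed.

Lemma div_freeE phi F : Cc_smooth Sigma phi ->
  \int[om]_(x in Sigma) edot (F x) (sgrad phi x) = \int[om]_x edot (F x) (sgrad phi x).
Proof.
move=> [sphi _ supp]; rewrite Rintegral_mkcond; apply: eq_Rintegral_ae.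
apply: filterS ae_sphere => x Sx; rewrite patchE.
have [xS|xS] := pselect (Sigma x); first by rewrite (mem_set xS).
rewrite (memNset xS) (sgrad_off_support sphi Sx (fun h => xS (supp x h))).
by rewrite edotC edot0l.
Qed.

(** A weak gradient always exists by [weak_sgrad_Gop], so the condition reduces to orthogonality of
    G f to Laplacians of test functions. As G is symmetric, [D_ Sigma] becomes an orthogonal
    complement, which gives its linearity and closedness. *)
Lemma D_P f : D_ Sigma f <-> sqi om f /\
  forall phi, Cc_smooth Sigma phi -> ip om (Gop f) (slaplacian phi) = 0.
Proof.
have a2 : - (2 * a)^-1 != 0 by rewrite oppr_eq0 invr_eq0 mulf_neq0// gt_eqF.
pose c := - (2 * a)^-1.
have sl X : sqi om f -> {ae om, forall x, single_layer f x * sdiv X x = (c *: Gop f) x * sdiv X (radial x)}.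
  move=> sf; apply: filterS ae_sphere => x Sx.
  rewrite (single_layerE f Sx) (radial_sphere Sx); exact: erefl.
split=> [[/L2P sf [F [_ wF] dF]]|[sf h]].
  split => // phi Cphi; have [sphi _ _] := Cphi; have [sX _] := smooth_sgrad sphi.
  have e : \int[om]_x (single_layer f x * sdiv (sgrad phi) x) = ip om (c *: Gop f) (slaplacian phi).
    exact: eq_Rintegral_ae (sl _ sf).
  have := dF _ Cphi; rewrite (div_freeE _ Cphi) (wF _ (smooth_sgrad sphi)) e.
  rewrite (ipZl ph _ (Gop_sqi hd sf) (slaplacian_sqi sphi)) => /eqP.
  by rewrite oppr_eq0 mulf_eq0 (negbTE a2)/= => /eqP.
split; first exact/L2P.
have [F [F1 wF]] := weak_sgrad_Gop hd (sqiZ c sf).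
have wF' X : smooth_tangent X -> \int[om]_x edot (F x) (X x) =
    - \int[om]_x ((c *: Gop f) x * sdiv X (radial x)).
  move=> sX; rewrite (wF _ sX); apply: congr1; apply: eq_Rintegral_ae.
  apply: filterS2 ae_sphere (zTZ c (schur_kN1 hd) sf) => x Sx e.
  by rewrite (radial_sphere Sx) /Gop e.
exists F.
  split; first exact: F1.
  move=> X sX; apply: (etrans (wF' _ sX)); apply: congr1; apply: esym.
  exact: eq_Rintegral_ae (sl _ sf).
move=> phi Cphi; have [sphi _ _] := Cphi; rewrite (div_freeE _ Cphi).
apply: (etrans (wF' _ (smooth_sgrad sphi))).
have -> : \int[om]_x ((c *: Gop f) x * sdiv (sgrad phi) (radial x)) = ip om (c *: Gop f) (slaplacian phi) by exact: erefl.
by rewrite (ipZl ph _ (Gop_sqi hd sf) (slaplacian_sqi sphi)) (h _ Cphi) mulr0 oppr0.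
Qed.

Lemma D_subspace : is_subspace (sqi om) (D_ Sigma).
Proof.
split.
- by move=> f /D_P[].
- apply/D_P; split; first exact: sqi0.
  move=> phi [/slaplacian_sqi st _ _]; rewrite (Gop_sym hd (sqi0 om) st).
  exact: (ip0l ph (Gop_sqi hd st)).
- move=> f g /D_P[sf f0] /D_P[sg g0]; apply/D_P; split; first exact: sqiD.
  move=> phi Cphi; have [/slaplacian_sqi st _ _] := Cphi.
  move: (f0 _ Cphi) (g0 _ Cphi).
  rewrite (Gop_sym hd sf st) (Gop_sym hd sg st) (Gop_sym hd (sqiD sf sg) st).
  by rewrite (ipDl ph sf sg (Gop_sqi hd st)) => -> ->; rewrite addr0.
- move=> c f /D_P[sf f0]; apply/D_P; split; first exact: sqiZ.
  move=> phi Cphi; have [/slaplacian_sqi st _ _] := Cphi; move: (f0 _ Cphi).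
  rewrite (Gop_sym hd sf st) (Gop_sym hd (sqiZ c sf) st).
  by rewrite (ipZl ph _ sf (Gop_sqi hd st)) => ->; rewrite mulr0.
Qed.

Lemma D_closed : seq_closed (sqi om) (ip om) (D_ Sigma).
Proof.
move=> u f uD sf uf; apply/D_P; split => // phi Cphi; have [/slaplacian_sqi st _ _] := Cphi.
have su n : sqi om (u n) by have /D_P[] := uD n.
rewrite (Gop_sym hd sf st).
have := tends_ip ph su sf (Gop_sqi hd st) uf.
rewrite (_ : (fun n => _) = cst 0); last first.
  apply/funext => n; have /D_P[_ h] := uD n.
  by rewrite -(Gop_sym hd (su n) st); exact: h.
by move/(cvg_lim (@norm_hausdorff _ _)); rewrite lim_cst.
Qed.

Lemma E_P f : sqi om f -> [/\ D_ Sigma (E_ Sigma f), sqi om (E_ Sigma f) &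
  forall h, D_ Sigma h -> ip om (E_ Sigma f) h = ip om f h].
Proof.
move=> sf; have [h1 h2] := orthoprojP D_subspace D_closed sf.
have /D_P[s _] := h1; split => // h Dh; have /D_P[sh _] := Dh.
have : ip om (f - E_ Sigma f) h = 0 by exact: h2.
by rewrite (ipBl ph sf s sh) => /eqP; rewrite subr_eq0 => /eqP.
Qed.

End Sigma.

End link.

(** * Unique continuation *)

Section uniform_closure.
Context {R : realType}.
Variables (D : set R) (g : R -> R).

(* Bounded uniform limits on D of polynomials in g. *)
Definition ulim (F : R -> R) := (exists M, forall s, D s -> `|F s| <= M) /\
  forall e : R, 0 < e -> exists q : {poly R}, forall s, D s -> `|F s - q.[g s]| <= e.

Lemma ulim_cst c : ulim (fun=> c).
Proof.
split; first by exists `|c|.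
by move=> e e0; exists c%:P => s _; rewrite hornerC subrr normr0 ltW.
Qed.

Lemma ulim_gen M : (forall s, D s -> `|g s| <= M) -> ulim g.
Proof.
move=> gM; split; first by exists M.
by move=> e e0; exists 'X => s _; rewrite hornerX subrr normr0 ltW.
Qed.

Lemma ulimD F G : ulim F -> ulim G -> ulim (fun s => F s + G s).
Proof.
move=> [[M1 h1] a1] [[M2 h2] a2]; split.
  by exists (M1 + M2) => s Ds; apply: le_trans (ler_normD _ _) _; apply: lerD; [exact: h1|exact: h2].
move=> e e0; have e2 : 0 < e / 2 by rewrite divr_gt0.
have [q1 k1] := a1 _ e2; have [q2 k2] := a2 _ e2; exists (q1 + q2) => s Ds.
rewrite hornerD opprD addrACA; apply: le_trans (ler_normD _ _) _.
by have := k1 _ Ds; have := k2 _ Ds; lra.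
Qed.

Lemma ulimM F G : ulim F -> ulim G -> ulim (fun s => F s * G s).
Proof.
move=> [[M1 h1] a1] [[M2 h2] a2]; split.
  by exists (`|M1| * `|M2|) => s Ds; rewrite normrM; apply: ler_pM => //;
    [apply: le_trans (h1 _ Ds) (ler_norm _)|apply: le_trans (h2 _ Ds) (ler_norm _)].
move=> e e0; pose M := `|M1| + `|M2| + 1.
have M0 : 0 < M by rewrite ltr_wpDl// addr_ge0.
pose t := Num.min 1 (e / (2 * M)).
have t0 : 0 < t by rewrite /t lt_min ltr01 divr_gt0// mulr_gt0.
have t1 : t <= 1 by rewrite /t ge_min lexx.
have te : t * (2 * M) <= e.
  by rewrite -ler_pdivlMr ?mulr_gt0// /t ge_min lexx orbT.
have [q1 k1] := a1 _ t0; have [q2 k2] := a2 _ t0; exists (q1 * q2) => s Ds.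
have := k1 _ Ds; have := k2 _ Ds; rewrite hornerM.
move: (q1.[g s]) (q2.[g s]) => x y ky kx.
have -> : F s * G s - x * y = F s * (G s - y) + (F s - x) * y by ring.
have yM : `|y| <= M.
  have : `|y| <= `|G s| + `|G s - y|.
    by rewrite -[X in `|X| <= _](subKr (G s)) ler_normB.
  by have := h2 _ Ds; have := ler_norm M2; have := normr_ge0 M1; rewrite /M; lra.
have FM : `|F s| <= M.
  by have := h1 _ Ds; have := ler_norm M1; have := normr_ge0 M2; rewrite /M; lra.
apply: le_trans (ler_normD _ _) _; rewrite !normrM.
have : `|F s| * `|G s - y| <= M * t by apply: ler_pM.
have : `|F s - x| * `|y| <= t * M by apply: ler_pM.
by move=> ? ?; lra.
Qed.

Lemma ulimX F n : ulim F -> ulim (fun s => F s ^+ n).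
Proof.
move=> uF; elim: n => [|n IH]; first exact: ulim_cst.
by rewrite (_ : (fun s => _) = fun s => F s * F s ^+ n); [exact: ulimM|apply/funext => s; rewrite exprS].
Qed.

Lemma ulim_lim F (G : nat -> R -> R) C k : 0 <= k < 1 -> (forall n, ulim (G n)) ->
  (forall n s, D s -> `|F s - G n s| <= C * k ^+ n) -> ulim F.
Proof.
move=> /andP[k0 k1] uG FG.
have c0 : C * k ^+ n @[n --> \oo] --> (0 : R).
  rewrite -(mulr0 C); apply: cvgM; first exact: cvg_cst.
  by apply: cvg_expr; rewrite ger0_norm.
have small (e : R) : 0 < e -> exists n, C * k ^+ n <= e.
  move=> e0; have /cvgrPdist_le/(_ _ e0)[n _ /(_ n (leqnn n))] := c0.
  by rewrite /= sub0r normrN => h; exists n; exact: le_trans (ler_norm _) h.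
split.
  have [n hn] := small 1 ltr01; have [[M hM] _] := uG n; exists (M + 1) => s Ds.
  rewrite -(subrK (G n s) (F s)) addrC; apply: le_trans (ler_normD _ _) _.
  by apply: lerD; [exact: hM|exact: le_trans (FG n s Ds) hn].
move=> e e0; have e2 : 0 < e / 2 by rewrite divr_gt0.
have [n hn] := small _ e2; have [_ /(_ _ e2)[q hq]] := uG n; exists q => s Ds.
rewrite -(subrKA (G n s)); apply: le_trans (ler_normD _ _) _.
by have := hq _ Ds; have := FG n s Ds; lra.
Qed.

(** The iteration G + (1 - F G) / M multiplies the error 1/F - G by 1 - F/M, at most 1 - m/M, so it
    converges uniformly; each iterate is again a polynomial expression. *)
Lemma ulimV F m : 0 < m -> (forall s, D s -> m <= F s) -> ulim F -> ulim (fun s => (F s)^-1).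
Proof.
move=> m0 Fm uF; have [[M' hM'] _] := uF; pose M := `|M'| + m.
have M0 : 0 < M by rewrite ltr_wpDl.
have FM s : D s -> m <= F s <= M.
  move=> Ds; rewrite Fm//=; apply: le_trans (ler_norm _) _.
  by have := hM' _ Ds; have := ler_norm M'; rewrite /M; lra.
pose G := fix G n := if n is n'.+1 then (fun s => G n' s + M^-1 * (1 + (-1) * (F s * G n' s))) else fun=> 0 : R.
have k01 : 0 <= 1 - m / M < 1.
  rewrite subr_ge0 gtrBl divr_gt0// andbT ler_pdivrMr// mul1r /M lerDr.
  exact: normr_ge0.
apply: (@ulim_lim _ G m^-1 _ k01) => [|n s Ds].
  elim=> [|n IH]; first exact: ulim_cst.
  apply: ulimD => //; apply: ulimM; first exact: ulim_cst.
  apply: ulimD; first exact: ulim_cst.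
  by apply: ulimM; [exact: ulim_cst|exact: ulimM].
have /andP[Fs1 Fs2] := FM s Ds; have Fs0 : 0 < F s := lt_le_trans m0 Fs1.
have /andP[k0 k1] := k01.
elim: n => [|n IH].
  by rewrite /= subr0 expr0 mulr1 ger0_norm ?invr_ge0 ?(ltW Fs0)// lef_pV2.
have -> : (F s)^-1 - G n.+1 s = ((F s)^-1 - G n s) * (1 - F s / M).
  by rewrite /=; field; rewrite !gt_eqF.
rewrite normrM exprSr mulrA; apply: ler_pM => //.
rewrite ger0_norm; last by rewrite subr_ge0 ler_pdivrMr// mul1r.
by rewrite lerD2l lerN2 ler_pM2r ?invr_gt0.
Qed.

(** The iteration G + c (F - G^2) with c = 1/(2M) keeps 0 <= G <= sqrt F and multiplies the error by
    1 - c (sqrt F + G), at most 1 - c sqrt m. Square roots are needed because the exponent a may be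
    a half-integer. *)
Lemma ulim_sqrt F m : 0 < m -> (forall s, D s -> m <= F s) -> ulim F ->
  ulim (fun s => Num.sqrt (F s)).
Proof.
move=> m0 Fm uF; have [[M' hM'] _] := uF; pose M := Num.sqrt (`|M'| + m).
have M0 : 0 < M by rewrite sqrtr_gt0 ltr_wpDl.
pose r s := Num.sqrt (F s); pose p := Num.sqrt m.
have p0 : 0 < p by rewrite sqrtr_gt0.
have pM : p <= M by rewrite ler_wsqrtr// lerDr.
have rM s : D s -> p <= r s <= M.
  move=> Ds; rewrite ler_wsqrtr ?Fm//= ler_wsqrtr//; apply: le_trans (ler_norm _) _.
  by have := hM' _ Ds; have := ler_norm M'; lra.
pose c := (2 * M)^-1; have c0 : 0 < c by rewrite invr_gt0 mulr_gt0.
pose G := fix G n := if n is n'.+1 then (fun s => G n' s + c * (F s + (-1) * (G n' s * G n' s))) else fun=> 0 : R.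
have cM : c * (2 * M) = 1 by rewrite mulVf// mulf_neq0// gt_eqF.
have cp : 0 < c * p by rewrite mulr_gt0.
have cpM : c * p <= 2^-1.
  have : c * p <= c * M by rewrite ler_wpM2l// ltW.
  by move: cM; lra.
have k01 : 0 <= 1 - c * p < 1 by apply/andP; split; lra.
have /andP[k0 k1] := k01.
apply: (@ulim_lim _ G M _ k01) => [|n s Ds].
  elim=> [|n IH]; first exact: ulim_cst.
  apply: ulimD => //; apply: ulimM; first exact: ulim_cst.
  apply: ulimD => //; apply: ulimM; first exact: ulim_cst.
  exact: ulimM.
have /andP[r1 r2] := rM s Ds; have r0 : 0 < r s := lt_le_trans p0 r1.
have rF : F s = r s * r s by rewrite -expr2 sqr_sqrtr// (le_trans (ltW m0))// Fm.
suff : 0 <= G n s <= r s /\ `|r s - G n s| <= M * (1 - c * p) ^+ n by case.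
elim: n => [|n [/andP[g0 g1] IH]].
  by rewrite /= lexx (ltW r0) subr0 expr0 mulr1 gtr0_norm.
have e : r s - G n.+1 s = (r s - G n s) * (1 - c * (r s + G n s)) by rewrite /= rF; ring.
have f0 : 0 <= 1 - c * (r s + G n s).
  have : c * (r s + G n s) <= c * (2 * M) by rewrite ler_wpM2l ?(ltW c0)//; lra.
  by rewrite cM; lra.
have f1 : 1 - c * (r s + G n s) <= 1 - c * p.
  by rewrite lerD2l lerN2 ler_wpM2l ?(ltW c0)//; lra.
have g2 : 0 <= r s - G n s by rewrite subr_ge0.
split.
  have h := mulr_ge0 g2 f0; rewrite -subr_ge0 -[X in _ && X]subr_ge0 e h andbT subr0.
  have : c * (G n s * G n s) <= c * (r s * r s).
    by rewrite ler_wpM2l ?(ltW c0)// ler_pM.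
  by rewrite /= rF; lra.
rewrite e normrM exprSr mulrA; apply: ler_pM => //.
by rewrite ger0_norm.
Qed.

End uniform_closure.

(** * Bumps in a small cap and the recursion on the exponent of the kernel *)

Section bump_recursion.
Context {R : realType} {d : nat}.
Local Notation E := 'rV[R]_d.
Local Notation om := (omega R d).
Local Notation w := (omega_d R d).
Hypothesis hd : (3 <= d)%N.
Local Notation a := (@ka R d).
Local Notation rn := (@rn R).
Let a0 : 0 < a := ka_gt0 hd.
Let w0 : 0 < w. Proof. by apply: omega_d_gt0; exact: leq_trans hd. Qed.

Variable eps : R.
Hypothesis eps0 : 0 < eps.
Local Notation c := (1 - eps).

(* Zonal bumps supported in the cap [1 - eps <= s]. *)
Definition bz (q : {poly R}) s : R := bump q (1 * s + - c).

Lemma is_derive_bz q s : is_derive s (1 : R) (bz q) (bz (bump_deriv q) s).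
Proof.
apply: is_derive_eq (der_comp (is_derive_bump q _) (derD (derZ 1 (is_derive_id s 1)) (derC (- c) s 1))) _.
by rewrite /bz; ring.
Qed.

Lemma bz_cont q s : {for s, continuous (bz q)}.
Proof. exact: is_derive_continuous (is_derive_bz q s). Qed.

Lemma zC1_bz q : zC1 (bz q) (bz (bump_deriv q)).
Proof. by move=> s _; split; [exact: is_derive_bz|exact: bz_cont]. Qed.

Lemma bz_out q s : s <= c -> bz q s = 0.
Proof. by move=> sc; rewrite /bz bump_le0//; lra. Qed.

(* The Laplacian on [bz q] acts on the polynomial factor [q]. *)
Definition Lstar (q : {poly R}) : {poly R} :=
  let q1 := bump_deriv q in let p1 := q - q^`() in let p2 := q1 - q1^`() in
  (1 - c ^+ 2)%:P * bump_deriv q1 - (2 * c)%:P * ('X * p2) - p2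
  - (d%:R - 1)%:P * (c%:P * q1 + 'X * p1).

Lemma zlap_bz q s : zlap d (bz (bump_deriv q)) (bz (bump_deriv (bump_deriv q))) s = bz (Lstar q) s.
Proof.
have [sc|sc] := leP s c; first by rewrite /zlap !bz_out// !mulr0 subrr.
rewrite /zlap /bz /bump mul1r subr_gt0 sc.
have t0 : s - c != 0 by rewrite subr_eq0 gt_eqF.
rewrite /Lstar /bump_deriv !(hornerM, hornerD, hornerN, hornerC, hornerX, hornerXn).
move: (q.[_]) (q^`().[_]) (('X^2 * (q - q^`()))^`().[_]) => A A' A''.
have -> : s = (s - c) + c by rewrite subrK.
rewrite addrK; move: (s - c) t0 => t t0; move: (expR _) => e.
by field.
Qed.

(** On the sphere |u - v|^2 = 2 - 2 (u . v): x is at distance less than sqrt(2 eps) from x0 and y at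
    distance at least 2 sqrt(2 eps), so |x - y| >= sqrt(2 eps). This is the origin of the factor
    4. *)
Lemma cap_far (x y x0 : E) : sphere R d x -> sphere R d y -> sphere R d x0 ->
  c < edot x x0 -> edot y x0 <= 1 - 4 * eps -> edot x y <= c.
Proof.
move=> Sx Sy S0 xx yy; rewrite leNgt; apply/negP => xy.
have t : enorm (y - x0) <= enorm (y - x) + enorm (x - x0).
  by rewrite -[y - x0](subrKA x); exact: enormD.
have sq (u v : E) : sphere R d u -> sphere R d v -> enorm (u - v) ^+ 2 = 2 - 2 * edot u v.
  by move=> Su Sv; rewrite enorm_sub_sphere// /kq; ring.
have h1 := sq y x0 Sy S0; have h2 := sq y x Sy Sx; have h3 := sq x x0 Sx S0.
rewrite [edot y x]edotC in h2.
have n1 : 0 <= enorm (y - x0) by exact: sqrtr_ge0.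
have h4 : enorm (y - x0) ^+ 2 <= (enorm (y - x) + enorm (x - x0)) ^+ 2.
  by rewrite ler_pXn2r// nnegrE ?addr_ge0// sqrtr_ge0.
have := sqr_ge0 (enorm (y - x) - enorm (x - x0)).
move: h4; rewrite sqrrD sqrrB h1 h2 h3; lra.
Qed.

(* Truncated near the diagonal, where [h] and the bump never interact. *)
Definition Tk p s : R := kQ p 1 (Num.min s c).

Lemma Tk_far p s : s <= c -> Tk p s = kQ p 1 s.
Proof. by move=> sc; rewrite /Tk min_l. Qed.

Lemma Tk_measurable p : measurable_fun setT (Tk p).
Proof.
apply: (measurableT_comp (kQ_measurable p 1)).
by apply: measurable_minr => //; exact: measurable_cst.
Qed.

Lemma kq_ge_eps r s : 2^-1 <= r -> s <= c -> eps <= kq r s.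
Proof.
move=> r2 sc; rewrite /kq; have := sqr_ge0 (1 - r); rewrite sqrrB.
have : 2^-1 * eps <= r * (1 - s).
  by apply: ler_pM; [rewrite invr_ge0|exact: ltW|exact: r2|move: sc; lra].
by lra.
Qed.

Definition Cp p : R := expR (- p * ln eps).

Lemma kQ_le_Cp p r s : 0 < p -> 2^-1 <= r -> s <= c -> kQ p r s <= Cp p.
Proof.
move=> p0 r2 sc; rewrite /kQ /Cp ler_expR !mulNr lerN2 ler_wpM2l ?(ltW p0)//.
have q := kq_ge_eps r2 sc.
by rewrite ler_ln ?posrE// (lt_le_trans eps0).
Qed.

Lemma Tk_bound p s : 0 < p -> `|Tk p s| <= Cp p.
Proof.
move=> p0; rewrite gtr0_norm ?kQ_gt0//; apply: kQ_le_Cp; [exact: p0|lra|by rewrite ge_min lexx orbT].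
Qed.

Lemma schur_Tk p : 0 < p -> schur om (zK (Tk p)) (Cp p * w).
Proof. by move=> p0; apply: schur_zK_bounded; [exact: Tk_measurable|move=> s _; exact: Tk_bound]. Qed.

Variable x0 : E.
Hypothesis S0 : sphere R d x0.

Definition phiz q (x : E) : R := bz q (edot (radial x) x0).

Lemma phiz_sqi q : sqi om (phiz q).
Proof. by apply: zonal_sqi => // s _; exact: bz_cont. Qed.

Definition Az q p y := \int[om]_x (Tk p (edot (radial x) y) * phiz q x).

(** Integration by parts needs r < 1, hence this limit. The bump lives where x . y <= 1 - eps, by
    [cap_far], and there the kernels with r_n >= 1/2 are bounded by [Cp p]. *)
Lemma Az_cvg q p y : 0 < p -> sphere R d y -> edot y x0 <= 1 - 4 * eps ->
  \int[om]_x (kQ p (rn n) (edot (radial x) y) * phiz q x) @[n --> \oo] --> Az q p y.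
Proof.
move=> p0 Sy yy; have sphi := phiz_sqi q; have [mphi _] := sphi.
have Ry : radial y = y by exact: radial_sphere.
have mk r : measurable_fun setT (fun x : E => kQ p r (edot (radial x) y)).
  have := @zK_measurable R d _ (kQ_measurable p r).
  move=> m; have := measurableT_comp m (pair2_measurable y).
  by congr (measurable_fun _ _); apply/funext => x; rewrite /= /zK Ry.
have mT : measurable_fun setT (fun x : E => Tk p (edot (radial x) y)).
  have := @zK_measurable R d _ (Tk_measurable p).
  move=> m; have := measurableT_comp m (pair2_measurable y).
  by congr (measurable_fun _ _); apply/funext => x; rewrite /= /zK Ry.
have [] := @Rdominated_cvg _ _ _ om (fun n x => kQ p (rn n) (edot (radial x) y) * phiz q x)
  (fun x => Tk p (edot (radial x) y) * phiz q x) (fun x => Cp p * `|phiz q x|).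
- by move=> n; apply: measurable_funM; [exact: mk|exact: mphi].
- by apply: measurable_funM; [exact: mT|exact: mphi].
- apply: filterS ae_sphere => x Sx; have Rx : radial x = x by exact: radial_sphere.
  rewrite /phiz Rx; have [xx|xx] := leP (edot x x0) c.
    by rewrite bz_out// mulr0; under eq_fun do rewrite mulr0; exact: cvg_cst.
  have xy := cap_far Sx Sy S0 xx yy; rewrite Tk_far//.
  apply: cvgM; last exact: cvg_cst.
  have q0 : 0 < kq 1 (edot x y) by apply: lt_le_trans eps0 (kq_ge_eps _ xy); rewrite invf_le1// ler1n.
  have cc := is_derive_continuous (is_derive_kQ_r p q0).
  exact: (@cvg_comp _ _ _ rn (fun r => kQ p r (edot x y)) _ _ _ (@rn_cvg R) cc).
- by apply: itgZ; have := integrable_abse (sqi_itg sphi); exact: eq_integrable.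
- move=> n; apply: filterS ae_sphere => x Sx; have Rx : radial x = x by exact: radial_sphere.
  rewrite /phiz Rx; have [xx|xx] := leP (edot x x0) c; first by rewrite bz_out// mulr0 normr0 mulr0.
  have xy := cap_far Sx Sy S0 xx yy; rewrite normrM ler_wpM2r// gtr0_norm ?kQ_gt0//.
  by apply: kQ_le_Cp => //; have /andP[] := rn_bounds (R := R) n.
by [].
Qed.

(** The term of exponent p + 2 carries the factor (1 - r^2)^2, which vanishes as r tends to 1; a
    relation between only two consecutive exponents remains. *)
Lemma kQ_zlap p r s : 0 < r < 1 -> `|s| <= 1 ->
  zlap d (fun s => 2 * r * p * kQ (p + 1) r s) (fun s => 2 * r * p * (2 * r * (p + 1) * kQ (p + 1 + 1) r s)) s =
  p * (p + 1) * (2 * (1 + r ^+ 2) * kQ (p + 1) r s - (1 - r ^+ 2) ^+ 2 * kQ (p + 1 + 1) r s - kQ p r s)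
  - (2 * a + 1) * p * ((1 + r ^+ 2) * kQ (p + 1) r s - kQ p r s).
Proof.
move=> /andP[r0 r1] s1; have q0 : 0 < kq r s by apply: kq_gt0 => //; rewrite gtr0_norm.
rewrite /zlap (kQS p q0) (kQS (p + 1) q0) (@ka_dim R d) /kq; ring.
Qed.

Lemma Az_rec q p y : 0 < p -> sphere R d y -> edot y x0 <= 1 - 4 * eps ->
  Az (Lstar q) p y = 2 * p * (2 * (p - a) + 1) * Az q (p + 1) y + p * (2 * a - p) * Az q p y.
Proof.
move=> p0 Sy yy; have p1 : 0 < p + 1 by rewrite addr_gt0.
have p2 : 0 < p + 1 + 1 by rewrite addr_gt0.
have c0 := @Az_cvg (Lstar q) p y p0 Sy yy; have c1 := @Az_cvg q p y p0 Sy yy.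
have c2 := @Az_cvg q _ y p1 Sy yy; have c3 := @Az_cvg q _ y p2 Sy yy.
pose I t n := \int[om]_x (kQ t (rn n) (edot (radial x) y) * phiz q x).
have e n : \int[om]_x (kQ p (rn n) (edot (radial x) y) * phiz (Lstar q) x) =
    p * (p + 1) * (2 * (1 + rn n ^+ 2) * I (p + 1) n - (1 - rn n ^+ 2) ^+ 2 * I (p + 1 + 1) n - I p n)
    - (2 * a + 1) * p * ((1 + rn n ^+ 2) * I (p + 1) n - I p n).
  have /andP[r2 r1] := rn_bounds (R := R) n.
  have r0 : 0 < rn n < 1 by rewrite r1 andbT; lra.
  have rr : `|rn n| < 1 by exact: rn_lt1.
  have zQ t := @zC1_kQ R t (rn n) rr.
  have zQ' : zC1 (fun s => 2 * rn n * p * kQ (p + 1) (rn n) s)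
      (fun s => 2 * rn n * p * (2 * rn n * (p + 1) * kQ (p + 1 + 1) (rn n) s)).
    by apply: zC1Z; exact: zQ.
  have iI t : itg om (fun x => kQ t (rn n) (edot (radial x) y) * phiz q x).
    apply: (zonal_pair_itg Sy S0) => s s1; [exact: zC1_cont (zQ t) s1|exact: bz_cont].
  transitivity (\int[om]_x (zlap d (bz (bump_deriv q)) (bz (bump_deriv (bump_deriv q))) (edot (radial x) x0) *
      kQ p (rn n) (edot (radial x) y))).
    by apply: eq_Rintegral => x _; rewrite zlap_bz mulrC.
  rewrite (zonal_green S0 Sy (zC1_bz _) (zQ p)).
  transitivity (\int[om]_x (zlap d (fun s => 2 * rn n * p * kQ (p + 1) (rn n) s)
      (fun s => 2 * rn n * p * (2 * rn n * (p + 1) * kQ (p + 1 + 1) (rn n) s)) (edot (radial x) y) *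
      bz q (edot (radial x) x0))).
    rewrite (zonal_green Sy S0 zQ' (zC1_bz _)); apply: congr1; apply: eq_Rintegral => x _.
    by rewrite [edot x0 y]edotC; ring.
  pose A1 := (p * (p + 1) * 2 - (2 * a + 1) * p) * (1 + rn n ^+ 2).
  pose A2 := p * (p + 1) * (1 - rn n ^+ 2) ^+ 2.
  pose A3 := (2 * a + 1) * p - p * (p + 1).
  transitivity (\int[om]_x (A1 * (kQ (p + 1) (rn n) (edot (radial x) y) * phiz q x) -
      A2 * (kQ (p + 1 + 1) (rn n) (edot (radial x) y) * phiz q x) +
      A3 * (kQ p (rn n) (edot (radial x) y) * phiz q x))).
    apply: eq_Rintegral => x _; rewrite kQ_zlap//; last exact: edot_radial_le1.
    by rewrite /A1 /A2 /A3 /phiz; ring.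
  have j1 := itgZ A1 (iI (p + 1)); have j2 := itgZ A2 (iI (p + 1 + 1)); have j3 := itgZ A3 (iI p).
  transitivity (A1 * I (p + 1) n - A2 * I (p + 1 + 1) n + A3 * I p n).
    rewrite (RintegralD measurableT (itgB j1 j2) j3) (RintegralB measurableT j1 j2).
    rewrite (RintegralZl _ measurableT (iI (p + 1))) (RintegralZl _ measurableT (iI (p + 1 + 1))).
    by rewrite (RintegralZl _ measurableT (iI p)); exact: erefl.
  rewrite /A1 /A2 /A3; move: (I _ n) (I _ n) (I _ n) (rn n) => u1 u2 u3 u4; ring.
have cvg2 (u : nat -> R) (l : R) : u n @[n --> \oo] --> l -> u n ^+ 2 @[n --> \oo] --> l ^+ 2.
  by move=> ul; rewrite expr2; under eq_fun do rewrite expr2; exact: cvgM.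
have r2c : rn n ^+ 2 @[n --> \oo] --> (1 : R).
  by rewrite -(expr1n R 2); apply: cvg2; exact: rn_cvg.
have cst_ (t : R) : (fun=> t : R) @ \oo --> t by exact: cvg_cst.
have lim2 : (p * (p + 1) * (2 * (1 + rn n ^+ 2) * I (p + 1) n - (1 - rn n ^+ 2) ^+ 2 * I (p + 1 + 1) n - I p n)
    - (2 * a + 1) * p * ((1 + rn n ^+ 2) * I (p + 1) n - I p n)) @[n --> \oo] -->
    p * (p + 1) * (2 * (1 + 1) * Az q (p + 1) y - (1 - 1) ^+ 2 * Az q (p + 1 + 1) y - Az q p y)
    - (2 * a + 1) * p * ((1 + 1) * Az q (p + 1) y - Az q p y).
  have k1 : (1 + rn n ^+ 2) * I (p + 1) n @[n --> \oo] --> (1 + 1) * Az q (p + 1) y.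
    by apply: cvgM c2; apply: cvgD r2c; exact: cst_.
  apply: cvgB; apply: cvgM (cst_ _) _; apply: cvgB c1; last exact: k1.
  apply: cvgB.
    by apply: cvgM c2; apply: cvgM (cst_ _) _; apply: cvgD r2c; exact: cst_.
  by apply: cvgM c3; apply: cvg2; apply: cvgB r2c; exact: cst_.
rewrite (funext e) in c0.
have -> := cvg_unique (@norm_hausdorff _ _) c0 lim2.
move: (Az _ _ _) (Az _ _ _) (Az _ _ _) => u1 u2 u3; ring.
Qed.

Variable h : E -> R.
Hypothesis sh : sqi om h.
Hypothesis h0 : {ae om, forall y, 1 - 4 * eps < edot y x0 -> h y = 0}.
Hypothesis H0 : forall q, ip om h (Gop (fun x => zop (d := d) (bz q) (bz (bump_deriv q))
  (bz (bump_deriv (bump_deriv q))) (edot (radial x) x0))) = 0.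

Definition Bz q p := ip om h (iop om (zK (Tk p)) (phiz q)).

Lemma ip_near (F G : E -> R) : (forall y, sphere R d y -> edot y x0 <= 1 - 4 * eps -> F y = G y) ->
  ip om h F = ip om h G.
Proof.
move=> FG; apply: eq_Rintegral_ae; apply: filterS2 ae_sphere h0 => y Sy hy.
by have [yy|yy] := leP (edot y x0) (1 - 4 * eps); [rewrite FG|rewrite hy// !mul0r].
Qed.

Lemma AzE q p y : sphere R d y -> iop om (zK (Tk p)) (phiz q) y = Az q p y.
Proof.
by move=> Sy; apply: eq_Rintegral => x _; rewrite /zK (radial_sphere Sy) edotC.
Qed.

Let Cw p : 0 < Cp p * w. Proof. by rewrite mulr_gt0// expR_gt0. Qed.

Lemma iTk_sqi q p : 0 < p -> sqi om (iop om (zK (Tk p)) (phiz q)).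
Proof. by move=> p0; have [] := iop_sqi (Cw p) (schur_Tk p0) (phiz_sqi q). Qed.

(* Delta_x |x - y|^(-2p) = 2p(2(p - a) + 1) |x - y|^(-2p - 2) + p(2a - p) |x - y|^(-2p). *)
Lemma Bz_rec q p : 0 < p -> Bz (Lstar q) p =
  2 * p * (2 * (p - a) + 1) * Bz q (p + 1) + p * (2 * a - p) * Bz q p.
Proof.
move=> p0; have p1 : 0 < p + 1 by rewrite addr_gt0.
have ph := sqi_prehilbert om.
have s1 := iTk_sqi q p1; have s2 := iTk_sqi q p0.
rewrite /Bz -(ipZr ph _ s1 sh) -(ipZr ph _ s2 sh) -(ipDr ph (sqiZ _ s1) (sqiZ _ s2) sh).
apply: ip_near => y Sy yy.
rewrite -[RHS]/(2 * p * (2 * (p - a) + 1) * iop om (zK (Tk (p + 1))) (phiz q) y +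
  p * (2 * a - p) * iop om (zK (Tk p)) (phiz q) y).
by rewrite !(AzE _ _ Sy); exact: Az_rec.
Qed.

(** Orthogonality to G (a^2 - Delta) phi reads a^2 B(q, a) = B(Lstar q, a). At p = a the recursion
    gives B(Lstar q, a) = 2a B(q, a + 1) + a^2 B(q, a), whence 2a B(q, a + 1) = 0. *)
Lemma Bz_start q : Bz q (a + 1) = 0.
Proof.
have ph := sqi_prehilbert om; have s1 := iTk_sqi q a0; have s2 := iTk_sqi (Lstar q) a0.
have e : ip om h (Gop (fun x => zop (d := d) (bz q) (bz (bump_deriv q))
    (bz (bump_deriv (bump_deriv q))) (edot (radial x) x0))) =
    w^-1 * (a ^+ 2 * Bz q a - Bz (Lstar q) a).
  rewrite /Bz -(ipZr ph _ s1 sh) -(ipBr ph (sqiZ _ s1) s2 sh) -(ipZr ph _ (sqiB (sqiZ _ s1) s2) sh).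
  apply: ip_near => y Sy yy.
  rewrite -[RHS]/(w^-1 * (a ^+ 2 * iop om (zK (Tk a)) (phiz q) y - iop om (zK (Tk a)) (phiz (Lstar q)) y)).
  rewrite !(AzE _ _ Sy) /Gop /zT; apply: congr1; rewrite /Az.
  have iI q' : itg om (fun x => Tk a (edot (radial x) y) * phiz q' x).
    apply: sqi_mul_itg (phiz_sqi q'); apply: (@sqi_bounded _ _ _ om _ (Cp a)); last by move=> x; exact: Tk_bound.
    have := @zK_measurable R d _ (Tk_measurable a).
    move=> m; have := measurableT_comp m (pair2_measurable y).
    by congr (measurable_fun _ _); apply/funext => x; rewrite /= /zK (radial_sphere Sy).
  rewrite -(RintegralZl _ measurableT (iI q)) -(RintegralB measurableT (itgZ _ (iI q)) (iI _)).
  apply: eq_Rintegral_ae; apply: filterS ae_sphere => x Sx.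
  rewrite /zK /zop zlap_bz (radial_sphere Sy) (radial_sphere Sx) [edot y x]edotC /phiz (radial_sphere Sx).
  have [xx|xx] := leP (edot x x0) c; first by rewrite !bz_out// !mulr0 subrr mulr0.
  by rewrite Tk_far ?(cap_far Sx Sy S0)// /kN; ring.
have := H0 q; rewrite e (Bz_rec q a0) => /eqP; rewrite mulf_eq0 invr_eq0 gt_eqF//= => /eqP h1.
have : 2 * a * Bz q (a + 1) = 0.
  move: h1; rewrite subrr mulr0 add0r mulr1.
  by move: (Bz q (a + 1)) (Bz q a) => u v h1; rewrite -oppr0 -h1; ring.
by move/eqP; rewrite mulf_eq0 mulf_eq0 gt_eqF//= gt_eqF//= => /eqP.
Qed.

(** The induction is on all q at once, since the recursion replaces q by [Lstar q]; the coefficient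
    2p (2 (p - a) + 1) is positive for p > a. *)
Lemma Bz_eq0 k q : Bz q (a + k.+1%:R) = 0.
Proof.
elim: k q => [|k IH] q; first exact: Bz_start.
have p0 : 0 < a + k.+1%:R by rewrite addr_gt0.
have := Bz_rec q p0; rewrite !IH mulr0 addr0 => /esym/eqP.
rewrite (_ : a + k.+1%:R + 1 = a + k.+2%:R); last by rewrite -addrA natr1.
rewrite mulf_eq0 => /orP[|/eqP//]; rewrite addrC addrK mulf_eq0 => /orP[].
  by rewrite gt_eqF// mulr_gt0// addrC.
by rewrite gt_eqF// addr_gt0// mulr_gt0.
Qed.

End bump_recursion.

(** * Approximation of kernels by polynomials in another kernel *)

Section kernel_approximation.
Context {R : realType} {d : nat}.
Local Notation E := 'rV[R]_d.
Local Notation om := (omega R d).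
Local Notation w := (omega_d R d).
Hypothesis hd : (3 <= d)%N.
Local Notation a := (@ka R d).
Let a0 : 0 < a := ka_gt0 hd.
Let w0 : 0 < w. Proof. by apply: omega_d_gt0; exact: leq_trans hd. Qed.
Let ph := sqi_prehilbert om.

(** q^(a + 1) is the d-th power of sqrt q since 2 (a + 1) = d, so it can be reached by [ulim_sqrt]
    and [ulimX]. *)
Lemma sqrt_pow_ka (q : R) : 0 < q -> Num.sqrt q ^+ d = expR ((a + 1) * ln q).
Proof.
move=> q0; have -> : Num.sqrt q = expR (ln q / 2).
  apply/eqP; rewrite -(eqrXn2 (n := 2))// ?sqrtr_ge0 ?expR_ge0//.
  by rewrite sqr_sqrtr ?(ltW q0)// -expRM_natl mulrC mulfVK// lnK.
by rewrite -expRM_natl; apply: congr1; rewrite /ka; field.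
Qed.

(** By linearity T q(U) is annihilated for every polynomial q, and the Schur bound shows that a
    uniformly small change of F changes the pairing little. *)
Lemma iop_linear_eq0 (T F : R -> R) (C : R) (h f : E -> R) (U : R -> R) (M : R) : 0 < C ->
  measurable_fun setT T -> measurable_fun setT F -> measurable_fun setT U ->
  (forall s, `|s| <= 1 -> `|T s| <= C) -> (forall s, `|s| <= 1 -> `|F s| <= M) ->
  (forall s, `|s| <= 1 -> `|U s| <= M) ->
  ulim [set s | `|s| <= 1] U F -> sqi om h -> sqi om f ->
  (forall i, ip om h (iop om (zK (fun s => T s * U s ^+ i)) f) = 0) ->
  ip om h (iop om (zK (fun s => T s * F s)) f) = 0.
Proof.
move=> C0 mT mF mU TC FM UM [_ uF] sh sf Z.
have sI (k : R -> R) B : 0 < B -> measurable_fun setT k -> (forall s, `|s| <= 1 -> `|k s| <= B) ->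
    sqi om (iop om (zK k) f) /\ nrm (ip om) (iop om (zK k) f) <= B * w * nrm (ip om) f.
  by move=> B0 mk kB; apply: iop_sqi => //; [exact: mulr_gt0|exact: schur_zK_bounded].
have M0 : 0 <= M.
  by apply: le_trans (normr_ge0 _) (FM 0 _); rewrite normr0.
have sTF : sqi om (iop om (zK (fun s => T s * F s)) f).
  have [] // := sI (fun s => T s * F s) (C * (M + 1)).
  - by rewrite mulr_gt0// ltr_wpDl.
  - exact: measurable_funM.
  - move=> s s1; rewrite normrM; apply: ler_pM => //; first exact: TC.
    by apply: le_trans (FM _ s1) _; rewrite lerDl.
have sTU i : sqi om (iop om (zK (fun s => T s * U s ^+ i)) f).
  have [] // := sI (fun s => T s * U s ^+ i) (C * (M ^+ i + 1)).
  - by rewrite mulr_gt0// ltr_wpDl// exprn_ge0.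
  - by apply: measurable_funM => //; exact: measurable_funX.
  - move=> s s1; rewrite normrM normrX; apply: ler_pM; [exact: normr_ge0|by rewrite exprn_ge0|exact: TC|].
    by apply: (@le_trans _ _ (M ^+ i)); [rewrite lerXn2r ?nnegrE ?UM|rewrite lerDl].
apply/eqP; rewrite -normr_le0; apply/ler_addgt0Pr => e e0; rewrite add0r.
pose B := nrm (ip om) h * (C * w * nrm (ip om) f) + 1.
have B0 : 0 < B.
  by rewrite ltr_wpDl// !mulr_ge0 ?nrm_ge0// ltW.
have eB : 0 < e / B by rewrite divr_gt0.
have [q hq] := uF _ eB.
pose G s := \sum_(i < size q) q`_i * (T s * U s ^+ i).
have GE s : G s = T s * q.[U s].
  rewrite /G horner_coef mulr_sumr; apply: eq_bigr => i _; ring.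
have mG : measurable_fun setT G.
  by apply: measurable_sum => i; apply: measurable_funM => //; apply: measurable_funM => //; exact: measurable_funX.
have eG : ip om h (iop om (zK G) f) = 0.
  transitivity (ip om h (fun y => \sum_(i < size q) (q`_i *: iop om (zK (fun s => T s * U s ^+ i)) f) y)).
    apply: eq_Rintegral => y _; apply: congr1.
    have iK (i : 'I_(size q)) : itg om (fun x => q`_i * (zK (fun s => T s * U s ^+ i) y x * f x)).
      apply: itgZ; apply: sqi_mul_itg sf.
      apply: (@sqi_bounded _ _ _ om _ (C * M ^+ i)).
        have := @zK_measurable R d (fun s => T s * U s ^+ i) _.
        move=> m; have := measurableT_comp (m _) (pair1_measurable y); apply.
        by apply: measurable_funM => //; exact: measurable_funX.
      move=> x; rewrite /zK normrM normrX; apply: ler_pM; [exact: normr_ge0|by rewrite exprn_ge0|by apply: TC; exact: edot_radial2_le1|].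
      by rewrite lerXn2r ?nnegrE// UM// edot_radial2_le1.
    transitivity (\int[om]_x \sum_(i < size q) q`_i * (zK (fun s => T s * U s ^+ i) y x * f x)).
      apply: eq_Rintegral => x _; rewrite /zK /G mulr_suml; apply: eq_bigr => i _; ring.
    rewrite Rintegral_sum//; apply: eq_bigr => i _.
    rewrite -[RHS]/(q`_i * iop om (zK (fun s => T s * U s ^+ i)) f y).
    apply: RintegralZl => //; apply: sqi_mul_itg sf.
    apply: (@sqi_bounded _ _ _ om _ (C * M ^+ i)).
      have := @zK_measurable R d (fun s => T s * U s ^+ i) _.
      move=> m; have := measurableT_comp (m _) (pair1_measurable y); apply.
      by apply: measurable_funM => //; exact: measurable_funX.
    move=> x; rewrite /zK normrM normrX; apply: ler_pM; [exact: normr_ge0|by rewrite exprn_ge0|by apply: TC; exact: edot_radial2_le1|].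
    by rewrite lerXn2r ?nnegrE// UM// edot_radial2_le1.
  transitivity (\sum_(i < size q) ip om h (q`_i *: iop om (zK (fun s => T s * U s ^+ i)) f)).
    rewrite /ip -Rintegral_sum; last by move=> i; apply: sqi_mul_itg => //; exact: sqiZ.
    by apply: eq_Rintegral => y _; rewrite mulr_sumr.
  by apply: big1 => i _; rewrite (ipZr ph _ (sTU i) sh) Z mulr0.
have [sD nD] : sqi om (iop om (zK (fun s => T s * F s - G s)) f) /\
    nrm (ip om) (iop om (zK (fun s => T s * F s - G s)) f) <= C * (e / B) * w * nrm (ip om) f.
  apply: sI; first exact: mulr_gt0.
    by apply: measurable_funB => //; exact: measurable_funM.
  move=> s s1; rewrite GE -mulrBr normrM; apply: ler_pM => //; first exact: TC.
  exact: hq.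
have sG : sqi om (iop om (zK G) f).
  have [] // := sI G (C * (M + e / B + 1)).
  - by rewrite mulr_gt0// ltr_wpDl// addr_ge0// ltW.
  - move=> s s1; rewrite GE normrM; apply: ler_pM => //; first exact: TC.
    have : `|q.[U s]| <= `|F s| + `|F s - q.[U s]|.
      by rewrite -[X in `|X| <= _](subKr (F s)) ler_normB.
    by have := hq s s1; have := FM s s1; lra.
have e1 : ip om h (iop om (zK (fun s => T s * F s)) f) =
    ip om h (iop om (zK (fun s => T s * F s - G s)) f) + ip om h (iop om (zK G) f).
  rewrite -(ipDr ph sD sG sh); apply: eq_Rintegral => y _; apply: congr1.
  rewrite -[RHS]/(iop om (zK (fun s => T s * F s - G s)) f y + iop om (zK G) f y).
  have mz (k : R -> R) : measurable_fun setT k -> measurable_fun setT (zK k y : E -> R).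
    by move=> mk; exact: (measurableT_comp (@zK_measurable R d k mk) (pair1_measurable y)).
  have bz (k : R -> R) K : measurable_fun setT k -> (forall s, `|s| <= 1 -> `|k s| <= K) ->
      itg om (fun x => zK k y x * f x).
    move=> mk kK; apply: sqi_mul_itg sf; apply: (@sqi_bounded _ _ _ om _ K); first exact: mz.
    by move=> x; apply: kK; exact: edot_radial2_le1.
  rewrite /iop -RintegralD//.
  - by apply: eq_Rintegral => x _; rewrite /zK -mulrDl subrK.
  - apply: (@bz _ (C * (e / B))); first by apply: measurable_funB => //; exact: measurable_funM.
    move=> s s1; rewrite GE -mulrBr normrM; apply: ler_pM => //; first exact: TC.
    exact: hq.
  - apply: (@bz _ (C * (M + e / B))) => // s s1; rewrite GE normrM; apply: ler_pM => //; first exact: TC.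
    have : `|q.[U s]| <= `|F s| + `|F s - q.[U s]|.
      by rewrite -[X in `|X| <= _](subKr (F s)) ler_normB.
    by have := hq s s1; have := FM s s1; lra.
rewrite e1 eG addr0; apply: le_trans (cauchy_schwarz ph sh sD) _.
apply: (@le_trans _ _ (nrm (ip om) h * (C * (e / B) * w * nrm (ip om) f))).
  by rewrite ler_wpM2l// nrm_ge0.
have -> : nrm (ip om) h * (C * (e / B) * w * nrm (ip om) f) =
    (nrm (ip om) h * (C * w * nrm (ip om) f)) * (e / B) by ring.
apply: (@le_trans _ _ (B * (e / B))); last by rewrite mulrC divfK// gt_eqF.
by rewrite ler_wpM2r ?(ltW eB)// /B lerDl.
Qed.

End kernel_approximation.

Section unique_continuation.
Context {R : realType} {d : nat}.
Local Notation E := 'rV[R]_d.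
Local Notation om := (omega R d).
Local Notation w := (omega_d R d).
Hypothesis hd : (3 <= d)%N.
Local Notation a := (@ka R d).
Local Notation rn := (@rn R).
Let a0 : 0 < a := ka_gt0 hd.
Let w0 : 0 < w. Proof. by apply: omega_d_gt0; exact: leq_trans hd. Qed.
Let ph := sqi_prehilbert om.

Lemma kQ_pow (p : R) r s i : 0 < kq r s -> kQ p r s * kQ 1 r s ^+ i = kQ (p + i%:R) r s.
Proof.
move=> q0; rewrite /kQ -expRM_natl -expRD; apply: congr1; ring.
Qed.

Lemma kQV (p : R) r s : kQ p r s * kQ (- p) r s = 1.
Proof. by rewrite /kQ -expRD opprK mulNr addNr expR0. Qed.

Lemma kQ1 r s : 0 < kq r s -> kQ 1 r s = (kq r s)^-1 :> R.
Proof. by move=> q0; rewrite /kQ mulN1r expRN lnK. Qed.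

Section center.
Variables (eps : R) (x0 : E) (h : E -> R).
Hypothesis eps0 : 0 < eps.
Hypothesis eps1 : eps <= 1.
Hypothesis S0 : sphere R d x0.
Hypothesis sh : sqi om h.
Hypothesis h0 : {ae om, forall y, 1 - 4 * eps < edot y x0 -> h y = 0}.
Hypothesis H0 : forall q, ip om h (Gop (fun x => zop (d := d) (bz eps q) (bz eps (bump_deriv q))
  (bz eps (bump_deriv (bump_deriv q))) (edot (radial x) x0))) = 0.
Local Notation c := (1 - eps).
Let mn s := Num.min s c.

Lemma kq_mn s : `|s| <= 1 -> 2 * eps <= kq 1 (mn s) <= 4.
Proof.
rewrite ler_norml => /andP[s1 s2]; have h1 : mn s <= c by rewrite ge_min lexx orbT.
have h2 : -1 <= mn s by rewrite le_min s1/=; move: eps1; lra.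
by move: (mn s) h1 h2 => m h1 h2; rewrite /kq; apply/andP; split; lra.
Qed.

Lemma kq_mn_gt0 s : 0 < kq 1 (mn s).
Proof.
have h1 : mn s <= c by rewrite ge_min lexx orbT.
by move: (mn s) h1 eps0 => m h1 e0; rewrite /kq; lra.
Qed.

Lemma Tk_ulim : ulim [set s | `|s| <= 1] (Tk eps 1) (Tk eps 1).
Proof. by apply: (@ulim_gen _ _ _ (Cp eps 1)) => s s1; exact: Tk_bound. Qed.

(** Put U = [Tk eps 1]. On truncated arguments kq = 1/U and s = 1 - kq/2, so s^j = [Tk eps (a + 1)]
    F with F = sqrt(1/U)^d (1 - 1/(2U))^j, a uniform limit of polynomials in U. The products
    [Tk eps (a + 1)] U^i are kernels of exponent a + i + 1, annihilated by [Bz_eq0]. *)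
Lemma moment_min q j : ip om h (iop om (zK (fun s => mn s ^+ j)) (phiz eps x0 q)) = 0.
Proof.
pose F s := Tk eps (- (a + 1)) s * mn s ^+ j.
have uq : ulim [set s | `|s| <= 1] (Tk eps 1) (fun s => (Tk eps 1 s)^-1).
  apply: (@ulimV _ _ _ _ 4^-1); [by []| |exact: Tk_ulim].
  move=> s /= s1; rewrite /Tk kQ1 ?kq_mn_gt0// lef_pV2 ?posrE ?kq_mn_gt0//.
  by have /andP[] := kq_mn s1.
have qE s : (Tk eps 1 s)^-1 = kq 1 (mn s) by rewrite /Tk kQ1 ?kq_mn_gt0// invrK.
have us : ulim [set s | `|s| <= 1] (Tk eps 1) (fun s => Num.sqrt (Tk eps 1 s)^-1 ^+ d).
  apply: ulimX; apply: (@ulim_sqrt _ _ _ _ (2 * eps)) => //; first exact: mulr_gt0.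
  by move=> s /= s1; rewrite qE; have /andP[] := kq_mn s1.
have um : ulim [set s | `|s| <= 1] (Tk eps 1) (fun s => (1 + (- 2^-1) * (Tk eps 1 s)^-1) ^+ j).
  apply: ulimX; apply: ulimD; first exact: ulim_cst.
  by apply: ulimM; first exact: ulim_cst.
have uF : ulim [set s | `|s| <= 1] (Tk eps 1) F.
  rewrite (_ : F = fun s => Num.sqrt (Tk eps 1 s)^-1 ^+ d * (1 + (- 2^-1) * (Tk eps 1 s)^-1) ^+ j).
    exact: ulimM.
  apply/funext => s; rewrite qE sqrt_pow_ka ?kq_mn_gt0// /F; apply: (f_equal2 *%R).
    by rewrite /Tk /kQ opprK.
  by apply: (congr1 (fun t => t ^+ j)); rewrite /kq -/(mn s); field.
have [[M FM] _] := uF.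
have mmn : measurable_fun setT mn.
  by apply: measurable_minr => //; exact: measurable_cst.
have mF : measurable_fun setT F.
  by apply: measurable_funM; [exact: Tk_measurable|exact: measurable_funX].
have C0 p : 0 < Cp eps p by exact: expR_gt0.
have a1 : 0 < a + 1 by rewrite addr_gt0.
have := @iop_linear_eq0 R d hd (Tk eps (a + 1)) F (Cp eps (a + 1)) h (phiz eps x0 q) (Tk eps 1)
  (`|M| + Cp eps 1) (C0 _) (Tk_measurable _ _) mF (Tk_measurable _ _).
move=> /(_ (fun s _ => Tk_bound eps0 s a1)) H.
rewrite (_ : (fun s => mn s ^+ j) = fun s => Tk eps (a + 1) s * F s); last first.
  by apply/funext => s; rewrite /F mulrA /Tk kQV mul1r.
apply: H => //.
- by move=> s s1; apply: le_trans (FM _ s1) _; apply: le_trans (ler_norm _) _; rewrite lerDl ltW.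
- by move=> s s1; apply: le_trans (Tk_bound eps0 s ltr01) _; rewrite lerDr.
- exact: phiz_sqi.
move=> i; rewrite (_ : (fun s => _) = Tk eps (a + i.+1%:R)).
  exact: (Bz_eq0 hd eps0 S0 sh h0 H0 i q).
apply/funext => s; rewrite /Tk kQ_pow ?kq_mn_gt0//.
by apply: (congr1 (fun p => kQ p 1 _)); rewrite -addrA -natr1 [1 + _]addrC.
Qed.

(** The truncation is invisible: h vanishes on the large cap, the bump lives in the small one, and
    [cap_far] separates them. *)
Lemma moment q j : ip om h (iop om (zK (fun s => s ^+ j)) (phiz eps x0 q)) = 0.
Proof.
rewrite -(moment_min q j); apply: (ip_near h0) => y Sy yy.
apply: eq_Rintegral_ae; apply: filterS ae_sphere => x Sx.
rewrite /zK /phiz (radial_sphere Sx) (radial_sphere Sy).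
have [xx|xx] := leP (edot x x0) c; first by rewrite bz_out// !mulr0.
by rewrite [edot y x]edotC /mn (min_l (cap_far Sx Sy S0 xx yy)).
Qed.

(** Otherwise the bump would be null almost everywhere and so would be its Poisson means, which
    converge at x0 to its value there, a positive number. *)
Lemma integral_phiz_gt0 : 0 < \int[om]_x phiz eps x0 1 x.
Proof.
have sp := phiz_sqi eps S0 1; have p0 x : 0 <= phiz eps x0 1 x by exact: bump1_ge0.
rewrite lt_neqAle Rintegral_ge0 ?andbT//; apply/eqP => e.
have z := Rintegral_eq0 (sqi_itg sp) p0 (esym e).
pose f (x : E) := bz eps 1 (edot x x0).
have cf : continuous f.
  move=> x; apply: (@continuous_comp _ _ _ (fun x : E => edot x x0) (bz eps 1)).
    exact: edot_continuous.
  exact: bz_cont.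
have f1 x : `|f x| <= 1 by rewrite ger0_norm ?bump1_le1// bump1_ge0.
have := kP_approx hd cf f1 S0.
rewrite (_ : (fun n => _) = fun=> 0); last first.
  apply/funext => n; rewrite (@zT_ae R d _ _ (fun=> 0)); last first.
    by apply: filterS2 z ae_sphere => x; rewrite /phiz /f => + Sx; rewrite (radial_sphere Sx).
  rewrite /zT /iop; under eq_Rintegral do rewrite mulr0.
  by rewrite Rintegral_cst// mul0r mulr0.
move/(cvg_lim (@norm_hausdorff _ _)); rewrite lim_cst// => /esym f0.
have : 0 < f x0 by rewrite /f /bz (edot_sphere S0); apply: bump1_gt0; rewrite mul1r opprB addrC subrK.
by rewrite f0 ltxx.
Qed.

Definition moment_fun (f : E -> R) j (x : E) := \int[om]_y (edot x (radial y) ^+ j * f y).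

Lemma edot_radial_itg (f : E -> R) (g : E -> R) M : sqi om f -> measurable_fun setT g ->
  (forall x, `|g x| <= M) -> itg om (fun y => g y * f y).
Proof. by move=> sf mg gM; apply: sqi_mul_itg sf; exact: sqi_bounded mg gM. Qed.

Lemma measurable_edotr (x : E) : measurable_fun setT (fun y : E => edot x (radial y)).
Proof.
by apply: measurable_sum => i; apply: measurable_funM => //; exact: measurable_radial_coord.
Qed.

Lemma edotr_le (x y : E) : `|edot x (radial y)| <= enorm x.
Proof.
by apply: le_trans (edot_cauchy _ _) _; rewrite ler_piMr ?sqrtr_ge0// enorm_radial_le1.
Qed.

Lemma moment_fun_itg j x : itg om (fun y => edot x (radial y) ^+ j * h y).
Proof.
apply: (@edot_radial_itg _ _ (enorm x ^+ j) sh).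
  by apply: measurable_funX; exact: measurable_edotr.
by move=> y; rewrite normrX lerXn2r ?nnegrE ?sqrtr_ge0// edotr_le.
Qed.

Lemma expr_lip (u v : R) j : `|u| <= 1 -> `|v| <= 1 -> `|u ^+ j - v ^+ j| <= j%:R * `|u - v|.
Proof.
move=> u1 v1; rewrite subrXX normrM mulrC ler_wpM2r//.
apply: le_trans (ler_norm_sum _ _ _) _.
rewrite -[X in _ <= X%:R](card_ord j) -sumr_const; apply: ler_sum => i _.
by rewrite normrM !normrX mulr_ile1// ?exprn_ge0// exprn_ile1.
Qed.

Lemma moment_fun_lip j x : sphere R d x ->
  `|moment_fun h j x0 - moment_fun h j x| <= j%:R * enorm (x0 - x) * \int[om]_y `|h y|.
Proof.
move=> Sx; rewrite /moment_fun -(RintegralB measurableT (moment_fun_itg j x0) (moment_fun_itg j x)).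
have iH : itg om (fun y => edot x0 (radial y) ^+ j * h y - edot x (radial y) ^+ j * h y).
  by apply: itgB; exact: moment_fun_itg.
apply: (@le_trans _ _ (\int[om]_y `|edot x0 (radial y) ^+ j * h y - edot x (radial y) ^+ j * h y|)).
  exact: le_normr_Rintegral.
have ih : itg om (fun y => `|h y|) by have := integrable_abse (sqi_itg sh); exact: eq_integrable.
rewrite -(RintegralZl _ measurableT ih); apply: le_Rintegral_itg => [||y].
- by have := integrable_abse iH; exact: eq_integrable.
- exact: itgZ.
rewrite -mulrBl normrM ler_wpM2r//.
have e1 : enorm x0 = 1 by []. have e2 : enorm x = 1 by [].
apply: le_trans (expr_lip _ _ _) _; [by rewrite -e1 edotr_le|by rewrite -e2 edotr_le|].
by rewrite ler_wpM2l// -edotBl edotr_le.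
Qed.

Lemma moment_fun_small j : `|moment_fun h j x0| <= j%:R * Num.sqrt (2 * eps) * \int[om]_y `|h y|.
Proof.
have sp := phiz_sqi eps S0 1; have p0 x : 0 <= phiz eps x0 1 x by exact: bump1_ge0.
have I0 := integral_phiz_gt0; have ip_ := sqi_itg sp.
pose B := j%:R * Num.sqrt (2 * eps) * \int[om]_y `|h y|.
have mk : measurable_fun setT (fun s : R => s ^+ j) by exact: measurable_funX.
have k1 (s : R) : `|s| <= 1 -> `|s ^+ j| <= 1 by move=> s1; rewrite normrX exprn_ile1.
have w1 : 0 < 1 * w by rewrite mul1r.
have sK := schur_zK_bounded (d := d) mk k1.
have [sH _] := iop_sqi w1 sK sh.
have e : ip om (iop om (zK (fun s => s ^+ j)) h) (phiz eps x0 1) = 0.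
  rewrite (iop_swap sK sh sp) -(moment 1 j); apply: eq_Rintegral => y _; apply: congr1.
  by apply: eq_Rintegral => x _; rewrite zK_sym.
have iD : itg om (fun x => (moment_fun h j x0 - iop om (zK (fun s => s ^+ j)) h x) * phiz eps x0 1 x).
  apply: sqi_mul_itg sp; apply: (@sqiB _ _ _ om (cst (moment_fun h j x0))) => //; exact: sqi_cst.
have e2 : moment_fun h j x0 * \int[om]_x phiz eps x0 1 x =
    \int[om]_x ((moment_fun h j x0 - iop om (zK (fun s => s ^+ j)) h x) * phiz eps x0 1 x).
  rewrite -(RintegralZl _ measurableT ip_).
  under [in RHS]eq_Rintegral do rewrite mulrBl.
  rewrite (RintegralB measurableT (itgZ _ ip_) (sqi_mul_itg sH sp)).
  by rewrite -[X in _ = _ - X]/(ip om _ _) e subr0.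
have : `|moment_fun h j x0| * \int[om]_x phiz eps x0 1 x <= B * \int[om]_x phiz eps x0 1 x.
  rewrite -[X in _ * X <= _](gtr0_norm I0) -normrM e2.
  apply: (@le_trans _ _ (\int[om]_x `|(moment_fun h j x0 - iop om (zK (fun s => s ^+ j)) h x) * phiz eps x0 1 x|)).
    exact: le_normr_Rintegral.
  rewrite -(RintegralZl _ measurableT ip_); apply: le_Rintegral_itg_ae.
  - by have := integrable_abse iD; exact: eq_integrable.
  - exact: itgZ.
  apply: filterS ae_sphere => x Sx; rewrite normrM [`|phiz _ _ _ _|]ger0_norm//.
  have [xx|xx] := leP (edot x x0) c.
    by rewrite /phiz (radial_sphere Sx) bz_out// !mulr0.
  rewrite ler_wpM2r//.
  have -> : iop om (zK (fun s => s ^+ j)) h x = moment_fun h j x.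
    by apply: eq_Rintegral => y _; rewrite /zK (radial_sphere Sx).
  apply: le_trans (moment_fun_lip j Sx) _; rewrite /B ler_wpM2r ?ler_wpM2l//.
    by apply: Rintegral_ge0 => y _.
  apply: ler_wsqrtr; rewrite edotBl !edotBr !edot_sphere// [edot x0 x]edotC.
  by lra.
by rewrite ler_pM2r.
Qed.

End center.

Variables (V : set E) (h : E -> R).
Hypothesis Vopen : sphere_open V.
Hypothesis V0 : V !=set0.
Hypothesis sh : sqi om h.
Hypothesis hV : {ae om, forall y, V y -> h y = 0}.
Hypothesis H0 : forall x0 eps q, sphere R d x0 -> 0 < eps ->
  (forall y, sphere R d y -> 1 - 4 * eps < edot y x0 -> V y) ->
  ip om h (Gop (fun x => zop (d := d) (bz eps q) (bz eps (bump_deriv q))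
    (bz eps (bump_deriv (bump_deriv q))) (edot (radial x) x0))) = 0.

Lemma cap_sub x0 : V x0 -> exists2 e0, 0 < e0 <= 1 & forall eps, 0 < eps <= e0 ->
  forall y, sphere R d y -> 1 - 4 * eps < edot y x0 -> V y.
Proof.
have [U oU ->] := Vopen => -[S0 Ux0].
have /nbhs_ballP[del /= del0 hb] : nbhs x0 U by exact: open_nbhs_nbhs.
(* y . x0 > 1 - 4 eps means |x0 - y|^2 < 8 eps, which has to stay below del^2. *)
exists (Num.min 1 (del ^+ 2 / 8)).
  by rewrite lt_min ltr01 divr_gt0 ?exprn_gt0//= ge_min lexx.
move=> eps /andP[e0]; rewrite le_min => /andP[_ e1] y Sy yx; split => //.
apply: hb; split => // i k; rewrite /ball/= !ord1.
apply: (@le_lt_trans _ _ (enorm (x0 - y))).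
  by have := coord_le_enorm (x0 - y) k; rewrite !mxE.
rewrite -(ltr_pXn2r (n := 2))// ?nnegrE ?sqrtr_ge0 ?(ltW del0)//.
rewrite enorm_sqr edotBl !edotBr !edot_sphere// [edot x0 y]edotC.
have : eps * 8 <= del ^+ 2 by rewrite -ler_pdivlMr.
by lra.
Qed.

Lemma moment_fun_open j x0 : V x0 -> moment_fun h j x0 = 0.
Proof.
move=> Vx; have [e0 /andP[e00 e01] cap] := cap_sub Vx.
have S0 : sphere R d x0 by have [U _ VE] := Vopen; move: Vx; rewrite VE => -[].
apply/eqP; rewrite -normr_le0; apply/ler_addgt0Pr => e ep; rewrite add0r.
pose B := j%:R * (\int[om]_y `|h y|) + 1.
have B0 : 0 < B by rewrite ltr_wpDl// mulr_ge0//; apply: Rintegral_ge0.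
pose t := e / B; have t0 : 0 < t by rewrite divr_gt0.
(* This gives sqrt(2 eps) <= t, the factor that makes the bound of [moment_fun_small] at most e. *)
pose eps := Num.min e0 (t ^+ 2 / 2).
have eps0 : 0 < eps by rewrite lt_min e00 divr_gt0 ?exprn_gt0.
have epse : eps <= e0 by rewrite ge_min lexx.
have ce : 0 < eps <= e0 by rewrite eps0.
have h0 : {ae om, forall y, 1 - 4 * eps < edot y x0 -> h y = 0}.
  by apply: filterS2 ae_sphere hV => y Sy hy yx; apply: hy; exact: cap ce y Sy yx.
apply: le_trans (moment_fun_small eps0 (le_trans epse e01) S0 sh h0 (fun q => H0 q S0 eps0 (cap _ ce)) j) _.
have st : Num.sqrt (2 * eps) <= t.
  rewrite -[leRHS]ger0_norm ?(ltW t0)// -sqrtr_sqr ler_wsqrtr//.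
  have : eps <= t ^+ 2 / 2 by rewrite ge_min lexx orbT.
  by lra.
apply: (@le_trans _ _ (t * B)); last by rewrite /t divfK// gt_eqF.
rewrite /B mulrDr mulr1 mulrAC -mulrA [t * _]mulrC.
have h2 : 0 <= j%:R * (\int[om]_y `|h y|) by rewrite mulr_ge0//; apply: Rintegral_ge0.
apply: (@le_trans _ _ (j%:R * (\int[om]_y `|h y|) * t)).
  by rewrite mulrA ler_wpM2l.
by rewrite lerDl ltW.
Qed.

Lemma moment_funZ j (k : R) (x : E) : moment_fun h j (k *: x) = k ^+ j * moment_fun h j x.
Proof.
rewrite /moment_fun -(RintegralZl _ measurableT (moment_fun_itg sh j x)); apply: eq_Rintegral => y _.
by rewrite edotZl exprMn mulrA.
Qed.

(** The moment is homogeneous, so it vanishes on the open cone over V. On the line from x0 to z it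
    is a polynomial in t that vanishes near t = 0, hence at t = 1, which is the point z. *)
Lemma moment_fun_eq0 j (z : E) : moment_fun h j z = 0.
Proof.
have [x0 Vx] := V0; pose v := z - x0.
have S0 : sphere R d x0 by have [U _ VE] := Vopen; move: Vx; rewrite VE => -[].
have x00 := sphere_neq0 S0.
pose co i := \int[om]_y (edot x0 (radial y) ^+ (j - i) * edot v (radial y) ^+ i * h y).
pose q : {poly R} := \poly_(i < j.+1) (co i *+ 'C(j, i)).
have ic i : itg om (fun y => edot x0 (radial y) ^+ (j - i) * edot v (radial y) ^+ i * h y).
  apply: (@edot_radial_itg _ (fun y => edot x0 (radial y) ^+ (j - i) * edot v (radial y) ^+ i)
    (enorm x0 ^+ (j - i) * enorm v ^+ i) sh).
    by apply: measurable_funM; apply: measurable_funX; exact: measurable_edotr.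
  move=> y; rewrite normrM !normrX.
  by apply: ler_pM; rewrite ?exprn_ge0// lerXn2r ?nnegrE ?sqrtr_ge0// edotr_le.
have qE t : q.[t] = moment_fun h j (x0 + t *: v).
  rewrite horner_poly /moment_fun.
  transitivity (\int[om]_y \sum_(i < j.+1) ('C(j, i)%:R * t ^+ i) *
      (edot x0 (radial y) ^+ (j - i) * edot v (radial y) ^+ i * h y)).
    rewrite Rintegral_sum; last by move=> i; apply: itgZ; exact: ic.
    apply: eq_bigr => i _; rewrite (RintegralZl _ measurableT (ic i)) -/(co i).
    by rewrite -mulr_natl; ring.
  apply: eq_Rintegral => y _; rewrite edotDl edotZl exprDn mulr_suml; apply: eq_bigr => i _.
  by rewrite exprMn -mulr_natl; ring.
have [del del0 hdel] : exists2 del : R, 0 < del & forall t, `|t| < del -> q.[t] = 0.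
  have [U oU VE] := Vopen; have Rx : radial x0 = x0 by exact: radial_sphere.
  have cl : {for (0 : R), continuous (fun t : R => x0 + t *: v)}.
    apply: (@cvgD _ _ _ (nbhs (0 : R))); first exact: (@cvg_cst _ _ _ (nbhs (0 : R))).
    by apply: cvgZr_tmp; exact: cvg_id.
  have e0 : x0 + 0 *: v = x0 by rewrite scale0r addr0.
  have cr : {for (0 : R), continuous (fun t : R => radial (x0 + t *: v))}.
    apply: (@continuous_comp _ _ _ (fun t : R => x0 + t *: v) (@radial R d)); first exact: cl.
    by rewrite e0; exact: radial_continuous.
  have nU : nbhs (radial (x0 + 0 *: v)) U.
    by rewrite e0 Rx; apply: open_nbhs_nbhs; split => //; move: Vx; rewrite VE => -[].
  have nN : nbhs (x0 + 0 *: v) [set x | 0 < enorm x].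
    rewrite e0; apply: open_nbhs_nbhs; split; last exact: enorm_gt0.
    rewrite (_ : [set x | _] = @enorm R d @^-1` [set t | 0 < t])//.
    by apply: open_comp; [move=> x _; exact: enorm_continuous|exact: open_gt].
  have : nbhs (0 : R) [set t | U (radial (x0 + t *: v)) /\ 0 < enorm (x0 + t *: v)].
    have := @filterI _ (nbhs (0 : R)) _ _ _ (cr _ nU) (cl _ nN); exact.
  move=> /nbhs_ballP[del /= del0 hb]; exists del => // t td.
  have [Ut nt] : U (radial (x0 + t *: v)) /\ 0 < enorm (x0 + t *: v).
    by apply: hb; rewrite /ball/= sub0r normrN.
  have nz : x0 + t *: v != 0 by apply: contraTneq nt => ->; rewrite enorm0 ltxx.
  rewrite qE (_ : x0 + t *: v = enorm (x0 + t *: v) *: radial (x0 + t *: v)); last first.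
    by rewrite /radial scalerA mulfV ?scale1r// gt_eqF.
  rewrite moment_funZ moment_fun_open ?mulr0// VE; split => //; by rewrite /sphere/= enorm_radial.
have q0 : q = 0.
  apply/eqP; apply/negPn/negP => qn0.
  (* As many distinct roots as [size q], one more than the degree allows; the denominators start at
     2 to stay strictly inside ]- del, del[. *)
  pose rs := [seq del / i.+2%:R | i <- iota 0 (size q)].
  have := @max_poly_roots _ q rs qn0; rewrite size_map size_iota ltnn => H.
  suff : false by []. apply: H.
    apply/allP => _ /mapP[i _ ->]; apply/eqP/hdel.
    rewrite gtr0_norm ?divr_gt0// ltr_pdivrMr// ltr_pMr//.
    by rewrite (ltr_nat R 1).
  rewrite map_inj_uniq ?iota_uniq// => i1 i2 /(mulfI (lt0r_neq0 del0)) /invr_inj /eqP.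
  by rewrite eqr_nat => /eqP [].
have -> : z = x0 + 1 *: v by rewrite scale1r /v addrCA subrr addr0.
by rewrite -qE q0 horner0.
Qed.

(** For r < 1 [kq r] is affine in s and stays between (1 - r)^2 and 4, so its inverse and the square
    root of the latter are within reach of the two iterations. *)
Lemma kP_ulim r : 0 <= r < 1 -> ulim [set s : R | `|s| <= 1] id (kP a r).
Proof.
move=> /andP[r0 r1]; have r2 : 0 < (1 - r) ^+ 2 by rewrite exprn_gt0// subr_gt0.
have qb s : `|s| <= 1 -> (1 - r) ^+ 2 <= kq r s <= 4.
  move=> s1; have := kq_ge r s1; rewrite (ger0_norm r0) => ->/=.
  have : `|r * s| <= 1 by rewrite normrM mulr_ile1// ger0_norm// ltW.
  rewrite ler_norml => /andP[h1 _]; have : r ^+ 2 <= 1 by rewrite expr_le1// ltW.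
  by rewrite /kq; lra.
have q0 s : `|s| <= 1 -> 0 < kq r s by move=> /qb/andP[h1 _]; exact: lt_le_trans h1.
have uq : ulim [set s : R | `|s| <= 1] id (kq r).
  rewrite (_ : kq r = fun s => (1 + r ^+ 2) + (- (2 * r)) * id s); last first.
    by apply/funext => s; rewrite /kq; ring.
  apply: ulimD; first exact: ulim_cst.
  by apply: ulimM; [exact: ulim_cst|apply: (@ulim_gen _ _ _ 1)].
have uV : ulim [set s : R | `|s| <= 1] id (fun s => (kq r s)^-1).
  by apply: ulimV uq; [exact: r2|move=> s /= /qb/andP[]].
have uS : ulim [set s : R | `|s| <= 1] id (fun s => Num.sqrt (kq r s)^-1 ^+ d).
  apply: ulimX; apply: (@ulim_sqrt _ _ _ _ 4^-1) => // s /= s1.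
  by rewrite lef_pV2 ?posrE ?q0//; have /andP[] := qb s s1.
have [[M hM] h1] := ulimM (ulim_cst [set s : R | `|s| <= 1] id (1 - r ^+ 2)) uS.
have e s : `|s| <= 1 -> kP a r s = (1 - r ^+ 2) * Num.sqrt (kq r s)^-1 ^+ d.
  move=> s1; rewrite sqrt_pow_ka ?invr_gt0 ?q0// lnV ?posrE ?q0//.
  by rewrite /kP /kQ mulrN mulNr.
split; first by exists M => s s1; rewrite e//; exact: hM.
by move=> t /h1[p hp]; exists p => s s1; rewrite e//; exact: hp.
Qed.

Lemma kP_h0 n x : sphere R d x -> iop om (zK (kP a (rn n))) h x = 0.
Proof.
move=> Sx; have [_ uP] := kP_ulim (rn_01 (R := R) n).
have ih : itg om (fun y => `|h y|) by have := integrable_abse (sqi_itg sh); exact: eq_integrable.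
pose I := \int[om]_y `|h y|; have I0 : 0 <= I by apply: Rintegral_ge0.
apply/eqP; rewrite -normr_le0; apply/ler_addgt0Pr => e e0; rewrite add0r.
have I1 : 0 < I + 1 by rewrite ltr_wpDl.
have [q hq] := uP _ (divr_gt0 e0 I1).
have iT i : itg om (fun y => q`_i * (edot x (radial y) ^+ i * h y)).
  by apply: itgZ; exact: moment_fun_itg.
have iQ : itg om (fun y => \sum_(i < size q) q`_i * (edot x (radial y) ^+ i * h y)).
  by apply: itg_sum.
have q0 : \int[om]_y \sum_(i < size q) q`_i * (edot x (radial y) ^+ i * h y) = 0.
  rewrite Rintegral_sum//; apply: big1 => i _.
  by rewrite (RintegralZl _ measurableT (moment_fun_itg sh i x)) -/(moment_fun h i x) moment_fun_eq0 mulr0.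
have sP := schur_kP hd (rn_01 (R := R) n).
have iP : itg om (fun y => zK (kP a (rn n)) x y * h y).
  have kc s : `|s| <= 1 -> {for s, continuous (kP a (rn n))}.
    by move=> s1; exact: kP_cont (rn_lt1 n) s1.
  by apply: sqi_mul_itg sh; apply: (zK_sqi hd) => //; exact: kP_measurable.
have iD := itgB iP iQ.
rewrite -[iop _ _ _ _]subr0 -q0 /iop -(RintegralB measurableT iP iQ).
apply: (@le_trans _ _ (\int[om]_y `|zK (kP a (rn n)) x y * h y -
    \sum_(i < size q) q`_i * (edot x (radial y) ^+ i * h y)|)).
  exact: le_normr_Rintegral.
apply: (@le_trans _ _ (\int[om]_y (e / (I + 1) * `|h y|))).
  apply: le_Rintegral_itg => [||y].
  - by have := integrable_abse iD; exact: eq_integrable.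
  - exact: itgZ.
  have -> : \sum_(i < size q) q`_i * (edot x (radial y) ^+ i * h y) = q.[edot x (radial y)] * h y.
    by rewrite horner_coef mulr_suml; apply: eq_bigr => i _; rewrite mulrA.
  rewrite -mulrBl normrM ler_wpM2r// /zK (radial_sphere Sx); apply: hq.
  by have := edot_radial2_le1 x y; rewrite (radial_sphere Sx).
rewrite (RintegralZl _ measurableT ih) -/I mulrAC ler_pdivrMr// ler_pM2l//.
by rewrite lerDl.
Qed.

(** All Poisson means of h vanish on the sphere by [kP_h0], and they converge to h in L^2. *)
Lemma unique_continuation_ae : {ae om, forall x, h x = 0}.
Proof.
apply: nrm_eq0 => //.
have c : tends (ip om) (fun n => zT (kP a (rn n)) h) h by exact: zT_kP_cvg.
have e n : nrm (ip om) (zT (kP a (rn n)) h - h) = nrm (ip om) h.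
  have -> : nrm (ip om) h = nrm (ip om) (- h) by rewrite (nrmN ph).
  apply: eq_nrm_ae; apply: filterS ae_sphere => x Sx.
  by rewrite -[LHS]/(zT (kP a (rn n)) h x - h x) /zT kP_h0// mulr0 sub0r.
move: c; rewrite /tends (_ : (fun n => _) = fun=> nrm (ip om) h); last by apply/funext.
by move/(cvg_lim (@norm_hausdorff _ _)); rewrite lim_cst.
Qed.

End unique_continuation.

(** * Injectivity of the operator and of its adjoint *)

Section injectivity.
Context {R : realType} {d : nat}.
Local Notation E := 'rV[R]_d.
Local Notation om := (omega R d).
Hypothesis hd : (3 <= d)%N.
Local Notation a := (@ka R d).
Let ph := sqi_prehilbert om.

Definition cap_bump (eps : R) (x0 : E) (q : {poly R}) (x : E) : R := bz eps q (edot x x0).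

Definition cap_zop (eps : R) (x0 : E) (q : {poly R}) (x : E) : R :=
  zop (d := d) (bz eps q) (bz eps (bump_deriv q)) (bz eps (bump_deriv (bump_deriv q))) (edot (radial x) x0).

Lemma cap_bump_Cc (V : set E) eps x0 q : sphere R d x0 -> 0 < eps ->
  (forall y, sphere R d y -> 1 - 4 * eps < edot y x0 -> V y) -> Cc_smooth V (cap_bump eps x0 q).
Proof.
move=> S0 e0 cap; pose A := sphere R d `&` [set x | 1 - eps <= edot x x0].
have cA : closed A.
  apply: closedI; first exact: closed_sphere.
  apply: (@preimage_closed _ _ (fun x : E => edot x x0) [set t : R | 1 - eps <= t]); last exact: closed_ge.
  by move=> x _; exact: edot_continuous.
have sub : surface_support (cap_bump eps x0 q) `<=` A.
  rewrite /surface_support [X in _ `<=` X]((closure_id _).1 cA); apply: closureS.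
  move=> x [Sx nx]; split => //=; rewrite leNgt; apply/negP => xx.
  by move/negP: nx; apply; rewrite /cap_bump bz_out// ltW.
split.
- exact: smooth_bump.
- apply: (subclosed_compact _ (@compact_sphere R d)); first exact: closed_closure.
  by move=> x /sub[].
- move=> x /sub[Sx /= xx]; apply: cap => //; move: xx e0; lra.
Qed.

Lemma cap_zop_sqi eps x0 q : sphere R d x0 -> sqi om (cap_zop eps x0 q).
Proof. by move=> S0; exact: (sqi_c S0 (zC1_bz eps q) (zC1_bz eps (bump_deriv q))). Qed.

Lemma ip_cap_zop f eps x0 q : sphere R d x0 -> sqi om f ->
  ip om f (cap_zop eps x0 q) = a ^+ 2 * ip om f (phiz eps x0 q) - ip om f (slaplacian (cap_bump eps x0 q)).
Proof.
move=> S0 sf; have sp := phiz_sqi eps S0 q.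
have st : sqi om (slaplacian (cap_bump eps x0 q)) by apply: slaplacian_sqi; exact: smooth_bump.
rewrite -(ipZr ph _ sp sf) -(ipBr ph (sqiZ _ sp) st sf).
apply: eq_Rintegral_ae; apply: filterS ae_sphere => x Sx; apply: congr1.
rewrite /cap_zop /zop -[RHS]/(a ^+ 2 * bz eps q (edot (radial x) x0) - sdiv (sgrad (cap_bump eps x0 q)) (radial x)).
rewrite (radial_sphere Sx); apply: congr1; apply: congr1; apply: esym.
by apply: sdiv_sgrad_zonal => // s; exact: is_derive_bz.
Qed.

Lemma ip_Gop_Gop_cap f eps x0 q : sphere R d x0 -> sqi om f ->
  ip om (Gop f) (Gop (cap_zop eps x0 q)) = a ^+ 2 * ip om f (phiz eps x0 q).
Proof.
move=> S0 sf; have sz := cap_zop_sqi eps q S0; have sp := phiz_sqi eps S0 q.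
rewrite (Gop_sym hd sf (Gop_sqi hd sz)) -(ipZr ph _ sp sf).
apply: eq_Rintegral_ae.
by apply: filterS (parametrix hd S0 (zC1_bz eps q) (zC1_bz eps (bump_deriv q))) => x h; apply: congr1.
Qed.

Lemma ip_phiz_eq0 (V : set E) f eps x0 q : sphere R d x0 -> 0 < eps ->
  (forall y, sphere R d y -> 1 - 4 * eps < edot y x0 -> V y) ->
  {ae om, forall y, V y -> f y = 0} -> ip om f (phiz eps x0 q) = 0.
Proof.
move=> S0 e0 cap f0; rewrite -(ip0l ph (phiz_sqi eps S0 q)).
apply: eq_Rintegral_ae; apply: filterS2 ae_sphere f0 => x Sx fx.
rewrite /phiz (radial_sphere Sx) -[RHS]/(0 * bz eps q (edot x x0)).
have [xx|xx] := leP (edot x x0) (1 - eps); first by rewrite bz_out// !mulr0.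
by rewrite fx ?mul0r//; apply: cap => //; move: xx e0; lra.
Qed.

(** Integrating by parts once leaves a product of derivatives of two functions with disjoint
    supports. *)
Lemma ip_phiz_slaplacian (V Sigma : set E) eps x0 q phi : sphere R d x0 -> 0 < eps ->
  (forall y, sphere R d y -> 1 - 4 * eps < edot y x0 -> V y) ->
  V `&` Sigma = set0 -> Cc_smooth Sigma phi -> ip om (phiz eps x0 q) (slaplacian phi) = 0.
Proof.
move=> S0 e0 cap VS [sphi _ supp].
rewrite /ip /phiz /slaplacian (zonal_green_field S0 (zC1_bz eps q) (smooth_sgrad sphi)).
rewrite (@eq_Rintegral_ae _ _ _ om _ (cst 0)) ?Rintegral_cst ?mul0r ?oppr0//.
apply: filterS ae_sphere => x Sx; rewrite (radial_sphere Sx).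
have [xx|xx] := leP (edot x x0) (1 - eps); first by rewrite bz_out// mul0r.
rewrite (sgrad_off_support sphi Sx) ?edot0l ?mulr0// => /supp Sigx.
have Vx : V x by apply: cap => //; move: xx e0; lra.
by have : (V `&` Sigma) x by []; rewrite VS.
Qed.

Lemma PKhalf_injective (Sigma : set E) g : sphere_open Sigma -> Sigma !=set0 ->
  D_ Sigma g -> {ae om, forall x, Sigma x -> Kh g x = 0} -> {ae om, forall x, g x = 0}.
Proof.
move=> So Sn /(D_P hd)[sg gT] gS; have sG := Gop_sqi hd sg; have sh := sqiD sg sG.
have hV : {ae om, forall y, Sigma y -> (g + Gop g) y = 0}.
  apply: filterS gS => y h Sy; have /eqP := h Sy.
  rewrite -[Kh g y]/(2^-1 * ((g + Gop g) y)) mulf_eq0 invr_eq0 pnatr_eq0/=.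
  by move/eqP.
have z : {ae om, forall x, (g + Gop g) x = 0}.
  apply: (unique_continuation_ae hd So Sn sh hV) => x0 eps q S0 e0 cap.
  have C := cap_bump_Cc q S0 e0 cap; have sz := cap_zop_sqi eps q S0.
  have sp := phiz_sqi eps S0 q.
  (* With b the bump, membership in [D_ Sigma] removes the Laplacian from <G g, (a^2 - Delta) b>,
     and the parametrix gives <G g, G (a^2 - Delta) b> = a^2 <g, b>. The sum is a^2 <g + G g, b>,
     zero since b is supported in Sigma. *)
  have e1 : ip om g (Gop (cap_zop eps x0 q)) = a ^+ 2 * ip om (Gop g) (phiz eps x0 q).
    by rewrite -(Gop_sym hd sg sz) (ip_cap_zop _ _ S0 sG) (gT _ C) subr0.
  have e2 := ip_Gop_Gop_cap eps q S0 sg.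
  have e3 := ip_phiz_eq0 q S0 e0 cap hV.
  rewrite (ipDl ph sg sG sp) in e3.
  apply: (etrans (ipDl ph sg sG (Gop_sqi hd sz))); rewrite e1 e2 -mulrDr addrC.
  by rewrite -(mulr0 (a ^+ 2)) -e3 addrC.
apply: (Gop_opp_eq0 hd sg); apply: filterS z => x /eqP.
by rewrite -[(g + Gop g) x]/(g x + Gop g x) addrC addr_eq0 => /eqP.
Qed.

Lemma Kh_D_injective (Sigma : set E) f : compactly_included Sigma -> L2on Sigma f ->
  (forall u, D_ Sigma u -> ip om (Kh f) u = 0) -> {ae om, forall x, f x = 0}.
Proof.
move=> [_ [_ /nonsubset Vn]] [/L2P sf f0] fD.
pose V := sphere R d `&` ~` closure Sigma.
have Vo : sphere_open V by exists (~` closure Sigma) => //; exact/closed_openC/closed_closure.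
have VS : V `&` Sigma = set0.
  by rewrite -subset0 => x [[_ nx] Sx]; apply: nx; exact: subset_closure.
have hV : {ae om, forall y, V y -> f y = 0}.
  by apply: filterS f0 => y fy [_ ny]; apply: fy => Sy; apply: ny; exact: subset_closure.
apply: (unique_continuation_ae hd Vo Vn sf hV) => x0 eps q S0 e0 cap.
have sz := cap_zop_sqi eps q S0; have sp := phiz_sqi eps S0 q; have sG := Gop_sqi hd sz.
(* By the parametrix, G of this function is a^2 times a bump supported off the closure of Sigma,
   hence orthogonal to the Laplacians of test functions in Sigma. *)
have DL : D_ Sigma (Gop (cap_zop eps x0 q)).
  apply/(D_P hd); split => // phi Cphi; have [/slaplacian_sqi st _ _] := Cphi.
  transitivity (ip om (a ^+ 2 *: phiz eps x0 q) (slaplacian phi)).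
    apply: eq_Rintegral_ae.
    apply: filterS (parametrix hd S0 (zC1_bz eps q) (zC1_bz eps (bump_deriv q))) => x h.
    by apply: (congr1 (fun t => t * slaplacian phi x)).
  by rewrite (ipZl ph _ sp st) (ip_phiz_slaplacian q S0 e0 cap VS Cphi) mulr0.
have := fD _ DL; have sGf := Gop_sqi hd sf.
rewrite (ipZl ph _ (sqiD sf sGf) sG) (ipDl ph sf sGf sG) (ip_Gop_Gop_cap eps q S0 sf).
rewrite (ip_phiz_eq0 q S0 e0 cap hV) mulr0 addr0 => /eqP.
by rewrite mulf_eq0 invr_eq0 pnatr_eq0/= => /eqP.
Qed.

End injectivity.

Lemma half_sum_le (R : realType) (m p q r : R) : p <= q + r -> q <= m -> r <= m -> 2^-1 * p <= m.
Proof. by lra. Qed.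

Lemma sum_half_le (R : realType) (m p q r : R) : p <= q + r -> q <= m / 2 -> r <= m / 2 -> p <= m.
Proof. by lra. Qed.

Lemma diff_le0 (R : realType) (m p q r s : R) :
  p + q = 2 * (r + s) -> r = m ^+ 2 -> s = m ^+ 2 -> (2 * m) ^+ 2 <= q -> p <= 0.
Proof. by rewrite exprMn; lra. Qed.

(** * Constrained minimization *)

Section regularization.
Context {R : realType} {d : nat}.
Local Notation E := 'rV[R]_d.
Local Notation om := (omega R d).
Hypothesis hd : (3 <= d)%N.
Let ph := sqi_prehilbert om.
Local Notation N := (nrm (ip om)).
Variable Sigma : set E.
Hypothesis Sopen : sphere_open Sigma.
Hypothesis Sneq0 : Sigma !=set0.
Hypothesis Ssub : compactly_included Sigma.

Lemma L2on_sqi f : L2on Sigma f -> sqi om f. Proof. by case=> /L2P. Qed.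

Lemma L2onD f g : L2on Sigma f -> L2on Sigma g -> L2on Sigma (f + g).
Proof. by have [_ _ h _] := @L2on_subspace R d Sigma; exact: h. Qed.

Lemma L2onZ c f : L2on Sigma f -> L2on Sigma (c *: f).
Proof. by have [_ _ _ h] := @L2on_subspace R d Sigma; exact: h. Qed.

Lemma L2onB f g : L2on Sigma f -> L2on Sigma g -> L2on Sigma (f - g).
Proof. by move=> Lf Lg; rewrite -[- g]scaleN1r; exact: (L2onD Lf (L2onZ _ Lg)). Qed.

Lemma D_sqi f : D_ Sigma f -> sqi om f. Proof. by case/(D_P hd). Qed.

Lemma D_B f g : D_ Sigma f -> D_ Sigma g -> D_ Sigma (f - g).
Proof.
have [_ _ h hZ] := @D_subspace R d hd Sigma.
by move=> Df Dg; rewrite -[- g]scaleN1r; exact: (h _ _ Df (hZ _ _ Dg)).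
Qed.

Lemma P_L2on_ae f : L2on Sigma f -> {ae om, forall x, P_ Sigma f x = f x}.
Proof.
move=> Lf; have [_ f0] := Lf; apply: filterS2 (P_E Sopen (L2on_sqi Lf)) f0 => x -> fx.
by have [Sx|nSx] := pselect (Sigma x); [rewrite restr_in|rewrite restr_out// fx].
Qed.

Lemma ip_P f h : sqi om f -> L2on Sigma h -> ip om (P_ Sigma f) h = ip om f h.
Proof.
move=> sf [_ h0]; apply: eq_Rintegral_ae; apply: filterS2 (P_E Sopen sf) h0 => x -> hx.
have [Sx|nSx] := pselect (Sigma x); first by rewrite restr_in.
by rewrite hx// !mulr0.
Qed.

Lemma Kh_sym f g : sqi om f -> sqi om g -> ip om (Kh f) g = ip om f (Kh g).
Proof.
move=> sf sg; have sGf := Gop_sqi hd sf; have sGg := Gop_sqi hd sg.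
rewrite (ipZl ph _ (sqiD sf sGf) sg) (ipDl ph sf sGf sg).
rewrite (ipZr ph _ (sqiD sg sGg) sf) (ipDr ph sg sGg sf).
by rewrite (Gop_sym hd sf sg).
Qed.

(* The operator [E (K + I/2)]. *)
Definition EK f : E -> R := E_ Sigma (Kh f).

Lemma EK_D f : sqi om f -> D_ Sigma (EK f).
Proof. by move=> sf; have [] := E_P hd Sigma (Kh_sqi hd sf). Qed.

Lemma EK_sqi f : sqi om f -> sqi om (EK f).
Proof. by move=> sf; exact: D_sqi (EK_D sf). Qed.

Lemma EK_adj f u : sqi om f -> D_ Sigma u -> ip om (EK f) u = ip om f (Kh u).
Proof.
move=> sf Du; have [_ _ ->//] := E_P hd Sigma (Kh_sqi hd sf).
exact: Kh_sym sf (D_sqi Du).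
Qed.

(** [EK] is made of selected representatives, so its linearity is not visible from the definition;
    it follows from this characterization by duality. *)
Lemma EK_unique f v : sqi om f -> D_ Sigma v ->
  (forall u, D_ Sigma u -> ip om v u = ip om f (Kh u)) -> {ae om, forall x, EK f x = v x}.
Proof.
move=> sf Dv h; have DB := D_B (EK_D sf) Dv; have sv := D_sqi Dv; have sE := EK_sqi sf.
have e : ip om (EK f - v) (EK f - v) = 0.
  by rewrite (ipBl ph sE sv (D_sqi DB)) (h _ DB) (EK_adj sf DB) subrr.
apply: filterS (ip_eq0 (D_sqi DB) e) => x /eqP.
by rewrite -[(EK f - v) x]/(EK f x - v x) subr_eq0 => /eqP.
Qed.

Lemma EKD f g : sqi om f -> sqi om g -> {ae om, forall x, EK (f + g) x = EK f x + EK g x}.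
Proof.
move=> sf sg; have [_ _ hD _] := @D_subspace R d hd Sigma.
apply: (EK_unique (sqiD sf sg) (hD _ _ (EK_D sf) (EK_D sg))) => u Du.
have sK := Kh_sqi hd (D_sqi Du).
rewrite (ipDl ph (EK_sqi sf) (EK_sqi sg) (D_sqi Du)) (ipDl ph sf sg sK).
by apply: f_equal2; [exact: (EK_adj sf Du)|exact: (EK_adj sg Du)].
Qed.

Lemma EKZ c f : sqi om f -> {ae om, forall x, EK (c *: f) x = c * EK f x}.
Proof.
move=> sf; have [_ _ _ hZ] := @D_subspace R d hd Sigma.
apply: (EK_unique (sqiZ c sf) (hZ c _ (EK_D sf))) => u Du.
rewrite (ipZl ph c (EK_sqi sf) (D_sqi Du)) (ipZl ph c sf (Kh_sqi hd (D_sqi Du))).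
by rewrite (EK_adj sf Du).
Qed.

Variable e : E -> R.
Hypothesis se : sqi om e.
Local Notation Ee := (E_ Sigma e).

Lemma Ee_D : D_ Sigma Ee. Proof. by have [] := E_P hd Sigma se. Qed.

Definition residual_fun g : E -> R := Ee - EK g.

Lemma residual_fun_D g : sqi om g -> D_ Sigma (residual_fun g).
Proof. by move=> sg; apply: D_B; [exact: Ee_D|exact: EK_D]. Qed.

Lemma residual_fun_sqi g : sqi om g -> sqi om (residual_fun g).
Proof. by move=> sg; exact: D_sqi (residual_fun_D sg). Qed.

(** [P_ Sigma g] is g and [Khalf] is [Kh] almost everywhere only, but [orthoproj_ae] makes the
    projections equal as functions. *)
Lemma residualE g : L2on Sigma g -> residual Sigma e g = N (residual_fun g).
Proof.
move=> Lg; have sP : sqi om (P_ Sigma g) by exact: L2on_sqi (P_L2on Sopen (L2on_sqi Lg)).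
have eK : E_ Sigma (Khalf (P_ Sigma g)) = E_ Sigma (Kh g).
  apply: orthoproj_ae; apply: filterS2 (KhalfE hd sP) (P_L2on_ae Lg) => x -> Px.
  rewrite -[LHS]/(2^-1 * (P_ Sigma g x + Gop (P_ Sigma g) x)) Px.
  by rewrite /Gop (zT_ae _ (P_L2on_ae Lg)).
by rewrite /residual eK; exact: erefl.
Qed.

Lemma residual_fun_mid x y : sqi om x -> sqi om y ->
  {ae om, forall z, residual_fun (2^-1 *: (x + y)) z = (2^-1 *: (residual_fun x + residual_fun y)) z}.
Proof.
move=> sx sy; apply: filterS2 (EKZ 2^-1 (sqiD sx sy)) (EKD sx sy) => z h1 h2.
rewrite -[LHS]/(Ee z - EK (2^-1 *: (x + y)) z) h1 h2.
rewrite -[RHS]/(2^-1 * ((Ee z - EK x z) + (Ee z - EK y z))).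
by move: (Ee z) (EK x z) (EK y z) => p q r; field.
Qed.

Lemma nrm_residual_mid x y m : sqi om x -> sqi om y -> N (residual_fun x) <= m -> N (residual_fun y) <= m ->
  N (residual_fun (2^-1 *: (x + y))) <= m.
Proof.
move=> sx sy xm ym; rewrite (eq_nrm_ae (residual_fun_mid sx sy)).
rewrite (nrmZ ph 2^-1 (sqiD (residual_fun_sqi sx) (residual_fun_sqi sy))) ger0_norm ?invr_ge0//.
exact: (half_sum_le (nrmD ph (residual_fun_sqi sx) (residual_fun_sqi sy)) xm ym).
Qed.

Lemma ip_rs x u : sqi om x -> D_ Sigma u -> ip om (residual_fun x) u = ip om Ee u - ip om x (Kh u).
Proof.
move=> sx Du; rewrite (ipBl ph (D_sqi Ee_D) (EK_sqi sx) (D_sqi Du)).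
by apply: (congr1 (fun t => ip om Ee u - t)); exact: (EK_adj sx Du).
Qed.

(* Weak lower semicontinuity, from the duality with [Kh] and no bound on [EK]. *)
Lemma nrm_residual_lsc (u : nat -> E -> R) x m : (forall n, sqi om (u n)) -> sqi om x ->
  tends (ip om) u x -> (forall n, N (residual_fun (u n)) <= m) -> N (residual_fun x) <= m.
Proof.
move=> su sx ux um; have Dr := residual_fun_D sx; have sK := Kh_sqi hd (D_sqi Dr).
have c := tends_ip ph su sx sK ux.
have c2 : (fun n => ip om Ee (residual_fun x) - ip om (u n) (Kh (residual_fun x))) @ \oo -->
    ip om Ee (residual_fun x) - ip om x (Kh (residual_fun x)).
  by apply: cvgB c; exact: cvg_cst.
have le : ip om (residual_fun x) (residual_fun x) <= m * N (residual_fun x).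
  have -> : ip om (residual_fun x) (residual_fun x) = ip om Ee (residual_fun x) - ip om x (Kh (residual_fun x)) := ip_rs sx Dr.
  apply: (cvgn_to_le c2) => n; apply: le_trans (ler_norm _) _.
  rewrite -(ip_rs (su n) Dr).
  apply: le_trans (cauchy_schwarz ph (residual_fun_sqi (su n)) (residual_fun_sqi sx)) _.
  by rewrite ler_wpM2r// nrm_ge0.
have m0 : 0 <= m by apply: le_trans (um 0); rewrite nrm_ge0.
rewrite -(nrm_sqr ph (residual_fun_sqi sx)) expr2 in le.
have [->//|n0] := eqVneq (N (residual_fun x)) 0.
by rewrite -(ler_pM2r (x := N (residual_fun x)))// lt_neqAle eq_sym n0 nrm_ge0.
Qed.

(** Convergence in norm says nothing pointwise, so vanishing off Sigma is tested by pairing with z,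
    the part of the limit off Sigma. *)
Lemma L2on_closed : seq_closed (sqi om) (ip om) (L2on Sigma).
Proof.
move=> u x uL sx ux; have su n := L2on_sqi (uL n); have sr := restr_sqi Sopen sx.
have sz := sqiB sx sr; pose z := x - restr Sigma x.
have zS y : Sigma y -> z y = 0 by move=> Sy; rewrite -[z y]/(x y - restr Sigma x y) restr_in// subrr.
have ip0 f : {ae om, forall y, ~ Sigma y -> f y = 0} -> ip om f z = 0.
  move=> f0; rewrite -(ip0l ph sz); apply: eq_Rintegral_ae; apply: filterS f0 => y fy.
  rewrite -[RHS]/(0 * z y); have [Sy|nSy] := pselect (Sigma y); first by rewrite zS// !mulr0.
  by rewrite fy.
have c := tends_ip ph su sx sz ux.
have x0 : ip om x z = 0.
  move: c; rewrite (_ : (fun n => _) = cst 0); last first.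
    by apply/funext => n; apply: ip0; have [] := uL n.
  by move/(cvg_lim (@norm_hausdorff _ _)); rewrite lim_cst.
have zz : ip om z z = 0.
  rewrite {1}/z (ipBl ph sx sr sz) x0 ip0 ?subrr//.
  by apply: nearW => y; exact: restr_out.
split; first exact/L2P.
apply: filterS (ip_eq0 sz zz) => y zy nSy.
by move: zy; rewrite -[(x - restr Sigma x) y]/(x y - restr Sigma x y) restr_out// subr0.
Qed.

Lemma admissible_sqi t g : admissible Sigma t g -> sqi om g.
Proof. by case=> /L2on_sqi. Qed.

Lemma residual_image t : residual Sigma e @` admissible Sigma t = (fun g => N (residual_fun g)) @` admissible Sigma t.
Proof. by apply: eq_imagel => g [Lg _]; exact: residualE. Qed.

Lemma residual_lbound t g : admissible Sigma t g ->
  inf (residual Sigma e @` admissible Sigma t) <= N (residual_fun g).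
Proof.
move=> ag; rewrite residual_image; apply: ge_inf; last by exists g.
by exists 0 => _ [f _ <-]; exact: nrm_ge0.
Qed.

Lemma admissible_mid t x y : admissible Sigma t x -> admissible Sigma t y ->
  admissible Sigma t (2^-1 *: (x + y)).
Proof.
move=> [Lx xt] [Ly yt]; split; first by apply: L2onZ; exact: L2onD.
rewrite -[L2norm _]/(N _) (nrmZ ph 2^-1 (sqiD (L2on_sqi Lx) (L2on_sqi Ly))).
rewrite ger0_norm ?invr_ge0//.
exact: (half_sum_le (nrmD ph (L2on_sqi Lx) (L2on_sqi Ly)) xt yt).
Qed.

Lemma minimizer_exists t : 0 < t -> exists h, is_minimizer Sigma e t h.
Proof.
move=> t0.
have [||||||||h ah hE] := @exists_minimizer R _ _ _ ph (@sqi_complete _ _ _ om)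
    (admissible Sigma t) (fun g => N (residual_fun g)) t.
- by move=> g; exact: admissible_sqi.
- exists 0; split; first by have [_ h _ _] := @L2on_subspace R d Sigma.
  by rewrite -[L2norm _]/(N 0) nrm_ae0 ?ltW//; exact: nearW.
- move=> u x ua sx ux; split; first by apply: (L2on_closed _ sx ux) => n; have [] := ua n.
  have su n := admissible_sqi (ua n).
  by apply: (cvgn_to_le (tends_nrm ph su sx ux)) => n; have [] := ua n.
- exact: admissible_mid.
- by move=> x _; exact: nrm_ge0.
- by move=> x y m /admissible_sqi sx /admissible_sqi sy; exact: nrm_residual_mid.
- move=> u x m ua /admissible_sqi sx ux; apply: nrm_residual_lsc sx ux => n.
  exact: admissible_sqi (ua n).
- by move=> x [].
exists h; split; first exact: ah.
by rewrite residual_image; have [Lh _] := ah; exact: (etrans (residualE Lh) hE).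
Qed.

(** The parallelogram law at the midpoint only shows that the two residuals agree. Hence (K +
    I/2)(h' - h) is orthogonal to [D_ Sigma], and [Kh_D_injective] concludes. *)
Lemma minimizer_unique t h h' : is_minimizer Sigma e t h -> is_minimizer Sigma e t h' ->
  eqL2 h' h.
Proof.
move=> [ah hE] [ah' hE']; set m := inf _ in hE hE'.
have [Lh _] := ah; have [Lh' _] := ah'; have sh := L2on_sqi Lh; have sh' := L2on_sqi Lh'.
rewrite (residualE Lh) in hE; rewrite (residualE Lh') in hE'.
have mid := residual_lbound (admissible_mid ah ah'); rewrite -/m in mid.
have sr := residual_fun_sqi sh; have sr' := residual_fun_sqi sh'.
rewrite (eq_nrm_ae (residual_fun_mid sh sh')) (nrmZ ph 2^-1 (sqiD sr sr')) ger0_norm ?invr_ge0// in mid.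
have m0 : 0 <= m by rewrite -hE nrm_ge0.
have mid2 : (2 * m) ^+ 2 <= ip om (residual_fun h + residual_fun h') (residual_fun h + residual_fun h').
  rewrite -(nrm_sqr ph (sqiD sr sr')) lerXn2r ?nnegrE ?nrm_ge0 ?mulr_ge0//.
  by rewrite -ler_pdivlMl.
have n1 : ip om (residual_fun h) (residual_fun h) = m ^+ 2 by rewrite -(nrm_sqr ph sr) hE.
have n2 : ip om (residual_fun h') (residual_fun h') = m ^+ 2 by rewrite -(nrm_sqr ph sr') hE'.
have sB := sqiB sr sr'.
have B0 : ip om (residual_fun h - residual_fun h') (residual_fun h - residual_fun h') = 0.
  apply/eqP; rewrite eq_le (ip_ge0 ph sB) andbT.
  exact: (diff_le0 (parallelogram ph sr sr') n1 n2 mid2).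
have LB := L2onB Lh' Lh; have sB' := L2on_sqi LB.
have z : {ae om, forall x, (h' - h) x = 0}.
  apply: (Kh_D_injective hd Ssub LB) => u Du.
  have su := D_sqi Du; have sK := Kh_sqi hd su.
  rewrite (Kh_sym sB' su) (ipBl ph sh' sh sK).
  have comb (p q q' c k k' : R) : p = q - q' -> q = c - k -> q' = c - k' -> k' - k = p.
    by move=> -> -> ->; ring.
  apply: (etrans (comb _ _ _ _ _ _ (ipBl ph sr sr' su) (ip_rs sh Du) (ip_rs sh' Du))).
  rewrite -(ip0l ph su); apply: eq_Rintegral_ae; apply: filterS (ip_eq0 sB B0) => x hx.
  by rewrite hx.
apply: filterS z => x /eqP; rewrite -[(h' - h) x]/(h' x - h x) subr_eq0 => /eqP hx _.
exact: hx.
Qed.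

Lemma residual_small eps : 0 < eps -> exists2 g, L2on Sigma g & N (residual_fun g) <= eps.
Proof.
(* The closure in L^2 of the range of [EK], defined by approximability so that closedness is a
   matter of halving [del]. *)
move=> e0; pose M : set (E -> R) := [set f | sqi om f /\
  forall del, 0 < del -> exists2 g, L2on Sigma g & N (f - EK g) <= del].
have MEK g : L2on Sigma g -> M (EK g).
  move=> Lg; split; first exact: EK_sqi (L2on_sqi Lg).
  by move=> del d0; exists g => //; rewrite subrr nrm_ae0 ?ltW//; exact: nearW.
have Ms : is_subspace (sqi om) M.
  split.
  - by move=> f [].
  - split; first exact: sqi0.
    move=> del d0; have [_ L0 _ _] := @L2on_subspace R d Sigma; exists 0 => //.
    rewrite (@eq_nrm_ae _ _ _ om _ 0) ?nrm_ae0 ?ltW//; first exact: nearW.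
    apply: filterS (EKZ 0 (sqi0 om)) => x; rewrite scale0r mul0r => h.
    by rewrite -[LHS]/(0 - EK 0 x) h subrr.
  - move=> f g [sf fM] [sg gM]; split; first exact: sqiD.
    move=> del d0; have d2 : 0 < del / 2 by rewrite divr_gt0.
    have [u Lu uf] := fM _ d2; have [v Lv vg] := gM _ d2.
    have su := L2on_sqi Lu; have sv := L2on_sqi Lv.
    exists (u + v); first exact: L2onD.
    rewrite (@eq_nrm_ae _ _ _ om _ ((f - EK u) + (g - EK v))).
      exact: (sum_half_le (nrmD ph (sqiB sf (EK_sqi su)) (sqiB sg (EK_sqi sv))) uf vg).
    apply: filterS (EKD su sv) => x h.
    rewrite -[LHS]/(f x + g x - EK (u + v) x) h -[RHS]/((f x - EK u x) + (g x - EK v x)).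
    by move: (f x) (g x) (EK u x) (EK v x) => p q r s; ring.
  - move=> c f [sf fM]; split; first exact: sqiZ.
    move=> del d0; have c1 : 0 < `|c| + 1 by rewrite ltr_wpDl.
    have [u Lu uf] := fM _ (divr_gt0 d0 c1); have su := L2on_sqi Lu.
    exists (c *: u); first exact: L2onZ.
    rewrite (@eq_nrm_ae _ _ _ om _ (c *: (f - EK u))).
      rewrite (nrmZ ph c (sqiB sf (EK_sqi su))).
      apply: (@le_trans _ _ ((`|c| + 1) * (del / (`|c| + 1)))).
        by apply: ler_pM => //; [exact: nrm_ge0|rewrite lerDl].
      by rewrite mulrC divfK// gt_eqF.
    apply: filterS (EKZ c su) => x h.
    by rewrite -[LHS]/(c * f x - EK (c *: u) x) h -[RHS]/(c * (f x - EK u x)) mulrBr.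
have Mc : seq_closed (sqi om) (ip om) M.
  move=> u x uM sx /tendsP ux; split => // del d0; have d2 : 0 < del / 2 by rewrite divr_gt0.
  have [n hn] := ux _ d2; have [sun uMn] := uM n; have [g Lg hg] := uMn _ d2.
  exists g => //; have sE := EK_sqi (L2on_sqi Lg).
  apply: (sum_half_le (nrm_triangle ph sx sun sE)) hg.
  by rewrite (nrm_distC ph sx sun); exact: (hn n (leqnn n)).
have sE := D_sqi Ee_D.
have [p [sp pM] pE] := sqi_projection Ms Mc sE.
(* Membership of p in [D_ Sigma] has not been established, so [Ee - p] is projected. The projection
   u is orthogonal to the range of [EK], hence P (K + I/2) u = 0 and u is null; thus [Ee - p] is
   orthogonal to all of [D_ Sigma]. *)
have sr := sqiB sE sp; pose u := E_ Sigma (Ee - p).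
have [Du su uE] := E_P hd Sigma sr; rewrite -/u in Du su uE.
have u0 : {ae om, forall x, u x = 0}.
  apply: (PKhalf_injective hd Sopen Sneq0 Du).
  have sK := Kh_sqi hd su; have Lr := restr_L2on Sopen sK; have sR := L2on_sqi Lr.
  have rr : ip om (restr Sigma (Kh u)) (restr Sigma (Kh u)) = 0.
    transitivity (ip om (restr Sigma (Kh u)) (Kh u)).
      apply: eq_Rintegral => x _; have [Sx|nSx] := pselect (Sigma x); first by rewrite !restr_in.
      by rewrite restr_out// !mul0r.
    have DE := EK_D sR.
    rewrite -(EK_adj sR Du) (ipC ph (D_sqi DE) su) (uE _ DE); exact: pE (MEK _ Lr).
  by apply: filterS (ip_eq0 sR rr) => x hx Sx; rewrite -hx restr_in.
have orth v : D_ Sigma v -> ip om (Ee - p) v = 0.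
  move=> Dv; rewrite -(uE _ Dv) -(ip0l ph (D_sqi Dv)).
  by apply: eq_Rintegral_ae; apply: filterS u0 => x ->.
have [g Lg hg] := pM _ e0; have sA := EK_sqi (L2on_sqi Lg).
exists g => //.
(* [Ee - p] is orthogonal to Ee, which lies in [D_ Sigma], and to p, which lies in M. *)
have n0 : N (Ee - p) = 0.
  apply/eqP; rewrite -sqrf_eq0 (nrm_sqr ph sr) (ipBr ph sE sp sr) (orth _ Ee_D) sub0r oppr_eq0.
  by apply/eqP; exact: (pE p (conj sp pM)).
have := nrm_triangle ph sE sp sA; rewrite n0 add0r => h; exact: le_trans h hg.
Qed.

Lemma inv_PKhalf_spec phi : Uplus Sigma phi ->
  D_ Sigma (inv_PKhalf Sigma (P_ Sigma phi)) /\
  eqL2 (P_ Sigma (Khalf (inv_PKhalf Sigma (P_ Sigma phi)))) (P_ Sigma phi).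
Proof.
move=> [[_ [g Dg ge]] _].
apply: (@getI _ [set g | D_ Sigma g /\ eqL2 (P_ Sigma (Khalf g)) (P_ Sigma phi)] g).
by split => //; apply: filterS ge => x h T; rewrite h.
Qed.

Lemma tau_error t h phi phi_eps eps : admissible Sigma t h ->
  Uplus Sigma phi -> L2 phi_eps -> L2norm (phi - phi_eps) < eps ->
  `| L2dot (tau_pm Sigma phi) e - (L2dot (P_ Sigma phi_eps) h - L2dot phi_eps e) |
  <= (L2norm phi + L2norm (tau_pm Sigma phi)) * N (residual_fun h) + eps * (t + L2norm e).
Proof.
move=> [Lh ht] Up /L2P spe phe; have [[/L2P sp _] _] := Up.
have [Dg gP] := inv_PKhalf_spec Up; rewrite /tau_pm.
move: (inv_PKhalf Sigma (P_ Sigma phi)) Dg gP => g Dg gP.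
have sg := D_sqi Dg; have sh := L2on_sqi Lh; have st := sqiB sg sp; have sb := sqiB sp spe.
have sKg := Kh_sqi hd sg.
have e1 : ip om phi h = ip om (EK h) g.
  have eP : P_ Sigma (Kh g) = P_ Sigma (Khalf g).
    by apply: orthoproj_ae; apply: filterS (KhalfE hd sg) => x ->.
  have eqP : ip om (P_ Sigma phi) h = ip om (P_ Sigma (Kh g)) h.
    by rewrite eP; apply: eq_Rintegral_ae; apply: filterS gP => x ->.
  apply: (etrans (esym (ip_P sp Lh))); apply: (etrans eqP).
  apply: (etrans (ip_P sKg Lh)); apply: (etrans (ipC ph sKg sh)).
  exact: (esym (EK_adj sh Dg)).
have e2 : ip om g e = ip om Ee g.
  by have [_ _ ->//] := E_P hd Sigma se; exact: (ipC ph).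
(* By [e1] and [e2] the exact data would leave only the pairing of the residual with g; the last two
   terms are the cost of replacing phi by [phi_eps]. *)
have main : ip om (g - phi) e - (ip om (P_ Sigma phi_eps) h - ip om phi_eps e) =
    ip om (residual_fun h) g + (ip om (phi - phi_eps) h - ip om (phi - phi_eps) e).
  have comb (t1 t2 ge pe p_h peh pee ee k r b1 b2 : R) : t2 = peh -> t1 = ge - pe ->
      b1 = p_h - peh -> b2 = pe - pee -> r = ee - k -> p_h = k -> ge = ee ->
      t1 - (t2 - pee) = r + (b1 - b2) by move=> -> -> -> -> -> -> ->; ring.
  exact: (comb _ _ _ _ _ _ _ _ _ _ _ _ (ip_P spe Lh) (ipBl ph sg sp se) (ipBl ph sp spe sh)
    (ipBl ph sp spe se) (ipBl ph (D_sqi Ee_D) (EK_sqi sh) sg) e1 e2).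
rewrite -[L2dot _ _]/(ip om (g - phi) e) -[L2dot (P_ _ _) _]/(ip om (P_ Sigma phi_eps) h).
rewrite -[L2dot phi_eps e]/(ip om phi_eps e) main.
rewrite -![L2norm _]/(N _) in ht phe *.
(* g is phi plus tau_pm(phi), whence the sum of the two norms. *)
have b1 : `|ip om (residual_fun h) g| <= (N phi + N (g - phi)) * N (residual_fun h).
  apply: le_trans (cauchy_schwarz ph (residual_fun_sqi sh) sg) _; rewrite mulrC ler_wpM2r ?nrm_ge0//.
  by have := nrmD ph sp st; rewrite addrC subrK.
have n0 : 0 <= N (phi - phi_eps) by exact: nrm_ge0.
have b2 : `|ip om (phi - phi_eps) h| <= eps * t.
  apply: le_trans (cauchy_schwarz ph sb sh) _.
  by apply: ler_pM => //; [exact: nrm_ge0|exact: ltW].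
have b3 : `|ip om (phi - phi_eps) e| <= eps * N e.
  apply: le_trans (cauchy_schwarz ph sb se) _.
  by rewrite ler_wpM2r ?nrm_ge0// ltW.
apply: le_trans (ler_normD _ _) _; apply: lerD => //.
apply: le_trans (ler_normB _ _) _; rewrite mulrDr; exact: lerD.
Qed.

Lemma residual_minimizer t h : is_minimizer Sigma e t h ->
  residual Sigma e h = N (residual_fun h) /\ forall g, admissible Sigma t g -> N (residual_fun h) <= N (residual_fun g).
Proof.
move=> [[Lh ht] hE]; have rE := residualE Lh; split; first exact: rE.
move=> g ag; apply: (le_trans _ (residual_lbound ag)).
by rewrite -hE rE lexx.
Qed.

End regularization.

Theorem theorem3p9 (R : realType) (d : nat) (hd : (3 <= d)%N)
    (Sigma : set 'rV[R]_d) (Sigma_open : sphere_open Sigma)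
    (Sigma_neq0 : Sigma !=set0) (Sigma_sub : compactly_included Sigma)
    (e : 'rV[R]_d -> R) (he : L2 e) :
  (forall t : R, 0 < t ->
    exists2 h, is_minimizer Sigma e t h &
      forall h', is_minimizer Sigma e t h' -> eqL2 h' h) /\
  forall h : R -> 'rV[R]_d -> R,
    (forall t : R, 0 < t -> is_minimizer Sigma e t (h t)) ->
    let L t := residual Sigma e (h t) in
    [/\ forall t : R, 0 < t ->
          forall (phi phi_eps : 'rV[R]_d -> R) (eps : R),
            Uplus Sigma phi -> L2 phi_eps -> L2norm (phi - phi_eps) < eps ->
            `| L2dot (tau_pm Sigma phi) e
               - (L2dot (P_ Sigma phi_eps) (h t) - L2dot phi_eps e) |
            <= (L2norm phi + L2norm (tau_pm Sigma phi)) * L t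
               + eps * (t + L2norm e),
        forall s t : R, 0 < s -> s <= t -> L t <= L s &
        L t @[t --> +oo] --> 0].
Proof.
have /L2P se := he; split=> [t t0|h hmin L].
  have [g mg] := minimizer_exists hd Sigma_open se t0.
  by exists g => // g' mg'; exact: (minimizer_unique hd Sigma_open Sigma_sub se mg mg').
have LE t : 0 < t -> L t = nrm (ip (omega R d)) (residual_fun Sigma e (h t)).
  by move=> t0; have [] := residual_minimizer hd Sigma_open (hmin t t0).
have Lmin t g : 0 < t -> admissible Sigma t g -> L t <= nrm (ip (omega R d)) (residual_fun Sigma e g).
  by move=> t0 ag; rewrite (LE t t0); have [_ le] := residual_minimizer hd Sigma_open (hmin t t0); exact: (le g ag).
split.
- move=> t t0 phi phi_eps eps Up spe phe; rewrite (LE t t0).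
  by apply: (tau_error hd Sigma_open se _ Up spe phe); have [] := hmin t t0.
- move=> s t s0 st; have t0 := lt_le_trans s0 st; rewrite (LE s s0); apply: (Lmin _ _ t0).
  by have [[Ls hs] _] := hmin s s0; split; [exact: Ls|exact: le_trans hs st].
apply/cvgrPdist_le => eps eps0.
have [g Lg hg] := residual_small hd Sigma_open Sigma_neq0 se eps0.
(* Beyond this threshold g is admissible, and the 1 keeps t positive. *)
exists (Num.max 1 (L2norm g)); split; first exact: num_real.
move=> t; rewrite gt_max => /andP[t1 tg]; have t0 : 0 < t := lt_trans ltr01 t1.
rewrite sub0r normrN ger0_norm; last by rewrite (LE t t0) nrm_ge0.
by apply: (le_trans _ hg); apply: (Lmin _ _ t0); split; [exact: Lg|exact: ltW].
Qed.
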